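(* Let $p=p_n\ge1$, and let $X_1,\ldots,X_n$ be i.i.d. $\mathbb R^p$-valued random vectors with absolutely continuous distribution function $F$ and $Y_1,\ldots,Y_m$ i.i.d. $\mathbb R^p$-valued random vectors with absolutely continuous distribution function $G$, the two samples independent, with $c_0n\le m\le n$ for a fixed constant $0<c_0\le1$. Let $d\ge1$ and let $\psi_0\equiv1,\psi_1,\ldots,\psi_d$ be twice differentiable functions on $[0,1]$ that are orthonormal in $L^2([0,1])$; put $B_{\ell d}=\max_{1\le k\le d}\sup_{z\in[0,1]}|\psi_k^{(\ell)}(z)|$ for $\ell=0,1,2$. Assume there are constants $C_0,C_1>0$ and $c_1\in(0,1)$ such that $$d\le\min\{n,m,\exp(C_0p)\},\qquad \max\big(p^7B_{1d}^2,\;pB_{2d}^2\big)\le C_1n^{1-c_1}.$$ For $u\in\mathcal S^{p-1}=\{u\in\mathbb R^p:|u|_2=1\}$ let $F^u_n(x)=n^{-1}\sum_{i=1}^nI(u^\intercal X_i\le x)$, and define $$\hat\Psi_{\max}(d)=\sqrt{\tfrac{nm}{n+m}}\sup_{u\in\mathcal S^{p-1}}\max_{1\le k\le d}\Big|\frac1m\sum_{j=1}^m\psi_k\big(F^u_n(u^\intercal Y_j)\big)\Big|.$$ Let $e_1,\ldots,e_n$ be i.i.d. $N(0,1)$, independent of the data, and $$\hat\Psi^{\rm MB}_{\max}(d)=\sup_{(u,k)\in\mathcal S^{p-1}\times[d]}\Big|\frac1{\sqrt n}\sum_{i=1}^ne_i\psi_k\big(F^u_n(u^\intercal X_i)\big)\Big|.$$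 For $\alpha\in(0,1)$ let $\hat c^{\rm MB}_\alpha(d)=\inf\{t\in\mathbb R:P_e(\hat\Psi^{\rm MB}_{\max}(d)>t)\le\alpha\}$, where $P_e$ is the conditional probability given $X_1,\ldots,X_n$, and let $\Phi^{\rm MS}_\alpha(d)=I\{\hat\Psi_{\max}(d)\ge\hat c^{\rm MB}_\alpha(d)\}$. Then under $H_0:F=G$, as $n,m\to\infty$, $$\sup_{0<\alpha<1}\big|P_{H_0}\{\Phi^{\rm MS}_\alpha(d)=1\}-\alpha\big|\to0.$$
   Context: Here $[d]=\{1,\ldots,d\}$; $p$ and $d$ may depend on $n$. *)

(* Defs.v *)
From HB Require Import structures.
From mathcomp Require Import all_boot all_order all_algebra.
From mathcomp Require Import all_classical all_reals all_analysis.
From mathcomp Require Import normal_distribution.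
Set Implicit Arguments. Unset Strict Implicit. Unset Printing Implicit Defensive.
Import Order.TTheory GRing.Theory Num.Theory.
Import numFieldNormedType.Exports.
Local Open Scope classical_set_scope.
Local Open Scope ring_scope.

Section Defs.
Variable R : realType.

Definition dotp (p : nat) (u x : 'I_p -> R) : R := \sum_(c < p) u c * x c.

Definition sphere (p : nat) : set ('I_p -> R) :=
  [set u | \sum_(c < p) u c ^+ 2 = 1].

Definition box (p : nat) (a b : 'I_p -> R) : set ('I_p -> R) :=
  [set x | forall c, a c < x c < b c].

Definition borelRp (p : nat) : set (set ('I_p -> R)) :=
  <<s [set B | exists a b, B = box a b] >>.

Definition lebesgue_null (p : nat) (N : set ('I_p -> R)) : Prop :=
  forall eps : R, 0 < eps -> exists a b : nat -> ('I_p -> R),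
    N `<=` \bigcup_k box (a k) (b k) /\
    forall K, \sum_(k < K) \prod_(c < p) `|b k c - a k c| <= eps.

Definition unit_itv : set R := [set z | 0 <= z <= 1].

Definition has_derivative01 (f f' : R -> R) : Prop :=
  forall z, unit_itv z ->
    (fun w => (f w - f z) / (w - z)) @ within unit_itv (z^') --> f' z.

Definition ecdf (p n : nat) (Xs : 'I_n -> ('I_p -> R)) (u : 'I_p -> R) (t : R) : R :=
  (\sum_(i < n) (if dotp u (Xs i) <= t then 1 else 0)) / n%:R.

Definition Psi_max (p n m d : nat) (psi : nat -> R -> R)
    (Xs : 'I_n -> ('I_p -> R)) (Ys : 'I_m -> ('I_p -> R)) : R :=
  Num.sqrt (n%:R * m%:R / (n%:R + m%:R)) *
  sup [set r | exists u k, sphere u /\ (1 <= k <= d)%N /\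
        r = `| m%:R^-1 * \sum_(j < m) psi k (ecdf Xs u (dotp u (Ys j))) | ].

Definition Psi_MB (p n d : nat) (psi : nat -> R -> R)
    (Xs : 'I_n -> ('I_p -> R)) (es : 'I_n -> R) : R :=
  sup [set r | exists u k, sphere u /\ (1 <= k <= d)%N /\
        r = `| (Num.sqrt n%:R)^-1 *
               \sum_(i < n) es i * psi k (ecdf Xs u (dotp u (Xs i))) | ].

Section Prob.
Context {dO : measure_display} {Omega : measurableType dO}.
Variable P : probability Omega R.

Definition mutually_independent (I : finType) (S : I -> set (set Omega)) : Prop :=
  forall (J : {set I}) (A : I -> set Omega),
    (forall i, i \in J -> S i (A i)) ->
    P (\bigcap_(i in [set i | i \in J]) A i) = (\prod_(i in J) P (A i))%E.

Definition events_vec (p : nat) (Z : Omega -> ('I_p -> R)) : set (set Omega) :=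
  [set Z @^-1` B | B in @borelRp p].
Definition events_real (Z : Omega -> R) : set (set Omega) :=
  [set Z @^-1` B | B in measurable].

Definition setting_H0 (c0 C0 C1 c1 : R) (p n m d : nat)
    (psi dpsi ddpsi : nat -> R -> R)
    (X : 'I_n -> Omega -> ('I_p -> R)) (Y : 'I_m -> Omega -> ('I_p -> R))
    (e : 'I_n -> Omega -> R) : Prop :=
  (1 <= p)%N /\
      (c0 * n%:R <= m%:R /\ (m <= n)%N) /\
      [/\ (1 <= d)%N, (d <= n)%N, (d <= m)%N & d%:R <= expR (C0 * p%:R)] /\
      [/\ forall z, unit_itv z -> psi 0%N z = 1,
          forall k, (k <= d)%N -> has_derivative01 (psi k) (dpsi k),
          forall k, (k <= d)%N -> has_derivative01 (dpsi k) (ddpsi k) &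
          forall k l, (k <= d)%N -> (l <= d)%N ->
            (\int[lebesgue_measure]_(z in unit_itv) (psi k z * psi l z)%:E)%E
              = ((k == l)%:R)%:E] /\
      (* max(p^7 B_{1d}^2, p B_{2d}^2) <= C1 n^{1-c1} *)
      (forall k z, (1 <= k <= d)%N -> unit_itv z ->
          p%:R ^+ 7 * (dpsi k z) ^+ 2 <= C1 * (n%:R `^ (1 - c1)) /\
          p%:R * (ddpsi k z) ^+ 2 <= C1 * (n%:R `^ (1 - c1))) /\
      [/\ forall i c, measurable_fun setT (fun w => X i w c),
          forall j c, measurable_fun setT (fun w => Y j w c) &
          forall i, measurable_fun setT (e i)] /\
      mutually_independent
        (fun a : ('I_n + 'I_m) + 'I_n =>
           match a with
           | inl (inl i) => events_vec (X i)
           | inl (inr j) => events_vec (Y j)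
           | inr i => events_real (e i)
           end) /\
      [/\ forall i i' B, @borelRp p B -> P (X i @^-1` B) = P (X i' @^-1` B),
          forall i j B, @borelRp p B -> P (Y j @^-1` B) = P (X i @^-1` B),
          forall i B, @borelRp p B -> lebesgue_null B -> P (X i @^-1` B) = 0%E &
          forall i B, measurable B -> P (e i @^-1` B) = normal_prob 0 1 B].

(* multiplier-bootstrap critical value \hat c^MB_alpha(d), as a function of the
   data: P_e is the probability over e given X = X(w) *)
Definition c_MB (p n d : nat) (psi : nat -> R -> R)
    (X : 'I_n -> Omega -> ('I_p -> R)) (e : 'I_n -> Omega -> R)
    (alpha : R) (w : Omega) : R :=
  inf [set t : R | (P [set w' | (t < Psi_MB d psi (fun i => X i w) (fun i => e i w'))%R]
                <= alpha%:E)%E].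

Definition reject_prob (p n m d : nat) (psi : nat -> R -> R)
    (X : 'I_n -> Omega -> ('I_p -> R)) (Y : 'I_m -> Omega -> ('I_p -> R))
    (e : 'I_n -> Omega -> R) (alpha : R) : \bar R :=
  P [set w | Psi_max d psi (fun i => X i w) (fun j => Y j w)
             >= c_MB d psi X e alpha w].

End Prob.
End Defs.

(* Main.v *)
Require Import Defs.
From HB Require Import structures.
From mathcomp Require Import all_boot all_order all_algebra all_fingroup.
From mathcomp Require Import all_classical all_reals all_analysis.
From mathcomp Require Import normal_distribution measurable_realfun.
From mathcomp Require Import ring lra zify.
Set Implicit Arguments.
Unset Strict Implicit.
Unset Printing Implicit Defensive.
Import Order.TTheory GRing.Theory Num.Theory.
Import numFieldNormedType.Exports.
Local Open Scope classical_set_scope.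
Local Open Scope ring_scope.

(** Under the null hypothesis the pooled sample of size n + m is exchangeable, so
    the rejection probability is the mean, over the pooled sample, of the
    rejection frequency under a uniformly random relabelling s of its points.
    Fix a pooled sample in general position.  Directions induce at most
    ((n + m)^2 + 1)^p orderings of it (Pajor's form of the Sauer-Shelah lemma),
    so both suprema are maxima over a finite set J with log #|J| = O(p log n).
    Up to a martingale transform along each ordering, the test statistic is a
    maximum of linear permutation statistics W_j(s) = sum_z c(s z) a_j(z).  The
    smoothed indicator sum_j e^(b w_j) / (1 + sum_j e^(b w_j)) of max_j w_j > 0
    is followed along the path sin(t) W + cos(t) G, where G is the multiplier
    process of a typical labelling: Stein's identity for random transpositions
    and Gaussian integration by parts make the second-order terms cancel up to
    concentration errors of the covariances.  The remainders and the
    anti-concentration of max_j G_j are controlled by the same quantity, the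
    expected product of the smoothed indicator and its complement, which a
    further integration by parts bounds by E[log-sum-exp G] = O(sqrt(p log n)). *)

(** * Softmax weights and the smoothed indicator of a positive maximum *)

(** The derivative along the path is sin(t) cos(t) times the difference of two second-order forms,
    one for the transposition covariance and one for the multiplier covariance, plus remainders that
    keep a factor cos(t). That factor is needed: given the labelling, only cos(t) G is random, so
    anti-concentration controls just cos(t) times the expected [wt0 * mass]. The random critical
    value is harmless because the bootstrap tails of all typical labellings are close to one and the
    same relabelling tail. Scales: put L = sqrt(p ln n), [v] = 1/L and y^4 sqrt n = B L^7. With [be]
    = L^3 / y the smoothing bias is of order y / L, anti-concentration multiplies it by L, and y is
    the final rate; the other remainders are no larger. The assumption on p^7 B_1^2 makes y^8 of
    order (ln n)^7 n^(-c1). The power of B stays low because a score of unit norm satisfies psi^2 <=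
    8 B. Suprema over the sphere and the infimum in the critical value are not visibly measurable;
    the rejection event is, since it depends only on which order patterns the directions realize. *)

Section Softmax.
Variables (R : realType) (J : finType) (be : R).
Implicit Types (w d : J -> R) (t : R).

Lemma is_derive_bigsum (I : finType) (h : I -> R -> R) (dh : I -> R) (x : R) :
  (forall i, is_derive x 1 (h i) (dh i)) ->
  is_derive x 1 (fun t => \sum_i h i t) (\sum_i dh i).
Proof.
move=> hd; rewrite -!big_enum /=.
rewrite [X in is_derive _ _ X](_ : _ = (fun t => \sum_(i <- enum I) h i t)); last first.
  by apply/funext => t; rewrite big_enum.
elim: (enum I) => [|i s ih].
  rewrite big_nil; under eq_fun do rewrite big_nil.
  exact: is_derive_cst.
rewrite big_cons; under eq_fun do rewrite big_cons.
exact: is_deriveD.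
Qed.

(** [ln] is short for line, not for the logarithm: derivatives are taken along straight lines in the
    space of exponents. *)
Definition ln_path w d t : J -> R := fun j => w j + t * d j.

Definition expsum (r : nat) w d : R := \sum_j expR (be * w j) * d j ^+ r.

(* The term [1] stands for an additional exponent [0], so that [mass] is close to
   [1] when [max_j w j] is well above [0] and close to [0] when it is well below. *)
Definition wt0 w : R := (1 + \sum_j expR (be * w j))^-1.
Definition wt w (j : J) : R := expR (be * w j) * wt0 w.
Definition mass w : R := \sum_j wt w j.
Definition mom (r : nat) w d : R := \sum_j wt w j * d j ^+ r.
Definition lse w : R := be^-1 * ln (1 + \sum_j expR (be * w j)).

Lemma denom_gt0 w : 0 < 1 + \sum_j expR (be * w j).
Proof.
apply: ltr_wpDr; last exact: ltr01.
by apply: sumr_ge0 => j _; exact: expR_ge0.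
Qed.

Lemma wt0_gt0 w : 0 < wt0 w. Proof. by rewrite invr_gt0 denom_gt0. Qed.

Lemma wt_ge0 w j : 0 <= wt w j.
Proof. by rewrite mulr_ge0 ?expR_ge0 // ltW ?wt0_gt0. Qed.

Lemma wtM_ge0 w i j : 0 <= wt w i * wt w j.
Proof. by rewrite mulr_ge0 // wt_ge0. Qed.

Lemma massE w : mass w = 1 - wt0 w.
Proof.
rewrite /mass /wt -mulr_suml /wt0.
have := denom_gt0 w; set S := \sum_j _ => S0.
by field; rewrite gt_eqF.
Qed.

Lemma mass_ge0 w : 0 <= mass w.
Proof. by apply: sumr_ge0 => j _; exact: wt_ge0. Qed.

Lemma mass_le1 w : mass w <= 1.
Proof. by rewrite massE lerBlDr lerDl ltW ?wt0_gt0. Qed.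

Lemma wt0_le1 w : wt0 w <= 1.
Proof. by have := mass_ge0 w; rewrite massE subr_ge0. Qed.

Lemma wt_le1 w j : wt w j <= 1.
Proof.
apply: le_trans (mass_le1 w); rewrite /mass (bigD1 j) //= lerDl.
by apply: sumr_ge0 => i _; exact: wt_ge0.
Qed.

Lemma wt0_mass_bnd w : 0 <= wt0 w * mass w <= 1.
Proof.
have := wt0_gt0 w; have := wt0_le1 w; have := mass_ge0 w; have := mass_le1 w.
by move=> *; nra.
Qed.

Lemma momE r w d : mom r w d = expsum r w d * wt0 w.
Proof.
by rewrite /mom /expsum mulr_suml; apply: eq_bigr => j _; rewrite /wt mulrAC.
Qed.

Lemma is_derive_expsum r w d t :
  is_derive t 1 (fun t => expsum r (ln_path w d t) d) (be * expsum r.+1 (ln_path w d t) d).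
Proof.
rewrite /expsum mulr_sumr; apply: is_derive_bigsum => j.
rewrite /ln_path.
have h : is_derive t 1 (fun t => be * (w j + t * d j)) (be * d j).
  apply: is_derive_eq; rewrite /GRing.scale /=; ring.
have H := @is_derive1_comp R expR (fun t => be * (w j + t * d j)) t _ _ (is_derive_expR _) h.
apply: is_derive_eq.
rewrite /GRing.scale /= exprS; ring.
Qed.

Lemma expsum0E w d : expsum 0 w d = \sum_j expR (be * w j).
Proof. by apply: eq_bigr => j _; rewrite expr0 mulr1. Qed.

Lemma is_derive_wt0 w d t :
  is_derive t 1 (fun t => wt0 (ln_path w d t))
    (- be * wt0 (ln_path w d t) * mom 1 (ln_path w d t) d).
Proof.
rewrite momE.
rewrite [X in is_derive _ _ X](_ : _ = (fun t => (1 + expsum 0 (ln_path w d t) d)^-1)); last first.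
  by apply/funext => s; rewrite expsum0E.
have S0 := denom_gt0 (ln_path w d t); rewrite -(expsum0E _ d) in S0.
have H := is_derive_expsum 0 w d t.
have H1 : is_derive t 1 (fun t => 1 + expsum 0 (ln_path w d t) d)
   (0 + be * expsum 1 (ln_path w d t) d) by apply: is_deriveD.
have nz : 1 + expsum 0 (ln_path w d t) d != 0 by rewrite gt_eqF.
have HH := @is_deriveV R (fun t => 1 + expsum 0 (ln_path w d t) d) t _ _ nz H1.
apply: is_derive_eq.
rewrite /GRing.scale /= /wt0 -(expsum0E _ d).
set D := 1 + _ in S0 nz *.
by field.
Qed.

(** If the missing weight [wt0] is placed at an extra index where the direction is 0, then for r > 0
    [mom r] is the r-th moment of a probability law, and differentiating the exponents produces a
    covariance with the direction. *)
Lemma is_derive_mom r w d t :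
  is_derive t 1 (fun t => mom r (ln_path w d t) d)
   (be * (mom r.+1 (ln_path w d t) d - mom r (ln_path w d t) d * mom 1 (ln_path w d t) d)).
Proof.
rewrite [X in is_derive _ _ X](_ : _ = (fun t => expsum r (ln_path w d t) d * wt0 (ln_path w d t)));
  last by apply/funext => s; rewrite momE.
have H1 := is_derive_expsum r w d t; have H2 := is_derive_wt0 w d t.
apply: is_derive_eq; rewrite /GRing.scale /= !momE; ring.
Qed.

Definition Dmass w d : R := be * wt0 w * mom 1 w d.
Definition D2mass w d : R := be ^+ 2 * wt0 w * (mom 2 w d - 2 * mom 1 w d ^+ 2).
Definition D3mass w d : R :=
  be ^+ 3 * wt0 w * (mom 3 w d - 6 * mom 1 w d * mom 2 w d + 6 * mom 1 w d ^+ 3).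

Lemma is_derive_mass w d t :
  is_derive t 1 (fun t => mass (ln_path w d t)) (Dmass (ln_path w d t) d).
Proof.
rewrite [X in is_derive _ _ X](_ : _ = (fun t => 1 - wt0 (ln_path w d t)));
  last by apply/funext => s; rewrite massE.
have H2 := is_derive_wt0 w d t.
apply: is_derive_eq; rewrite /Dmass /=; ring.
Qed.

Lemma is_derive_Dmass w d t :
  is_derive t 1 (fun t => Dmass (ln_path w d t) d) (D2mass (ln_path w d t) d).
Proof.
have H1 := is_derive_mom 1 w d t; have H2 := is_derive_wt0 w d t.
rewrite /Dmass; apply: is_derive_eq; rewrite /D2mass /GRing.scale /=; ring.
Qed.

Lemma is_derive_D2mass w d t :
  is_derive t 1 (fun t => D2mass (ln_path w d t) d) (D3mass (ln_path w d t) d).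
Proof.
have H1 := is_derive_mom 1 w d t; have H2 := is_derive_wt0 w d t.
have H3 := is_derive_mom 2 w d t.
rewrite /D2mass; apply: is_derive_eq; rewrite /D3mass /GRing.scale /=; ring.
Qed.

Lemma is_derive_lse w d t : be != 0 ->
  is_derive t 1 (fun t => lse (ln_path w d t)) (mom 1 (ln_path w d t) d).
Proof.
move=> be0.
rewrite [X in is_derive _ _ X](_ : _ = (fun t => be^-1 * ln (1 + expsum 0 (ln_path w d t) d)));
  last by apply/funext => s; rewrite expsum0E.
have S0 := denom_gt0 (ln_path w d t); rewrite -(expsum0E _ d) in S0.
have H := is_derive_expsum 0 w d t.
have H1 : is_derive t 1 (fun t => 1 + expsum 0 (ln_path w d t) d)
   (0 + be * expsum 1 (ln_path w d t) d) by apply: is_deriveD.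
have H2 := @is_derive1_comp R (@ln R) (fun t => 1 + expsum 0 (ln_path w d t) d) t _ _ (is_derive1_ln S0) H1.
apply: is_derive_eq.
rewrite /GRing.scale /= momE /wt0 -(expsum0E _ d).
by field; rewrite be0 gt_eqF.
Qed.

Lemma mvt_bound (f df : R -> R) (s K : R) : 0 <= s ->
  (forall t, is_derive t 1 f (df t)) -> (forall t, 0 <= t <= s -> `|df t| <= K) ->
  `|f s - f 0| <= K * s.
Proof.
move=> s0 H HK.
have cf : {within `[0, s], continuous f}.
  apply: continuous_subspaceT => x.
  by apply: differentiable_continuous; apply/derivable1_diffP; have [] := H x.
have [c] := @MVT_segment R f df 0 s s0 (fun x _ => H x) cf.
rewrite in_itv /= => cs ->; rewrite subr0 normrM (ger0_norm s0).
by rewrite ler_wpM2r // HK.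
Qed.

(** The mean value inequality is used twice, for [df] and for [f t - t * df 0]. This loses the
    factor 1/2 of Taylor's formula, which only affects constants. *)
Lemma mvt2_bound (f df ddf : R -> R) (s K : R) : 0 <= s ->
  (forall t, is_derive t 1 f (df t)) -> (forall t, is_derive t 1 df (ddf t)) ->
  (forall t, 0 <= t <= s -> `|ddf t| <= K) ->
  `|f s - f 0 - s * df 0| <= K * s ^+ 2.
Proof.
move=> s0 H H2 HK.
have K0 : 0 <= K by rewrite (le_trans (normr_ge0 (ddf 0))) // HK // lexx s0.
have H3 t : is_derive t 1 (fun t => f t - t * df 0) (df t - df 0).
  by have Ht := H t; apply: is_derive_eq; rewrite /GRing.scale /=; ring.
have := @mvt_bound (fun t => f t - t * df 0) _ s (K * s) s0 H3.
rewrite mul0r subr0 addrAC expr2 mulrA => -> // t /andP[t0 ts].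
apply: (le_trans (mvt_bound (s := t) (K := K) t0 H2 _)).
  by move=> u /andP[u0 ut]; apply: HK; rewrite u0 (le_trans ut).
by rewrite ler_wpM2l.
Qed.

Lemma ln_path0 w d : ln_path w d 0 = w.
Proof. by apply/funext => j; rewrite /ln_path mul0r addr0. Qed.

Lemma mom_abs r w d : `|mom r w d| <= mom r w (fun j => `|d j|).
Proof.
apply: le_trans (ler_norm_sum _ _ _) _; apply: ler_sum => j _.
by rewrite normrM (ger0_norm (wt_ge0 _ _)) normrX.
Qed.

Lemma sum2_wt w : \sum_i \sum_j wt w i * wt w j = mass w ^+ 2.
Proof. by rewrite expr2 /mass mulr_suml; apply: eq_bigr => i _; rewrite mulr_sumr. Qed.

Lemma mom_mulE r s w d :
  mom r w d * mom s w d = \sum_i \sum_j wt w i * wt w j * (d i ^+ r * d j ^+ s).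
Proof.
rewrite /mom mulr_suml; apply: eq_bigr => i _; rewrite mulr_sumr.
by apply: eq_bigr => j _; ring.
Qed.

Lemma mass_momE1 r w d :
  mass w * mom r w d = \sum_i \sum_j wt w i * wt w j * d i ^+ r.
Proof.
rewrite mulrC /mom mulr_suml; apply: eq_bigr => i _; rewrite mulr_sumr.
by apply: eq_bigr => j _; ring.
Qed.

Lemma mass_momE2 r w d :
  mass w * mom r w d = \sum_i \sum_j wt w i * wt w j * d j ^+ r.
Proof.
rewrite /mom mulr_suml; apply: eq_bigr => i _; rewrite mulr_sumr.
by apply: eq_bigr => j _; ring.
Qed.

(** Cauchy-Schwarz by symmetrization: written as double sums over the weights, twice the difference
    of the sides is a weighted sum of [(d i - d j)^2]. *)
Lemma mom1_sqr_le w d : mom 1 w d ^+ 2 <= mass w * mom 2 w d.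
Proof.
rewrite expr2 mom_mulE.
suff : 2 * \sum_i \sum_j wt w i * wt w j * (d i ^+ 1 * d j ^+ 1) <=
  mass w * mom 2 w d + mass w * mom 2 w d by move=> *; lra.
rewrite {1}mass_momE1 mass_momE2 -big_split mulr_sumr; apply: ler_sum => i _ /=.
rewrite -big_split mulr_sumr; apply: ler_sum => j _ /=.
rewrite -mulrDr mulrCA ler_wpM2l ?wtM_ge0 //.
rewrite -subr_ge0 [X in 0 <= X](_ : _ = (d i - d j) ^+ 2) ?sqr_ge0 //; ring.
Qed.

Lemma mom_even_ge0 w d : 0 <= mom 2 w d.
Proof. by apply: sumr_ge0 => j _; rewrite mulr_ge0 ?wt_ge0 ?sqr_ge0. Qed.

Lemma mom1_sqr_le2 w d : mom 1 w d ^+ 2 <= mom 2 w d.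
Proof.
apply: le_trans (mom1_sqr_le w d) _; rewrite ler_piMl ?mass_le1 ?mom_even_ge0 //.
Qed.

(** Symmetrization again, now from a^3 - 3 a b^2 + 2 b^3 = (a + 2 b) (a - b)^2 for nonnegative a and
    b. *)
Lemma mom12_le w d : (forall j, 0 <= d j) -> mom 1 w d * mom 2 w d <= mom 3 w d.
Proof.
move=> d0.
have m3 : 0 <= mom 3 w d.
  by apply: sumr_ge0 => j _; rewrite mulr_ge0 ?wt_ge0 ?exprn_ge0.
apply: (@le_trans _ _ (mass w * mom 3 w d)); last by rewrite ler_piMl ?mass_le1.
rewrite mom_mulE.
suff : 3 * \sum_i \sum_j wt w i * wt w j * (d i ^+ 1 * d j ^+ 2) <=
  mass w * mom 3 w d + 2 * (mass w * mom 3 w d) by move=> *; lra.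
rewrite {1}mass_momE1 mass_momE2 !mulr_sumr -big_split; apply: ler_sum => i _ /=.
rewrite !mulr_sumr -big_split; apply: ler_sum => j _ /=.
rewrite mulrCA (mulrCA 2) -mulrDr ler_wpM2l ?wtM_ge0 //.
rewrite -subr_ge0 [X in 0 <= X](_ : _ = (d i + 2 * d j) * (d i - d j) ^+ 2); last by ring.
by rewrite mulr_ge0 ?sqr_ge0 // addr_ge0 // mulr_ge0.
Qed.

(* Keeping the factor [wt0] is what lets anti-concentration absorb the
   third-order remainders. *)
Lemma D3mass_bound w d :
  `|D3mass w d| <= 13 * `|be| ^+ 3 * (wt0 w * mom 3 w (fun j => `|d j|)).
Proof.
set a := fun j => `|d j|.
have a0 j : 0 <= a j by exact: normr_ge0.
have m1 := mom_abs 1 w d; have m3 := mom_abs 3 w d; rewrite -/a in m1 m3.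
have m2 : mom 2 w d = mom 2 w a.
  by apply: eq_bigr => j _; rewrite /a real_normK ?num_real.
have m12 := mom12_le w a0.
have m2p := mom_even_ge0 w a.
have s2 : mom 1 w a ^+ 2 <= mom 2 w a by exact: mom1_sqr_le2.
have h12 : `|mom 1 w d * mom 2 w d| <= mom 3 w a.
  by rewrite normrM m2 (ger0_norm m2p); apply: le_trans m12; rewrite ler_wpM2r.
have h13 : `|mom 1 w d ^+ 3| <= mom 3 w a.
  rewrite normrX; apply: le_trans m12.
  apply: (@le_trans _ _ (mom 1 w a ^+ 3)).
    by rewrite lerXn2r // nnegrE (le_trans _ m1).
  by rewrite exprS ler_wpM2l // (le_trans _ m1).
rewrite /D3mass normrM normrM normrX (ger0_norm (ltW (wt0_gt0 w))).
(* 13 = 1 + 6 + 6, the absolute values of the coefficients in [D3mass]. *)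
rewrite [X in _ <= X](_ : _ = `|be| ^+ 3 * wt0 w * (13 * mom 3 w a)); last by ring.
rewrite ler_wpM2l ?(mulr_ge0 (exprn_ge0 3 (normr_ge0 be)) (ltW (wt0_gt0 w))) //.
move: m3 h12 h13; rewrite !ler_norml => /andP[? ?] /andP[? ?] /andP[? ?]; lra.
Qed.

Lemma mom2_sup w d K : (forall j, `|d j| <= K) -> mom 2 w d <= mass w * K ^+ 2.
Proof.
move=> dK; rewrite /mass mulr_suml; apply: ler_sum => j _.
rewrite ler_wpM2l ?wt_ge0 // -(real_normK (num_real (d j))) lerXn2r ?nnegrE //.
exact: le_trans (dK j).
Qed.

Lemma D2mass_bound w d K : (forall j, `|d j| <= K) ->
  `|D2mass w d| <= 3 * be ^+ 2 * K ^+ 2.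
Proof.
move=> dK.
have h2 := mom2_sup w dK; have h1 := mom1_sqr_le2 w d.
have m2 := mom_even_ge0 w d; have m1 := sqr_ge0 (mom 1 w d).
have h3 : mom 2 w d <= K ^+ 2.
  by apply: le_trans h2 _; rewrite ler_piMl ?mass_le1 ?sqr_ge0.
rewrite /D2mass normrM ger0_norm; last by rewrite mulr_ge0 ?sqr_ge0 // ltW ?wt0_gt0.
have hX : `|mom 2 w d - 2 * mom 1 w d ^+ 2| <= 3 * K ^+ 2 by rewrite ler_norml; lra.
rewrite [X in _ <= X](_ : _ = be ^+ 2 * 1 * (3 * K ^+ 2)); last by ring.
have w0 := ltW (wt0_gt0 w); have w1 := wt0_le1 w; have b2 := sqr_ge0 be.
by apply: ler_pM => //; [exact: mulr_ge0|exact: ler_wpM2l].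
Qed.

Lemma mass_taylor w d K : (forall j, `|d j| <= K) ->
  `|mass (ln_path w d 1) - mass w - Dmass w d| <= 3 * be ^+ 2 * K ^+ 2.
Proof.
move=> dK.
have := @mvt2_bound _ _ _ 1 (3 * be ^+ 2 * K ^+ 2) ler01 (is_derive_mass w d)
  (is_derive_Dmass w d).
rewrite mul1r ln_path0 expr1n mulr1 => -> // t _; exact: D2mass_bound.
Qed.

Lemma lse_taylor w d K : 0 < be -> (forall j, `|d j| <= K) ->
  `|lse (ln_path w d 1) - lse w - mom 1 w d| <= 2 * be * K ^+ 2.
Proof.
move=> b0 dK.
have := @mvt2_bound _ _ _ 1 (2 * be * K ^+ 2) ler01
  (fun t => is_derive_lse w d t (lt0r_neq0 b0)) (is_derive_mom 1 w d).
rewrite mul1r ln_path0 expr1n mulr1 => -> // t _.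
set v := ln_path w d t.
have h2 := mom2_sup v dK; have h1 := mom1_sqr_le2 v d.
have m2 := mom_even_ge0 v d; have m1 := sqr_ge0 (mom 1 v d).
have h3 : mom 2 v d <= K ^+ 2.
  by apply: le_trans h2 _; rewrite ler_piMl ?mass_le1 ?sqr_ge0.
rewrite normrM gtr0_norm // (mulrC 2) -mulrA (ler_wpM2l (ltW b0)) // -expr2.
by rewrite ler_norml; lra.
Qed.

(** Each exponent moves by at most 1 along the path, so the numerator and each denominator change by
    at most a factor e. The product contains one numerator and two copies of [wt0], whence e^3.
    Remainders at intermediate points can thus be charged to the starting point. *)
Lemma wt_stable w d t : 0 < be -> 0 <= t <= 1 -> (forall j, be * `|d j| <= 1) ->
  forall j, wt0 (ln_path w d t) * wt (ln_path w d t) j <= expR 3 * (wt0 w * wt w j).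
Proof.
move=> b0 /andP[t0 t1] bd j.
have key i : `|be * (t * d i)| <= 1.
  rewrite normrM (gtr0_norm b0) normrM (ger0_norm t0) mulrCA.
  by apply: le_trans (bd i); rewrite ler_piMl // mulr_ge0 // ltW.
have E i : expR (be * ln_path w d t i) = expR (be * (t * d i)) * expR (be * w i).
  by rewrite /ln_path mulrDr addrC expRD.
have w0 : wt0 (ln_path w d t) <= expR 1 * wt0 w.
  rewrite /wt0 -[expR 1]invrK -expRN -invfM lef_pV2 ?posrE ?mulr_gt0 ?expR_gt0 ?denom_gt0 //.
  rewrite mulrDr mulr1 mulr_sumr lerD //.
  apply: ler_sum => i _; rewrite E ler_wpM2r ?expR_ge0 // ler_expR.
  by have := key i; rewrite ler_norml => /andP[].
have w0p := ltW (wt0_gt0 (ln_path w d t)).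
have e1 : expR (be * (t * d j)) <= expR 1.
  by rewrite ler_expR; have := key j; rewrite ler_norml => /andP[].
rewrite /wt E.
have -> : expR 3 = expR 1 * expR 1 * expR 1 :> R by rewrite -!expRD; congr expR; lra.
have wp := ltW (wt0_gt0 w); have ep := expR_ge0 (be * w j).
rewrite [X in X <= _](_ : _ = expR (be * (t * d j)) * (wt0 (ln_path w d t) * wt0 (ln_path w d t)) * expR (be * w j)); last by ring.
rewrite [X in _ <= X](_ : _ = expR 1 * ((expR 1 * wt0 w) * (expR 1 * wt0 w)) * expR (be * w j)); last by ring.
by rewrite ler_wpM2r // ler_pM ?expR_ge0 ?mulr_ge0 // ler_pM.
Qed.

(** The remainder is weighted by [wt0 w * wt w j] at the base point instead of being bounded by a
    supremum; it can then be averaged over transpositions and absorbed by anti-concentration. *)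
Lemma Dmass_taylor w d s : 0 < be -> 0 <= s <= 1 -> (forall j, be * `|d j| <= 1) ->
  `|Dmass (ln_path w d s) d - Dmass w d - s * D2mass w d| <=
  13 * expR 3 * be ^+ 3 * s ^+ 2 * \sum_j wt0 w * wt w j * `|d j| ^+ 3.
Proof.
move=> b0 /andP[s0 s1] bd.
have := @mvt2_bound _ _ _ s
  (13 * expR 3 * be ^+ 3 * \sum_j wt0 w * wt w j * `|d j| ^+ 3) s0
  (is_derive_Dmass w d) (is_derive_D2mass w d).
rewrite !ln_path0 (mulrAC _ _ (s ^+ 2)) => -> // t /andP[t0 ts].
apply: le_trans (D3mass_bound _ _) _; rewrite (gtr0_norm b0).
rewrite [X in _ <= X](_ : _ = 13 * be ^+ 3 * (expR 3 * \sum_j wt0 w * wt w j * `|d j| ^+ 3)); last by ring.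
rewrite ler_wpM2l ?(mulr_ge0 _ (exprn_ge0 3 (ltW b0))) //.
rewrite /mom !mulr_sumr; apply: ler_sum => j _.
have t01 : 0 <= t <= 1 by rewrite t0 (le_trans ts).
have h := wt_stable w b0 t01 bd j.
by have := ler_wpM2r (exprn_ge0 3 (normr_ge0 (d j))) h; rewrite -!mulrA.
Qed.

(** The Hessian of [mass] contracted with a matrix [V]; [D2massE] is the rank-one case. Being linear
    in [V], it takes a transposition covariance as well as a Gaussian one. *)
Definition D2form (V : J -> J -> R) w : R :=
  be ^+ 2 * wt0 w * (\sum_j wt w j * V j j - 2 * \sum_i \sum_j wt w i * wt w j * V i j).

Lemma D2massE w d : D2mass w d = D2form (fun i j => d i * d j) w.
Proof.
rewrite /D2mass /D2form [mom 1 w d ^+ 2]expr2 mom_mulE; congr (_ * _ * (_ - _ * _)).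
Qed.

Lemma D2form_bound V w K : 0 <= K -> (forall i j, `|V i j| <= K) ->
  `|D2form V w| <= 3 * be ^+ 2 * K * (wt0 w * mass w).
Proof.
move=> K0 VK.
have h1 : `|\sum_j wt w j * V j j| <= mass w * K.
  apply: le_trans (ler_norm_sum _ _ _) _; rewrite /mass mulr_suml; apply: ler_sum => j _.
  by rewrite normrM (ger0_norm (wt_ge0 _ _)) ler_wpM2l ?wt_ge0.
have h2 : `|\sum_i \sum_j wt w i * wt w j * V i j| <= mass w ^+ 2 * K.
  rewrite -sum2_wt mulr_suml; apply: le_trans (ler_norm_sum _ _ _) _; apply: ler_sum => i _.
  rewrite mulr_suml; apply: le_trans (ler_norm_sum _ _ _) _; apply: ler_sum => j _.
  by rewrite normrM ger0_norm ?wtM_ge0 // ler_wpM2l ?wtM_ge0.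
have h3 : mass w ^+ 2 * K <= mass w * K.
  by rewrite ler_wpM2r // expr2 ler_piMl ?mass_ge0 ?mass_le1.
rewrite /D2form normrM ger0_norm; last by rewrite mulr_ge0 ?sqr_ge0 // ltW ?wt0_gt0.
rewrite [X in _ <= X](_ : _ = be ^+ 2 * wt0 w * (3 * (mass w * K))); last by ring.
apply: (ler_wpM2l (mulr_ge0 (sqr_ge0 be) (ltW (wt0_gt0 w)))).
by move: h1 h2; rewrite !ler_norml => /andP[? ?] /andP[? ?]; lra.
Qed.

End Softmax.

(** * Uniform permutations and the transposition Stein identity *)

Section FiniteMean.
Variables (R : realType) (T : finType).
Implicit Types f g : T -> R.

Definition fmean f : R := #|T|%:R^-1 * \sum_t f t.

Lemma fmeanD f g : fmean (fun t => f t + g t) = fmean f + fmean g.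
Proof. by rewrite /fmean big_split mulrDr. Qed.

Lemma fmeanZ k f : fmean (fun t => k * f t) = k * fmean f.
Proof. by rewrite /fmean -mulr_sumr mulrCA. Qed.

Lemma fmeanN f : fmean (fun t => - f t) = - fmean f.
Proof. by rewrite /fmean sumrN mulrN. Qed.

Lemma fmeanB f g : fmean (fun t => f t - g t) = fmean f - fmean g.
Proof. by rewrite fmeanD fmeanN. Qed.

Lemma fmean_sum (K : finType) (F : K -> T -> R) :
  fmean (fun t => \sum_k F k t) = \sum_k fmean (F k).
Proof. by rewrite /fmean exchange_big mulr_sumr. Qed.

Lemma ler_fmean f g : (forall t, f t <= g t) -> fmean f <= fmean g.
Proof. by move=> fg; rewrite ler_wpM2l ?invr_ge0 ?ler0n // ler_sum. Qed.

Lemma eq_fmean f g : (forall t, f t = g t) -> fmean f = fmean g.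
Proof. by move=> fg; congr (_ * _); apply: eq_bigr => t _. Qed.

Lemma fmean_ge0 f : (forall t, 0 <= f t) -> 0 <= fmean f.
Proof. by move=> f0; rewrite mulr_ge0 ?invr_ge0 ?ler0n // sumr_ge0. Qed.

Lemma norm_fmean f : `|fmean f| <= fmean (fun t => `|f t|).
Proof.
rewrite /fmean normrM ger0_norm ?invr_ge0 ?ler0n //.
by rewrite ler_wpM2l ?invr_ge0 ?ler0n // ler_norm_sum.
Qed.

Lemma fmean_cst (k : R) : (0 < #|T|)%N -> fmean (fun=> k) = k.
Proof.
move=> T0; rewrite /fmean sumr_const -[k *+ _]mulr_natl mulrA mulVf ?mul1r //.
by rewrite pnatr_eq0 -lt0n.
Qed.

Lemma fmean_bij (h : T -> T) f : bijective h -> fmean (fun t => f (h t)) = fmean f.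
Proof. by move=> bh; congr (_ * _); rewrite [RHS](reindex h) //; exact: onW_bij. Qed.

Definition fprob (A : pred T) : R := fmean (fun t => (A t)%:R).

Lemma fprob_ge0 A : 0 <= fprob A.
Proof. by apply: fmean_ge0 => t; rewrite ler0n. Qed.

Lemma fprob_sub (A B : pred T) : {subset A <= B} -> fprob A <= fprob B.
Proof.
move=> AB; apply: ler_fmean => t; rewrite ler_nat.
by have := AB t; rewrite /in_mem /= /in_mem /=; case: (A t) => // ->.
Qed.

Lemma fprobU (A B : pred T) : fprob (predU A B) <= fprob A + fprob B.
Proof.
rewrite -fmeanD; apply: ler_fmean => t /=.
by case: (A t) => //=; case: (B t); rewrite /= ?addr0 ?add0r ?lexx // -[X in _ <= X]natrD ler_nat.
Qed.

Lemma fprob_exists (K : finType) (A : K -> pred T) (x : R) :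
  (forall k, fprob (A k) <= x) -> fprob (fun t => [exists k, A k t]) <= #|K|%:R * x.
Proof.
move=> Ax; apply: (@le_trans _ _ (\sum_k fprob (A k))); last first.
  by rewrite mulr_natl -sumr_const; apply: ler_sum => k _.
rewrite -fmean_sum; apply: ler_fmean => t.
have [/existsP[k Ak]|_] := boolP [exists k, A k t]; last first.
  by apply: sumr_ge0 => k _; rewrite ler0n.
by rewrite (bigD1 k) //= Ak lerDl; apply: sumr_ge0 => i _; rewrite ler0n.
Qed.

Lemma fprob_markov f (k : R) : 0 < k -> (forall t, 0 <= f t) ->
  fprob (fun t => k <= f t) <= fmean f / k.
Proof.
move=> k0 f0; rewrite ler_pdivlMr // mulrC -fmeanZ; apply: ler_fmean => t.
by case: (leP k (f t)); rewrite ?mulr1 ?mulr0.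
Qed.

Lemma fprobC (A : pred T) : (0 < #|T|)%N -> fprob (predC A) = 1 - fprob A.
Proof.
move=> T0; rewrite -[X in X - _](fmean_cst _ T0) -fmeanB; apply: eq_fmean => t /=.
by case: (A t); rewrite ?subrr ?subr0.
Qed.

End FiniteMean.
Arguments fprob {R T} A.
Arguments fprob_ge0 {R T} A.
Arguments fprob_sub {R T A B}.
Arguments fprobU {R T} A B.
Arguments fprobC {R T} A.

Section SoftmaxLinear.
Variables (R : realType) (J : finType) (be : R).
Implicit Types (w d : J -> R).

Lemma mom1_sum (K : finType) w (x : K -> R) (d : K -> J -> R) :
  mom be 1 w (fun j => \sum_k x k * d k j) = \sum_k x k * mom be 1 w (d k).
Proof.
rewrite /mom.
under eq_bigr do rewrite expr1 mulr_sumr.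
rewrite exchange_big; apply: eq_bigr => k _; rewrite mulr_sumr.
by apply: eq_bigr => j _; rewrite expr1; ring.
Qed.

Lemma Dmass_sum (K : finType) w (x : K -> R) (d : K -> J -> R) :
  Dmass be w (fun j => \sum_k x k * d k j) = \sum_k x k * Dmass be w (d k).
Proof.
by rewrite /Dmass mom1_sum mulr_sumr; apply: eq_bigr => k _; rewrite mulrCA.
Qed.

Lemma mom1N w d : mom be 1 w (fun j => - d j) = - mom be 1 w d.
Proof. by rewrite /mom -sumrN; apply: eq_bigr => j _; rewrite !expr1 mulrN. Qed.

Lemma mom1Z w k d : mom be 1 w (fun j => k * d j) = k * mom be 1 w d.
Proof. by rewrite /mom mulr_sumr; apply: eq_bigr => j _; rewrite !expr1; ring. Qed.

Lemma DmassN w d : Dmass be w (fun j => - d j) = - Dmass be w d.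
Proof. by rewrite /Dmass mom1N mulrN. Qed.

Lemma D2massN w d : D2mass be w (fun j => - d j) = D2mass be w d.
Proof.
rewrite /D2mass mom1N sqrrN; congr (_ * (_ - _)).
by apply: eq_bigr => j _; rewrite sqrrN.
Qed.

Lemma D2form_sum (K : finType) w (x : K -> R) (V : K -> J -> J -> R) :
  D2form be (fun i j => \sum_k x k * V k i j) w = \sum_k x k * D2form be (V k) w.
Proof.
rewrite /D2form.
transitivity (\sum_k (be ^+ 2 * wt0 be w * (x k * \sum_j wt be w j * V k j j) -
  be ^+ 2 * wt0 be w * (2 * (x k * \sum_i \sum_j wt be w i * wt be w j * V k i j)))); last first.
  by apply: eq_bigr => k _; ring.
rewrite sumrB -!mulr_sumr mulrBr; congr (_ * _ - _ * (_ * _)).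
  under eq_bigr do rewrite mulr_sumr.
  rewrite exchange_big; apply: eq_bigr => k _; rewrite mulr_sumr.
  by apply: eq_bigr => j _; ring.
under eq_bigr => i _ do under eq_bigr do rewrite mulr_sumr.
under eq_bigr => i _ do rewrite exchange_big.
rewrite exchange_big; apply: eq_bigr => k _; rewrite mulr_sumr.
apply: eq_bigr => i _; rewrite mulr_sumr.
by apply: eq_bigr => j _; ring.
Qed.

Lemma D2formB w V V' :
  D2form be (fun i j => V i j - V' i j) w = D2form be V w - D2form be V' w.
Proof.
rewrite /D2form.
have -> : \sum_j wt be w j * (V j j - V' j j) = \sum_j wt be w j * V j j - \sum_j wt be w j * V' j j.
  by rewrite -sumrB; apply: eq_bigr => j _; rewrite mulrBr.
have -> : \sum_i \sum_j wt be w i * wt be w j * (V i j - V' i j) =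
  \sum_i \sum_j wt be w i * wt be w j * V i j - \sum_i \sum_j wt be w i * wt be w j * V' i j.
  rewrite -sumrB; apply: eq_bigr => i _; rewrite -sumrB; apply: eq_bigr => j _.
  by rewrite mulrBr.
by ring.
Qed.

End SoftmaxLinear.

Section PermStein.
Variables (R : realType) (I J : finType) (c : I -> R) (a : J -> I -> R).
Hypothesis I_gt0 : (0 < #|I|)%N.
Hypothesis c_sum0 : \sum_s c s = 0.
Implicit Types (s : {perm I}) (z y : I).

Definition lstat s (j : J) : R := \sum_z c (s z) * a j z.
Definition swapd s z y (j : J) : R := (c (s z) - c (s y)) * (a j z - a j y).
(** For a pair (z, y) uniform among all N^2 pairs, a swap lowers [lstat] on average by 2 / N times
    its value ([lstat_pairs]): an exchangeable pair with lambda = 2 / N. The factor 1 / (4 N) is 1 /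
    (2 lambda) times the averaging factor 1 / N^2. *)
Definition swapcov s (i j : J) : R :=
  (4 * #|I|%:R)^-1 * \sum_z \sum_y swapd s z y i * swapd s z y j.

Lemma tpermM_bij z y : bijective (fun s : {perm I} => tperm z y * s)%g.
Proof.
exists (fun s => tperm z y * s)%g => s; by rewrite mulgA tperm2 mul1g.
Qed.

Lemma c_perm_sum0 s : \sum_z c (s z) = 0.
Proof. by have := c_sum0; rewrite (reindex_inj (@perm_inj _ s)). Qed.

Lemma lstat_swap s z y j : lstat (tperm z y * s)%g j = lstat s j - swapd s z y j.
Proof.
rewrite /lstat /swapd; have [<-|zy] := eqVneq z y.
  by rewrite !subrr mul0r subr0 tperm1 mul1g.
rewrite (bigD1 z) //= (bigD1 y) 1?eq_sym //= !permM tpermL tpermR.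
rewrite [X in _ = X - _](bigD1 z) //= [X in _ = _ + X - _](bigD1 y) 1?eq_sym //=.
rewrite (eq_bigr (fun x => c (s x) * a j x)); last first.
  by move=> x /andP[xz xy]; rewrite permM tpermD // eq_sym.
by ring.
Qed.

Lemma swapd_swap s z y j : swapd (tperm z y * s)%g z y j = - swapd s z y j.
Proof. by rewrite /swapd !permM tpermL tpermR; ring. Qed.

Lemma lstat_pairs s j :
  lstat s j = \sum_(q : I * I) (2 * #|I|%:R)^-1 * swapd s q.1 q.2 j.
Proof.
rewrite -mulr_sumr -(pair_bigA _ (fun z y => swapd s z y j)) /=.
have N0 : #|I|%:R != 0 :> R by rewrite pnatr_eq0 -lt0n.
transitivity ((2 * #|I|%:R)^-1 * (2 * #|I|%:R * lstat s j)).
  by rewrite mulKf // mulf_neq0 // pnatr_eq0.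
congr (_ * _); rewrite /lstat /swapd.
transitivity (\sum_z (#|I|%:R * (c (s z) * a j z) - c (s z) * (\sum_y a j y) -
   a j z * (\sum_y c (s y)) + \sum_y c (s y) * a j y)).
  rewrite c_perm_sum0.
  under [RHS]eq_bigr do rewrite mulr0 subr0.
  rewrite big_split sumrB /= sumr_const -!mulr_sumr -mulr_suml c_perm_sum0 mul0r subr0.
  by rewrite -mulr_natl; ring.
apply: eq_bigr => z _.
rewrite !mulr_sumr mulr_natl -sumr_const -!sumrB -big_split /=.
by apply: eq_bigr => y _; ring.
Qed.

Lemma swapcovE s i j :
  swapcov s i j = \sum_(q : I * I) (4 * #|I|%:R)^-1 * (swapd s q.1 q.2 i * swapd s q.1 q.2 j).
Proof.
by rewrite -mulr_sumr -(pair_bigA _ (fun z y => swapd s z y i * swapd s z y j)).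
Qed.

Variables (be dm v0 : R).
Hypothesis be_gt0 : 0 < be.
Hypothesis dm_bound : forall s z y j, `|swapd s z y j| <= dm.
Hypothesis be_dm : be * dm <= 1.
Hypothesis swapcov_diag : forall s j, swapcov s j j <= v0.

Let X (g : J -> R) (r : R) s : J -> R := fun j => g j + r * lstat s j.

(** Stein's method of exchangeable pairs: [lstat] is a sum of swap differences, and each term is
    averaged with its mirror image under the transposition. The first-order change of [Dmass]
    between the two mirror points yields [D2form] of the swap covariance, and the Taylor remainder
    is cubic in the swap differences. *)
Lemma perm_stein (g : J -> R) (r : R) : 0 <= r <= 1 ->
  `|fmean (fun s => Dmass be (X g r s) (lstat s)) -
    r * fmean (fun s => D2form be (swapcov s) (X g r s))| <=
  13 * expR 3 * be ^+ 3 * r ^+ 2 * dm * v0 *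
    fmean (fun s => wt0 be (X g r s) * mass be (X g r s)).
Proof.
move=> r01.
have N0 : #|I|%:R != 0 :> R by rewrite pnatr_eq0 -lt0n.
(* Multiplication by the transposition preserves the uniform law, negates the swap difference and
   moves the point by [- r] times that difference. *)
have swapE (q : I * I) : fmean (fun s => Dmass be (X g r s) (swapd s q.1 q.2)) =
  2^-1 * fmean (fun s => Dmass be (X g r s) (swapd s q.1 q.2) +
    Dmass be (ln_path (X g r s) (fun j => - swapd s q.1 q.2 j) r) (fun j => - swapd s q.1 q.2 j)).
  set h := (fun s : {perm I} => Dmass be (X g r s) (swapd s q.1 q.2)).
  have e1 : fmean h = fmean (fun s => h (tperm q.1 q.2 * s)%g).
    by rewrite (fmean_bij h (tpermM_bij q.1 q.2)).
  have e2 s : h (tperm q.1 q.2 * s)%g =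
     Dmass be (ln_path (X g r s) (fun j => - swapd s q.1 q.2 j) r) (fun j => - swapd s q.1 q.2 j).
    rewrite /h; congr Dmass; apply/funext => j; last exact: swapd_swap.
    by rewrite /X /ln_path lstat_swap; ring.
  by rewrite fmeanD -(eq_fmean e2) -e1 -/h; field.
have -> : fmean (fun s => Dmass be (X g r s) (lstat s)) = \sum_(q : I * I)
   (2 * #|I|%:R)^-1 * fmean (fun s => Dmass be (X g r s) (swapd s q.1 q.2)).
  under eq_bigr do rewrite -fmeanZ.
  rewrite -fmean_sum; apply: eq_fmean => s.
  by rewrite -Dmass_sum; congr Dmass; apply/funext => j; exact: lstat_pairs.
have -> : r * fmean (fun s => D2form be (swapcov s) (X g r s)) = \sum_(q : I * I)
   (4 * #|I|%:R)^-1 * fmean (fun s => r * D2mass be (X g r s) (swapd s q.1 q.2)).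
  rewrite -fmeanZ; under [RHS]eq_bigr do rewrite -fmeanZ.
  rewrite -fmean_sum; apply: eq_fmean => s.
  rewrite (_ : swapcov s = (fun i j => \sum_(q : I * I) (4 * #|I|%:R)^-1 *
     (swapd s q.1 q.2 i * swapd s q.1 q.2 j))); last first.
    by apply/funext => i; apply/funext => j; rewrite swapcovE.
  rewrite D2form_sum mulr_sumr; apply: eq_bigr => q _; rewrite -D2massE.
  by rewrite mulrCA.
rewrite -sumrB.
apply: le_trans (ler_norm_sum _ _ _) _.
have pt (q : I * I) : `|(2 * #|I|%:R)^-1 * fmean (fun s => Dmass be (X g r s) (swapd s q.1 q.2)) -
   (4 * #|I|%:R)^-1 * fmean (fun s => r * D2mass be (X g r s) (swapd s q.1 q.2))| <=
  (4 * #|I|%:R)^-1 * fmean (fun s => 13 * expR 3 * be ^+ 3 * r ^+ 2 *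
    \sum_j wt0 be (X g r s) * wt be (X g r s) j * `|swapd s q.1 q.2 j| ^+ 3).
  rewrite swapE.
  rewrite [X in `|X|](_ : _ = (4 * #|I|%:R)^-1 * fmean (fun s => Dmass be (X g r s) (swapd s q.1 q.2) +
    Dmass be (ln_path (X g r s) (fun j => - swapd s q.1 q.2 j) r) (fun j => - swapd s q.1 q.2 j)
    - r * D2mass be (X g r s) (swapd s q.1 q.2))); last first.
    by rewrite fmeanB; field.
  rewrite normrM ger0_norm ?invr_ge0 ?mulr_ge0 ?ler0n // ler_wpM2l ?invr_ge0 ?mulr_ge0 ?ler0n //.
  apply: le_trans (norm_fmean _) _; apply: ler_fmean => s.
  have bd j : be * `|- swapd s q.1 q.2 j| <= 1.
    by rewrite normrN; apply: le_trans be_dm; rewrite (ler_wpM2l (ltW be_gt0)).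
  have := Dmass_taylor (X g r s) be_gt0 r01 bd.
  rewrite (DmassN be (X g r s)) D2massN opprK.
  under eq_bigr do rewrite normrN.
  by rewrite [X in `|X - _|]addrC.
apply: le_trans (ler_sum _ (fun q _ => pt q)) _.
under eq_bigr do rewrite -fmeanZ.
rewrite -fmean_sum -fmeanZ; apply: ler_fmean => s.
rewrite [X in X <= _](_ : _ = 13 * expR 3 * be ^+ 3 * r ^+ 2 * \sum_(q : I * I)
   (4 * #|I|%:R)^-1 * \sum_j wt0 be (X g r s) * wt be (X g r s) j * `|swapd s q.1 q.2 j| ^+ 3); last first.
  by rewrite mulr_sumr; apply: eq_bigr => q _; ring.
rewrite [X in _ <= X](_ : _ = 13 * expR 3 * be ^+ 3 * r ^+ 2 *
   (dm * v0 * (wt0 be (X g r s) * mass be (X g r s)))); last by ring.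
apply: ler_wpM2l.
  apply: mulr_ge0; last exact: sqr_ge0.
  apply: mulr_ge0; last exact: exprn_ge0 (ltW be_gt0).
  by rewrite mulr_ge0 // expR_ge0.
rewrite [X in X <= _](_ : _ = \sum_j wt0 be (X g r s) * wt be (X g r s) j *
   \sum_(q : I * I) (4 * #|I|%:R)^-1 * `|swapd s q.1 q.2 j| ^+ 3); last first.
  under eq_bigr do rewrite mulr_sumr.
  rewrite exchange_big; apply: eq_bigr => j _; rewrite mulr_sumr.
  by apply: eq_bigr => q _; ring.
rewrite /mass !mulrA !mulr_sumr; apply: ler_sum => j _.
rewrite [X in _ <= X](_ : _ = wt0 be (X g r s) * wt be (X g r s) j * (dm * v0)); last by ring.
apply: ler_wpM2l.
  by rewrite (mulr_ge0 (ltW (wt0_gt0 be _)) (wt_ge0 be _ _)).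
have dm0 : 0 <= dm.
  by have /card_gt0P[z _] := I_gt0; apply: le_trans (dm_bound s z z j).
(* One factor of the cube is bounded by [dm]; the remaining squares add up to the diagonal of
   [swapcov]. *)
apply: le_trans (ler_wpM2l dm0 (swapcov_diag s j)); rewrite swapcovE mulr_sumr.
apply: ler_sum => q _; rewrite [X in _ <= X]mulrCA ler_wpM2l ?invr_ge0 ?mulr_ge0 ?ler0n //.
by rewrite exprS -expr2 -(real_normK (num_real (swapd _ _ _ _))) ler_wpM2r ?sqr_ge0.
Qed.

End PermStein.

(** * Concentration under uniform permutations *)

Section ExpBounds.
Variable R : realType.

(** The linear term disappears once a centred family is summed, which leaves a sub-Gaussian bound.
    For u <= 1/2 the inequality follows from exp u <= 1 / (1 - u) <= 1 + u + 2 u^2, otherwise from u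
    <= 2 u^2. *)
Lemma expR_le_add_sqr (u : R) : expR u <= u + expR (2 * u ^+ 2).
Proof.
have e0 := expR_ge1Dx (2 * u ^+ 2).
have [u2|u2] := leP u 2^-1.
  apply: (@le_trans _ _ (1 + u + 2 * u ^+ 2)); last by lra.
  have u1 : 0 < 1 - u by lra.
  rewrite -[expR u]invrK -expRN -[X in _ <= X]invrK.
  have q0 : 0 < 1 + u + 2 * u ^+ 2 by have := sqr_ge0 (u + 4^-1); rewrite sqrrD => ?; nra.
  rewrite lef_pV2 ?posrE ?invr_gt0 ?expR_gt0 //.
  apply: le_trans (expR_ge1Dx (- u)).
  rewrite -[_^-1]mul1r ler_pdivrMr //.
  by have := sqr_ge0 u; nra.
have : expR u <= expR (2 * u ^+ 2) by rewrite ler_expR; nra.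
by lra.
Qed.

Lemma sum_expR_centered (T : finType) (A : pred T) (y : T -> R) (K : R) :
  \sum_(x | A x) y x = 0 -> (forall x, A x -> `|y x| <= K) ->
  \sum_(x | A x) expR (y x) <= #|A|%:R * expR (2 * K ^+ 2).
Proof.
move=> y0 yK; apply: (@le_trans _ _ (\sum_(x | A x) (y x + expR (2 * K ^+ 2)))).
  apply: ler_sum => x Ax; apply: le_trans (expR_le_add_sqr _) _.
  rewrite lerD2l ler_expR ler_wpM2l // -(real_normK (num_real (y x))) lerXn2r ?nnegrE ?yK //.
  exact: le_trans (yK x Ax).
by rewrite big_split /= y0 add0r sumr_const -[X in X <= _]mulr_natl; apply: lexx.
Qed.

(** Proved from the end of the range downwards. For [k = 0] and labels of sum zero the last term
    vanishes, and a linear statistic becomes a martingale transform for sampling without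
    replacement: the first factor is a label minus the mean of the labels still available, the
    second does not involve the labels. *)
Lemma mart_decomp (l al : nat -> R) (N k : nat) : (k <= N)%N ->
  \sum_(k <= i < N) l i * al i =
  \sum_(k <= i < N) (l i - (\sum_(i <= x < N) l x) / (N - i)%:R) *
     (al i - (\sum_(i.+1 <= x < N) al x) / (N - i.+1)%:R) +
  (\sum_(k <= i < N) l i) * (\sum_(k <= i < N) al i) / (N - k)%:R.
Proof.
move=> kN; rewrite -(subKn kN); move: (leq_subr k N); move: (N - k)%N => r.
elim: r => [|r ih] rN; first by rewrite subn0 !big_geq // mulr0 mul0r addr0.
set q := (N - r.+1)%N.
have qN : (q < N)%N by rewrite /q; lia.
have qS : q.+1 = (N - r)%N by rewrite /q; lia.
rewrite !(big_ltn qN) qS ih; last by lia.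
have -> : (N - q = r.+1)%N by rewrite /q; lia.
have -> : (N - (N - r) = r)%N by lia.
set C := \sum_(N - r <= i < N) l i; set A := \sum_(N - r <= i < N) al i.
set S := \sum_(N - r <= i < N) _.
(* At the last index the mean of the following weights is an empty sum divided by 0, that is 0, so
   the identity is checked separately there. *)
case: r rN ih @q qN qS @C @A @S => [|r] rN ih q qN qS C A S.
  by rewrite /A /C /S subn0 !big_geq // !mul0r !addr0 subr0 !divr1 subrr mul0r add0r.
have k0 : r.+1%:R != 0 :> R by rewrite pnatr_eq0.
have k1 : r.+1%:R + 1 != 0 :> R by rewrite natr1 pnatr_eq0.
have -> : r.+2%:R = r.+1%:R + 1 :> R by rewrite natr1.
by field; rewrite !nat1r natr1 !pnatr_eq0.
Qed.

End ExpBounds.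

Section PermMartingale.
Variables (R : realType) (I : finType) (c : I -> R) (cm : R).
Hypothesis c_sum0 : \sum_s c s = 0.
Hypothesis c_bound : forall s, `|c s| <= cm.
Let N := #|I|.
Variable pt : nat -> I.
Hypothesis pt_inj : forall i j, (i < N)%N -> (j < N)%N -> pt i = pt j -> i = j.
Implicit Types s : {perm I}.

Definition lab s (i : nat) : R := c (s (pt i)).
(* The label at step [i] minus the mean of the labels not yet revealed. *)
Definition minc s (i : nat) : R :=
  lab s i - (\sum_(i <= x < N) lab s x) / (N - i)%:R.

Lemma sum_pt (F : I -> R) : \sum_(0 <= i < N) F (pt i) = \sum_z F z.
Proof.
rewrite big_mkord [RHS](reindex (fun i : 'I_N => pt i)) //.
apply: onW_bij; apply: inj_card_bij; last by rewrite card_ord.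
by move=> i j /pt_inj ij; apply/val_inj/ij.
Qed.

Lemma sum_lab s : \sum_(0 <= i < N) lab s i = 0.
Proof. by rewrite (sum_pt (fun z => c (s z))) c_perm_sum0. Qed.

Lemma lab_swap_lt s i k x : (i < k)%N -> (k <= x < N)%N ->
  lab (tperm (pt k) (pt x) * s)%g i = lab s i.
Proof.
move=> ik /andP[kx xN]; have iN : (i < N)%N by lia.
have kN : (k < N)%N by lia.
rewrite /lab permM tpermD //; apply/eqP => e.
  by have := pt_inj kN iN e; lia.
by have := pt_inj xN iN e; lia.
Qed.

Lemma lab_swapL s k x : lab (tperm (pt k) (pt x) * s)%g k = lab s x.
Proof. by rewrite /lab permM tpermL. Qed.

(** Because the labels sum to zero, the mean of the unrevealed ones is a function of the revealed
    ones; this is what makes [minc] adapted. *)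
Lemma rest_lab s i : (i <= N)%N ->
  \sum_(i <= x < N) lab s x = - \sum_(0 <= x < i) lab s x.
Proof.
move=> iN; have := sum_lab s; rewrite (@big_cat_nat _ _ _ i) //= => /eqP.
by rewrite addrC addr_eq0 => /eqP.
Qed.

Lemma minc_swap_lt s i k x : (i < k)%N -> (k <= x < N)%N ->
  minc (tperm (pt k) (pt x) * s)%g i = minc s i.
Proof.
move=> ik kx; rewrite /minc !rest_lab; [|lia|lia].
rewrite (lab_swap_lt _ ik) //; congr (_ - - _ / _).
by rewrite !big_nat; apply: eq_bigr => q qi; rewrite lab_swap_lt //; lia.
Qed.

Variable phi : nat -> {perm I} -> R.
Variable Ph : R.
Hypothesis phi_bound : forall i s, `|phi i s| <= Ph.
Hypothesis phi_pred : forall i k x s, (i <= k)%N -> (k <= x < N)%N ->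
  phi i (tperm (pt k) (pt x) * s)%g = phi i s.

(** [phi_pred] expresses predictability without a filtration: [phi i] is unchanged by transpositions
    among the positions from [i] on, so it depends only on what [s] assigns to earlier positions. *)
Definition mart s (k : nat) : R := \sum_(0 <= i < k) phi i s * minc s i.

Lemma mart_swap s k x : (k <= x < N)%N ->
  mart (tperm (pt k) (pt x) * s)%g k = mart s k.
Proof.
move=> kx; rewrite /mart !big_nat; apply: eq_bigr => i /andP[_ ik].
by rewrite phi_pred ?minc_swap_lt // ltnW.
Qed.

(** Azuma-Hoeffding with transpositions in place of conditional expectations: averaging over the
    swaps of position [k] with each position from [k] on keeps the past fixed and makes the label at
    [k] uniform among the unrevealed ones, so that the increment is centred and at most [2 * cm]. *)
Lemma mart_mgf (la : R) k : (k <= N)%N ->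
  fmean (fun s => expR (la * mart s k)) <= expR (2 * (`|la| * Ph * (2 * cm)) ^+ 2 * k%:R).
Proof.
have P0 : (0 < #|{perm I}|)%N by apply/card_gt0P; exists 1%g.
elim: k => [|k ih] kN.
  rewrite mulr0 expR0 -[leRHS](fmean_cst (T := {perm I}) 1) //.
  by apply: ler_fmean => s; rewrite /mart big_geq // mulr0 expR0.
set K := 2 * _ ^+ 2.
have Ph0 : 0 <= Ph by apply: le_trans (phi_bound 0 1%g).
have cm0 : 0 <= cm by apply: le_trans (c_bound (pt 0)).
pose y s x := lab s x - (\sum_(k <= x < N) lab s x) / (N - k)%:R.
pose A := [pred x : 'I_N | k <= x]%N.
have Nk : (N - k)%:R != 0 :> R by rewrite pnatr_eq0; lia.
have cA : #|A| = (N - k)%N.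
  transitivity (\sum_(k <= i < N) 1)%N; last by rewrite sum_nat_const_nat muln1.
  by rewrite (big_nat_widenl _ 0) // big_mkord sum1_card; apply: eq_card.
have swapE (x : 'I_N) : A x ->
  fmean (fun s => expR (la * mart s k.+1)) =
  fmean (fun s => expR (la * mart s k) * expR (la * phi k s * y s x)).
  move=> Ax; have kx : (k <= x < N)%N by rewrite (ltn_ord x) andbT.
  rewrite -(fmean_bij _ (tpermM_bij (pt k) (pt x))); apply: eq_fmean => s.
  rewrite {1}/mart big_nat_recr //= -/(mart _ _) mart_swap // phi_pred // mulrDr expRD.
  congr (_ * expR _); rewrite /minc /y lab_swapL !rest_lab; [|lia|lia].
  rewrite (eq_big_nat _ _ (F2 := fun x => lab s x)); first by rewrite mulrA.
  by move=> i /andP[_ ik]; rewrite lab_swap_lt.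
have : \sum_(x | A x) fmean (fun s => expR (la * mart s k.+1)) <=
   (N - k)%:R * fmean (fun s => expR (la * mart s k) * expR K).
  rewrite (eq_bigr _ swapE).
  rewrite [X in X <= _](_ : _ = fmean (fun s => \sum_(x | A x)
     (expR (la * mart s k) * expR (la * phi k s * y s x)))); last first.
    by rewrite /fmean exchange_big mulr_sumr.
  rewrite -fmeanZ; apply: ler_fmean => s.
  rewrite -mulr_sumr mulrCA ler_wpM2l ?expR_ge0 // -cA.
  apply: le_trans (sum_expR_centered (K := `|la| * Ph * (2 * cm)) _ _) _ => //.
    rewrite -mulr_sumr; apply/eqP; rewrite mulf_eq0; apply/orP; right; apply/eqP.
    rewrite sumrB sumr_const cA -[(_ / _) *+ _]mulr_natr.
    rewrite [X in X - _](_ : _ = \sum_(k <= x < N) lab s x); last first.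
      by rewrite (big_nat_widenl _ 0) // big_mkord; apply: eq_bigl => i.
    by rewrite divfK ?subrr.
  move=> x Ax; rewrite !normrM -!mulrA ler_wpM2l // ler_pM ?phi_bound //.
  have rb : `|(\sum_(k <= x < N) lab s x) / (N - k)%:R| <= cm.
    rewrite normrM normfV (ger0_norm (ler0n _ _)) ler_pdivrMr ?ltr0n ?subn_gt0 //.
    apply: le_trans (ler_norm_sum _ _ _) _.
    apply: (@le_trans _ _ (\sum_(k <= i < N) cm)); first by apply: ler_sum => i _; exact: c_bound.
    by rewrite sumr_const_nat -[cm *+ _]mulr_natr.
  apply: le_trans (ler_normB _ _) _.
  have := c_bound (s (pt x)); rewrite -/(lab s x) => h; lra.
rewrite sumr_const cA -[(fmean _) *+ _]mulr_natl ler_pM2l ?ltr0n ?subn_gt0 // => h.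
apply: le_trans h _.
rewrite [X in fmean X](_ : _ = (fun s => expR K * expR (la * mart s k))); last first.
  by apply/funext => s; rewrite mulrC.
rewrite fmeanZ.
apply: le_trans (ler_wpM2l (expR_ge0 _) (ih (ltnW kN))) _.
by rewrite -/K -expRD ler_expR -natr1; lra.
Qed.

Lemma mart_tail (K tau : R) : 0 < K -> 0 <= tau -> Ph ^+ 2 * cm ^+ 2 * N%:R <= K ^+ 2 ->
  fprob (fun s => 8 * K * tau <= mart s N) <= expR (- tau ^+ 2).
Proof.
move=> K0 t0 HK.
have [->|tn0] := eqVneq tau 0.
  rewrite expr0n oppr0 expR0.
  have P0 : (0 < #|{perm I}|)%N by apply/card_gt0P; exists 1%g.
  rewrite -[leRHS](fmean_cst (T := {perm I}) 1) //; apply: ler_fmean => s.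
  by rewrite -[leRHS]/(1%:R) ler_nat leq_b1.
(* Chernoff: this value minimizes [8 la^2 K^2 - 8 la K tau], and the minimum is [- 2 tau^2]. *)
pose la := tau / (2 * K).
have la0 : 0 < la by rewrite divr_gt0 ?mulr_gt0 // lt_neqAle eq_sym tn0.
apply: (@le_trans _ _ (fprob (fun s => expR (la * (8 * K * tau)) <= expR (la * mart s N)))).
  by apply: fprob_sub => s; rewrite /in_mem /= ler_expR ler_pM2l.
apply: le_trans (fprob_markov (expR_gt0 _) (fun s => expR_ge0 _)) _.
rewrite -expRN; apply: le_trans (ler_wpM2r (expR_ge0 _) (mart_mgf la (leqnn N))) _.
rewrite -expRD ler_expR (gtr0_norm la0).
have -> : 2 * (la * Ph * (2 * cm)) ^+ 2 * N%:R = 8 * la ^+ 2 * (Ph ^+ 2 * cm ^+ 2 * N%:R) by ring.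
have e1 : 8 * la ^+ 2 * (Ph ^+ 2 * cm ^+ 2 * N%:R) <= 8 * la ^+ 2 * K ^+ 2.
  by rewrite ler_wpM2l // mulr_ge0 // sqr_ge0.
have e2 : 8 * la ^+ 2 * K ^+ 2 = 2 * tau ^+ 2 by rewrite /la; field; rewrite gt_eqF.
have e3 : la * (8 * K * tau) = 4 * tau ^+ 2 by rewrite /la; field; rewrite gt_eqF.
have := sqr_ge0 tau; lra.
Qed.

End PermMartingale.

Section PermConcentration.
Variables (R : realType) (I : finType) (c : I -> R) (cm : R).
Hypothesis c_sum0 : \sum_s c s = 0.
Hypothesis c_bound : forall s, `|c s| <= cm.
Let N := #|I|.
Variable pt : nat -> I.
Hypothesis pt_inj : forall i j, (i < N)%N -> (j < N)%N -> pt i = pt j -> i = j.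

Lemma mart_tail2 (phi : nat -> {perm I} -> R) (Ph K tau : R) :
  (forall i s, `|phi i s| <= Ph) ->
  (forall i k x s, (i <= k)%N -> (k <= x < N)%N ->
    phi i (tperm (pt k) (pt x) * s)%g = phi i s) ->
  0 < K -> 0 <= tau -> Ph ^+ 2 * cm ^+ 2 * N%:R <= K ^+ 2 ->
  fprob (fun s => 8 * K * tau <= `|mart c pt phi s N|) <= 2 * expR (- tau ^+ 2).
Proof.
move=> phb php K0 t0 HK.
have h1 := mart_tail c_sum0 c_bound pt_inj phb php K0 t0 HK.
have h2 := @mart_tail R I c cm c_sum0 c_bound pt pt_inj (fun i s => - phi i s) Ph _ _ K tau K0 t0 HK.
have {}h2 : fprob (fun s => 8 * K * tau <= - mart c pt phi s N) <= expR (- tau ^+ 2).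
  apply: le_trans (h2 _ _).
  - apply: fprob_sub => s; rewrite /in_mem /= /mart.
    by under [X in _ -> is_true (_ <= X)]eq_bigr do rewrite mulNr; rewrite sumrN.
  - by move=> i s; rewrite normrN.
  - by move=> i k x s ik kx; rewrite php.
apply: le_trans (_ : fprob (predU (fun s => 8 * K * tau <= mart c pt phi s N)
   (fun s => 8 * K * tau <= - mart c pt phi s N)) <= _).
  by apply: fprob_sub => s; rewrite /in_mem /= lerNr ler_normr /= lerNr.
by apply: le_trans (fprobU _ _) _; lra.
Qed.

(** By [mart_decomp] the statistic is a martingale transform with deterministic weights, each of
    them a value of [al] minus an average of later values, hence at most [2 * A]. *)
Lemma lstat_tail (al : I -> R) (A K tau : R) : (forall z, `|al z| <= A) ->
  0 < K -> 0 <= tau -> (2 * A) ^+ 2 * cm ^+ 2 * N%:R <= K ^+ 2 ->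
  fprob (fun s : {perm I} => 8 * K * tau <= `|\sum_z c (s z) * al z|) <= 2 * expR (- tau ^+ 2).
Proof.
move=> alA K0 t0 HK.
pose phi i (s : {perm I}) := al (pt i) - (\sum_(i.+1 <= x < N) al (pt x)) / (N - i.+1)%:R.
have A0 : 0 <= A by apply: le_trans (alA (pt 0)).
apply: le_trans (@mart_tail2 phi (2 * A) K tau _ _ K0 t0 HK).
- apply: fprob_sub => s; rewrite /in_mem /=.
  rewrite -(sum_pt pt_inj (fun z => c (s z) * al z)).
  rewrite (mart_decomp (fun i => c (s (pt i))) (fun i => al (pt i)) (leq0n N)).
  rewrite (sum_lab c_sum0 pt_inj) mul0r mul0r addr0 /mart.
  by under [X in _ -> is_true (_ <= `|X|)]eq_bigr do rewrite mulrC.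
- move=> i s; rewrite /phi; apply: le_trans (ler_normB _ _) _.
  rewrite mulr_natl mulr2n lerD ?alA //.
  have [N1|N1] := leqP N i.+1; first by rewrite big_geq // mul0r normr0.
  rewrite normrM normfV (ger0_norm (ler0n _ _)) ler_pdivrMr ?ltr0n ?subn_gt0 //.
  apply: le_trans (ler_norm_sum _ _ _) _.
  apply: (@le_trans _ _ (\sum_(i.+1 <= i < N) A)); first by apply: ler_sum => j _; exact: alA.
  by rewrite sumr_const_nat -[A *+ _]mulr_natr.
- by [].
Qed.

End PermConcentration.

(** * Linearization of two-sample rank statistics *)

Section TwoSampleLabels.
Variables (R : realType) (n m : nat).
Hypotheses (n_gt0 : (0 < n)%N) (m_gt0 : (0 < m)%N) (mn : (m <= n)%N).
Local Notation I := ('I_n + 'I_m)%type.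
Local Notation N := (#|{: 'I_n + 'I_m}|).

Definition kap : R := Num.sqrt (n%:R * m%:R / (n%:R + m%:R)).
(** A permutation [s] gives the pooled point [z] the sample index [s z], with [inl] for the first
    sample. Under these labels a linear statistic is [kap] times the difference of the mean over the
    second sample and the mean over the first ([lstat_avg]). *)
Definition cl (s : I) : R := if s is inl _ then - (kap / n%:R) else kap / m%:R.

Lemma cardI : N = (n + m)%N.
Proof. by rewrite card_sum !card_ord. Qed.

Let nR : 0 < n%:R :> R. Proof. by rewrite ltr0n. Qed.
Let mR : 0 < m%:R :> R. Proof. by rewrite ltr0n. Qed.
Let NR : 0 < N%:R :> R. Proof. by rewrite cardI ltr0n addn_gt0 n_gt0. Qed.
Let NE : N%:R = n%:R + m%:R :> R. Proof. by rewrite cardI natrD. Qed.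

Lemma kap_gt0 : 0 < kap.
Proof. by rewrite sqrtr_gt0 divr_gt0 ?mulr_gt0 // addr_gt0. Qed.

Lemma kap2 : kap ^+ 2 = n%:R * m%:R / (n%:R + m%:R).
Proof. by rewrite sqr_sqrtr // divr_ge0 ?mulr_ge0 ?addr_ge0 ?ler0n. Qed.

Lemma sum_cl : \sum_s cl s = 0.
Proof.
rewrite big_sumType /= !sumr_const !card_ord -[X in X + _]mulr_natr -[X in _ + X]mulr_natr.
by field; rewrite !gt_eqF.
Qed.

Lemma cl_bound s : `|cl s| <= kap / m%:R.
Proof.
have k0 := kap_gt0.
case: s => s /=; last by rewrite ger0_norm // divr_ge0 ?ltW.
rewrite normrN ger0_norm ?divr_ge0 ?(ltW k0) ?ler0n //.
by rewrite ler_pM2l // lef_pV2 ?posrE // ler_nat.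
Qed.

(** The variance proxy in all the tail bounds that follow; it stays bounded as long as [m] is of the
    order of [n]. *)
Lemma cm2N : (kap / m%:R) ^+ 2 * N%:R = n%:R / m%:R.
Proof.
rewrite exprMn kap2 NE exprVn; field.
by rewrite !gt_eqF ?addr_gt0.
Qed.

Variable pt : nat -> I.
Hypothesis pt_inj : forall i j, (i < N)%N -> (j < N)%N -> pt i = pt j -> i = j.
Implicit Types s : {perm I}.

Definition isX (z : I) : bool := if z is inl _ then true else false.
Definition cntX s k : nat := \sum_(0 <= i < k) isX (s (pt i)).
Definition plab s k : R := \sum_(0 <= i < k) lab cl pt s i.
(** By [cntXE], the empirical distribution function of the first sample just before position [k] of
    the ordering. This form shows that it is predictable and that it differs from the pooled rank by
    a partial sum of labels. *)
Definition Fpred s k : R := k%:R / N%:R - m%:R / N%:R / kap * plab s k.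

Lemma cntXE s k : (cntX s k)%:R / n%:R = Fpred s k.
Proof.
have k0 := kap_gt0; rewrite /Fpred.
have -> : plab s k = kap * (k%:R / m%:R - (cntX s k)%:R * (n%:R^-1 + m%:R^-1)).
  rewrite /plab /cntX; elim: k => [|k ih]; first by rewrite !big_geq //; ring.
  rewrite !big_nat_recr //= ih natrD -natr1 /lab.
  by case: (s (pt k)) => ? /=; rewrite ?addr0; ring.
rewrite NE; field.
by rewrite !gt_eqF ?addr_gt0.
Qed.

Lemma cntXN s : cntX s N = n.
Proof.
apply/eqP; rewrite -(eqr_nat R) -(inj_eq (mulIf (invr_neq0 (lt0r_neq0 nR)))) cntXE.
by rewrite /Fpred /plab (sum_lab sum_cl pt_inj) mulr0 subr0 (divff (lt0r_neq0 NR)) (divff (lt0r_neq0 nR)).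
Qed.

Lemma cntX_le s k : (k <= N)%N -> (cntX s k <= n)%N.
Proof.
move=> kN; rewrite -[X in (_ <= X)%N](cntXN s).
by rewrite /cntX [X in (_ <= X)%N](@big_cat_nat _ _ _ k) //= leq_addr.
Qed.

Lemma cntX_unit s k : (k <= N)%N -> 0 <= ((cntX s k)%:R / n%:R : R) <= 1.
Proof.
move=> kN; rewrite divr_ge0 ?ler0n //= ler_pdivrMr // mul1r ler_nat.
exact: cntX_le.
Qed.

Lemma cntXS s k : cntX s k.+1 = (cntX s k + isX (s (pt k)))%N.
Proof. by rewrite /cntX big_nat_recr. Qed.

Variables (psi : R -> R) (B : R).
Hypothesis psi_lip : forall x y, 0 <= x <= 1 -> 0 <= y <= 1 ->
  `|psi x - psi y| <= B * `|x - y|.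

Lemma sum_X s k : (k <= N)%N ->
  \sum_(0 <= i < k) (isX (s (pt i)))%:R * psi ((cntX s i.+1)%:R / n%:R) =
  \sum_(0 <= r < cntX s k) psi (r.+1%:R / n%:R).
Proof.
elim: k => [|k ih] kN; first by rewrite /cntX !big_geq.
rewrite big_nat_recr //= ih 1?ltnW // !cntXS; case: (isX _) => /=.
  by rewrite mul1r addn1 big_nat_recr.
by rewrite mul0r addr0 addn0.
Qed.

Definition Yavg (F : I -> R) s : R :=
  kap / m%:R * \sum_(0 <= i < N) (~~ isX (s (pt i)))%:R * psi (F (pt i)).
Definition lrank s : R := \sum_(0 <= i < N) lab cl pt s i * psi (i.+1%:R / N%:R).

(* Clipping keeps the martingale transform bounded off the good event as well. *)
Definition clip (K x : R) : R := Num.max (- K) (Num.min K x).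

Lemma clip_bound K x : 0 <= K -> `|clip K x| <= K.
Proof.
move=> K0; rewrite ler_norml /clip le_max lexx /= ge_max ge_min lexx /= andbT.
lra.
Qed.

Lemma clip_id K x : `|x| <= K -> clip K x = x.
Proof. by rewrite ler_norml /clip => /andP[a b]; rewrite (min_r b) (max_r a). Qed.

(** [Fpred s i] ignores the label at step [i], whereas the rank [i.+1] counts the point itself; the
    shift is what makes the integrand predictable. *)
Definition phip s i : R := psi (Fpred s i) - psi (i.+1%:R / N%:R).

Lemma plab_swap s i k x : (i <= k)%N -> (k <= x < N)%N ->
  plab (tperm (pt k) (pt x) * s)%g i = plab s i.
Proof.
move=> ik kx; rewrite /plab !big_nat; apply: eq_bigr => q /andP[_ qi].
by rewrite lab_swap_lt //; lia.
Qed.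

Variables (tau : R).
Hypothesis tau1 : 1 <= tau.
Let t0 : 0 <= tau. Proof. exact: le_trans ler01 tau1. Qed.
Let q : R := Num.sqrt (n%:R / m%:R).

Let q2 : q ^+ 2 = n%:R / m%:R.
Proof. by rewrite sqr_sqrtr // divr_ge0 ?ler0n. Qed.

Let q_gt0 : 0 < q. Proof. by rewrite sqrtr_gt0 divr_gt0. Qed.

(** A partial sum of labels is the linear statistic of the indicator of the first [k] positions, so
    [lstat_tail] applies with [A = 1]. *)
Lemma plab_tail k : (k <= N)%N ->
  fprob (fun s => 16 * q * tau <= `|plab s k|) <= 2 * expR (- tau ^+ 2).
Proof.
move=> kN.
have K0 : 0 < 2 * q by rewrite mulr_gt0.
pose al z : R := [exists i : 'I_N, (i < k)%N && (pt i == z)]%:R.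
have al1 z : `|al z| <= 1.
  by rewrite /al ger0_norm ?ler0n // -[leRHS]/(1%:R) ler_nat leq_b1.
have HK : (2 * 1) ^+ 2 * (kap / m%:R) ^+ 2 * N%:R <= (2 * q) ^+ 2.
  by rewrite -mulrA cm2N [leRHS]exprMn q2 mulr1.
apply: le_trans (lstat_tail sum_cl cl_bound pt_inj al1 K0 t0 HK).
apply: fprob_sub => s; rewrite /in_mem /=.
have -> : \sum_z cl (s z) * al z = plab s k.
  rewrite -(sum_pt pt_inj (fun z => cl (s z) * al z)) (@big_cat_nat _ _ _ k) //=.
  rewrite [X in _ + X]big_nat_cond [X in _ + X]big1 ?addr0; last first.
    move=> i /andP[/andP[ki iN] _]; rewrite /al; case: existsP => [[j /andP[jk /eqP e]]|]; last by rewrite mulr0.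
    by have := pt_inj (ltn_ord j) iN e; lia.
  rewrite /plab !big_nat; apply: eq_bigr => i /andP[_ ik].
  have iN : (i < N)%N by lia.
  rewrite /al; case: existsP => [_|[]]; first by rewrite mulr1.
  by exists (Ordinal iN); rewrite /= ik eqxx.
by move=> h; apply: le_trans h; lra.
Qed.

Let Ph := B * (17 * tau / Num.sqrt N%:R).
Hypothesis B0 : 0 < B.

Let sN : 0 < Num.sqrt N%:R :> R. Proof. by rewrite sqrtr_gt0. Qed.
Let sN2 : Num.sqrt N%:R ^+ 2 = N%:R :> R. Proof. by rewrite sqr_sqrtr ?ler0n. Qed.

Lemma mNk : m%:R / N%:R / kap * q = (Num.sqrt N%:R)^-1.
Proof.
have k0 := kap_gt0.
have h1 : 0 <= m%:R / N%:R / kap * q.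
  by rewrite mulr_ge0 ?(ltW q_gt0) // !divr_ge0 ?(ltW k0) ?ler0n.
have h2 : 0 <= (Num.sqrt N%:R)^-1 :> R by rewrite invr_ge0 ltW.
apply/eqP; rewrite -(eqrXn2 (isT : (0 < 2)%N) h1 h2).
rewrite exprMn q2 exprVn sN2 !exprMn exprVn exprVn kap2 NE; apply/eqP; field.
by rewrite !gt_eqF ?addr_gt0.
Qed.

Definition goodP s : bool := [forall k : 'I_N.+1, `|plab s k| < 16 * q * tau].

Lemma goodP_tail : fprob (predC goodP) <= N.+1%:R * (2 * expR (- tau ^+ 2)).
Proof.
apply: le_trans (_ : fprob (fun s => [exists k : 'I_N.+1, 16 * q * tau <= `|plab s k|]) <= _).
  apply: fprob_sub => s; rewrite /in_mem /= negb_forall => /existsP[k].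
  by rewrite -leNgt => h; apply/existsP; exists k.
rewrite -[in leRHS](card_ord N.+1); apply: fprob_exists => k.
by apply: plab_tail; rewrite -ltnS.
Qed.

Lemma goodP_dev s k : goodP s -> (k <= N)%N -> `|Fpred s k - k%:R / N%:R| <= 16 * tau / Num.sqrt N%:R.
Proof.
move=> /forallP gs kN; have kN' : (k < N.+1)%N by [].
have := ltW (gs (Ordinal kN')) => /= h.
rewrite /Fpred [X in `|X|](_ : _ = - (m%:R / N%:R / kap * plab s k)); last by ring.
have k0 := kap_gt0.
have z0 : 0 <= m%:R / N%:R / kap by rewrite !divr_ge0 ?(ltW k0) ?ler0n.
rewrite normrN normrM (ger0_norm z0); apply: le_trans (ler_wpM2l z0 h) _.
rewrite [X in X <= _](_ : _ = 16 * tau * (m%:R / N%:R / kap * q)); last by ring.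
by rewrite mNk.
Qed.

Lemma Fpred_unit s k : (k <= N)%N -> 0 <= Fpred s k <= 1.
Proof. by move=> kN; rewrite -cntXE; exact: cntX_unit. Qed.

Lemma rank_unit k : (k <= N)%N -> 0 <= (k%:R / N%:R : R) <= 1.
Proof. by move=> kN; rewrite divr_ge0 ?ler0n //= ler_pdivrMr // mul1r ler_nat. Qed.

Lemma invN_le : N%:R^-1 <= tau / Num.sqrt N%:R.
Proof.
rewrite -[in leLHS]sN2 expr2 invfM.
have s1 : (Num.sqrt N%:R)^-1 <= 1 :> R.
  by rewrite invf_le1 // -[leLHS]sqrtr1 ler_wsqrtr // ler1n -(ltr_nat R).
by rewrite ler_wpM2r ?invr_ge0 ?(ltW sN) // (le_trans s1).
Qed.

(** 17 = 16 + 1: the deviation of the partial sums of labels on the good event, and 1 / N for the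
    shift from [k] to [k.+1]. *)
Lemma phip_bound s k : goodP s -> (k < N)%N -> `|phip s k| <= Ph.
Proof.
move=> gs kN; apply: le_trans (psi_lip (Fpred_unit s (ltnW kN)) (rank_unit kN)) _.
rewrite (ler_wpM2l (ltW B0)) //.
have := goodP_dev gs (ltnW kN); have := invN_le.
rewrite [X in `|X| <= _ -> _](_ : _ = (Fpred s k - k.+1%:R / N%:R) + N%:R^-1); last first.
  by rewrite -natr1; field; rewrite gt_eqF.
move=> h1 h2.
have := ler_normB (Fpred s k - k.+1%:R / N%:R + N%:R^-1) N%:R^-1.
rewrite addrK (ger0_norm (_ : 0 <= N%:R^-1)) ?invr_ge0 ?ler0n // => h3.
rewrite -mulrA; rewrite -mulrA in h2; lra.
Qed.

Definition martp s : R := mart cl pt (fun i s => clip Ph (phip s i)) s N.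
Definition goodM s : bool := `|martp s| < 8 * (Ph * q) * tau.

Lemma Ph_gt0 : 0 < Ph.
Proof. by rewrite /Ph mulr_gt0 // divr_gt0 // mulr_gt0 // (lt_le_trans ltr01). Qed.

Lemma goodM_tail : fprob (predC goodM) <= 2 * expR (- tau ^+ 2).
Proof.
have P0 := Ph_gt0.
have HK : Ph ^+ 2 * (kap / m%:R) ^+ 2 * N%:R <= (Ph * q) ^+ 2.
  by rewrite -mulrA cm2N [leRHS]exprMn q2.
have := @mart_tail2 R _ cl _ sum_cl cl_bound pt pt_inj
  (fun i s => clip Ph (phip s i)) Ph (Ph * q) tau _ _ (mulr_gt0 P0 q_gt0) t0 HK.
move=> H; apply: le_trans (H _ _).
- by apply: fprob_sub => s; rewrite /in_mem /= /goodM -leNgt.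
- by move=> i s; apply: clip_bound; exact: ltW.
- by move=> i k x s ik kx; rewrite /phip /Fpred plab_swap.
Qed.

Hypothesis riemann : `|\sum_(0 <= r < n) psi (r.+1%:R / n%:R)| <= B.
Hypothesis harm : \sum_(0 <= i < N) (N - i)%:R^-1 <= tau ^+ 2 :> R.

Lemma kap_n : kap / n%:R <= (Num.sqrt N%:R)^-1.
Proof.
have k0 := kap_gt0.
rewrite -(@ler_pXn2r _ 2) ?nnegrE ?invr_ge0 ?divr_ge0 ?(ltW k0) ?(ltW sN) ?ler0n //.
rewrite exprMn exprVn exprVn sN2 kap2 NE.
rewrite [X in X <= _](_ : _ = (m%:R / n%:R) * (n%:R + m%:R)^-1); last first.
  by field; rewrite !gt_eqF ?addr_gt0.
rewrite ler_piMl ?invr_ge0 ?addr_ge0 ?ler0n // ler_pdivrMr // mul1r ler_nat //.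
Qed.

Lemma labE s i : lab cl pt s i = kap / m%:R * (~~ isX (s (pt i)))%:R - kap / n%:R * (isX (s (pt i)))%:R.
Proof. by rewrite /lab; case: (s (pt i)) => ? /=; rewrite ?mulr0 ?mulr1 ?subr0 ?add0r. Qed.

Lemma sum_abs_lab s : \sum_(0 <= i < N) `|lab cl pt s i| = 2 * kap.
Proof.
rewrite (sum_pt pt_inj (fun z => `|cl (s z)|)).
rewrite -(reindex_inj (@perm_inj _ s) (P := predT) (F := fun z => `|cl z|)) /=.
have k0 := kap_gt0.
rewrite big_sumType /= !sumr_const !card_ord normrN.
rewrite !ger0_norm ?divr_ge0 ?(ltW k0) ?ler0n //.
rewrite -[X in X + _]mulr_natr -[X in _ + X]mulr_natr.
by field; rewrite !gt_eqF.
Qed.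

(** A term-by-term estimate of the score errors would only give order [B * tau]. The gain of 1 /
    sqrt N comes from predictability: summed against the labels, a predictable score error is a
    martingale transform plus a small compensator. *)
Lemma linearization (T : nat) (F : I -> R) s : goodP s -> goodM s ->
  (forall z, 0 <= F z <= 1) ->
  (forall i, (i < N)%N -> `|F (pt i) - (cntX s i.+1)%:R / n%:R| <= T%:R / n%:R) ->
  `|Yavg F s - lrank s| <= (T%:R + 3) * B / Num.sqrt N%:R + 408 * q * B * tau ^+ 4 / Num.sqrt N%:R.
Proof.
move=> gP gM F01 FT.
have k0 := kap_gt0.
pose Fs i : R := (cntX s i.+1)%:R / n%:R.
(* Ties: replacing [F] by the exact count costs at most [T] points. *)
have t1 : `|Yavg F s - kap / m%:R * \sum_(0 <= i < N) (~~ isX (s (pt i)))%:R * psi (Fs i)|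
   <= T%:R * B / Num.sqrt N%:R.
  rewrite -mulrBr -sumrB normrM ger0_norm ?divr_ge0 ?(ltW k0) ?ler0n //.
  apply: (@le_trans _ _ (kap / m%:R * \sum_(0 <= i < N) (~~ isX (s (pt i)))%:R * (B * (T%:R / n%:R)))).
    rewrite ler_wpM2l ?divr_ge0 ?(ltW k0) ?ler0n //.
    apply: le_trans (ler_norm_sum _ _ _) _; rewrite !big_nat; apply: ler_sum => i /andP[_ iN].
    rewrite -mulrBr normrM ger0_norm ?ler0n // ler_wpM2l ?ler0n //.
    apply: le_trans (psi_lip (F01 _) (cntX_unit s iN)) _.
    by rewrite (ler_wpM2l (ltW B0)) // FT.
  rewrite -mulr_suml.
  have -> : \sum_(0 <= i < N) (~~ isX (s (pt i)))%:R = m%:R :> R.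
    have : \sum_(0 <= i < N) ((~~ isX (s (pt i)))%:R + (isX (s (pt i)))%:R) = N%:R :> R.
      rewrite (eq_bigr (fun=> 1)); last by move=> i _; case: (isX _); rewrite ?add0r ?addr0.
      by rewrite sumr_const_nat subn0.
    rewrite big_split /= -[X in _ + X]natr_sum -/(cntX s N) cntXN NE => h.
    by apply: (addIr n%:R); rewrite h addrC.
  rewrite [X in X <= _](_ : _ = T%:R * B * (kap / n%:R)); last by field; rewrite !gt_eqF.
  by rewrite ler_wpM2l ?kap_n // mulr_ge0 ?ler0n // ltW.
(* The labels of the first sample contribute the sum of [psi (r / n)] for r from 1 to n, whatever
   [s] is. This Riemann sum is at most [B]. *)
have t2 : `|kap / m%:R * \sum_(0 <= i < N) (~~ isX (s (pt i)))%:R * psi (Fs i) -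
   \sum_(0 <= i < N) lab cl pt s i * psi (Fs i)| <= B / Num.sqrt N%:R.
  rewrite [X in `|X|](_ : _ = kap / n%:R * \sum_(0 <= i < N) (isX (s (pt i)))%:R * psi (Fs i)); last first.
    rewrite !mulr_sumr -sumrB; apply: eq_bigr => i _; rewrite labE; ring.
  rewrite /Fs sum_X // cntXN normrM ger0_norm ?divr_ge0 ?(ltW k0) ?ler0n //.
  by rewrite [leRHS]mulrC ler_pM ?kap_n ?normr_ge0 // divr_ge0 ?(ltW k0) ?ler0n.
(* Dropping the current point from the count makes the integrand predictable. *)
have t3 : `|\sum_(0 <= i < N) lab cl pt s i * psi (Fs i) -
   \sum_(0 <= i < N) lab cl pt s i * psi (Fpred s i)| <= 2 * B / Num.sqrt N%:R.
  rewrite -sumrB; apply: le_trans (ler_norm_sum _ _ _) _.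
  apply: (@le_trans _ _ (\sum_(0 <= i < N) `|lab cl pt s i| * (B / n%:R))).
    rewrite !big_nat; apply: ler_sum => i /andP[_ iN].
    rewrite -mulrBr normrM ler_wpM2l // -cntXE.
    apply: le_trans (psi_lip (cntX_unit s iN) (cntX_unit s (ltnW iN))) _.
    rewrite (ler_wpM2l (ltW B0)) // /Fs cntXS natrD mulrDl addrC addKr.
    rewrite ger0_norm ?divr_ge0 ?ler0n // ler_piMl ?invr_ge0 ?ler0n //.
    by rewrite -[leRHS]/(1%:R) ler_nat leq_b1.
  rewrite -mulr_suml sum_abs_lab.
  rewrite [X in X <= _](_ : _ = 2 * B * (kap / n%:R)); last by ring.
  by rewrite ler_wpM2l ?kap_n // mulr_ge0 // ltW.
have Pb k : (k <= N)%N -> `|plab s k| <= 16 * q * tau.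
  move=> kN; have kN' : (k < N.+1)%N by [].
  by have /forallP /(_ (Ordinal kN')) /ltW := gP.
(* The compensator divides partial sums of labels by the number of labels left, which brings in the
   harmonic sum bounded by [tau ^+ 2]. 408 = 8 * 17 + 16 * 17. *)
have t4 : `|\sum_(0 <= i < N) lab cl pt s i * phip s i| <= 408 * q * B * tau ^+ 4 / Num.sqrt N%:R.
  rewrite [X in `|X|](_ : _ = martp s - \sum_(0 <= i < N) phip s i * (plab s i / (N - i)%:R)); last first.
    rewrite /martp /mart -sumrB !big_nat; apply: eq_bigr => i /andP[_ iN].
    rewrite clip_id ?phip_bound // /minc rest_lab //; [|exact: sum_cl|exact: ltnW].
    by rewrite -/(plab s i); ring.
  apply: le_trans (ler_normB _ _) _.
  have e1 : `|martp s| <= 8 * (Ph * q) * tau by exact: ltW.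
  have P0 := Ph_gt0.
  have e2 : `|\sum_(0 <= i < N) phip s i * (plab s i / (N - i)%:R)| <= Ph * (16 * q * tau) * tau ^+ 2.
    apply: le_trans (ler_norm_sum _ _ _) _.
    apply: (@le_trans _ _ (\sum_(0 <= i < N) Ph * (16 * q * tau) * (N - i)%:R^-1)).
      rewrite !big_nat; apply: ler_sum => i /andP[_ iN].
      rewrite !normrM normfV (ger0_norm (ler0n _ _)) mulrA.
      by rewrite ler_wpM2r ?invr_ge0 ?ler0n // ler_pM ?phip_bound ?Pb // ltnW.
    rewrite -mulr_sumr ler_wpM2l // mulr_ge0 ?(ltW P0) // !mulr_ge0 ?(ltW q_gt0) //.
  apply: le_trans (lerD e1 e2) _.
  set u := q * B / Num.sqrt N%:R.
  have u0 : 0 <= u by rewrite divr_ge0 ?mulr_ge0 ?(ltW q_gt0) ?(ltW B0) ?(ltW sN).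
  rewrite [X in X <= _](_ : _ = u * (136 * tau ^+ 2 + 272 * tau ^+ 4)); last by rewrite /u /Ph; ring.
  rewrite [X in _ <= X](_ : _ = u * (408 * tau ^+ 4)); last by rewrite /u; ring.
  rewrite ler_wpM2l //.
  have : tau ^+ 2 <= tau ^+ 4 by rewrite ler_weXn2l.
  lra.
have dE : lrank s = \sum_(0 <= i < N) lab cl pt s i * psi (Fpred s i) -
   \sum_(0 <= i < N) lab cl pt s i * phip s i.
  by rewrite -sumrB; apply: eq_bigr => i _; rewrite /phip; ring.
rewrite dE; move: t1 t2 t3 t4.
rewrite !ler_norml => /andP[? ?] /andP[? ?] /andP[? ?] /andP[? ?].
lra.
Qed.

End TwoSampleLabels.

(** * Gaussian integration by parts *)

Section NormalByParts.
Variable R : realType.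
Local Notation mu := (@lebesgue_measure R).
Local Notation N01 := (@normal_prob R 0 1).
Local Notation phi := (@normal_pdf R 0 1).

Lemma integral_normal_prob (f : R -> \bar R) : measurable_fun setT f ->
  (\int[N01]_x `|f x| < +oo)%E ->
  (\int[N01]_x f x = \int[mu]_x (f x * (phi x)%:E))%E.
Proof.
move=> mf finf.
rewrite -(Radon_Nikodym_change_of_variables (@normal_prob_dominates R 0 1))//=; last first.
  by apply/integrableP; split.
apply: ae_eq_integral => //.
- apply: emeasurable_funM => //; apply: (measurable_int mu).
  by apply: Radon_Nikodym_integrable; exact: normal_prob_dominates.
- apply: emeasurable_funM => //=; apply/measurableT_comp => //=.
  exact: measurable_normal_pdf.
- apply: ae_eqe_mul2l => /=.
  rewrite Radon_NikodymE//=; first exact: normal_prob_dominates.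
  move=> abmu.
  case: cid => /= h [h1 h2 h3].
  apply: integral_ae_eq => //=.
  + by apply/measurableT_comp =>//; exact: measurable_normal_pdf.
  + by move=> E E01 mE; rewrite -h3//=.
Qed.

Lemma normal_pdf01E x : phi x = normal_peak 1 * expR (- (x ^+ 2 / 2)) :> R.
Proof.
rewrite normal_pdfE ?oner_eq0 // /normal_fun subr0 expr1n mulNr.
by rewrite -mulr_natr mul1r.
Qed.

(** Half of the Gaussian exponent absorbs the polynomial; the other half is, up to a constant, the
    density of variance 2, which is integrable. *)
Lemma sqr_pdf_bound : exists2 C : R, 0 <= C & forall x, (1 + x ^+ 2) * phi x <= C * normal_pdf 0 (Num.sqrt 2) x.
Proof.
have s2 : Num.sqrt 2 != 0 :> R by rewrite sqrtr_eq0 -ltNge.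
have p0 := @normal_peak_gt0 R _ s2.
have p1 := @normal_peak_ge0 R 1.
exists (5 * normal_peak 1 / normal_peak (Num.sqrt 2)).
  by rewrite divr_ge0 ?(ltW p0) // mulr_ge0.
move=> x; rewrite normal_pdf01E normal_pdfE // /normal_fun subr0 sqr_sqrtr //.
rewrite [leRHS](_ : _ = normal_peak 1 * (5 * expR (- x ^+ 2 / (2 *+ 2)))); last first.
  by field; rewrite gt_eqF.
rewrite mulrCA ler_wpM2l //.
have -> : - (x ^+ 2 / 2) = - (x ^+ 2 / 4) + - (x ^+ 2 / 4) by lra.
have -> : - x ^+ 2 / (2 *+ 2) = - (x ^+ 2 / 4) by rewrite mulNr; congr (- (_ / _)); ring.
rewrite expRD mulrA ler_wpM2r ?expR_ge0 // expRN ler_pdivrMr ?expR_gt0 //.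
have := expR_ge1Dx (x ^+ 2 / 4); have := sqr_ge0 x; lra.
Qed.

Lemma integrable_sqr_pdf : mu.-integrable setT (fun x => ((1 + x ^+ 2) * phi x)%:E).
Proof.
have [C C0 HC] := sqr_pdf_bound.
apply: (@le_integrable _ _ _ mu _ measurableT _ (fun x => (C * normal_pdf 0 (Num.sqrt 2) x)%:E)).
- apply/measurable_EFinP; apply: measurable_funM; last exact: measurable_normal_pdf.
  by apply: measurable_funD => //; apply: measurable_funX.
- move=> x _; rewrite !abse_EFin lee_fin !ger0_norm.
  + exact: HC.
  + by rewrite mulr_ge0 ?normal_pdf_ge0.
  + by rewrite mulr_ge0 ?normal_pdf_ge0 // addr_ge0 ?sqr_ge0.
- under eq_fun do rewrite EFinM; apply: integrableZl => //.
  exact: integrable_normal_pdf.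
Qed.

Lemma normal_integrable_bounded (f : R -> R) (K : R) : measurable_fun setT f ->
  (forall x, `|f x| <= K) -> N01.-integrable setT (EFin \o f).
Proof.
move=> mf fK; apply: (@le_integrable _ _ _ N01 _ measurableT _ (cst K%:E)).
- exact/measurable_EFinP.
- by move=> x _; rewrite /= lee_fin (ger0_norm (le_trans (normr_ge0 _) (fK x))).
- by apply: finite_measure_integrable_cst.
Qed.

(** [integral_normal_prob] presupposes integrability, so the square is reached by monotone
    convergence from the bounded truncations [Num.min (1 + x ^+ 2) k]. *)
Lemma normal_integrable_sqr : N01.-integrable setT (fun x => (1 + x ^+ 2)%:E).
Proof.
have msq : measurable_fun setT (fun x : R => 1 + x ^+ 2).
  by apply: measurable_funD => //; apply: measurable_funX.
have q0 x : 0 <= 1 + x ^+ 2 :> R by rewrite addr_ge0 ?sqr_ge0.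
apply/integrableP; split; first exact/measurable_EFinP.
pose g (k : nat) (x : R) : \bar R := (Num.min (1 + x ^+ 2) k%:R)%:E.
have mg k : measurable_fun setT (g k).
  by apply/measurable_EFinP; apply: measurable_minr.
have g0 k x : (0 <= g k x)%E by rewrite lee_fin le_min q0 ler0n.
have ndg x : {homo g ^~ x : a b / (a <= b)%N >-> (a <= b)%E}.
  move=> a b ab; rewrite lee_fin le_min !ge_min lexx /=.
  by rewrite ler_nat ab orbT.
have -> : (\int[N01]_x `|(1 + x ^+ 2)%:E| = \int[N01]_x (limn (g ^~ x)))%E.
  apply: eq_integral => x _; rewrite abse_EFin (ger0_norm (q0 x)); apply/esym/cvg_lim => //.
  apply: cvg_near_cst.
  near=> k; rewrite /g min_l //.
  by near: k; exact: nbhs_infty_ger.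
rewrite monotone_convergence //.
apply: (@le_lt_trans _ _ (\int[mu]_x ((1 + x ^+ 2) * phi x)%:E)%E); last first.
  exact: integrable_lty integrable_sqr_pdf.
apply: lime_le.
  apply: ereal_nondecreasing_is_cvgn => a b ab.
  by apply: ge0_le_integral; [exact: measurableT|move=> x _; exact: g0|exact: mg|exact: mg|move=> x _; exact: ndg].
near=> k.
have ib : N01.-integrable setT (g k).
  apply: (@normal_integrable_bounded (fun x => Num.min (1 + x ^+ 2) k%:R) k%:R).
    by apply: measurable_minr.
  by move=> x; rewrite ger0_norm ?ge_min ?lexx ?orbT // le_min q0 ler0n.
rewrite integral_normal_prob; [|exact: mg|by have /integrableP[] := ib].
apply: ge0_le_integral.
- exact: measurableT.
- by move=> x _; rewrite mule_ge0 // lee_fin normal_pdf_ge0.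
- apply: emeasurable_funM; first exact: mg.
  by apply/measurableT_comp => //; exact: measurable_normal_pdf.
- by apply/measurable_EFinP; apply: measurable_funM => //; exact: measurable_normal_pdf.
- by move=> x _; rewrite -EFinM lee_fin ler_wpM2r ?normal_pdf_ge0 // ge_min lexx.
Unshelve. all: by end_near.
Qed.

Lemma is_derive_pdf (x : R) : is_derive x 1 phi (- x * phi x).
Proof.
rewrite (_ : phi = fun x => normal_peak 1 * expR (- (x ^+ 2 / 2))); last first.
  by apply/funext => y; rewrite normal_pdf01E.
have h : is_derive x 1 (fun x : R => - (x ^+ 2 / 2)) (- x).
  by apply: is_derive_eq; rewrite /GRing.scale /=; field.
have H := @is_derive1_comp R expR (fun x => - (x ^+ 2 / 2)) x _ _ (is_derive_expR _) h.
by apply: is_derive_eq; rewrite /GRing.scale /=; ring.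
Qed.

Lemma pdf_cvg0 : phi k%:R @[k --> \oo] --> (0 : R).
Proof.
apply/cvgrPdist_le => e e0.
near=> k; rewrite sub0r normrN ger0_norm ?normal_pdf_ge0 // normal_pdf01E.
have k1 : (1 <= k)%N by near: k; exact: nbhs_infty_ge.
have kb : normal_peak 1 * 2 / e <= k%:R :> R by near: k; exact: nbhs_infty_ger.
have k0 : 0 < k%:R :> R by rewrite ltr0n.
have kk : k%:R <= k%:R ^+ 2 :> R by rewrite expr2 ler_pMl // ler1n.
rewrite expRN ler_pdivrMr ?expR_gt0 //.
apply: (@le_trans _ _ (e * (k%:R / 2))).
  by rewrite ler_pdivrMr // mulrC in kb; lra.
rewrite ler_wpM2l ?(ltW e0) //.
have := expR_ge1Dx (k%:R ^+ 2 / 2 : R); lra.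
Unshelve. all: by end_near.
Qed.

(** The derivative of [h * phi] is [(dh - x h) phi]. Its integral over [-k, k] is a boundary term
    that vanishes with the density, and domination by a multiple of [(1 + x^2) phi] lets k tend to
    infinity. *)
Lemma normal_by_parts (h dh : R -> R) (K : R) :
  (forall x : R, is_derive x 1 h (dh x)) -> continuous dh ->
  (forall x, `|h x| <= K) -> (forall x, `|dh x| <= K) ->
  (\int[N01]_x (x * h x)%:E = \int[N01]_x (dh x)%:E)%E.
Proof.
move=> Dh cdh hK dhK.
have ch : continuous h.
  by move=> x; apply: differentiable_continuous; apply/derivable1_diffP; have [] := Dh x.
have mh : measurable_fun setT h by exact: continuous_measurable_fun.
have mdh : measurable_fun setT dh by exact: continuous_measurable_fun.
have K0 : 0 <= K by apply: le_trans (hK 0).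
have mxh : measurable_fun setT (fun x : R => x * h x) by apply: measurable_funM.
have xh_le x : `|x * h x| <= K * (1 + x ^+ 2).
  rewrite normrM mulrC; apply: ler_pM => //.
  have := sqr_ge0 (`|x| - 1); rewrite sqrrB1 real_normK ?num_real // mulr2n => ?.
  by have := normr_ge0 x; have := sqr_ge0 x; lra.
have i1 : N01.-integrable setT (fun x => (x * h x)%:E).
  apply: (@le_integrable _ _ _ N01 _ measurableT _ (fun x => (K * (1 + x ^+ 2))%:E)).
  - exact/measurable_EFinP.
  - move=> x _; rewrite !abse_EFin lee_fin; apply: le_trans (xh_le x) _; exact: ler_norm.
  - by under eq_fun do rewrite EFinM; apply: integrableZl => //; exact: normal_integrable_sqr.
have i2 : N01.-integrable setT (fun x => (dh x)%:E) by exact: normal_integrable_bounded dhK.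
have f1 := integrable_fin_num measurableT i1.
have f2 := integrable_fin_num measurableT i2.
suff H : (\int[N01]_x (dh x)%:E - \int[N01]_x (x * h x)%:E = 0)%E.
  rewrite -(fineK f1) -(fineK f2) in H *.
  by move: H => /eqP; rewrite -EFinB eqe subr_eq0 => /eqP ->.
rewrite -integralB_EFin //.
have i3 : N01.-integrable setT (fun x => (dh x)%:E - (x * h x)%:E)%E by exact: integrableB.
rewrite integral_normal_prob; last 2 first.
- exact: measurable_int i3.
- by have /integrableP[] := i3.
pose G x := (dh x - x * h x) * phi x.
have mG : measurable_fun setT G.
  apply: measurable_funM; first exact: measurable_funB.
  exact: measurable_normal_pdf.
have GE x : (((dh x)%:E - (x * h x)%:E) * (phi x)%:E = (G x)%:E)%E by rewrite -EFinB -EFinM.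
under eq_integral do rewrite GE.
have Gle x : `|G x| <= 2 * K * ((1 + x ^+ 2) * phi x).
  rewrite /G normrM (ger0_norm (normal_pdf_ge0 _ _ _)) mulrA ler_wpM2r ?normal_pdf_ge0 //.
  apply: le_trans (ler_normB _ _) _.
  have a := dhK x; have b := xh_le x.
  have : K <= K * (1 + x ^+ 2) by rewrite ler_peMr // lerDl sqr_ge0.
  lra.
pose Ik (k : nat) : set R := `[- k%:R, k%:R]%classic.
pose f_ (k : nat) x : \bar R := ((G \_ (Ik k)) x)%:E.
have := @dominated_convergence _ _ _ mu setT measurableT f_ (EFin \o G)
  (fun x => (2 * K * ((1 + x ^+ 2) * phi x))%:E).
case.
- by move=> k; apply/measurable_EFinP; apply/(measurable_restrictT _ (measurable_itv _)); exact: measurable_funTS.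
- exact/measurable_EFinP.
- apply: aeW => x _; apply: cvg_near_cst; near=> k; rewrite /f_ patchE mem_set //=.
  by rewrite /Ik /= in_itv /= -ler_norml; near: k; exact: nbhs_infty_ger.
- by under eq_fun do rewrite EFinM; apply: integrableZl => //; exact: integrable_sqr_pdf.
- apply: aeW => x k _; rewrite /f_ patchE abse_EFin lee_fin; case: ifP => // _.
  by rewrite normr0 mulr_ge0 ?mulr_ge0 // ?normal_pdf_ge0 ?addr_ge0 ?sqr_ge0.
move=> _ _ cv.
suff cv0 : [sequence (\int[mu]_x f_ n x)%E]_n @ \oo --> (0 : \bar R).
  by rewrite -(cvg_lim (@ereal_hausdorff R) cv) (cvg_lim (@ereal_hausdorff R) cv0).
rewrite (_ : [sequence _]_n = fun k => (h k%:R * phi k%:R - h (- k%:R) * phi (- k%:R))%:E); last first.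
  apply/funext => k /=.
  have -> : (\int[mu]_x f_ k x = \int[mu]_(x in Ik k) (G x)%:E)%E.
    rewrite [RHS]integral_mkcond; apply: eq_integral => x _.
    by rewrite /f_ restrict_EFin.
  have [->|k0] := posnP k.
    by rewrite /Ik oppr0 subrr set_itv1 integral_set1.
  have k0R : 0 < k%:R :> R by rewrite ltr0n.
  have kk : - k%:R < k%:R :> R by lra.
  have DF (x : R) : is_derive x 1 (fun x => h x * phi x) (G x).
    have := Dh x; have := is_derive_pdf x => ? ?.
    by apply: is_derive_eq; rewrite /G /GRing.scale /=; ring.
  have cF : continuous (fun x => h x * phi x).
    by move=> x; apply: differentiable_continuous; apply/derivable1_diffP; have [] := DF x.
  rewrite (@continuous_FTC2 R G (fun x => h x * phi x) (- k%:R) k%:R kk) //.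
  - apply: continuous_subspaceT => x; rewrite /G.
    apply: cvgM; last exact: continuous_normal_pdf.
    by apply: cvgB; [exact: cdh|apply: cvgM; [exact: cvg_id|exact: ch]].
  - split; [|exact: cvg_at_right_filter (cF _)|exact: cvg_at_left_filter (cF _)].
    by move=> x _; have [] := DF x.
  - by move=> x _; rewrite derive1E; have [_ ->] := DF x.
apply: cvg_EFin; first by apply: nearW.
have pN x : phi (- x) = phi x by rewrite !normal_pdf01E sqrrN.
apply/cvgrPdist_le => e e0.
have := pdf_cvg0 => /cvgrPdist_le /(_ (e / (2 * K + 1))).
have q0 : 0 < e / (2 * K + 1) by rewrite divr_gt0 //; lra.
move=> /(_ q0) ev; near=> k.
have : `|0 - phi k%:R| <= e / (2 * K + 1) by near: k.
rewrite /= !sub0r !normrN pN -mulrBl normrM (ger0_norm (normal_pdf_ge0 _ _ _)) => b.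
apply: (@le_trans _ _ ((2 * K + 1) * (e / (2 * K + 1)))); last first.
  by rewrite mulrCA divff ?mulr1 // gt_eqF //; lra.
apply: ler_pM => //; first exact: normal_pdf_ge0.
apply: le_trans (ler_normB _ _) _.
have := hK k%:R; have := hK (- k%:R); lra.
Unshelve. all: by end_near.
Qed.

End NormalByParts.

(** * Separating one coordinate of an independent family *)

Section Independence.
Context {dO : measure_display} {Omega : measurableType dO} {R : realType}.
Variable P : probability Omega R.
Variables (I : finType) (S : I -> set (set Omega)).
Hypothesis S_meas : forall i, S i `<=` measurable.
Hypothesis S_setI : forall i, setI_closed (S i).
Hypothesis S_setT : forall i, S i setT.
Hypothesis S_indep : mutually_independent P S.
Variable i0 : I.

Definition others : set (set Omega) := \bigcup_(j in [set j | j != i0]) S j.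

Let rect : set (set Omega) :=
  [set B | exists F : I -> set Omega, (forall j, S j (F j)) /\
     B = \bigcap_(j in [set j | j != i0]) F j].

Lemma others_measurable : others `<=` measurable.
Proof. by move=> A [j _ /S_meas]. Qed.

Let rect_meas : rect `<=` measurable.
Proof.
move=> _ [F [SF ->]]; apply: fin_bigcap_measurable; first exact: finite_finset.
by move=> j _; exact: S_meas.
Qed.

Let rectI : setI_closed rect.
Proof.
move=> _ _ [F [SF ->]] [G [SG ->]]; exists (fun j => F j `&` G j); split.
  by move=> j; exact: S_setI.
by rewrite bigcapI.
Qed.

Let rectT : rect setT.
Proof.
exists (fun=> setT); split => //; apply/seteqP; split => // x _ j _ //.
Qed.

Let others_rect : others `<=` rect.
Proof.
move=> A [j /= ji SA]; exists (fun k => if k == j then A else setT); split.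
  by move=> k; case: eqP => [->|].
apply/seteqP; split => [x Ax k _|x /(_ j ji)]; last by rewrite eqxx.
by case: eqP.
Qed.

(** A pi-lambda argument: on the pi-system of finite intersections of events of the other
    coordinates, the measures B -> P (A and B) and B -> P A * P B agree by mutual independence. *)
Lemma indep_others (A B : set Omega) : S i0 A -> <<s others >> B ->
  (P (A `&` B) = P A * P B)%E.
Proof.
move=> SA oB.
have mA : measurable A by exact: S_meas SA.
have fA : P A \is a fin_num by exact: fin_num_measure.
have a0 : 0 <= fine (P A) by exact: fine_ge0.
pose m2 := mscale (NngNum a0) P.
have := @g_sigma_algebra_measure_unique _ R Omega rect rect_meas (fun=> setT) (fun=> rectT) _
  (mrestr P mA) m2 rectI.
move=> H.
have -> : (P (A `&` B) = mrestr P mA B)%E by rewrite /mrestr setIC.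
rewrite H.
- by rewrite /m2 /= /mscale /= fineK.
- by rewrite bigcup_const //; exists 0%N.
- move=> _ [F [SF ->]]; rewrite /m2 /= /mrestr /mscale /= fineK //.
  pose F' j := if j == i0 then A else F j.
  have := S_indep (J := [set: I]%SET) (A := F') => h1.
  have := S_indep (J := [set~ i0]%SET) (A := F) => h2.
  have e1 : \bigcap_(j in [set j | j != i0]) F j `&` A =
     \bigcap_(j in [set j | j \in [set: I]%SET]) F' j.
    apply/seteqP; split => [x [Fx Ax] j _|x Fx].
      by rewrite /F'; case: eqP => // /eqP ji; exact: Fx.
    split; last by have := Fx i0; rewrite /F' eqxx; apply; rewrite /= inE.
    move=> j /= ji; have := Fx j; rewrite /F' (negbTE ji); apply; rewrite /= inE //.
  have e2 : \bigcap_(j in [set j | j != i0]) F j =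
     \bigcap_(j in [set j | j \in [set~ i0]%SET]) F j.
    by congr bigcap; apply/seteqP; split => j /=; rewrite !inE.
  rewrite e1 h1; last by move=> j _; rewrite /F'; case: eqP => [->|].
  rewrite e2 h2; last by move=> j _; exact: SF.
  rewrite (bigD1 i0) ?inE //= /F' eqxx; congr (_ * _)%E.
  apply: eq_big => [j|j]; rewrite !inE //.
  by move=> ji; rewrite (negbTE ji).
- by move=> k; rewrite /= /mrestr setTI ltey_eq fA.
- by apply: sub_sigma_algebra2 oB; exact: others_rect.
Qed.

(** The other coordinates are represented by the sample point itself, under the smaller
    sigma-algebra that they generate. No product space has to be built for them, and depending only
    on them becomes a measurability statement. *)
Definition restOmega := g_sigma_algebraType others.

Definition toRest (w : Omega) : restOmega := w.

Lemma measurable_toRest : measurable_fun setT toRest.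
Proof.
move=> _ B mB; rewrite setTI.
exact: (smallest_sub (@sigma_algebra_measurable _ Omega) others_measurable) mB.
Qed.

Context {d1 : measure_display} {T1 : measurableType d1}.
Variable U : Omega -> T1.
Hypothesis U_meas : measurable_fun setT U.
Hypothesis U_S : forall A, measurable A -> S i0 (U @^-1` A).

HB.instance Definition _ := isMeasurableFun.Build _ _ _ _ U U_meas.
HB.instance Definition _ := isMeasurableFun.Build _ _ _ _
  toRest measurable_toRest.

Definition Urest (w : Omega) : T1 * restOmega := (U w, toRest w).
Lemma Urest_meas : measurable_fun setT Urest.
Proof. by apply: measurable_fun_pair => //; exact: measurable_toRest. Qed.
HB.instance Definition _ := isMeasurableFun.Build _ _ _ _ Urest Urest_meas.

Definition lawU : probability T1 R := distribution P U.
Definition lawRest : probability restOmega R := distribution P toRest.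

Lemma indep_product (C : set (T1 * restOmega)) : measurable C ->
  (P (Urest @^-1` C) = (lawU \x lawRest) C)%E.
Proof.
move=> mC; rewrite (product_measure_unique (m' := distribution P Urest)) //.
move=> A B mA mB; rewrite /lawU /lawRest /distribution /pushforward /=.
rewrite -[RHS]indep_others //; last exact: U_S.
Qed.

End Independence.

Section MeasurableFunctional.
Variables (R : realType) (n : nat).
Implicit Types H : ('I_n -> R) -> R.

(** Measurability of a functional of [n] reals, tested on all families of measurable functions. This
    dispenses with a sigma-algebra on ['I_n -> R] and applies equally on [Omega] and on a product of
    the line with [restOmega]. *)
Definition mfunc H : Prop :=
  forall (d : measure_display) (T : measurableType d) (g : 'I_n -> T -> R),
    (forall i, measurable_fun setT (g i)) ->
    measurable_fun setT (fun t => H (fun i => g i t)).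

Lemma mfunc_cst (k : R) : mfunc (fun=> k).
Proof. by move=> d T g mg; exact: measurable_cst. Qed.

Lemma mfunc_proj i : mfunc (fun v => v i).
Proof. by move=> d T g mg; exact: mg. Qed.

Lemma mfuncD H1 H2 : mfunc H1 -> mfunc H2 -> mfunc (fun v => H1 v + H2 v).
Proof. by move=> m1 m2 d T g mg; apply: measurable_funD; [exact: m1|exact: m2]. Qed.

Lemma mfuncM H1 H2 : mfunc H1 -> mfunc H2 -> mfunc (fun v => H1 v * H2 v).
Proof. by move=> m1 m2 d T g mg; apply: measurable_funM; [exact: m1|exact: m2]. Qed.

Lemma mfunc_sum (K : finType) (H : K -> ('I_n -> R) -> R) :
  (forall k, mfunc (H k)) -> mfunc (fun v => \sum_k H k v).
Proof.
move=> mH d T g mg; apply: measurable_sum => k; exact: mH.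
Qed.

Lemma mfunc_comp (h : R -> R) H : measurable_fun setT h -> mfunc H -> mfunc (fun v => h (H v)).
Proof. by move=> mh mH d T g mg; apply: (measurableT_comp mh); exact: mH. Qed.

Lemma mfuncN H : mfunc H -> mfunc (fun v => - H v).
Proof. by move=> mH d T g mg; apply: measurable_funN; exact: mH. Qed.

Lemma mfuncB H1 H2 : mfunc H1 -> mfunc H2 -> mfunc (fun v => H1 v - H2 v).
Proof. by move=> m1 m2; apply: mfuncD => //; exact: mfuncN. Qed.

Lemma mfuncX (k : nat) H : mfunc H -> mfunc (fun v => H v ^+ k).
Proof. by move=> mH d T g mg; apply: measurable_funX; exact: mH. Qed.

Lemma mfunc_expR H : mfunc H -> mfunc (fun v => expR (H v)).
Proof. by apply: mfunc_comp. Qed.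

Definition upd (v : 'I_n -> R) (i : 'I_n) (x : R) : 'I_n -> R :=
  fun j => if j == i then x else v j.

End MeasurableFunctional.

Section GaussianFunctional.
Context {dO : measure_display} {Omega : measurableType dO} {R : realType}.
Variable P : probability Omega R.
Variables (n : nat) (e : 'I_n -> Omega -> R).
Hypothesis e_meas : forall i, measurable_fun setT (e i).
Hypothesis e_indep : mutually_independent P (fun i => events_real (e i)).
Hypothesis e_normal : forall i B, measurable B -> P (e i @^-1` B) = normal_prob 0 1 B.
Local Notation N01 := (@normal_prob R 0 1).

Let S i := events_real (e i).

Let S_meas i : S i `<=` measurable.
Proof. by move=> _ [B mB <-]; rewrite -[X in measurable X]setTI; exact: e_meas. Qed.

Let S_setI i : setI_closed (S i).
Proof.
move=> _ _ [A mA <-] [B mB <-]; exists (A `&` B); first exact: measurableI.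
by rewrite preimage_setI.
Qed.

Let S_setT i : S i setT.
Proof. by exists setT. Qed.

Let e' i : Omega -> measurableTypeR R := e i.

Let e'_meas i : measurable_fun setT (e' i).
Proof. by move=> _ B mB; exact: e_meas. Qed.

Let lawE i (f : measurableTypeR R -> \bar R) :
  (\int[lawU P (e'_meas i)]_x f x = \int[N01]_x f x)%E.
Proof. by apply: eq_measure_integral => A mA _; exact: e_normal. Qed.

Definition evec w : 'I_n -> R := fun i => e i w.

Lemma gauss_integral_ge0 i (f : measurableTypeR R -> \bar R) : measurable_fun setT f ->
  (forall x, (0 <= f x)%E) -> (\int[P]_w f (e i w) = \int[N01]_x f x)%E.
Proof.
move=> mf f0; rewrite -(lawE i f) /lawU; apply/esym.
exact: ge0_integral_distribution.
Qed.

Lemma gauss_sqr_integrable i : P.-integrable setT (fun w => (1 + e i w ^+ 2)%:E).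
Proof.
have q0 x : 0 <= 1 + x ^+ 2 :> R by rewrite addr_ge0 ?sqr_ge0.
apply/integrableP; split.
  apply/measurable_EFinP; apply: measurable_funD => //; exact: measurable_funX.
have msq : measurable_fun setT (fun x : measurableTypeR R => (1 + x ^+ 2)%:E).
  by apply/measurable_EFinP; apply: measurable_funD => //; exact: measurable_funX.
under eq_integral do rewrite abse_EFin (ger0_norm (q0 _)).
rewrite (gauss_integral_ge0 i msq) //.
exact: (integrable_lty measurableT (normal_integrable_sqr R)).
Qed.

(** Coordinate [i] is independent of the sigma-algebra of the others, so the law of the pair is a
    product; the quadratic growth bound, uniform in [y], supplies the integrability. *)
Lemma fubini_coord i (f : R -> restOmega S i -> R) (K : R) :
  measurable_fun setT (fun q : measurableTypeR R * restOmega S i => f q.1 q.2) ->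
  (forall x y, `|f x y| <= K * (1 + x ^+ 2)) ->
  (\int[P]_w (f (e i w) w)%:E =
   \int[lawRest P S_meas i]_y \int[N01]_x (f x y)%:E)%E.
Proof.
move=> mf fK.
have U_S A : measurable A -> S i (e' i @^-1` A) by move=> mA; exists A.
pose g (q : measurableTypeR R * restOmega S i) : \bar R := (f q.1 q.2)%:E.
have mg : measurable_fun setT g by exact/measurable_EFinP.
have K0 : 0 <= K.
  by have := le_trans (normr_ge0 _) (fK 0 point); rewrite expr0n addr0 mulr1.
have msq : measurable_fun setT (fun x : measurableTypeR R => (1 + x ^+ 2)%:E).
  by apply/measurable_EFinP; apply: measurable_funD => //; exact: measurable_funX.
pose UR := Urest S i (e' i).
have mUR : measurable_fun setT UR by exact: Urest_meas.
have ig : P.-integrable setT (g \o UR).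
  apply: (@le_integrable _ _ _ P _ measurableT _ (fun w => K%:E * (1 + e i w ^+ 2)%:E)%E).
  - exact: measurableT_comp mg mUR.
  - move=> w _; rewrite /g /= lee_fin; apply: le_trans (fK _ _) _; exact: ler_norm.
  - by apply: integrableZl => //; exact: gauss_sqr_integrable.
have ip : (lawU P (e'_meas i) \x lawRest P S_meas i)%E.-integrable setT g.
  apply/integrable12ltyP => //.
  apply: (@le_lt_trans _ _ (\int[lawU P (e'_meas i)]_x (K%:E * (1 + x ^+ 2)%:E))%E).
    apply: ge0_le_integral => //=.
    - by move=> x _; apply: integral_ge0.
    - apply: (@measurable_fun_fubini_tonelli_F _ _ _ _ _ (lawRest P S_meas i) (fun q => `|g q|%E)) => //.
      exact: measurableT_comp.
    - by apply: emeasurable_funM.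
    - move=> x _; apply: (@le_trans _ _ (\int[lawRest P S_meas i]_y cst (K * (1 + x ^+ 2))%:E y)%E).
        apply: ge0_le_integral => //=.
        + have := measurable_fun_pair2 (f := g) x mg => mgx.
          exact: (measurableT_comp (@abse_measurable R setT) mgx).
        + by move=> y _; rewrite lee_fin; exact: fK.
      by rewrite integral_cst //= probability_setT mule1 EFinM.
  rewrite lawE ge0_integralZl //.
  - by rewrite lte_mul_pinfty ?lee_fin //; exact: (integrable_lty measurableT (normal_integrable_sqr R)).
  - by move=> x _; rewrite lee_fin addr_ge0 ?sqr_ge0.
transitivity (\int[P]_w (g \o UR) w)%E; first by [].
have <- : (\int[lawU P (e'_meas i) \x lawRest P S_meas i]_q g q = \int[P]_w (g \o UR) w)%E.
  have ig' : P.-integrable (UR @^-1` setT) (g \o UR) by rewrite preimage_setT.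
  have := integral_pushforward mUR mg ig' measurableT; rewrite preimage_setT => <-.
  apply: eq_measure_integral => C mC _.
  exact: (esym (@indep_product _ _ _ P _ S S_meas S_setI S_setT e_indep i _ _ (e' i) (e'_meas i) U_S C mC)).
rewrite -(integral21_prod_meas1 ip); apply: eq_integral => y _.
by rewrite /fubini_G lawE.
Qed.

Lemma coord_measurable_rest i j : j != i ->
  measurable_fun setT (fun y : restOmega S i => e j y).
Proof.
move=> ji _ B mB; rewrite setTI; apply: sub_sigma_algebra; exists j => //.
by exists B.
Qed.

Lemma gauss_by_parts i (H dH : ('I_n -> R) -> R) (K : R) :
  mfunc H -> mfunc dH ->
  (forall v (x : R), is_derive x 1 (fun y => H (upd v i y)) (dH (upd v i x))) ->
  (forall v, continuous (fun x : R => dH (upd v i x))) ->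
  (forall v, `|H v| <= K) -> (forall v, `|dH v| <= K) ->
  (\int[P]_w (e i w * H (evec w))%:E = \int[P]_w (dH (evec w))%:E)%E.
Proof.
move=> mH mdH DH cdH HK dHK.
have K0 : 0 <= K by apply: le_trans (HK (fun=> 0)).
(* Overwriting entry [i] leaves a vector that depends on [q.2] only through the other coordinates,
   hence is measurable for [restOmega]. At [(e i w, w)] nothing changes. *)
pose cf (q : measurableTypeR R * restOmega S i) : 'I_n -> R := upd (evec q.2) i q.1.
have mcf j : measurable_fun setT (fun q => cf q j).
  rewrite /cf /upd; have [_|ji] := eqVneq j i; first exact: measurable_fst.
  exact: measurableT_comp (coord_measurable_rest ji) measurable_snd.
have cfE w : cf (e i w, w) = evec w.
  by apply/funext => j; rewrite /cf /upd /=; case: eqP => // ->.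
transitivity (\int[P]_w (e i w * H (cf (e i w, w)))%:E)%E.
  by apply: eq_integral => w _; rewrite cfE.
transitivity (\int[P]_w (dH (cf (e i w, w)))%:E)%E; last first.
  by apply: eq_integral => w _; rewrite cfE.
rewrite (@fubini_coord i (fun x y => x * H (cf (x, y))) K); last 2 first.
- by apply: measurable_funM; [exact: measurable_fst|exact: mH].
- move=> x y; rewrite normrM mulrC; apply: ler_pM => //.
  have := sqr_ge0 (`|x| - 1); rewrite sqrrB1 real_normK ?num_real // mulr2n => ?.
  by have := normr_ge0 x; have := sqr_ge0 x; lra.
rewrite (@fubini_coord i (fun x y => dH (cf (x, y))) K); last 2 first.
- exact: mdH.
- by move=> x y; apply: le_trans (dHK _) _; rewrite ler_peMr // lerDl sqr_ge0.
apply: eq_integral => y _.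
apply: (@normal_by_parts R (fun x => H (cf (x, y))) (fun x => dH (cf (x, y))) K).
- by move=> x; exact: (DH (evec y) x).
- exact: (cdH (evec y)).
- by move=> x; exact: HK.
- by move=> x; exact: dHK.
Qed.

End GaussianFunctional.

(** * Expectations of functionals of the multipliers *)

Section StepLemma.
Variable R : realType.

(** A mean value inequality that needs no derivative of [f]: after cutting [a, b] into k + 1 pieces
    the quadratic errors add up to O(1 / k). It avoids differentiation under the expectation, and
    the size of [C] is irrelevant. *)
Lemma step_bound (f : R -> R) (A C a b : R) : a <= b -> 0 <= A -> 0 <= C ->
  (forall t h : R, a <= t -> 0 <= h -> t + h <= b -> `|f (t + h) - f t| <= A * h + C * h ^+ 2) ->
  `|f b - f a| <= A * (b - a).
Proof.
move=> ab A0 C0 H.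
have key (k : nat) : `|f b - f a| <= A * (b - a) + C * (b - a) ^+ 2 / k.+1%:R.
  pose h := (b - a) / k.+1%:R.
  have k0 : 0 < k.+1%:R :> R by rewrite ltr0n.
  have h0 : 0 <= h by rewrite divr_ge0 ?subr_ge0 // ler0n.
  have E i : (i <= k.+1)%N -> `|f (a + i%:R * h) - f a| <= i%:R * (A * h + C * h ^+ 2).
    elim: i => [|i ih] ik; first by rewrite !mul0r addr0 subrr normr0.
    have step : `|f (a + i%:R * h + h) - f (a + i%:R * h)| <= A * h + C * h ^+ 2.
      apply: H => //; first by rewrite lerDl mulr_ge0 // ler0n.
      rewrite -addrA -[X in _ + (_ + X)]mul1r -mulrDl natr1 -lerBrDl /h mulrCA.
      by rewrite ler_piMr ?subr_ge0 // ler_pdivrMr // mul1r ler_nat.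
    have -> : f (a + i.+1%:R * h) - f a =
      (f (a + i%:R * h + h) - f (a + i%:R * h)) + (f (a + i%:R * h) - f a).
      by rewrite -natr1 mulrDl mul1r addrA; ring.
    apply: le_trans (ler_normD _ _) _; rewrite -natr1 mulrDl mul1r.
    by have := ih (ltnW ik); lra.
  have := E k.+1 (leqnn _).
  rewrite /h mulrCA divff ?gt_eqF // mulr1 addrCA subrr addr0 => /le_trans; apply.
  rewrite le_eqVlt; apply/orP; left; apply/eqP; field.
  by rewrite nat1r pnatr_eq0.
apply/ler_addgt0Pr => e e0.
have D0 : 0 <= C * (b - a) ^+ 2 by rewrite mulr_ge0 // sqr_ge0.
have [k kD] : exists k : nat, C * (b - a) ^+ 2 / e < k.+1%:R.
  by exists (Num.trunc (C * (b - a) ^+ 2 / e)); exact: truncnS_gt.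
apply: le_trans (key k) _; rewrite lerD2l ler_pdivrMr ?ltr0n //.
by rewrite ltr_pdivrMr // in kD; rewrite (mulrC e); exact: ltW.
Qed.

End StepLemma.

Section Expectation.
Context {dO : measure_display} {Omega : measurableType dO} {R : realType}.
Variable P : probability Omega R.
Variables (n : nat) (e : 'I_n -> Omega -> R).
Hypothesis e_meas : forall i, measurable_fun setT (e i).
Hypothesis e_indep : mutually_independent P (fun i => events_real (e i)).
Hypothesis e_normal : forall i B, measurable B -> P (e i @^-1` B) = normal_prob 0 1 B.
Implicit Types H : ('I_n -> R) -> R.

Definition EX H : R := \int[P]_w H (evec e w).

Definition sqn (v : 'I_n -> R) : R := 1 + \sum_i v i ^+ 2.

Lemma sqn_ge1 v : 1 <= sqn v.
Proof. by rewrite lerDl sumr_ge0 // => i _; exact: sqr_ge0. Qed.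

Lemma sqn_ge0 v : 0 <= sqn v. Proof. exact: le_trans ler01 (sqn_ge1 v). Qed.

(** Quadratic growth is a class closed under linear combinations and containing [v i * H v] for
    bounded [H]; it covers every functional whose expectation is taken, and [integrable_sqn] makes
    all of them integrable. *)
Definition nice H : Prop := mfunc H /\ exists C, forall v, `|H v| <= C * sqn v.

Lemma mfunc_sqn : mfunc sqn.
Proof.
apply: mfuncD; first exact: mfunc_cst.
by apply: mfunc_sum => i; apply: mfuncX; exact: mfunc_proj.
Qed.

Lemma integrable_sqn : P.-integrable setT (fun w => (sqn (evec e w))%:E).
Proof.
pose q (w : Omega) : \bar R := (1 + \sum_(i <- enum 'I_n) (1 + e i w ^+ 2)%:E)%E.
apply: (@le_integrable _ _ _ P _ measurableT _ q).
- by apply/measurable_EFinP; exact: mfunc_sqn.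
- move=> w _; rewrite /q sumEFin -EFinD !abse_EFin lee_fin big_enum /=.
  rewrite (ger0_norm (sqn_ge0 _)) ger0_norm; last first.
    by rewrite addr_ge0 // sumr_ge0 // => i _; rewrite addr_ge0 ?sqr_ge0.
  by rewrite lerD2l; apply: ler_sum => i _; rewrite lerDr.
- apply: integrableD => //; first exact: finite_measure_integrable_cst.
  by apply: integrable_sum => // i _; exact: gauss_sqr_integrable.
Qed.

Lemma nice_integrable H : nice H -> P.-integrable setT (EFin \o (fun w => H (evec e w))).
Proof.
move=> [mH [C HC]].
apply: (@le_integrable _ _ _ P _ measurableT _ (fun w => (C%:E * (sqn (evec e w))%:E)%E)).
- by apply/measurable_EFinP; exact: mH.
- by move=> w _; rewrite -EFinM !abse_EFin lee_fin; apply: le_trans (HC _) (ler_norm _).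
- by apply: integrableZl => //; exact: integrable_sqn.
Qed.

Lemma niceD H1 H2 : nice H1 -> nice H2 -> nice (fun v => H1 v + H2 v).
Proof.
move=> [m1 [C1 h1]] [m2 [C2 h2]]; split; first exact: mfuncD.
exists (C1 + C2) => v; apply: le_trans (ler_normD _ _) _.
by rewrite mulrDl lerD.
Qed.

Lemma niceZ k H : nice H -> nice (fun v => k * H v).
Proof.
move=> [m1 [C1 h1]]; split; first by apply: mfuncM => //; exact: mfunc_cst.
by exists (`|k| * C1) => v; rewrite normrM -mulrA ler_wpM2l.
Qed.

Lemma nice_sum (K : finType) (H : K -> ('I_n -> R) -> R) :
  (forall k, nice (H k)) -> nice (fun v => \sum_k H k v).
Proof.
move=> nH; split; first by apply: mfunc_sum => k; have [] := nH k.
have /choice[C HC] : forall k, exists C, forall v, `|H k v| <= C * sqn v.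
  by move=> k; have [] := nH k.
exists (\sum_k C k) => v; apply: le_trans (ler_norm_sum _ _ _) _.
by rewrite mulr_suml; apply: ler_sum => k _.
Qed.

Lemma nice_bounded H K : mfunc H -> (forall v, `|H v| <= K) -> nice H.
Proof.
move=> mH HK; split=> //; exists `|K| => v; apply: le_trans (HK v) _.
by apply: le_trans (ler_norm _) _; rewrite ler_peMr // sqn_ge1.
Qed.

Lemma nice_cst k : nice (fun=> k).
Proof. by apply: (@nice_bounded _ `|k|) => //; exact: mfunc_cst. Qed.

Lemma niceB H1 H2 : nice H1 -> nice H2 -> nice (fun v => H1 v - H2 v).
Proof.
move=> n1 n2; have := niceD n1 (niceZ (-1) n2).
by rewrite (_ : (fun v => _ + -1 * _) = (fun v => H1 v - H2 v)) //; apply/funext => v; rewrite mulN1r.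
Qed.

Lemma nice_coord i H K : mfunc H -> (forall v, `|H v| <= K) -> nice (fun v => v i * H v).
Proof.
move=> mH HK; split; first by apply: mfuncM => //; exact: mfunc_proj.
exists `|K| => v; rewrite normrM mulrC; apply: ler_pM => //.
  exact: le_trans (HK v) (ler_norm _).
have h : v i ^+ 2 <= \sum_i v i ^+ 2.
  by rewrite (bigD1 i) //= lerDl sumr_ge0 // => j _; exact: sqr_ge0.
have := sqr_ge0 (`|v i| - 1); rewrite sqrrB1 real_normK ?num_real // mulr2n => ?.
by rewrite /sqn; have := normr_ge0 (v i); have := sqr_ge0 (v i); lra.
Qed.

Lemma nice_sqn : nice sqn.
Proof.
split; first exact: mfunc_sqn.
by exists 1 => v; rewrite mul1r ger0_norm // sqn_ge0.
Qed.

Lemma EXD H1 H2 : nice H1 -> nice H2 -> EX (fun v => H1 v + H2 v) = EX H1 + EX H2.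
Proof. by move=> n1 n2; rewrite /EX RintegralD //; exact: nice_integrable. Qed.

Lemma EXZ k H : nice H -> EX (fun v => k * H v) = k * EX H.
Proof. by move=> n1; rewrite /EX RintegralZl //; exact: nice_integrable. Qed.

Lemma EXB H1 H2 : nice H1 -> nice H2 -> EX (fun v => H1 v - H2 v) = EX H1 - EX H2.
Proof. by move=> n1 n2; rewrite /EX RintegralB //; exact: nice_integrable. Qed.

Lemma EX_cst k : EX (fun=> k) = k.
Proof.
rewrite /EX (_ : \int[P]_w k = k * fine (P setT)); last exact: Rintegral_cst.
by rewrite probability_setT mulr1.
Qed.

Lemma EX_le H1 H2 : nice H1 -> nice H2 -> (forall v, H1 v <= H2 v) -> EX H1 <= EX H2.
Proof. by move=> n1 n2 h; apply: le_Rintegral => //; exact: nice_integrable. Qed.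

Lemma eq_EX H1 H2 : (forall v, H1 v = H2 v) -> EX H1 = EX H2.
Proof. by move=> h; congr EX; apply/funext. Qed.

Lemma EX_sum (K : finType) (H : K -> ('I_n -> R) -> R) :
  (forall k, nice (H k)) -> EX (fun v => \sum_k H k v) = \sum_k EX (H k).
Proof.
move=> nH; rewrite -big_enum /=.
rewrite (_ : EX _ = EX (fun v => \sum_(k <- enum K) H k v)); last first.
  by apply: eq_EX => v; rewrite big_enum.
elim: (enum K) => [|k s ih]; first by rewrite big_nil (eq_EX (H2 := fun=> 0)) ?EX_cst // => v; rewrite big_nil.
rewrite big_cons -ih -EXD //.
  by apply: eq_EX => v; rewrite big_cons.
elim: s {ih} => [|k' s ih].
  rewrite (_ : (fun v => _) = fun=> 0); first exact: nice_cst.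
  by apply/funext => v; rewrite big_nil.
rewrite (_ : (fun v => _) = (fun v => H k' v + \sum_(k <- s) H k v)); first exact: niceD.
by apply/funext => v; rewrite big_cons.
Qed.

Lemma EX_dist H1 H2 H3 : nice H1 -> nice H2 -> nice H3 ->
  (forall v, `|H1 v - H2 v| <= H3 v) -> `|EX H1 - EX H2| <= EX H3.
Proof.
move=> n1 n2 n3 h; rewrite -EXB // ler_norml -mulN1r -EXZ //.
apply/andP; split; apply: EX_le => //; try exact: niceB; try exact: niceZ.
  by move=> v; rewrite mulN1r; have := h v; rewrite ler_norml => /andP[].
by move=> v; have := h v; rewrite ler_norml => /andP[].
Qed.

Lemma EX_fmean (T : finType) (F : T -> ('I_n -> R) -> R) : (forall t, nice (F t)) ->
  EX (fun v => fmean (fun t => F t v)) = fmean (fun t => EX (F t)).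
Proof. by move=> nF; rewrite /fmean EXZ ?EX_sum //; exact: nice_sum. Qed.

Lemma nice_fmean (T : finType) (F : T -> ('I_n -> R) -> R) : (forall t, nice (F t)) ->
  nice (fun v => fmean (fun t => F t v)).
Proof. by move=> nF; apply: niceZ; exact: nice_sum. Qed.

Lemma EX_by_parts i (H dH : ('I_n -> R) -> R) (K : R) :
  mfunc H -> mfunc dH ->
  (forall v (x : R), is_derive x 1 (fun y => H (upd v i y)) (dH (upd v i x))) ->
  (forall v, continuous (fun x : R => dH (upd v i x))) ->
  (forall v, `|H v| <= K) -> (forall v, `|dH v| <= K) ->
  EX (fun v => v i * H v) = EX dH.
Proof.
by move=> mH mdH DH cdH HK dHK; congr fine; exact: (gauss_by_parts e_meas e_indep e_normal mH mdH DH cdH HK dHK).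
Qed.

End Expectation.

(** * Comparison of permutation and Gaussian softmax means *)

Section SoftmaxMeasurable.
Variables (R : realType) (n : nat) (J : finType) (be : R).
Variable Xf : ('I_n -> R) -> J -> R.
Hypothesis Xf_m : forall j, mfunc (fun v => Xf v j).

Lemma mfunc_denom : mfunc (fun v => 1 + \sum_j expR (be * Xf v j)).
Proof.
apply: mfuncD; first exact: mfunc_cst.
apply: mfunc_sum => j; apply: mfunc_expR; apply: mfuncM => //; exact: mfunc_cst.
Qed.

Lemma mfunc_wt0 : mfunc (fun v => wt0 be (Xf v)).
Proof.
rewrite (_ : (fun v => _) = (fun v => expR (- ln (1 + \sum_j expR (be * Xf v j))))).
  apply: mfunc_expR; apply: mfuncN; apply: mfunc_comp; first exact: measurable_ln.
  exact: mfunc_denom.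
by apply/funext => v; rewrite expRN lnK // posrE denom_gt0.
Qed.

Lemma mfunc_wt j : mfunc (fun v => wt be (Xf v) j).
Proof.
apply: mfuncM; last exact: mfunc_wt0.
by apply: mfunc_expR; apply: mfuncM => //; exact: mfunc_cst.
Qed.

Lemma mfunc_mass : mfunc (fun v => mass be (Xf v)).
Proof. by apply: mfunc_sum => j; exact: mfunc_wt. Qed.

Lemma mfunc_mom r d : mfunc (fun v => mom be r (Xf v) d).
Proof.
apply: mfunc_sum => j; apply: mfuncM; first exact: mfunc_wt.
exact: mfunc_cst.
Qed.

Lemma mfunc_Dmass d : mfunc (fun v => Dmass be (Xf v) d).
Proof.
apply: mfuncM; last exact: mfunc_mom.
by apply: mfuncM; [exact: mfunc_cst|exact: mfunc_wt0].
Qed.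

Lemma mfunc_D2form V : mfunc (fun v => D2form be V (Xf v)).
Proof.
apply: mfuncM; first by apply: mfuncM; [exact: mfunc_cst|exact: mfunc_wt0].
apply: mfuncB.
  by apply: mfunc_sum => j; apply: mfuncM; [exact: mfunc_wt|exact: mfunc_cst].
apply: mfuncM; first exact: mfunc_cst.
apply: mfunc_sum => i; apply: mfunc_sum => j; apply: mfuncM; last exact: mfunc_cst.
by apply: mfuncM; exact: mfunc_wt.
Qed.

Lemma mfunc_lse : mfunc (fun v => lse be (Xf v)).
Proof.
apply: mfuncM; first exact: mfunc_cst.
by apply: mfunc_comp; [exact: measurable_ln|exact: mfunc_denom].
Qed.

End SoftmaxMeasurable.

Section SoftmaxBounds.
Variables (R : realType) (J : finType) (be : R).
Implicit Types (w d : J -> R).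

Lemma mom_sup r w d K : (forall j, `|d j| <= K) -> `|mom be r w d| <= `|K| ^+ r.
Proof.
move=> dK; apply: le_trans (mom_abs _ _ _ _) _.
apply: (@le_trans _ _ (mass be w * `|K| ^+ r)).
  rewrite /mass mulr_suml; apply: ler_sum => j _; rewrite ler_wpM2l ?wt_ge0 //.
  by rewrite lerXn2r ?nnegrE //; exact: le_trans (dK j) (ler_norm _).
by rewrite ler_piMl ?mass_le1 // exprn_ge0.
Qed.

Lemma Dmass_sup w d K : 0 < be -> (forall j, `|d j| <= K) -> `|Dmass be w d| <= be * `|K|.
Proof.
move=> b0 dK; rewrite /Dmass !normrM (gtr0_norm b0) -mulrA (ler_wpM2l (ltW b0)) //.
have h := mom_sup 1 w dK; rewrite expr1 in h.
rewrite (gtr0_norm (wt0_gt0 _ _)); apply: le_trans h.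
by rewrite ler_piMl // wt0_le1.
Qed.

Lemma le_lse w j : 0 < be -> w j <= lse be w.
Proof.
move=> b0; rewrite /lse mulrC ler_pdivlMr // mulrC -[leLHS]expRK.
rewrite ler_ln ?posrE ?expR_gt0 ?denom_gt0 //.
rewrite (bigD1 j) //= addrCA lerDl addr_ge0 // sumr_ge0 // => i _; exact: expR_ge0.
Qed.

Lemma lse_ge0 w : 0 < be -> 0 <= lse be w.
Proof.
move=> b0; rewrite mulr_ge0 ?invr_ge0 ?(ltW b0) // ln_ge0 // lerDl sumr_ge0 // => j _.
Qed.

Lemma lse0 : lse be (fun _ : J => 0 : R) = be^-1 * ln (1 + #|J|%:R).
Proof. by rewrite /lse; congr (_ * ln (1 + _)); rewrite mulr0 expR0 sumr_const. Qed.

End SoftmaxBounds.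

Section GaussSoftmax.
Context {dO : measure_display} {Omega : measurableType dO} {R : realType}.
Variable P : probability Omega R.
Variables (n : nat) (e : 'I_n -> Omega -> R).
Hypothesis e_meas : forall i, measurable_fun setT (e i).
Hypothesis e_indep : mutually_independent P (fun i => events_real (e i)).
Hypothesis e_normal : forall i B, measurable B -> P (e i @^-1` B) = normal_prob 0 1 B.
Variables (J : finType) (b : 'I_n -> J -> R).
Local Notation EX := (EX P e).

Definition gv (v : 'I_n -> R) (j : J) : R := \sum_i v i * b i j.
Definition gcov (j k : J) : R := \sum_i b i j * b i k.
Definition gX (x : J -> R) (s : R) (v : 'I_n -> R) : J -> R := fun j => x j + s * gv v j.
Definition bmax : R := \sum_i \sum_j `|b i j|.

Lemma b_le i j : `|b i j| <= bmax.
Proof.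
rewrite /bmax (bigD1 i) //= (bigD1 j) //= -addrA lerDl addr_ge0 ?sumr_ge0 // => k _.
exact: sumr_ge0.
Qed.

Lemma bmax_ge0 : 0 <= bmax.
Proof. by apply: sumr_ge0 => i _; exact: sumr_ge0. Qed.

Lemma gv_upd v i y j : gv (upd v i y) j = gv (upd v i 0) j + y * b i j.
Proof.
rewrite /gv (bigD1 i) //= [in RHS](bigD1 i) //= /upd eqxx mul0r add0r addrC.
congr (_ + _); apply: eq_bigr => k ki; by rewrite (negbTE ki).
Qed.

Lemma gX_upd x s v i y :
  gX x s (upd v i y) = ln_path (gX x s (upd v i 0)) (b i) (s * y).
Proof. by apply/funext => j; rewrite /gX /ln_path gv_upd; ring. Qed.

Lemma mfunc_gX x s j : mfunc (fun v => gX x s v j).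
Proof.
apply: mfuncD; first exact: mfunc_cst.
apply: mfuncM; first exact: mfunc_cst.
apply: mfunc_sum => i; apply: mfuncM; [exact: mfunc_proj|exact: mfunc_cst].
Qed.

Lemma gv_bound v j : `|gv v j| ^+ 2 <= (n%:R * bmax ^+ 2) * sqn v.
Proof.
have b0 := bmax_ge0.
rewrite real_normK ?num_real //.
have h : gv v j ^+ 2 <= n%:R * \sum_i (v i * b i j) ^+ 2.
  rewrite /gv; set f := fun i => v i * b i j.
  suff : 2 * (\sum_i f i) ^+ 2 <= 2 * (n%:R * \sum_i f i ^+ 2) by rewrite ler_pM2l.
  have -> : 2 * (\sum_i f i) ^+ 2 = \sum_i \sum_j 2 * (f i * f j).
    by rewrite expr2 mulr_suml mulr_sumr; apply: eq_bigr => i _; rewrite !mulr_sumr.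
  have -> : 2 * (n%:R * \sum_i f i ^+ 2) = \sum_i \sum_(j < n) (f i ^+ 2 + f j ^+ 2).
    under [RHS]eq_bigr do rewrite big_split /= sumr_const card_ord.
    rewrite big_split /= sumrMnl sumr_const card_ord -[(\sum_i _) *+ n]mulr_natl; ring.
  apply: ler_sum => i _; apply: ler_sum => k _.
  by rewrite -subr_ge0 [X in 0 <= X](_ : _ = (f i - f k) ^+ 2) ?sqr_ge0 //; ring.
apply: le_trans h _; rewrite -mulrA ler_wpM2l ?ler0n // /sqn mulrDr mulr1.
rewrite mulr_sumr; apply: ler_wpDl; first exact: sqr_ge0.
apply: ler_sum => i _; rewrite exprMn mulrC ler_wpM2r ?sqr_ge0 //.
by rewrite -(real_normK (num_real (b i j))) lerXn2r ?nnegrE // b_le.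
Qed.

Section WithBeta.
Variable be : R.
Hypothesis be_gt0 : 0 < be.
Variables (x : J -> R) (s : R).

Let X := gX x s.
Let mX := fun j => @mfunc_gX x s j.

Lemma is_derive_scaled (F dF : R -> R) (y : R) : (forall t : R, is_derive t 1 F (dF t)) ->
  is_derive y 1 (fun y => F (s * y)) (s * dF (s * y)).
Proof.
move=> DF; have h : is_derive y 1 (fun y : R => s * y) s.
  by apply: is_derive_eq; rewrite /GRing.scale /=; ring.
have := @is_derive1_comp R F (fun y => s * y) y _ _ (DF _) h.
by move=> H; apply: is_derive_eq; rewrite mulrC.
Qed.

Lemma continuous_scaled (F dF : R -> R) : (forall t : R, is_derive t 1 F (dF t)) ->
  continuous (fun y : R => s * F (s * y)).
Proof.
move=> DF y; apply: cvgM; first exact: cvg_cst.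
apply: differentiable_continuous; apply/derivable1_diffP.
by have [] := is_derive_scaled y DF.
Qed.

(** The two sides drive anti-concentration: on the left a softmax mean of the Gaussian vector, at
    most its expected log-sum-exp; on the right a softmax variance, which [Q_bounds] estimates from
    below. *)
Lemma EX_mom_by_parts :
  EX (fun v => mom be 1 (X v) (gv v)) =
  s * be * EX (fun v => \sum_j wt be (X v) j * gcov j j -
     \sum_i \sum_j wt be (X v) i * wt be (X v) j * gcov i j).
Proof.
pose dH i v := s * (be * (mom be 2 (X v) (b i) - mom be 1 (X v) (b i) * mom be 1 (X v) (b i))).
have mdH i : mfunc (dH i).
  apply: mfuncM; first exact: mfunc_cst.
  apply: mfuncM; first exact: mfunc_cst.
  by apply: mfuncB; [|apply: mfuncM]; exact: mfunc_mom.
pose K := `|bmax| + `|s| * (be * (`|bmax| ^+ 2 + `|bmax| * `|bmax|)).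
have HK i v : `|mom be 1 (X v) (b i)| <= K.
  apply: le_trans (mom_sup be 1 (X v) (b_le i)) _.
  by rewrite expr1 lerDl !mulr_ge0 ?(ltW be_gt0) // addr_ge0 // mulr_ge0.
have dHK i v : `|dH i v| <= K.
  apply: (@le_trans _ _ (`|s| * (be * (`|bmax| ^+ 2 + `|bmax| * `|bmax|)))); last by rewrite lerDr.
  rewrite /dH normrM ler_wpM2l // normrM (gtr0_norm be_gt0) (ler_wpM2l (ltW be_gt0)) //.
  apply: le_trans (ler_normB _ _) _; rewrite lerD ?mom_sup ?normrM //; [exact: b_le|].
  by have h := mom_sup be 1 (X v) (b_le i); rewrite expr1 in h; rewrite ler_pM.
have step i : EX (fun v => v i * mom be 1 (X v) (b i)) = EX (dH i).
  apply: (EX_by_parts e_meas e_indep e_normal (K := K)) => //.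
  - exact: mfunc_mom.
  - move=> v y; rewrite /dH /X.
    under eq_fun do rewrite gX_upd.
    rewrite (gX_upd x s v i y).
    exact: (is_derive_scaled y (fun t => is_derive_mom be 1 (gX x s (upd v i 0)) (b i) t)).
  - move=> v; rewrite /dH /X; under eq_fun do rewrite gX_upd.
    apply: (@continuous_scaled (fun t => be * (mom be 2 (ln_path (gX x s (upd v i 0)) (b i) t) (b i) -
       mom be 1 (ln_path (gX x s (upd v i 0)) (b i) t) (b i) *
       mom be 1 (ln_path (gX x s (upd v i 0)) (b i) t) (b i)))) => t.
    have H1 := is_derive_mom be 1 (gX x s (upd v i 0)) (b i) t.
    have H2 := is_derive_mom be 2 (gX x s (upd v i 0)) (b i) t.
    by apply: is_deriveM.
transitivity (EX (fun v => \sum_i v i * mom be 1 (X v) (b i))).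
  by apply: eq_EX => v; rewrite -mom1_sum.
rewrite EX_sum //; last by move=> i; apply: (nice_coord i (K := K)) => //; exact: mfunc_mom.
rewrite (eq_bigr _ (fun i _ => step i)) -EX_sum //; last by move=> i; exact: nice_bounded (dHK i).
rewrite -EXZ //; last first.
  apply: (@nice_bounded _ _ _ (\sum_j `|gcov j j| + \sum_i \sum_j `|gcov i j|)).
    apply: mfuncB.
      by apply: mfunc_sum => j; apply: mfuncM; [exact: mfunc_wt|exact: mfunc_cst].
    apply: mfunc_sum => i; apply: mfunc_sum => j; apply: mfuncM; last exact: mfunc_cst.
    by apply: mfuncM; exact: mfunc_wt.
  move=> v; apply: le_trans (ler_normB _ _) _; apply: lerD.
    apply: le_trans (ler_norm_sum _ _ _) _; apply: ler_sum => j _.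
    by rewrite normrM (ger0_norm (wt_ge0 _ _ _)) ler_piMl // wt_le1.
  apply: le_trans (ler_norm_sum _ _ _) _; apply: ler_sum => i _.
  apply: le_trans (ler_norm_sum _ _ _) _; apply: ler_sum => j _.
  rewrite normrM (ger0_norm (wtM_ge0 _ _ _ _)) ler_piMl //.
  by rewrite mulr_ile1 ?wt_ge0 ?wt_le1.
apply: eq_EX => v; rewrite -mulr_sumr -mulr_sumr sumrB -mulrA; congr (_ * (_ * (_ - _))).
  rewrite /mom exchange_big; apply: eq_bigr => j _; rewrite -mulr_sumr; congr (_ * _).
transitivity (\sum_i \sum_j \sum_k wt be (X v) j * wt be (X v) k * (b i j * b i k)).
  by apply: eq_bigr => i _; rewrite mom_mulE.
rewrite exchange_big; apply: eq_bigr => j _; rewrite exchange_big; apply: eq_bigr => k _.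
by rewrite -mulr_sumr.
Qed.

(** The Gaussian counterpart of [perm_stein], exact instead of up to a cubic remainder. *)
Lemma EX_Dmass_by_parts :
  EX (fun v => Dmass be (X v) (gv v)) = s * EX (fun v => D2form be gcov (X v)).
Proof.
pose dH i v := s * D2mass be (X v) (b i).
have mD2 i : mfunc (fun v => D2mass be (X v) (b i)).
  rewrite (_ : (fun v => _) = (fun v => D2form be (fun j k => b i j * b i k) (X v))).
    exact: mfunc_D2form.
  by apply/funext => v; rewrite D2massE.
have mdH i : mfunc (dH i) by apply: mfuncM => //; exact: mfunc_cst.
pose K := be * `|bmax| + `|s| * (3 * be ^+ 2 * bmax ^+ 2).
have HK i v : `|Dmass be (X v) (b i)| <= K.
  apply: le_trans (Dmass_sup (X v) be_gt0 (b_le i)) _.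
  by rewrite lerDl (mulr_ge0 (normr_ge0 s)) // (mulr_ge0 _ (sqr_ge0 bmax)) // (mulr_ge0 _ (sqr_ge0 be)).
have dHK i v : `|dH i v| <= K.
  apply: (@le_trans _ _ (`|s| * (3 * be ^+ 2 * bmax ^+ 2))); last by rewrite lerDr mulr_ge0 // ltW.
  by rewrite /dH normrM ler_wpM2l // D2mass_bound //; exact: b_le.
have step i : EX (fun v => v i * Dmass be (X v) (b i)) = EX (dH i).
  apply: (EX_by_parts e_meas e_indep e_normal (K := K)) => //.
  - exact: mfunc_Dmass.
  - move=> v y; rewrite /dH /X.
    under eq_fun do rewrite gX_upd.
    rewrite (gX_upd x s v i y).
    exact: (is_derive_scaled y (fun t => is_derive_Dmass be (gX x s (upd v i 0)) (b i) t)).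
  - move=> v; rewrite /dH /X; under eq_fun do rewrite gX_upd.
    exact: (continuous_scaled (fun t => is_derive_D2mass be (gX x s (upd v i 0)) (b i) t)).
transitivity (EX (fun v => \sum_i v i * Dmass be (X v) (b i))).
  by apply: eq_EX => v; rewrite -Dmass_sum.
rewrite EX_sum //; last by move=> i; apply: (nice_coord i (K := K)) => //; exact: mfunc_Dmass.
rewrite (eq_bigr _ (fun i _ => step i)) -EX_sum //; last by move=> i; exact: nice_bounded (dHK i).
rewrite -EXZ //; last first.
  apply: (@nice_bounded _ _ _ (3 * be ^+ 2 * \sum_i \sum_j `|gcov i j|)); first exact: mfunc_D2form.
  move=> v; have c0 : 0 <= \sum_i \sum_j `|gcov i j| by apply: sumr_ge0 => i _; exact: sumr_ge0.
  apply: le_trans (D2form_bound (K := \sum_i \sum_j `|gcov i j|) be (X v) c0 _) _.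
    move=> i j; rewrite (bigD1 i) //= (bigD1 j) //= -addrA lerDl addr_ge0 ?sumr_ge0 // => k _.
    exact: sumr_ge0.
  rewrite ler_piMr ?(mulr_ge0 _ c0) ?(mulr_ge0 _ (sqr_ge0 be)) //.
  by have /andP[] := wt0_mass_bnd be (X v).
apply: eq_EX => v; rewrite -mulr_sumr; congr (_ * _).
under eq_bigr do rewrite D2massE -[D2form _ _ _]mul1r.
rewrite -D2form_sum; congr D2form; apply/funext => i; apply/funext => j.
by apply: eq_bigr => k _; rewrite mul1r.
Qed.

End WithBeta.
End GaussSoftmax.

Lemma normr_shift (R : realDomainType) (x y k c : R) :
  `|x - y| <= c -> `|y| <= k -> `|x| <= k + c.
Proof. by move=> h1 h2; rewrite -[x](subrK y) addrC (le_trans (ler_normD _ _)) // lerD. Qed.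

Section GaussComparison.
Context {dO : measure_display} {Omega : measurableType dO} {R : realType}.
Variable P : probability Omega R.
Variables (n : nat) (e : 'I_n -> Omega -> R).
Hypothesis e_meas : forall i, measurable_fun setT (e i).
Hypothesis e_indep : mutually_independent P (fun i => events_real (e i)).
Hypothesis e_normal : forall i B, measurable B -> P (e i @^-1` B) = normal_prob 0 1 B.
Variables (J : finType) (b : 'I_n -> J -> R).
Local Notation EX := (EX P e).
Local Notation gv := (gv b).
Local Notation gX := (gX b).
Local Notation gcov := (gcov b).
Variable eta : R.
Hypothesis eta_ge0 : 0 <= eta.
Hypothesis gcov_diag : forall j, `|gcov j j - 1| <= eta.

Lemma gcov_bound j k : `|gcov j k| <= 1 + eta.
Proof.
have hj : gcov j j <= 1 + eta by have := gcov_diag j; rewrite ler_norml => /andP[_]; rewrite lerBlDl.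
have hk : gcov k k <= 1 + eta by have := gcov_diag k; rewrite ler_norml => /andP[_]; rewrite lerBlDl.
apply: (@le_trans _ _ (2^-1 * (gcov j j + gcov k k))); last by lra.
apply: le_trans (ler_norm_sum _ _ _) _; rewrite -big_split mulr_sumr; apply: ler_sum => i _ /=.
rewrite normrM -subr_ge0 [X in 0 <= X](_ : _ = 2^-1 * (`|b i j| - `|b i k|) ^+ 2).
  by rewrite mulr_ge0 ?invr_ge0 // sqr_ge0.
by rewrite sqrrB !real_normK ?num_real // mulr2n; field.
Qed.

Definition cG : R := n%:R * bmax b ^+ 2.
(** Bounds all coordinates of the Gaussian vector at once, while its square is a multiple of [sqn];
    Taylor remainders that are quadratic in the direction therefore remain integrable. *)
Definition KG (v : 'I_n -> R) : R := Num.sqrt (cG * sqn v).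

Lemma cG_ge0 : 0 <= cG. Proof. by rewrite mulr_ge0 ?ler0n // sqr_ge0. Qed.

Lemma KG_ge0 v : 0 <= KG v. Proof. exact: sqrtr_ge0. Qed.

Lemma KG2 v : KG v ^+ 2 = cG * sqn v.
Proof. by rewrite sqr_sqrtr // mulr_ge0 ?cG_ge0 ?sqn_ge0. Qed.

Lemma gv_KG v j : `|gv v j| <= KG v.
Proof.
rewrite -(@ler_pXn2r _ 2) ?nnegrE ?KG_ge0 // KG2.
exact: gv_bound.
Qed.

Lemma KG_le v : KG v <= (cG + 1) * sqn v.
Proof.
have := KG2 v; have := KG_ge0 v; have := sqn_ge1 v; have := sqr_ge0 (KG v - 1).
by rewrite sqrrB1 mulr2n mulrDl mul1r => *; lra.
Qed.

Lemma mfunc_gv j : mfunc (fun v => gv v j).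
Proof. by apply: mfunc_sum => i; apply: mfuncM; [exact: mfunc_proj|exact: mfunc_cst]. Qed.

Lemma mfunc_mom1_gv (be : R) x s : mfunc (fun v => mom be 1 (gX x s v) (gv v)).
Proof.
apply: mfunc_sum => j; apply: mfuncM; first by apply: mfunc_wt => k; exact: mfunc_gX.
by apply: mfuncX; exact: mfunc_gv.
Qed.

Lemma nice_mom1_gv (be : R) x s : nice (fun v => mom be 1 (gX x s v) (gv v)).
Proof.
split; first exact: mfunc_mom1_gv.
exists (cG + 1) => v; apply: le_trans (mom_sup be 1 _ (gv_KG v)) _.
by rewrite expr1 (ger0_norm (KG_ge0 v)) KG_le.
Qed.

Lemma lse_upper (be : R) (w : J -> R) (K : R) : 0 < be -> 0 <= K -> (forall j : J, `|w j| <= K) ->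
  lse be w <= be^-1 * ln (1 + #|J|%:R) + K + 2 * be * K ^+ 2.
Proof.
move=> b0 K0 wK.
have := lse_taylor (fun=> 0) b0 wK; rewrite lse0.
rewrite (_ : ln_path _ _ _ = w); last by apply/funext => j; rewrite /ln_path mul1r add0r.
have := mom_sup be 1 (fun=> 0) wK; rewrite expr1 (ger0_norm K0) !ler_norml => /andP[_ ?] /andP[_ ?].
lra.
Qed.

Lemma nice_lse (be : R) s : 0 < be -> nice (fun v => lse be (gX (fun=> 0) s v)).
Proof.
move=> b0; split; first by apply: mfunc_lse => j; exact: mfunc_gX.
have l0 : 0 <= be^-1 * ln (1 + #|J|%:R) :> R.
  by rewrite mulr_ge0 ?invr_ge0 ?(ltW b0) // ln_ge0 // lerDl ler0n.
exists (be^-1 * ln (1 + #|J|%:R) + `|s| * (cG + 1) + 2 * be * (`|s| ^+ 2 * cG)) => v.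
rewrite ger0_norm ?lse_ge0 //.
have wK j : `|gX (fun=> 0) s v j| <= `|s| * KG v.
  by rewrite /gX add0r normrM ler_wpM2l // gv_KG.
apply: le_trans (lse_upper b0 (mulr_ge0 (normr_ge0 s) (KG_ge0 v)) wK) _.
rewrite exprMn KG2 !mulrDl lerD //; first rewrite lerD //.
- by rewrite ler_peMr // sqn_ge1.
- rewrite -[leRHS]mulrA ler_wpM2l //; exact: KG_le.
- by rewrite -!mulrA.
Qed.

Definition Qf (be : R) x s v : R := \sum_j wt be (gX x s v) j * gcov j j -
     \sum_i \sum_j wt be (gX x s v) i * wt be (gX x s v) j * gcov i j.

Lemma Qf_abs be x s v : `|Qf be x s v| <= 2 * (1 + eta).
Proof.
rewrite /Qf; set w := gX x s v; apply: le_trans (ler_normB _ _) _.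
have m0 := mass_ge0 be w; have m1 := mass_le1 be w.
have p1 : `|\sum_j wt be w j * gcov j j| <= mass be w * (1 + eta).
  apply: le_trans (ler_norm_sum _ _ _) _; rewrite /mass mulr_suml; apply: ler_sum => j _.
  by rewrite normrM (ger0_norm (wt_ge0 _ _ _)) ler_wpM2l ?wt_ge0 // gcov_bound.
have p2 : `|\sum_i \sum_j wt be w i * wt be w j * gcov i j| <= mass be w ^+ 2 * (1 + eta).
  rewrite -sum2_wt mulr_suml; apply: le_trans (ler_norm_sum _ _ _) _; apply: ler_sum => i _.
  rewrite mulr_suml; apply: le_trans (ler_norm_sum _ _ _) _; apply: ler_sum => j _.
  by rewrite normrM (ger0_norm (wtM_ge0 _ _ _ _)) ler_wpM2l ?wtM_ge0 // gcov_bound.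
have q0 : 0 <= 1 + eta by rewrite addr_ge0.
have : mass be w ^+ 2 * (1 + eta) <= 1 + eta by rewrite ler_piMl // expr_le1.
have : mass be w * (1 + eta) <= 1 + eta by rewrite ler_piMl.
lra.
Qed.

Lemma nice_Qf be x s : nice (Qf be x s).
Proof.
apply: (@nice_bounded _ _ _ (2 * (1 + eta))).
  apply: mfuncB.
    by apply: mfunc_sum => j; apply: mfuncM; [apply: mfunc_wt => k; exact: mfunc_gX|exact: mfunc_cst].
  apply: mfunc_sum => i; apply: mfunc_sum => j; apply: mfuncM; last exact: mfunc_cst.
  by apply: mfuncM; apply: mfunc_wt => k; exact: mfunc_gX.
exact: Qf_abs.
Qed.

Section Anticoncentration.
Variables (be be1 : R).
Hypotheses (be_gt0 : 0 < be) (be1_gt0 : 0 < be1).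

Definition Mlse : R := EX (fun v => lse be1 (gX (fun=> 0) 1 v)).

Lemma gX01 v : gX (fun=> 0) 1 v = gv v.
Proof. by apply/funext => j; rewrite /gX add0r mul1r. Qed.

(** The shift [x] enters only through the weights, and each weight multiplies a coordinate that is
    at most the log-sum-exp. Hence the bound is uniform in [x]. *)
Lemma EX_mom_le x s : EX (fun v => mom be 1 (gX x s v) (gv v)) <= Mlse.
Proof.
apply: (EX_le e_meas e_normal); [exact: nice_mom1_gv|exact: nice_lse|move=> v].
rewrite gX01; apply: (@le_trans _ _ (mass be (gX x s v) * lse be1 (gv v))).
  rewrite /mass mulr_suml; apply: ler_sum => j _.
  by rewrite expr1 ler_wpM2l ?wt_ge0 // le_lse.
by rewrite ler_piMl ?mass_le1 // lse_ge0.
Qed.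

(** With unit variances no covariance exceeds 1, so the softmax variance is at least
    [mass - mass^2 = wt0 * mass]; variances that are only within [eta] of 1 cost [2 * eta]. *)
Lemma Q_bounds x s v :
  wt0 be (gX x s v) * mass be (gX x s v) - 2 * eta <= Qf be x s v.
Proof.
rewrite /Qf.
set w := gX x s v.
have h1 : (1 - eta) * mass be w <= \sum_j wt be w j * gcov j j.
  rewrite /mass mulrC mulr_suml; apply: ler_sum => j _; rewrite ler_wpM2l ?wt_ge0 //.
  by have := gcov_diag j; rewrite ler_norml => /andP[? _]; lra.
have h2 : \sum_i \sum_j wt be w i * wt be w j * gcov i j <= mass be w ^+ 2 * (1 + eta).
  rewrite -sum2_wt mulr_suml; apply: ler_sum => i _; rewrite mulr_suml; apply: ler_sum => j _.
  rewrite ler_wpM2l ?wtM_ge0 //; exact: le_trans (ler_norm _) (gcov_bound i j).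
have m0 := mass_ge0 be w; have m1 := mass_le1 be w.
have -> : wt0 be w = 1 - mass be w by rewrite massE; lra.
have e1 : eta * mass be w <= eta by rewrite ler_piMr.
have e2 : eta * mass be w ^+ 2 <= eta by rewrite ler_piMr // expr_le1.
rewrite mulrBl mul1r -expr2; nra.
Qed.

Lemma nice_wt0_mass x s : nice (fun v => wt0 be (gX x s v) * mass be (gX x s v)).
Proof.
apply: (@nice_bounded _ _ _ 1).
  by apply: mfuncM; [apply: mfunc_wt0|apply: mfunc_mass] => j; exact: mfunc_gX.
by move=> v; have /andP[a c] := wt0_mass_bnd be (gX x s v); rewrite ger0_norm.
Qed.

Lemma Mlse_ge0 : 0 <= Mlse.
Proof.
rewrite -(EX_cst P e 0); apply: (EX_le e_meas e_normal); [exact: nice_cst|exact: nice_lse|].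
by move=> v; exact: lse_ge0.
Qed.

(** Integration by parts identifies [s * be] times the expected softmax variance with a softmax mean
    of the Gaussian vector, which [Mlse] bounds. The shift [x] is arbitrary, so the estimate can be
    used conditionally on a permutation. *)
Lemma anticoncentration x s : 0 <= s <= 1 ->
  s * EX (fun v => wt0 be (gX x s v) * mass be (gX x s v)) <= Mlse / be + 2 * eta.
Proof.
move=> /andP[s0 s1].
have h := EX_mom_le x s; rewrite (EX_mom_by_parts e_meas e_indep e_normal b be_gt0) in h.
rewrite -/(Qf be x s) in h.
have h2 : EX (fun v => wt0 be (gX x s v) * mass be (gX x s v) - 2 * eta) <= EX (Qf be x s).
  apply: (EX_le e_meas e_normal); [|exact: nice_Qf|exact: Q_bounds].
  by apply: niceB; [exact: nice_wt0_mass|exact: nice_cst].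
rewrite (EXB e_meas e_normal) ?EX_cst in h2; [|exact: nice_wt0_mass|exact: nice_cst].
set E := EX (fun v => wt0 _ _ * _) in h2 *.
set Q := EX _ in h h2.
have : s * be * (E - 2 * eta) <= Mlse by apply: le_trans h; rewrite ler_wpM2l // mulr_ge0 // ltW.
rewrite -lerBlDr ler_pdivlMr // => h3.
have : 2 * eta * s * be <= 2 * eta * be by rewrite ler_wpM2r ?(ltW be_gt0) // ler_piMr // mulr_ge0.
nra.
Qed.

(** Interpolation of the scale from 0, where log-sum-exp is [ln (1 + #|J|) / be1], to 1, with slope
    at most [2 * be1 * (1 + eta)]. The parameter [be1] is unrelated to [be]; taken of order sqrt(ln
    #|J|) it gives the usual size of an expected maximum. *)
Lemma Mlse_bound : Mlse <= be1^-1 * ln (1 + #|J|%:R) + 2 * be1 * (1 + eta).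
Proof.
pose f s := EX (fun v => lse be1 (gX (fun=> 0) s v)).
have q0 : 0 <= 1 + eta by rewrite addr_ge0.
have A0 : 0 <= 2 * be1 * (1 + eta) by rewrite mulr_ge0 // mulr_ge0 // ltW.
pose C := EX (fun v => 2 * be1 * cG * sqn v).
have nC : nice (fun v => 2 * be1 * cG * sqn v) := niceZ (2 * be1 * cG) (nice_sqn n).
have C0 : 0 <= C.
  rewrite -(EX_cst P e 0); apply: (EX_le e_meas e_normal) => //; first exact: nice_cst.
  by move=> v; rewrite mulr_ge0 ?sqn_ge0 // mulr_ge0 ?cG_ge0 // mulr_ge0 // ltW.
have := @step_bound R f (2 * be1 * (1 + eta)) C 0 1 ler01 A0 C0.
rewrite subr0 mulr1.
have f0 : f 0 = be1^-1 * ln (1 + #|J|%:R).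
  rewrite /f -lse0 -(EX_cst P e (lse be1 (fun _ : J => 0))); apply: eq_EX => v.
  by congr lse; apply/funext => j; rewrite /gX mul0r addr0.
rewrite f0 -/Mlse => H.
suff : `|f 1 - be1^-1 * ln (1 + #|J|%:R)| <= 2 * be1 * (1 + eta).
  by rewrite ler_norml /f -/Mlse => /andP[_]; lra.
apply: H => t h t0 h0 th.
have t1 : t <= 1 by lra.
have key : `|f (t + h) - f t - h * EX (fun v => mom be1 1 (gX (fun=> 0) t v) (gv v))| <= C * h ^+ 2.
  have nm := nice_mom1_gv be1 (fun=> 0) t.
  have nl s := @nice_lse be1 s be1_gt0.
  rewrite /f -(EXZ e_meas e_normal) // -(EXB e_meas e_normal) // [leRHS]mulrC /C -(EXZ e_meas e_normal) //.
  apply: (EX_dist e_meas e_normal); [exact: niceB|exact: niceZ|exact: niceZ|].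
  move=> v /=.
  have dK j : `|h * gv v j| <= h * KG v by rewrite normrM (ger0_norm h0) ler_wpM2l // gv_KG.
  have := lse_taylor (gX (fun=> 0) t v) be1_gt0 dK.
  rewrite mom1Z exprMn KG2 (_ : ln_path _ _ _ = gX (fun=> 0) (t + h) v); last first.
    by apply/funext => j; rewrite /ln_path /gX; ring.
  by move=> hh; apply: le_trans hh _; rewrite le_eqVlt; apply/orP; left; apply/eqP; ring.
have mb : `|EX (fun v => mom be1 1 (gX (fun=> 0) t v) (gv v))| <= 2 * be1 * (1 + eta).
  rewrite (EX_mom_by_parts e_meas e_indep e_normal b be1_gt0).
  rewrite -/(Qf be1 (fun=> 0) t).
  have hQ : `|EX (Qf be1 (fun=> 0) t)| <= 2 * (1 + eta).
    have -> : EX (Qf be1 (fun=> 0) t) = EX (Qf be1 (fun=> 0) t) - EX (fun=> 0) by rewrite EX_cst subr0.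
    rewrite -[leRHS](EX_cst P e); apply: (EX_dist e_meas e_normal); [exact: nice_Qf|exact: nice_cst|exact: nice_cst|].
    by move=> v; rewrite subr0; exact: Qf_abs.
  rewrite normrM (ger0_norm (mulr_ge0 t0 (ltW be1_gt0))).
  rewrite [leRHS](_ : _ = be1 * (2 * (1 + eta))); last by ring.
  apply: ler_pM; [by rewrite mulr_ge0 // ltW|exact: normr_ge0| |exact: hQ].
  by rewrite ler_piMl // ltW.
have hm : `|h * EX (fun v => mom be1 1 (gX (fun=> 0) t v) (gv v))| <= 2 * be1 * (1 + eta) * h.
  by rewrite normrM (ger0_norm h0) mulrC ler_wpM2r.
exact: normr_shift key hm.
Qed.

Definition Lip : R := Mlse + 2 * eta * be.

Lemma nice_mass x s : nice (fun v => mass be (gX x s v)).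
Proof.
apply: (@nice_bounded _ _ _ 1); first by apply: mfunc_mass => j; exact: mfunc_gX.
by move=> v; rewrite ger0_norm ?mass_ge0 ?mass_le1.
Qed.

Lemma Lip_ge0 : 0 <= Lip.
Proof. by rewrite addr_ge0 ?Mlse_ge0 // !mulr_ge0 // ltW. Qed.

(** The derivative in the threshold is [be] times the expected [wt0 * mass], so the factor [be]
    cancels against the 1 / be of [anticoncentration]. Up to the [eta] term the Lipschitz constant
    does not depend on the smoothing. *)
Lemma mass_lipschitz (t u : R) : t <= u ->
  `|EX (fun v => mass be (gX (fun=> - u) 1 v)) - EX (fun v => mass be (gX (fun=> - t) 1 v))|
  <= Lip * (u - t).
Proof.
move=> tu.
pose f t := EX (fun v => mass be (gX (fun=> - t) 1 v)).
have C0 : 0 <= 3 * be ^+ 2 by rewrite mulr_ge0 ?sqr_ge0.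
apply: (@step_bound R f Lip (3 * be ^+ 2) t u tu Lip_ge0 C0) => r h _ h0 _.
have n1 := nice_mass (fun=> - (r + h)) 1; have n2 := nice_mass (fun=> - r) 1.
have n3 := nice_wt0_mass (fun=> - r) 1.
have key : `|f (r + h) - f r| <= EX (fun v => h * be * (wt0 be (gX (fun=> - r) 1 v) * mass be (gX (fun=> - r) 1 v)) + 3 * be ^+ 2 * h ^+ 2).
  apply: (EX_dist e_meas e_normal) => //.
    by apply: niceD; [exact: niceZ|exact: nice_cst].
  move=> v; set w := gX (fun=> - r) 1 v.
  have dK (j : J) : `|- h| <= h by rewrite normrN ger0_norm.
  have := mass_taylor be w dK.
  rewrite (_ : ln_path _ _ _ = gX (fun=> - (r + h)) 1 v); last first.
    by apply/funext => j; rewrite /ln_path /w /gX; ring.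
  have -> : Dmass be w (fun=> - h) = - (h * be * (wt0 be w * mass be w)).
    rewrite /Dmass /mom /mass; under eq_bigr do rewrite expr1.
    by rewrite -mulr_suml; ring.
  have p0 : 0 <= h * be * (wt0 be w * mass be w).
    apply: mulr_ge0; first by rewrite mulr_ge0 // ltW.
    by have /andP[] := wt0_mass_bnd be w.
  by clear dK; rewrite !ler_norml => /andP[? ?]; lra.
apply: le_trans key _.
rewrite (EXD e_meas e_normal) ?EX_cst; [|exact: niceZ|exact: nice_cst].
rewrite lerD2r (EXZ e_meas e_normal) //.
have := @anticoncentration (fun=> - r) 1; rewrite ler01 lexx mul1r => /(_ isT) ac.
rewrite mulrAC -mulrA [leRHS]mulrC ler_wpM2l //.
apply: le_trans (ler_wpM2r (ltW be_gt0) ac) _.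
by rewrite mulrDl divfK ?gt_eqF //.
Qed.

Section PermVsGauss.
Variables (I : finType) (c : I -> R) (a : J -> I -> R).
Hypothesis I_gt0 : (0 < #|I|)%N.
Hypothesis c_sum0 : \sum_s c s = 0.
Variables (dm v0 : R).
Hypothesis dm_bound : forall s z y j, `|swapd c a s z y j| <= dm.
Hypothesis be_dm : be * dm <= 1.
Hypothesis swapcov_diag : forall s j, swapcov c a s j j <= v0.
Hypothesis dm_ge0 : 0 <= dm.
Hypothesis v0_ge0 : 0 <= v0.
Variables (good : pred {perm I}) (Dl V0 nu : R).
Hypotheses (Dl_ge0 : 0 <= Dl) (V0_ge0 : 0 <= V0).
Hypothesis good_cov : forall s, good s -> forall i j, `|swapcov c a s i j - gcov i j| <= Dl.
Hypothesis all_cov : forall s i j, `|swapcov c a s i j - gcov i j| <= V0.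
Hypothesis good_prob : fprob (predC good) <= nu.
Variable x : J -> R.
Local Notation W := (lstat c a).
Let c3 := 13 * expR 3 * be ^+ 3 * dm * v0.
Let Lb := Mlse / be + 2 * eta.

Let c3_ge0 : 0 <= c3.
Proof.
by rewrite /c3 mulr_ge0 // mulr_ge0 // (mulr_ge0 _ (exprn_ge0 3 (ltW be_gt0))).
Qed.

(** Three sources of error: covariance mismatch [Dl] on typical labellings, the crude mismatch [V0]
    on the others, which have probability at most [nu], and the cubic remainder [c3] of
    [perm_stein]. *)
Definition cmp_rate : R := 3 * be ^+ 2 * (Dl * Lb + V0 * nu) + c3 * Lb.

Let X (th : R) (s : {perm I}) : ('I_n -> R) -> J -> R :=
  gX (fun j => x j + sin th * W s j) (cos th).

Let w0 : R := \sum_(s : {perm I}) \sum_j `|W s j|.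

Let W_le s j : `|W s j| <= w0.
Proof.
rewrite /w0 (bigD1 s) //= (bigD1 j) //= -addrA lerDl addr_ge0 ?sumr_ge0 // => k _.
exact: sumr_ge0.
Qed.

Let w0_ge0 : 0 <= w0. Proof. by apply: sumr_ge0 => s _; exact: sumr_ge0. Qed.

Let nice_DW th s : nice (fun v => Dmass be (X th s v) (W s)).
Proof.
apply: (@nice_bounded _ _ _ (be * `|w0|)); first by apply: mfunc_Dmass => j; exact: mfunc_gX.
by move=> v; apply: Dmass_sup => //; exact: W_le.
Qed.

Let nice_Dg th s : nice (fun v => Dmass be (X th s v) (gv v)).
Proof.
split.
  apply: mfuncM; last exact: mfunc_mom1_gv.
  by apply: mfuncM; [exact: mfunc_cst|apply: mfunc_wt0 => j; exact: mfunc_gX].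
exists (be * (cG + 1)) => v; apply: le_trans (Dmass_sup _ be_gt0 (gv_KG v)) _.
by rewrite (ger0_norm (KG_ge0 v)) -mulrA (ler_wpM2l (ltW be_gt0)) // KG_le.
Qed.

Let nice_D2 V th s : nice (fun v => D2form be V (X th s v)).
Proof.
pose K := \sum_i \sum_j `|V i j|.
have K0 : 0 <= K by apply: sumr_ge0 => i _; exact: sumr_ge0.
apply: (@nice_bounded _ _ _ (3 * be ^+ 2 * K)); first by apply: mfunc_D2form => j; exact: mfunc_gX.
move=> v; apply: le_trans (D2form_bound be (X th s v) K0 _) _.
  move=> i j; rewrite /K (bigD1 i) //= (bigD1 j) //= -addrA lerDl addr_ge0 ?sumr_ge0 // => k _.
  exact: sumr_ge0.
have /andP[_ h] := wt0_mass_bnd be (X th s v).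
by rewrite ler_piMr // mulr_ge0 // mulr_ge0 // sqr_ge0.
Qed.

Let nwm th s : nice (fun v => wt0 be (X th s v) * mass be (X th s v)).
Proof. exact: nice_wt0_mass. Qed.

Let nu_ge0 : 0 <= nu. Proof. exact: le_trans (fprob_ge0 _) good_prob. Qed.

Let deriv (th : R) : R :=
  EX (fun v => fmean (fun s => cos th * Dmass be (X th s v) (W s) - sin th * Dmass be (X th s v) (gv v))).

Lemma deriv_bound th : 0 <= th <= pi / 2 -> `|deriv th| <= cmp_rate.
Proof.
move=> /andP[th0 th1].
have c0 : 0 <= cos th by apply: cos_ge0_pihalf; rewrite th1 andbT; have := pi_gt0 R; lra.
have s0 : 0 <= sin th by apply: sin_ge0_pi; rewrite th0 /=; have := pi_gt0 R; lra.
have c1 : cos th <= 1 by exact: cos_le1.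
have s1 : sin th <= 1 by exact: sin_le1.
pose Em := fmean (fun s => EX (fun v => wt0 be (X th s v) * mass be (X th s v))).
(* Anti-concentration is applied for each fixed permutation, with the permutation term as part of
   the shift and [cos th] as the scale of the Gaussian part. *)
have cE : cos th * Em <= Lb.
  rewrite -fmeanZ -[leRHS](fmean_cst (T := {perm I})); last by apply/card_gt0P; exists 1%g.
  by apply: ler_fmean => s; apply: anticoncentration; rewrite c0 c1.
have Em0 : 0 <= Em.
  apply: fmean_ge0 => s; rewrite -(EX_cst P e 0); apply: (EX_le e_meas e_normal) => //.
    exact: nice_cst.
  by move=> v; have /andP[] := wt0_mass_bnd be (X th s v).
have dE : deriv th = cos th * EX (fun v => fmean (fun s => Dmass be (X th s v) (W s))) -
   sin th * (cos th * fmean (fun s => EX (fun v => D2form be gcov (X th s v)))).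
  rewrite /deriv (EX_fmean e_meas e_normal); last by move=> s; apply: niceB; exact: niceZ.
  rewrite (EX_fmean e_meas e_normal) // -!fmeanZ -fmeanB; apply: eq_fmean => s.
  rewrite (EXB e_meas e_normal) ?(EXZ e_meas e_normal) //; try exact: niceZ.
  by congr (_ - _ * _); rewrite (EX_Dmass_by_parts e_meas e_indep e_normal b be_gt0).
pose A1 := EX (fun v => fmean (fun s => Dmass be (X th s v) (W s))).
pose A2 := EX (fun v => sin th * fmean (fun s => D2form be (swapcov c a s) (X th s v))).
have st : `|A1 - A2| <= c3 * Em.
  rewrite /Em -(EX_fmean e_meas e_normal) // -(EXZ e_meas e_normal); last exact: nice_fmean.
  apply: (EX_dist e_meas e_normal); [exact: nice_fmean| |apply: niceZ; exact: nice_fmean|].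
    by apply: niceZ; exact: nice_fmean.
  move=> v.
  have := @perm_stein R I J c a I_gt0 c_sum0 be dm v0 be_gt0 dm_bound be_dm swapcov_diag
    (fun j => x j + cos th * gv v j) (sin th).
  rewrite s0 s1 => /(_ isT).
  have XE s : (fun j => x j + cos th * gv v j + sin th * W s j) = X th s v.
    by apply/funext => j; rewrite /X /gX; ring.
  under [X in `|X - _|]eq_fmean do rewrite XE.
  under [X in `|_ - _ * X|]eq_fmean do rewrite XE.
  under [X in _ <= _ * X -> _]eq_fmean do rewrite XE.
  move=> h; apply: le_trans h _.
  set q := fmean _; have q0 : 0 <= q.
    by apply: fmean_ge0 => s; have /andP[] := wt0_mass_bnd be (X th s v).
  rewrite ler_wpM2r //.
  rewrite [leLHS](_ : _ = sin th ^+ 2 * c3); last by rewrite /c3; ring.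
  by rewrite ler_piMl ?expr_le1.
have A2E : A2 = sin th * fmean (fun s => EX (fun v => D2form be (swapcov c a s) (X th s v))).
  rewrite /A2 (EXZ e_meas e_normal) ?(EX_fmean e_meas e_normal) //; exact: nice_fmean.
pose A3 := fmean (fun s => EX (fun v => D2form be (fun i j => swapcov c a s i j - gcov i j) (X th s v))).
have dE2 : deriv th = cos th * (A1 - A2) + sin th * (cos th * A3).
  rewrite dE -/A1 A2E /A3.
  have -> : fmean (fun s => EX (fun v => D2form be (fun i j => swapcov c a s i j - gcov i j) (X th s v))) =
    fmean (fun s => EX (fun v => D2form be (swapcov c a s) (X th s v))) -
    fmean (fun s => EX (fun v => D2form be gcov (X th s v))).
    rewrite -fmeanB; apply: eq_fmean => s; rewrite -(EXB e_meas e_normal) //.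
    by apply: eq_EX => v; rewrite D2formB.
  by ring.
have hA3 : `|cos th * A3| <= 3 * be ^+ 2 * (Dl * Lb + V0 * nu).
  rewrite normrM (ger0_norm c0).
  (* Outside [good] only the crude covariance bound holds; the small probability of that case pays
     for it. *)
  have pt s : `|EX (fun v => D2form be (fun i j => swapcov c a s i j - gcov i j) (X th s v))| <=
     3 * be ^+ 2 * (Dl * EX (fun v => wt0 be (X th s v) * mass be (X th s v)) + V0 * (~~ good s)%:R).
    have b2 : 0 <= 3 * be ^+ 2 by rewrite mulr_ge0 // sqr_ge0.
    have Ew0 : 0 <= EX (fun v => wt0 be (X th s v) * mass be (X th s v)).
      rewrite -(EX_cst P e 0); apply: (EX_le e_meas e_normal) => //; first exact: nice_cst.
      by move=> v; have /andP[] := wt0_mass_bnd be (X th s v).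
    rewrite -[X in `|X|]subr0 -[X in `|_ - X|](EX_cst P e).
    case: (boolP (good s)) => gs /=.
      rewrite mulr0 addr0 mulrA -(EXZ e_meas e_normal) //.
      apply: (EX_dist e_meas e_normal) => //; [exact: nice_cst|exact: niceZ|move=> v].
      rewrite subr0; exact: D2form_bound (good_cov gs).
    rewrite mulr1; apply: (@le_trans _ _ (3 * be ^+ 2 * V0)); last by rewrite ler_wpM2l // lerDr mulr_ge0.
    rewrite -[leRHS](EX_cst P e).
    apply: (EX_dist e_meas e_normal) => //; [exact: nice_cst|exact: nice_cst|move=> v].
    rewrite subr0; apply: le_trans (D2form_bound be (X th s v) V0_ge0 (all_cov s)) _.
    have /andP[_ h] := wt0_mass_bnd be (X th s v).
    by rewrite ler_piMr // mulr_ge0.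
  have : `|A3| <= 3 * be ^+ 2 * (Dl * Em + V0 * nu).
    apply: le_trans (norm_fmean _) _; apply: le_trans (ler_fmean pt) _.
    rewrite fmeanZ fmeanD !fmeanZ -/Em ler_wpM2l ?(mulr_ge0 _ (sqr_ge0 be)) // lerD2l ler_wpM2l //.
  move=> h; apply: le_trans (ler_wpM2l c0 h) _.
  rewrite mulrCA ler_wpM2l ?(mulr_ge0 _ (sqr_ge0 be)) // mulrDr lerD //.
    by rewrite mulrCA ler_wpM2l.
  by rewrite ler_piMl // mulr_ge0.
have hA1 : `|cos th * (A1 - A2)| <= c3 * Lb.
  rewrite normrM (ger0_norm c0); apply: le_trans (ler_wpM2l c0 st) _.
  by rewrite mulrCA ler_wpM2l.
rewrite dE2; apply: le_trans (ler_normD _ _) _; rewrite /cmp_rate addrC lerD //.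
rewrite normrM (ger0_norm s0); apply: le_trans hA3.
by rewrite ler_piMl.
Qed.

Let sin_step (t h : R) : 0 <= h -> `|sin (t + h) - sin t - h * cos t| <= h ^+ 2.
Proof.
move=> h0.
have D1 (u : R) : is_derive u 1 (fun u : R => sin (t + u)) (cos (t + u)).
  have g : is_derive u 1 (fun u : R => t + u) (0 + 1) by exact: is_deriveD.
  have H := @is_derive1_comp R sin (fun u => t + u) u _ _ (is_derive_sin _) g.
  by apply: is_derive_eq; rewrite add0r mulr1.
have D2 (u : R) : is_derive u 1 (fun u : R => cos (t + u)) (- sin (t + u)).
  have g : is_derive u 1 (fun u : R => t + u) (0 + 1) by exact: is_deriveD.
  have H := @is_derive1_comp R cos (fun u => t + u) u _ _ (is_derive_cos _) g.
  by apply: is_derive_eq; rewrite add0r mulr1.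
have := @mvt2_bound R _ _ _ h 1 h0 D1 D2; rewrite addr0 mul1r; apply => u _.
by rewrite normrN ler_norml sin_geN1 sin_le1.
Qed.

Let cos_step (t h : R) : 0 <= h -> `|cos (t + h) - cos t + h * sin t| <= h ^+ 2.
Proof.
move=> h0.
have D2 (u : R) : is_derive u 1 (fun u : R => cos (t + u)) (- sin (t + u)).
  have g : is_derive u 1 (fun u : R => t + u) (0 + 1) by exact: is_deriveD.
  have H := @is_derive1_comp R cos (fun u => t + u) u _ _ (is_derive_cos _) g.
  by apply: is_derive_eq; rewrite add0r mulr1.
have D1 (u : R) : is_derive u 1 (fun u : R => - sin (t + u)) (- cos (t + u)).
  have g : is_derive u 1 (fun u : R => t + u) (0 + 1) by exact: is_deriveD.
  have H := @is_derive1_comp R sin (fun u => t + u) u _ _ (is_derive_sin _) g.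
  by apply: is_derive_eq; rewrite add0r mulr1.
have := @mvt2_bound R _ _ _ h 1 h0 D2 D1; rewrite addr0 mul1r mulrN opprK; apply => u _.
by rewrite normrN ler_norml cos_geN1 cos_le1.
Qed.

(** The factor 2 bounds the length pi / 2 of the path. *)
Lemma perm_vs_gauss :
  `|fmean (fun s => mass be (fun j => x j + W s j)) - EX (fun v => mass be (gX x 1 v))|
  <= 2 * cmp_rate.
Proof.
pose f th := EX (fun v => fmean (fun s => mass be (X th s v))).
have f0 : f 0 = EX (fun v => mass be (gX x 1 v)).
  apply: eq_EX => v; rewrite -[RHS](fmean_cst (T := {perm I})); last by apply/card_gt0P; exists 1%g.
  apply: eq_fmean => s; congr mass; apply/funext => j.
  by rewrite /X /gX sin0 cos0 mul0r addr0.
have f1 : f (pi / 2) = fmean (fun s => mass be (fun j => x j + W s j)).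
  rewrite -[RHS](EX_cst P e); apply: eq_EX => v; apply: eq_fmean => s; congr mass; apply/funext => j.
  by rewrite /X /gX sin_pihalf cos_pihalf mul1r mul0r addr0.
rewrite -f0 -f1.
have A0 : 0 <= cmp_rate.
  apply: le_trans (normr_ge0 (deriv 0)) (deriv_bound _).
  by rewrite lexx divr_ge0 ?pi_ge0.
(* Coefficient of [h ^+ 2] in the local expansion for a given Gaussian vector. Only its
   integrability matters, because [step_bound] discards the quadratic term. *)
pose Cf v := 3 * be ^+ 2 * (2 * (2 * w0 ^+ 2 + 2 * KG v ^+ 2) * 5) + be * (w0 + KG v).
have KGm : mfunc KG.
  by apply: mfunc_comp; [exact: continuous_measurable_fun (@sqrt_continuous R)|apply: mfuncM; [exact: mfunc_cst|exact: mfunc_sqn]].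
have nCf : nice Cf.
  rewrite /Cf.
  apply: niceD.
    apply: niceZ.
    rewrite (_ : (fun v => _) = (fun v => 20 * w0 ^+ 2 + 20 * cG * sqn v)); last first.
      by apply/funext => v; rewrite KG2; ring.
    by apply: niceD; [exact: nice_cst|exact: (niceZ (20 * cG) (nice_sqn n))].
  apply: niceZ; apply: niceD; first exact: nice_cst.
  by split => //; exists (cG + 1) => v; rewrite ger0_norm ?KG_ge0 ?KG_le.
have Cf0 v : 0 <= Cf v.
  have k0 := KG_ge0 v; have q1 := sqr_ge0 w0; have q2 := sqr_ge0 (KG v).
  apply: addr_ge0; apply: mulr_ge0.
  - by rewrite mulr_ge0 // sqr_ge0.
  - by apply: mulr_ge0 => //; apply: mulr_ge0 => //; apply: addr_ge0; apply: mulr_ge0.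
  - exact: ltW.
  - exact: addr_ge0.
have C0 : 0 <= EX Cf.
  by rewrite -(EX_cst P e 0); apply: (EX_le e_meas e_normal) => //; exact: nice_cst.
have pih0 : 0 <= pi / 2 :> R by rewrite divr_ge0 ?pi_ge0.
have := @step_bound R f cmp_rate (EX Cf) 0 (pi / 2) pih0 A0 C0.
move=> H; apply: le_trans (H _) _; last first.
  by rewrite subr0 mulrC ler_wpM2r //; have /andP[_ /ltW] := pihalf_02 R.
move=> t h t0 h0 th.
have dt : `|deriv t| <= cmp_rate by apply: deriv_bound; rewrite t0; lra.
have nm r : nice (fun v => fmean (fun s => mass be (X r s v))).
  by apply: nice_fmean => s; exact: nice_mass.
have nd : nice (fun v => fmean (fun s => cos t * Dmass be (X t s v) (W s) - sin t * Dmass be (X t s v) (gv v))).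
  by apply: nice_fmean => s; apply: niceB; exact: niceZ.
have key : `|f (t + h) - f t - h * deriv t| <= EX Cf * h ^+ 2.
  rewrite /f -(EXB e_meas e_normal) // /deriv -(EXZ e_meas e_normal) // [leRHS]mulrC -(EXZ e_meas e_normal) //.
  apply: (EX_dist e_meas e_normal); [exact: niceB|exact: niceZ|exact: niceZ|move=> v].
  rewrite -fmeanB -fmeanZ -fmeanB; apply: le_trans (norm_fmean _) _.
  rewrite -[leRHS](fmean_cst (T := {perm I})); last by apply/card_gt0P; exists 1%g.
  apply: ler_fmean => s.
  have k0 := KG_ge0 v.
  have ss := sin_step t h0; have cs := cos_step t h0.
  have h2 : h ^+ 2 <= 2 * h.
    have /andP[_ p2] := pihalf_02 R.
    by rewrite expr2 ler_wpM2r //; lra.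
  pose ds := sin (t + h) - sin t; pose dc := cos (t + h) - cos t.
  pose d j := ds * W s j + dc * gv v j.
  have sb : `|sin t| <= 1 by rewrite ler_norml sin_geN1 sin_le1.
  have cb : `|cos t| <= 1 by rewrite ler_norml cos_geN1 cos_le1.
  have hs : `|h * sin t| <= h by rewrite normrM (ger0_norm h0) ler_piMr.
  have hc : `|h * cos t| <= h by rewrite normrM (ger0_norm h0) ler_piMr.
  have dsb : `|ds| <= 3 * h.
    apply: le_trans (normr_shift ss hc) _.
    by rewrite (_ : 3 * h = h + 2 * h) ?lerD2l //; ring.
  have dcb : `|dc| <= 3 * h.
    rewrite -normrN in hs; rewrite -[h * sin t]opprK in cs.
    apply: le_trans (normr_shift cs hs) _.
    by rewrite (_ : 3 * h = h + 2 * h) ?lerD2l //; ring.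
  have dK j : `|d j| <= 3 * h * (w0 + KG v).
    apply: le_trans (ler_normD _ _) _; rewrite !normrM mulrDr lerD //; apply: ler_pM => //.
    exact: gv_KG.
  have XE : X (t + h) s v = ln_path (X t s v) d 1.
    by apply/funext => j; rewrite /X /gX /ln_path /d /ds /dc; ring.
  have := mass_taylor be (X t s v) dK; rewrite -XE => mt.
  have De : Dmass be (X t s v) d = ds * Dmass be (X t s v) (W s) + dc * Dmass be (X t s v) (gv v).
    rewrite /Dmass (_ : mom be 1 _ d = ds * mom be 1 (X t s v) (W s) + dc * mom be 1 (X t s v) (gv v)); first by ring.
    rewrite /mom !mulr_sumr -big_split; apply: eq_bigr => j _ /=; rewrite !expr1 /d; ring.
  have DWb : `|Dmass be (X t s v) (W s)| <= be * w0.
    by have := Dmass_sup (X t s v) be_gt0 (W_le s); rewrite (ger0_norm w0_ge0).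
  have Dgb : `|Dmass be (X t s v) (gv v)| <= be * KG v.
    by have := Dmass_sup (X t s v) be_gt0 (gv_KG v); rewrite (ger0_norm k0).
  have e1 : `|(ds - h * cos t) * Dmass be (X t s v) (W s)| <= h ^+ 2 * (be * w0).
    by rewrite normrM ler_pM.
  have e2 : `|(dc + h * sin t) * Dmass be (X t s v) (gv v)| <= h ^+ 2 * (be * KG v).
    by rewrite normrM ler_pM.
  have K2 : (3 * h * (w0 + KG v)) ^+ 2 <= h ^+ 2 * (2 * (2 * w0 ^+ 2 + 2 * KG v ^+ 2) * 5).
    rewrite [leLHS](_ : _ = h ^+ 2 * (9 * (w0 + KG v) ^+ 2)); last by ring.
    rewrite ler_wpM2l ?sqr_ge0 //.
    rewrite [leRHS](_ : _ = 20 * (w0 ^+ 2 + KG v ^+ 2)); last by ring.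
    rewrite -subr_ge0 [X in 0 <= X](_ : _ = 9 * (w0 - KG v) ^+ 2 + 2 * w0 ^+ 2 + 2 * KG v ^+ 2); last by ring.
    by rewrite !addr_ge0 // mulr_ge0 ?sqr_ge0.
  have mt2 : `|mass be (X (t + h) s v) - mass be (X t s v) - Dmass be (X t s v) d| <=
     h ^+ 2 * (3 * be ^+ 2 * (2 * (2 * w0 ^+ 2 + 2 * KG v ^+ 2) * 5)).
    apply: le_trans mt _; rewrite [leRHS]mulrCA; apply: ler_wpM2l K2.
    by rewrite mulr_ge0 // sqr_ge0.
  rewrite [X in `|X|](_ : _ = (mass be (X (t + h) s v) - mass be (X t s v) - Dmass be (X t s v) d) +
    (ds - h * cos t) * Dmass be (X t s v) (W s) + (dc + h * sin t) * Dmass be (X t s v) (gv v)).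
    rewrite /Cf mulrDr [be * _]mulrDr [h ^+ 2 * (_ + _ * KG v)]mulrDr addrA.
    apply: le_trans (ler_normD _ _) (lerD _ e2).
    exact: le_trans (ler_normD _ _) (lerD mt2 e1).
  by rewrite De; ring.
have hd : `|h * deriv t| <= cmp_rate * h by rewrite normrM (ger0_norm h0) mulrC ler_wpM2r.
exact: normr_shift key hd.
Qed.

End PermVsGauss.
End Anticoncentration.
End GaussComparison.

(** * Score functions *)

Section UnitInterval.
Variable R : realType.
Local Notation mu := (@lebesgue_measure R).
Local Notation U := (@unit_itv R).

Lemma unit_itvE : U = `[0, 1]%classic.
Proof. by apply/seteqP; split => x; rewrite /unit_itv /= in_itv. Qed.

Lemma has_derivative01_continuous (f f' : R -> R) : has_derivative01 f f' ->
  {within `[0, 1]%classic, continuous f}.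
Proof.
move=> H; apply/subspace_continuousP => z zU.
have zU' : U z by rewrite unit_itvE.
have h := H z zU'.
apply/cvgrPdist_lt => eps eps0.
have h1 := h; move/cvgrPdist_lt/(_ 1 ltr01) : h1 => h1.
rewrite !near_withinE in h1; rewrite near_withinE.
pose K := `|f' z| + 1.
have K0 : 0 < K by rewrite ltr_wpDl.
have hK : \forall t \near z, `|z - t| < eps / K.
  by apply/nbhs_ballP; exists (eps / K); rewrite /= ?divr_gt0.
near=> t => tU.
have [->|tz] := eqVneq t z; first by rewrite subrr normr0.
have q : `|f' z - (f t - f z) / (t - z)| < 1.
  have : t != z -> U t -> `|f' z - (f t - f z) / (t - z)| < 1 by near: t.
  by apply => //; rewrite unit_itvE.
have b : `|(f t - f z) / (t - z)| < K.
  have := ler_normB (f' z) (f' z - (f t - f z) / (t - z)); rewrite opprB addrCA subrr addr0.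
  by rewrite /K; lra.
have d : `|z - t| < eps / K by near: t.
have tz0 : 0 < `|t - z| by rewrite normr_gt0 subr_eq0.
rewrite distrC -[f t - f z](divfK (x := t - z)) ?subr_eq0 // normrM.
rewrite distrC in d.
have : `|(f t - f z) / (t - z)| * `|t - z| <= K * `|t - z| by rewrite ler_wpM2r // ltW.
have : K * `|t - z| < K * (eps / K) by rewrite ltr_pM2l.
rewrite mulrCA divff ?gt_eqF // mulr1; lra.
Unshelve. all: by end_near.
Qed.

Lemma has_derivative01_is_derive (f f' : R -> R) (z : R) : has_derivative01 f f' -> 0 < z < 1 ->
  is_derive z 1 f (f' z).
Proof.
move=> H /andP[z0 z1].
have zU : U z by rewrite /unit_itv /= !ltW.
have h := H z zU.
have cv : (fun t : R => t^-1 *: (f (t *: 1 + z) - f z)) @ 0^' --> f' z.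
  apply/cvgrPdist_lt => eps eps0.
  have h1 := h; move/cvgrPdist_lt/(_ eps eps0) : h1 => h1; rewrite !near_withinE in h1.
  have h2 : \forall t \near z, U t.
    near=> t; rewrite /unit_itv /=.
    have a1 : z / 2 < t by near: t; apply: lt_nbhsr; lra.
    have a2 : t < (1 + z) / 2 by near: t; apply: lt_nbhsl; lra.
    by apply/andP; split; lra.
  have : \forall t \near z, t != z -> `|f' z - (f t - f z) / (t - z)| < eps.
    by near=> t => tz; have := near h1 t; apply => //; near: t.
  move=> /nbhs_ballP [r /= r0 hr].
  rewrite near_withinE; apply/nbhs_ballP; exists r => //= t bt t0.
  have := hr (t + z); rewrite /ball /= opprD addrCA subrr addr0 normrN.
  move: bt; rewrite /ball /= sub0r normrN => bt /(_ bt).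
  rewrite -subr_eq0 addrK t0 => /(_ isT).
  by rewrite /GRing.scale /= mulr1 mulrC.
split; first by apply/cvg_ex; exists (f' z).
by apply: cvg_lim.
Unshelve. all: by end_near.
Qed.

Lemma derivative01_lipschitz (f f' : R -> R) (B : R) : has_derivative01 f f' ->
  (forall z, U z -> `|f' z| <= B) ->
  forall x y, 0 <= x <= 1 -> 0 <= y <= 1 -> `|f x - f y| <= B * `|x - y|.
Proof.
move=> H HB.
suff W x y : 0 <= x -> x <= y -> y <= 1 -> `|f y - f x| <= B * `|y - x|.
  move=> x y /andP[x0 x1] /andP[y0 y1]; have [xy|/ltW yx] := leP x y; last exact: W.
  by rewrite distrC (distrC x); exact: W.
move=> x0 xy y1.
have cf : {within `[x, y]%classic, continuous f}.
  apply: continuous_subspaceW (has_derivative01_continuous H) => t /=.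
  by rewrite !in_itv /= => /andP[a c]; rewrite (le_trans x0 a) (le_trans c y1).
have [z|c] := @MVT_segment R f f' x y xy _ cf.
  rewrite in_itv /= => /andP[a c]; apply: has_derivative01_is_derive => //.
  by rewrite (le_lt_trans x0 a) (lt_le_trans c y1).
rewrite in_itv /= => /andP[a c'] ->; rewrite normrM ler_wpM2r // HB //.
by rewrite /unit_itv /= (le_trans x0 a) (le_trans c' y1).
Qed.

Section Riemann.
Variables (g : R -> R) (L : R).
Hypothesis L_ge0 : 0 <= L.
Hypothesis g_cont : {within `[0, 1]%classic, continuous g}.
Hypothesis g_lip : forall x y : R, 0 <= x <= 1 -> 0 <= y <= 1 -> `|g x - g y| <= L * `|x - y|.

Lemma g_integrable : mu.-integrable `[0, 1]%classic (EFin \o g).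
Proof. by apply: continuous_compact_integrable => //; exact: segment_compact. Qed.

(** Right endpoints, because these are the values that an empirical distribution function takes at
    its own sample points. *)
Lemma riemann_sum (n : nat) : (0 < n)%N ->
  `|\int[mu]_(z in `[0, 1]%classic) g z - n%:R^-1 * \sum_(0 <= r < n) g (r.+1%:R / n%:R)| <= L / n%:R.
Proof.
move=> n0; have nR : 0 < n%:R :> R by rewrite ltr0n.
pose F r := \int[mu]_(z in `[0, r%:R / n%:R]%classic) g z.
suff key r : (r <= n)%N ->
    `|F r - n%:R^-1 * \sum_(0 <= i < r) g (i.+1%:R / n%:R)| <= r%:R * (L / n%:R ^+ 2).
  have := key n (leqnn n); rewrite /F divff ?gt_eqF // => /le_trans; apply.
  by rewrite le_eqVlt; apply/orP; left; apply/eqP; field; rewrite gt_eqF.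
elim: r => [|r ih] rn.
  by rewrite /F !mul0r set_itv1 Rintegral_set1 big_geq // mulr0 subrr normr0.
have a0 : 0 <= r%:R / n%:R :> R by rewrite divr_ge0 ?ler0n.
have ab : r%:R / n%:R <= r.+1%:R / n%:R :> R by rewrite ler_pM2r ?invr_gt0 // ler_nat.
have b1 : r.+1%:R / n%:R <= 1 :> R by rewrite ler_pdivrMr // mul1r ler_nat.
have splitE : `[0, r.+1%:R / n%:R]%classic =
   `[0, r%:R / n%:R]%classic `|` `]r%:R / n%:R, r.+1%:R / n%:R]%classic :> set R.
  by rewrite -itv_bndbnd_setU // bnd_simp.
have isub (A : set R) : measurable A -> A `<=` `[0, 1]%classic -> mu.-integrable A (EFin \o g).
  by move=> mA A01; apply: integrableS g_integrable.
pose D : set R := `]r%:R / n%:R, r.+1%:R / n%:R]%classic.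
have D01 : D `<=` `[0, 1]%classic.
  move=> z; rewrite /D /= !in_itv /= => /andP[az zb]; apply/andP; split.
    exact: le_trans a0 (ltW az).
  exact: le_trans zb b1.
have measD : measurable D by exact: measurable_itv.
have mD : mu D = (n%:R^-1)%:E.
  rewrite /D lebesgue_measure_itv /= lte_fin ltr_pM2r ?invr_gt0 // ltr_nat ltnSn -EFinB.
  by congr EFin; rewrite -natr1; field; rewrite gt_eqF.
have FS : F r.+1 = F r + \int[mu]_(z in D) g z.
  rewrite /F splitE Rintegral_setU //.
    rewrite -splitE; apply: isub => // z /=; rewrite !in_itv /= => /andP[-> zb].
    exact: le_trans b1.
  apply/disj_setPS => z [] /=; rewrite !in_itv /= => /andP[_ h1] /andP[h2 _].
  by move: (le_lt_trans h1 h2); rewrite ltxx.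
have dD : `|\int[mu]_(z in D) g z - n%:R^-1 * g (r.+1%:R / n%:R)| <= L / n%:R ^+ 2.
  have iD := isub D (measurable_itv _) D01.
  have cstE : n%:R^-1 * g (r.+1%:R / n%:R) = \int[mu]_(z in D) cst (g (r.+1%:R / n%:R)) z.
    rewrite Rintegral_cst // mulrC; congr (_ * _); exact: (esym (congr1 fine mD)).
  have icst k : mu.-integrable D (EFin \o cst k).
    have ic : mu.-integrable `[0, 1]%classic (EFin \o cst k).
      apply: continuous_compact_integrable; first exact: segment_compact.
      by apply: continuous_subspaceT => x; exact: cvg_cst.
    by apply: integrableS ic.
  rewrite cstE -RintegralB //.
  apply: le_trans (le_normr_Rintegral _ _) _ => //.
    exact: (@integrableB _ _ _ mu D measD (EFin \o g) (EFin \o cst (g (r.+1%:R / n%:R))) iD (icst _)).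
  have -> : L / n%:R ^+ 2 = \int[mu]_(z in D) cst (L / n%:R) z.
    rewrite Rintegral_cst // (_ : fine _ = n%:R^-1); last exact: (congr1 fine mD).
    by field; rewrite gt_eqF.
  apply: le_Rintegral => //.
    exact: (integrable_abse (@integrableB _ _ _ mu D measD (EFin \o g) (EFin \o cst (g (r.+1%:R / n%:R))) iD (icst _))).
  move=> z zD; have zU := D01 z zD.
  have z01 : 0 <= z <= 1 by move: zU; rewrite /= in_itv.
  apply: le_trans (g_lip z01 _) _; first by rewrite b1 (le_trans a0).
  rewrite ler_wpM2l //; move: zD; rewrite /D /= in_itv /= => /andP[h1 h2].
  rewrite ler0_norm ?subr_le0 // opprB lerBlDr (_ : _ / _ = n%:R^-1 + r%:R / n%:R).
    by rewrite lerD2l ltW.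
  by rewrite -natr1 mulrDl mul1r addrC.
rewrite FS big_nat_recr //= mulrDr [leRHS](_ : _ = r%:R * (L / n%:R ^+ 2) + L / n%:R ^+ 2); last by rewrite -natr1 mulrDl mul1r.
rewrite opprD addrACA.
by apply: le_trans (ler_normD _ _) _; apply: lerD => //; exact: ih (ltnW rn).
Qed.

End Riemann.

Section Score.
Variables (psi dpsi : R -> R) (B : R).
Hypothesis psi_der : has_derivative01 psi dpsi.
Hypothesis dpsi_bound : forall z, U z -> `|dpsi z| <= B.
Hypothesis psi_mean : (\int[mu]_(z in U) (psi z)%:E = 0)%E.
Hypothesis psi_norm : (\int[mu]_(z in U) (psi z * psi z)%:E = 1)%E.

Lemma score_bound_ge0 : 0 <= B.
Proof. by apply: le_trans (normr_ge0 (dpsi 0)) (dpsi_bound _); rewrite /unit_itv /= lexx ler01. Qed.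

Let psi_lip (x y : R) : 0 <= x <= 1 -> 0 <= y <= 1 -> `|psi x - psi y| <= B * `|x - y|.
Proof. exact: (derivative01_lipschitz psi_der dpsi_bound). Qed.

Let psi_cont : {within `[0, 1]%classic, continuous psi}.
Proof. exact: has_derivative01_continuous psi_der. Qed.

Let psi2_cont : {within `[0, 1]%classic, continuous (fun z => psi z * psi z)}.
Proof.
have /subspace_continuousP h := psi_cont.
by apply/subspace_continuousP => x xA; apply: cvgM; exact: h.
Qed.

Lemma score_sum (n : nat) : (0 < n)%N -> `|\sum_(0 <= r < n) psi (r.+1%:R / n%:R)| <= B.
Proof.
move=> n0; have nR : 0 < n%:R :> R by rewrite ltr0n.
have := riemann_sum score_bound_ge0 psi_cont psi_lip n0.
rewrite (_ : \int[mu]_(z in _) psi z = 0); last by rewrite /Rintegral -unit_itvE psi_mean.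
by rewrite sub0r normrN normrM normfV (ger0_norm (ltW nR)) mulrC ler_pM2r ?invr_gt0.
Qed.

(** The Riemann sum with a single node gives [|psi 1| <= B]; the Lipschitz bound adds at most
    another [B]. *)
Lemma score_le (x : R) : 0 <= x <= 1 -> `|psi x| <= 2 * B.
Proof.
move=> x01; have := score_sum (ltn0Sn 0); rewrite big_nat1 divr1 => h.
have u1 : 0 <= (1 : R) <= 1 by rewrite ler01 lexx.
have := psi_lip x01 u1; have := ler_normD (psi x - psi 1) (psi 1); rewrite subrK.
have : B * `|x - 1| <= B.
  rewrite ler_piMr ?score_bound_ge0 // ler_norml; case/andP: x01 => x0 x1.
  by apply/andP; split; lra.
lra.
Qed.

Let mpsi2 (D : set R) : measurable D -> D `<=` `[0, 1]%classic ->
  measurable_fun D (fun z => (psi z * psi z)%:E).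
Proof.
move=> mD D01; have /measurable_int := g_integrable psi2_cont.
by apply: measurable_funS.
Qed.

(** A score of unit norm cannot be bounded by [2 * B] with a small [B]. This is what later permits
    the normalization of the derivative bound to at least 1. *)
Lemma score_bound_ge : 1 <= 4 * B ^+ 2.
Proof.
have : (\int[mu]_(z in U) (psi z * psi z)%:E <= \int[mu]_(z in U) (cst (4 * B ^+ 2)%:E z))%E.
  rewrite unit_itvE; apply: ge0_le_integral => //.
  - by move=> x _; rewrite lee_fin -expr2 sqr_ge0.
  - exact: mpsi2.
  move=> x; rewrite /= in_itv /= => x01; rewrite lee_fin -expr2 -real_normK ?num_real //.
  have -> : 4 * B ^+ 2 = (2 * B) ^+ 2 by ring.
  by rewrite ler_pXn2r ?nnegrE ?score_le // mulr_ge0 // score_bound_ge0.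
have m01 : mu `[0, 1]%classic = 1%E by rewrite lebesgue_measure_itv /= lte_fin ltr01 sube0.
have -> : (\int[mu]_(z in U) (cst (4 * B ^+ 2)%:E z) = (4 * B ^+ 2)%:E)%E.
  rewrite unit_itvE integral_cst //.
  exact: etrans (congr1 (fun t => (4 * B ^+ 2)%:E * t)%E m01) (mule1 _).
by rewrite psi_norm lee_fin.
Qed.

Lemma score_sqr_sum (n : nat) : (0 < n)%N ->
  `|n%:R^-1 * (\sum_(0 <= r < n) psi (r.+1%:R / n%:R) ^+ 2) - 1| <= 4 * B ^+ 2 / n%:R.
Proof.
move=> n0.
have lip (x y : R) : 0 <= x <= 1 -> 0 <= y <= 1 ->
    `|psi x * psi x - psi y * psi y| <= 4 * B ^+ 2 * `|x - y|.
  move=> x01 y01.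
  rewrite (_ : _ - _ = (psi x + psi y) * (psi x - psi y)); last by ring.
  rewrite normrM (_ : 4 * B ^+ 2 * `|x - y| = 4 * B * (B * `|x - y|)); last by ring.
  apply: ler_pM => //; last exact: psi_lip.
  apply: le_trans (ler_normD _ _) _; have := score_le x01; have := score_le y01; lra.
have q0 : 0 <= 4 * B ^+ 2 by rewrite mulr_ge0 // sqr_ge0.
have := riemann_sum q0 psi2_cont lip n0.
rewrite (_ : \int[mu]_(z in _) _ = 1); last by rewrite /Rintegral -unit_itvE psi_norm.
by rewrite distrC; under [in X in X -> _]eq_bigr do rewrite -expr2.
Qed.

(* With h = |psi x|, psi^2 stays above h^2/2 on an interval of length h/(4B)
   next to x, so that h^3 <= 8B. *)
Lemma score_sqr_le (x : R) : 1 <= B -> 0 <= x <= 1 -> psi x ^+ 2 <= 8 * B.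
Proof.
move=> B1 x01; have B0 : 0 < B by exact: lt_le_trans ltr01 B1.
pose h := `|psi x|; have h0 : 0 <= h by exact: normr_ge0.
have h2B : h <= 2 * B by exact: score_le.
rewrite -real_normK ?num_real // -/h.
have [h1|h1] := leP h 1.
  by apply: le_trans (exprn_ile1 2 h0 h1) _; lra.
pose l := h / (4 * B).
have l0 : 0 < l by rewrite divr_gt0 ?mulr_gt0 //; lra.
have l2 : l <= 2^-1 by rewrite ler_pdivrMr ?mulr_gt0 //; lra.
have lB : B * l = h / 4 by rewrite /l; field; rewrite gt_eqF.
have [c [c0 c1 cx]] : exists c : R, [/\ 0 <= c, c + l <= 1 & forall z, c <= z <= c + l -> `|z - x| <= l].
  case/andP: x01 => x0 x1; have [xh|xh] := leP x 2^-1.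
    exists x; split => // [|z /andP[z1 z2]]; first lra.
    by rewrite ler_norml; apply/andP; split; lra.
  exists (x - l); split => [||z /andP[z1 z2]]; [lra|lra|].
  by rewrite ler_norml; apply/andP; split; lra.
have sub : (`[c, (c + l)%R]%classic : set R) `<=` `[0, 1]%classic.
  by move=> z; rewrite /= !in_itv /= => /andP[z1 z2]; rewrite (le_trans c0 z1) (le_trans z2 c1).
have : (\int[mu]_(z in `[c, (c + l)%R]%classic) (cst (h ^+ 2 / 2)%:E z) <=
        \int[mu]_(z in U) (psi z * psi z)%:E)%E.
  apply: (@le_trans _ _ (\int[mu]_(z in `[c, (c + l)%R]%classic) (psi z * psi z)%:E)%E); last first.
    rewrite unit_itvE; apply: ge0_subset_integral => //; first exact: mpsi2.
    by move=> z _; rewrite lee_fin -expr2 sqr_ge0.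
  apply: ge0_le_integral => //.
  - by move=> z _; rewrite lee_fin divr_ge0 // sqr_ge0.
  - exact: mpsi2.
  move=> z zc; have := sub z zc; rewrite /= in_itv /= => z01.
  move: zc; rewrite /= in_itv /= => /cx zx.
  rewrite lee_fin -expr2 -(real_normK (num_real (psi z))).
  have : h <= `|psi z| + h / 4.
    have := psi_lip x01 z01; have := ler_normD (psi x - psi z) (psi z); rewrite subrK.
    rewrite (distrC x) -/h; have : B * `|z - x| <= B * l by rewrite ler_wpM2l // ltW.
    by rewrite lB; lra.
  move=> hz; apply: (@le_trans _ _ ((3 / 4 * h) ^+ 2)).
    have h20 := sqr_ge0 h; rewrite (_ : (3 / 4 * h) ^+ 2 = 9 / 16 * h ^+ 2); last by field.
    by lra.
  by rewrite ler_pXn2r ?nnegrE ?mulr_ge0 //; lra.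
have ml : mu `[c, (c + l)%R]%classic = l%:E.
  by rewrite lebesgue_measure_itv /= lte_fin ltrDl l0 -EFinB addrAC subrr add0r.
have -> : (\int[mu]_(z in `[c, (c + l)%R]%classic) (cst (h ^+ 2 / 2)%:E z) = (h ^+ 2 / 2 * l)%:E)%E.
  rewrite integral_cst //; exact: (congr1 (fun t => (h ^+ 2 / 2)%:E * t)%E ml).
rewrite psi_norm lee_fin /l => k.
have k3 : h ^+ 3 <= 8 * B.
  move: k; rewrite (_ : h ^+ 2 / 2 * (h / (4 * B)) = h ^+ 3 / (8 * B)).
    by rewrite ler_pdivrMr ?mul1r // mulr_gt0.
  by field; rewrite gt_eqF.
by apply: le_trans k3; rewrite [leRHS]exprSr ler_peMr ?sqr_ge0 // ltW.
Qed.

End Score.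

End UnitInterval.

(** Telescoping of 1 / (k + 1) <= ln (k + 1) - ln k, which is ln (1 + x) <= x at x = - 1 / (k +
    1). *)
Lemma harmonic_le (R : realType) (N : nat) : (0 < N)%N ->
  \sum_(0 <= i < N) (N - i)%:R^-1 <= 1 + ln N%:R :> R.
Proof.
case: N => // N _; rewrite big_nat_rev /= add0n.
rewrite (eq_big_nat _ _ (F2 := fun i => i.+1%:R^-1)); last first.
  by move=> i /andP[_ iN]; rewrite subnBA ?subSS // ?addnBA // ?addKn //; lia.
elim: N => [|N ih]; first by rewrite big_nat1 invr1 ln1 addr0.
rewrite big_nat_recr //=.
have n0 : 0 < N.+1%:R :> R by rewrite ltr0n.
have n1 : 0 < N.+2%:R :> R by rewrite ltr0n.
suff h : N.+2%:R^-1 <= ln N.+2%:R - ln N.+1%:R :> R.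
  by apply: le_trans (lerD ih h) _; rewrite -addrA [ln N.+1%:R + _]addrC subrK.
rewrite -ln_div ?posrE // -[X in _ <= ln X]invrK lnV ?posrE ?invr_gt0 ?divr_gt0 // invf_div.
have -> : N.+1%:R / N.+2%:R = 1 + - N.+2%:R^-1 :> R.
  by rewrite -{1}[N.+1%:R](addrK 1) natr1 mulrBl divff ?gt_eqF // mul1r.
rewrite lerNr; apply: le_ln1Dx.
by rewrite ltrN2 invf_lt1 // ltr1n.
Qed.

(** * Covariances of the relabelled samples *)

Section TwoSampleCovariance.
Variables (R : realType) (n m : nat).
Hypotheses (n_gt0 : (0 < n)%N) (m_gt0 : (0 < m)%N) (mn : (m <= n)%N).
Local Notation I := ('I_n + 'I_m)%type.
Local Notation N := #|{: I}|.
Local Notation kap := (kap R n m).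
Local Notation cl := (@cl R n m).
Implicit Types (s : {perm I}) (al : I -> R).

Let nR : 0 < n%:R :> R. Proof. by rewrite ltr0n. Qed.
Let mR : 0 < m%:R :> R. Proof. by rewrite ltr0n. Qed.
Let NE : N%:R = n%:R + m%:R :> R. Proof. by rewrite cardI natrD. Qed.
Let NR : 0 < N%:R :> R. Proof. by rewrite NE addr_gt0. Qed.
Let k0 : 0 < kap. Proof. exact: kap_gt0. Qed.
Let k2 : kap ^+ 2 = n%:R * m%:R / (n%:R + m%:R). Proof. exact: kap2. Qed.

Definition xind s z : R := (isX (s z))%:R.
Definition avgX s al : R := n%:R^-1 * \sum_z xind s z * al z.
Definition avgY s al : R := m%:R^-1 * \sum_z (1 - xind s z) * al z.
Definition avgI al : R := N%:R^-1 * \sum_z al z.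

Lemma xind01 s z : 0 <= xind s z <= 1.
Proof. by rewrite /xind; case: (isX _); rewrite /= ?lexx ?ler01. Qed.

Lemma sum_xind s : \sum_z xind s z = n%:R.
Proof.
rewrite /xind (reindex_inj (@perm_inj _ s^-1)%g) /=.
under eq_bigr do rewrite permKV.
rewrite big_sumType /= sumr_const card_ord [X in _ + X]big1 ?addr0 //.
Qed.

Lemma sum_xindC s : \sum_z (1 - xind s z) = m%:R.
Proof. by rewrite sumrB sum_xind sumr_const NE addrAC subrr add0r. Qed.

Lemma kap_inv : kap / m%:R + kap / n%:R = kap^-1.
Proof.
have -> : kap / m%:R + kap / n%:R = kap ^+ 2 * (n%:R + m%:R) / (n%:R * m%:R) / kap.
  by field; rewrite !gt_eqF.
by rewrite k2; field; rewrite !gt_eqF // addr_gt0.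
Qed.

Lemma cl_xind s z : cl (s z) = kap / m%:R - kap^-1 * xind s z.
Proof.
rewrite /cl /xind -kap_inv; case: (s z) => i /=; last by rewrite mulr0 subr0.
by rewrite mulr1 opprD addrA subrr add0r.
Qed.

Lemma lstat_avg s al : \sum_z cl (s z) * al z = kap * (avgY s al - avgX s al).
Proof.
under eq_bigr do rewrite cl_xind.
rewrite /avgY /avgX !mulr_sumr -sumrB mulr_sumr; apply: eq_bigr => z _.
by rewrite -kap_inv; ring.
Qed.

Lemma avg_mix s al : N%:R * avgI al = n%:R * avgX s al + m%:R * avgY s al.
Proof.
rewrite /avgI /avgX /avgY ![_%:R * (_^-1 * _)]mulrA !divff ?gt_eqF // !mul1r -big_split /=.
by apply: eq_bigr => z _; ring.
Qed.

(** The pooled mean is a weighted average of the two sample means, so the deviation is the fraction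
    m / N of their difference, and that difference is the linear statistic divided by [kap]. *)
Lemma avgX_dev s al : `|avgX s al - avgI al| <= `|\sum_z cl (s z) * al z| / kap.
Proof.
have -> : avgX s al - avgI al = - (m%:R / N%:R) * (avgY s al - avgX s al).
  apply: (mulfI (x := N%:R)); first by rewrite gt_eqF.
  by rewrite mulrBr (avg_mix s) NE; field; rewrite -NE gt_eqF.
rewrite lstat_avg [`|kap * _|]normrM (ger0_norm (ltW k0)) [leRHS]mulrAC divff ?gt_eqF // mul1r normrM normrN.
rewrite ler_piMl // ger0_norm ?divr_ge0 ?ler0n // ler_pdivrMr // mul1r NE lerDr ltW //.
Qed.

Lemma avgY_dev s al : `|avgY s al - avgI al| <= `|\sum_z cl (s z) * al z| / kap.
Proof.
have -> : avgY s al - avgI al = (n%:R / N%:R) * (avgY s al - avgX s al).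
  apply: (mulfI (x := N%:R)); first by rewrite gt_eqF.
  by rewrite mulrBr (avg_mix s) NE; field; rewrite -NE gt_eqF.
rewrite lstat_avg [`|kap * _|]normrM (ger0_norm (ltW k0)) [leRHS]mulrAC divff ?gt_eqF // mul1r normrM.
rewrite ler_piMl // ger0_norm ?divr_ge0 ?ler0n // ler_pdivrMr // mul1r NE lerDl ltW //.
Qed.

Lemma dbl_sum (f g a b : I -> R) :
  \sum_z \sum_y f z * g y * ((a z - a y) * (b z - b y)) =
  (\sum_z f z * (a z * b z)) * (\sum_y g y) - (\sum_z f z * a z) * (\sum_y g y * b y)
  - (\sum_z f z * b z) * (\sum_y g y * a y) + (\sum_z f z) * (\sum_y g y * (a y * b y)).
Proof.
rewrite !big_distrlr /= -!sumrB -big_split /=; apply: eq_bigr => z _.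
by rewrite -!sumrB -big_split /=; apply: eq_bigr => y _; ring.
Qed.

(** The labels take only two values, at distance 1 / kap ([kap_inv]); the square is nonzero exactly
    when the two points lie in different samples. *)
Lemma cl_diff2 s z y :
  (cl (s z) - cl (s y)) ^+ 2 = (kap ^+ 2)^-1 * (xind s z * (1 - xind s y) + (1 - xind s z) * xind s y).
Proof.
rewrite !cl_xind (_ : _ - _ = kap^-1 * (xind s y - xind s z)); last by ring.
rewrite exprMn exprVn; congr (_ * _).
by rewrite /xind; case: (isX _); case: (isX _) => /=; ring.
Qed.

Variables (J : finType) (a : J -> I -> R).
Local Notation swapcov := (swapcov cl a).

(** Only swaps between the two samples contribute. The formula shows that the swap covariance is
    close to the pooled second moment as soon as sample means are close to pooled ones and the
    pooled means are small. *)
Lemma swapcov_avg s i j : swapcov s i j = 2^-1 *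
  (avgX s (fun z => a i z * a j z) + avgY s (fun z => a i z * a j z)
   - avgX s (a i) * avgY s (a j) - avgY s (a i) * avgX s (a j)).
Proof.
rewrite /swapcov /swapd.
have -> : \sum_z \sum_y (cl (s z) - cl (s y)) * (a i z - a i y) * ((cl (s z) - cl (s y)) * (a j z - a j y)) =
   (kap ^+ 2)^-1 * (\sum_z \sum_y xind s z * (1 - xind s y) * ((a i z - a i y) * (a j z - a j y)) +
                    \sum_z \sum_y (1 - xind s z) * xind s y * ((a i z - a i y) * (a j z - a j y))).
  rewrite -big_split mulr_sumr; apply: eq_bigr => z _ /=; rewrite -big_split mulr_sumr.
  by apply: eq_bigr => y _ /=; rewrite -mulrDl [RHS]mulrA -cl_diff2; ring.
rewrite !dbl_sum sum_xind sum_xindC /avgX /avgY NE k2.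
set A1 := \sum_z xind s z * (_ * _); set A2 := \sum_y (1 - xind s y) * (_ * _).
set B1 := \sum_z xind s z * a i z; set B2 := \sum_y (1 - xind s y) * a j y.
set D1 := \sum_z xind s z * a j z; set D2 := \sum_y (1 - xind s y) * a i y.
by field; rewrite !gt_eqF // addr_gt0.
Qed.

Let nm : m%:R <= n%:R :> R. Proof. by rewrite ler_nat. Qed.

Lemma N_kap : N%:R / kap ^+ 2 <= 4 * (n%:R / m%:R).
Proof.
rewrite k2 NE (_ : _ / _ = (n%:R + m%:R) ^+ 2 / (n%:R * m%:R)); last by field; rewrite !gt_eqF // addr_gt0.
rewrite ler_pdivrMr ?mulr_gt0 //.
rewrite (_ : 4 * (n%:R / m%:R) * (n%:R * m%:R) = (2 * n%:R) ^+ 2); last by field; rewrite gt_eqF.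
by rewrite ler_pXn2r ?nnegrE ?addr_ge0 ?mulr_ge0 ?ler0n //; move: nm; lra.
Qed.

Lemma cl_diff_le s z y : (cl (s z) - cl (s y)) ^+ 2 <= (kap ^+ 2)^-1.
Proof.
rewrite cl_diff2 ler_piMr ?invr_ge0 ?sqr_ge0 //.
by rewrite /xind; case: (isX _); case: (isX _) => /=; lra.
Qed.

(** Valid for every labelling, as [perm_stein] requires, and expressed by the pooled second moment,
    which is close to 1; the supremum of the scores does not enter. *)
Lemma swapcov_diag_le s j : swapcov s j j <= 4 * (n%:R / m%:R) * avgI (fun z => a j z ^+ 2).
Proof.
have av0 : 0 <= avgI (fun z => a j z ^+ 2).
  by rewrite mulr_ge0 ?invr_ge0 ?ler0n // sumr_ge0 // => z _; exact: sqr_ge0.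
apply: le_trans (_ : (N%:R / kap ^+ 2) * avgI (fun z => a j z ^+ 2) <= _); last first.
  by rewrite ler_wpM2r // N_kap.
rewrite /swapcov /swapd.
apply: (@le_trans _ _ ((4 * N%:R)^-1 * \sum_z \sum_y (kap ^+ 2)^-1 * (2 * a j z ^+ 2 + 2 * a j y ^+ 2))).
  rewrite ler_wpM2l ?invr_ge0 ?mulr_ge0 ?ler0n //; apply: ler_sum => z _; apply: ler_sum => y _.
  rewrite (_ : _ * _ * _ = (cl (s z) - cl (s y)) ^+ 2 * (a j z - a j y) ^+ 2); last by ring.
  apply: ler_pM; rewrite ?sqr_ge0 ?cl_diff_le //.
  by rewrite -subr_ge0 (_ : _ - _ = (a j z + a j y) ^+ 2) ?sqr_ge0 //; ring.
have -> : \sum_z \sum_y (kap ^+ 2)^-1 * (2 * a j z ^+ 2 + 2 * a j y ^+ 2) =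
   4 * N%:R / kap ^+ 2 * \sum_z a j z ^+ 2.
  transitivity ((kap ^+ 2)^-1 * \sum_z (2 * N%:R * a j z ^+ 2 + 2 * \sum_y a j y ^+ 2)).
    rewrite [RHS]mulr_sumr; apply: eq_bigr => z _; rewrite -mulr_sumr; congr (_ * _).
    rewrite big_split /= sumr_const -[X in X + _]mulr_natr -mulr_sumr; ring.
  rewrite big_split /= sumr_const -mulr_sumr -[X in _ + X]mulr_natr; ring.
by rewrite /avgI le_eqVlt; apply/orP; left; apply/eqP; field; rewrite !gt_eqF.
Qed.

Variable M : R.
Hypothesis M_ge0 : 0 <= M.
Hypothesis a_le : forall j z, `|a j z| <= M.
Hypothesis aa_le : forall i j z, `|a i z * a j z| <= M.

Lemma swapd_le s z y j : `|swapd cl a s z y j| <= 2 * M / kap.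
Proof.
rewrite /swapd normrM mulrC; apply: ler_pM => //.
  by apply: le_trans (ler_normB _ _) _; have := a_le j z; have := a_le j y; lra.
rewrite -(@ler_pXn2r _ 2) ?nnegrE ?invr_ge0 ?(ltW k0) //.
by rewrite exprVn real_normK ?num_real // cl_diff_le.
Qed.

Lemma swapcov_le s i j : `|swapcov s i j| <= 4 * (n%:R / m%:R) * M.
Proof.
apply: le_trans (_ : (N%:R / kap ^+ 2) * M <= _); last by rewrite ler_wpM2r // N_kap.
rewrite /swapcov /swapd normrM ger0_norm ?invr_ge0 ?mulr_ge0 ?ler0n //.
apply: (@le_trans _ _ ((4 * N%:R)^-1 * \sum_z \sum_y (kap ^+ 2)^-1 * (4 * M))).
  rewrite ler_wpM2l ?invr_ge0 ?mulr_ge0 ?ler0n //.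
  apply: le_trans (ler_norm_sum _ _ _) _; apply: ler_sum => z _.
  apply: le_trans (ler_norm_sum _ _ _) _; apply: ler_sum => y _.
  rewrite (_ : _ * _ * _ = (cl (s z) - cl (s y)) ^+ 2 * ((a i z - a i y) * (a j z - a j y))); last by ring.
  rewrite normrM; apply: ler_pM => //; first by rewrite ger0_norm ?sqr_ge0 // cl_diff_le.
  have sq k x x' : (a k x - a k x') ^+ 2 <= 4 * M.
    have h1 := ler_norm (a k x * a k x); have h2 := ler_norm (a k x' * a k x').
    have := aa_le k k x; have := aa_le k k x'; have := sqr_ge0 (a k x + a k x').
    by rewrite sqrrD sqrrB !expr2 !mulr2n; lra.
  have h1 := sq i z y; have h2 := sq j z y.
  rewrite ler_norml; apply/andP; split.
    by have := sqr_ge0 ((a i z - a i y) + (a j z - a j y)); rewrite sqrrD mulr2n; lra.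
  by have := sqr_ge0 ((a i z - a i y) - (a j z - a j y)); rewrite sqrrB mulr2n; lra.
rewrite !sumr_const -[X in _ * X]mulr_natr -[X in _ * (X * _)]mulr_natr le_eqVlt.
by apply/orP; left; apply/eqP; field; rewrite !gt_eqF.
Qed.

Variable tau : R.
Hypothesis tau0 : 0 < tau.
Let q : R := Num.sqrt (n%:R / m%:R).

Definition goodC s : bool := [forall i, forall j, `|\sum_z cl (s z) * (a i z * a j z)| < 16 * M * q * tau]
   && [forall j, `|\sum_z cl (s z) * a j z| < 16 * M * q * tau].

Let q2 : q ^+ 2 = n%:R / m%:R.
Proof. by rewrite sqr_sqrtr // divr_ge0 ?ler0n. Qed.

Let q_gt0 : 0 < q. Proof. by rewrite sqrtr_gt0 divr_gt0. Qed.

Lemma goodC_tail : 0 < M ->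
  fprob (predC goodC) <= (#|J|%:R ^+ 2 + #|J|%:R) * (2 * expR (- tau ^+ 2)).
Proof.
move=> M0.
have z0 : I := inl (Ordinal n_gt0).
pose pt i := nth z0 (enum {: I}) i.
have pti i j : (i < N)%N -> (j < N)%N -> pt i = pt j -> i = j.
  by move=> iN jN /eqP; rewrite nth_uniq ?enum_uniq -?cardE // => /eqP.
have tail (al : I -> R) : (forall z, `|al z| <= M) ->
    fprob (fun s : {perm I} => 16 * M * q * tau <= `|\sum_z cl (s z) * al z|) <= 2 * expR (- tau ^+ 2).
  move=> alM; have := @lstat_tail R _ cl (kap / m%:R) (sum_cl R n_gt0 m_gt0) (cl_bound R n_gt0 m_gt0 mn) pt pti al M (2 * M * q) tau alM.
  rewrite (_ : 8 * (2 * M * q) * tau = 16 * M * q * tau); last by ring.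
  apply; [by rewrite !mulr_gt0|exact: ltW|].
  by rewrite -mulrA cm2N // [leRHS]exprMn q2.
apply: (@le_trans _ _ (fprob (fun s : {perm I} => [exists ij : J * J, 16 * M * q * tau <= `|\sum_z cl (s z) * (a ij.1 z * a ij.2 z)|]) +
    fprob (fun s : {perm I} => [exists j, 16 * M * q * tau <= `|\sum_z cl (s z) * a j z|]))).
  apply: le_trans (fprobU _ _); apply: fprob_sub => s; rewrite /in_mem /= /goodC negb_and => /orP[].
    move=> /forallPn[i /forallPn[j]]; rewrite -leNgt => h; apply/orP; left.
    by apply/existsP; exists (i, j).
  move=> /forallPn[j]; rewrite -leNgt => h; apply/orP; right.
  by apply/existsP; exists j.
rewrite [leRHS]mulrDl; apply: lerD; last by apply: fprob_exists => j; exact: tail.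
rewrite expr2 -natrM -card_prod; apply: fprob_exists => ij; exact: tail.
Qed.

Let om : R := 16 * M * q * tau / kap.
Variables (b1 b2 : R).
Hypothesis mean_le : forall j, `|avgI (a j)| <= b1.
Hypothesis var_le : forall j, `|avgI (fun z => a j z ^+ 2) - 1| <= b2.

Lemma good_avg s i j : goodC s ->
  [/\ `|avgX s (fun z => a i z * a j z) - avgI (fun z => a i z * a j z)| <= om,
      `|avgY s (fun z => a i z * a j z) - avgI (fun z => a i z * a j z)| <= om,
      `|avgX s (a i)| <= om + b1 & `|avgY s (a i)| <= om + b1].
Proof.
move=> /andP[/forallP/(_ i)/forallP/(_ j) g1 /forallP/(_ i) g2].
have ki : 0 <= kap^-1 by rewrite invr_ge0 ltW.
have h1 : `|\sum_z cl (s z) * (a i z * a j z)| / kap <= om by rewrite ler_wpM2r // ltW.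
have h2 : `|\sum_z cl (s z) * a i z| / kap <= om by rewrite ler_wpM2r // ltW.
split.
- exact: le_trans (avgX_dev s (fun z => a i z * a j z)) h1.
- exact: le_trans (avgY_dev s (fun z => a i z * a j z)) h1.
- have := le_trans (avgX_dev s (a i)) h2; have := mean_le i.
  by have := ler_normD (avgX s (a i) - avgI (a i)) (avgI (a i)); rewrite subrK; lra.
- have := le_trans (avgY_dev s (a i)) h2; have := mean_le i.
  by have := ler_normD (avgY s (a i) - avgI (a i)) (avgI (a i)); rewrite subrK; lra.
Qed.

Lemma good_swapcov s i j : goodC s ->
  `|swapcov s i j - avgI (fun z => a i z * a j z)| <= om + (om + b1) ^+ 2.
Proof.
move=> g; have [x1 y1 xi yi] := good_avg i j g; have [_ _ xj yj] := good_avg j i g.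
rewrite swapcov_avg.
have p1 : `|avgX s (a i) * avgY s (a j)| <= (om + b1) ^+ 2 by rewrite normrM expr2 ler_pM.
have p2 : `|avgY s (a i) * avgX s (a j)| <= (om + b1) ^+ 2 by rewrite normrM expr2 ler_pM.
move: x1 y1 p1 p2; set X1 := avgX s (fun z => _ * _); set Y1 := avgY s (fun z => _ * _).
set S := avgI _; set Q1 := _ * avgY s _; set Q2 := _ * avgX s _; set K := _ ^+ 2.
rewrite !ler_norml => /andP[? ?] /andP[? ?] /andP[? ?] /andP[? ?].
by apply/andP; split; lra.
Qed.

(** Here [ta] are the bootstrap scores, which use empirical ranks, and [a] the scores at pooled
    ranks. In the cross terms [|a|] is bounded by (1 + a^2) / 2, so that averaging brings in second
    moments near 1 instead of the supremum of the scores. *)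
Lemma good_bootcov s (ta : J -> I -> R) rho i j : goodC s -> 0 <= rho ->
  (forall j z, `|ta j z - a j z| <= rho) ->
  `|avgX s (fun z => ta i z * ta j z) - avgI (fun z => a i z * a j z)| <= om + rho * (2 + b2 + om + rho).
Proof.
move=> g r0 tar; have [x1 _ _ _] := good_avg i j g.
have key : `|avgX s (fun z => ta i z * ta j z) - avgX s (fun z => a i z * a j z)| <= rho * (2 + b2 + om + rho).
  rewrite /avgX -mulrBr -sumrB normrM ger0_norm ?invr_ge0 ?ler0n //.
  apply: (@le_trans _ _ (n%:R^-1 * \sum_z xind s z * (rho * (1 + rho + 2^-1 * (a i z * a i z) + 2^-1 * (a j z * a j z))))).
    rewrite ler_wpM2l ?invr_ge0 ?ler0n //.
    apply: le_trans (ler_norm_sum _ _ _) _; apply: ler_sum => z _; rewrite -mulrBr normrM.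
    have /andP[x0 _] := xind01 s z; rewrite ger0_norm // ler_wpM2l //.
    rewrite (_ : _ - _ = (ta i z - a i z) * (ta j z - a j z) + (ta i z - a i z) * a j z + a i z * (ta j z - a j z)); last by ring.
    have h k : `|a k z| <= 2^-1 + 2^-1 * (a k z * a k z).
      rewrite ler_norml; apply/andP; split.
        by have := sqr_ge0 (a k z + 1); rewrite sqrrD expr2 mulr1 expr1n mulr2n; lra.
      by have := sqr_ge0 (a k z - 1); rewrite sqrrB expr2 mulr1 expr1n mulr2n; lra.
    apply: le_trans (ler_normD _ _) _.
    apply: (@le_trans _ _ (rho * rho + rho * (2^-1 + 2^-1 * (a j z * a j z)) + (2^-1 + 2^-1 * (a i z * a i z)) * rho)).
      apply: lerD; last by rewrite normrM ler_pM.
      by apply: le_trans (ler_normD _ _) _; apply: lerD; rewrite normrM ler_pM.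
    by rewrite le_eqVlt; apply/orP; left; apply/eqP; field.
  have sq k : avgX s (fun z => a k z * a k z) <= 1 + b2 + om.
    have [y1 _ _ _] := good_avg k k g; have v := var_le k.
    have e2 : avgI (fun z => a k z * a k z) = avgI (fun z => a k z ^+ 2) by [].
    move: y1 v; rewrite e2 !ler_norml => /andP[_ y] /andP[_ v]; lra.
  have := sq i; have := sq j.
  rewrite (_ : n%:R^-1 * _ = rho * (1 + rho + 2^-1 * avgX s (fun z => a i z * a i z) + 2^-1 * avgX s (fun z => a j z * a j z))).
    by move=> h1 h2; rewrite ler_wpM2l //; lra.
  rewrite /avgX (_ : \sum_z _ = rho * ((1 + rho) * (\sum_z xind s z) +
     2^-1 * (\sum_z xind s z * (a i z * a i z)) + 2^-1 * (\sum_z xind s z * (a j z * a j z)))).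
    by rewrite sum_xind; field; rewrite gt_eqF.
  by rewrite !mulr_sumr -!big_split /= mulr_sumr; apply: eq_bigr => z _ /=; ring.
have := ler_normD (avgX s (fun z => ta i z * ta j z) - avgX s (fun z => a i z * a j z))
   (avgX s (fun z => a i z * a j z) - avgI (fun z => a i z * a j z)).
by rewrite addrA subrK; lra.
Qed.

End TwoSampleCovariance.

(** * Ranks along a preorder with bounded ties *)

Section Ranks.
Variables (R : realType) (n m : nat).
Hypotheses (n_gt0 : (0 < n)%N) (m_gt0 : (0 < m)%N) (mn : (m <= n)%N).
Local Notation I := ('I_n + 'I_m)%type.
Local Notation N := #|{: I}|.
Local Notation kap := (kap R n m).
Local Notation cl := (@cl R n m).
Implicit Types (s : {perm I}).

Variables (le : rel I) (T : nat).
Hypotheses (leT_total : total le) (leT_trans : transitive le).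
Hypothesis ties : forall z, (#|[pred y | le y z && le z y]| <= T)%N.

Let z0 : I := inl (Ordinal n_gt0).
Definition pts : seq I := sort le (enum {: I}).
Definition pt (i : nat) : I := nth z0 pts i.
Definition rk (z : I) : nat := index z pts.

Lemma size_pts : size pts = N. Proof. by rewrite size_sort -cardE. Qed.

Lemma pts_uniq : uniq pts. Proof. by rewrite sort_uniq enum_uniq. Qed.

Lemma mem_pts z : z \in pts. Proof. by rewrite mem_sort mem_enum. Qed.

Lemma pt_inj i j : (i < N)%N -> (j < N)%N -> pt i = pt j -> i = j.
Proof. by move=> iN jN /eqP; rewrite nth_uniq ?pts_uniq ?size_pts // => /eqP. Qed.

Lemma rk_lt z : (rk z < N)%N. Proof. by rewrite -size_pts index_mem mem_pts. Qed.

Lemma pt_rk z : pt (rk z) = z. Proof. by rewrite /pt nth_index ?mem_pts. Qed.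

Lemma rk_pt i : (i < N)%N -> rk (pt i) = i.
Proof. by move=> iN; rewrite /rk index_uniq ?pts_uniq ?size_pts. Qed.

Lemma le_pt i j : (i <= j)%N -> (j < N)%N -> le (pt i) (pt j).
Proof.
move=> ij jN; apply: (sorted_leq_nth leT_trans) => //.
- by move=> x; have := leT_total x x; rewrite orbb.
- exact: sort_sorted.
- by rewrite inE size_pts (leq_ltn_trans ij).
- by rewrite inE size_pts.
Qed.

Definition xcdf s (z : I) : R := n%:R^-1 * \sum_y (isX (s y) && le y z)%:R.

Let nR : 0 < n%:R :> R. Proof. by rewrite ltr0n. Qed.

Lemma xcdf01 s z : 0 <= xcdf s z <= 1.
Proof.
rewrite /xcdf mulr_ge0 ?invr_ge0 ?ler0n ?sumr_ge0 //= mulrC ler_pdivrMr // mul1r.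
rewrite [leRHS](_ : _ = (cntX pt s N)%:R); last by rewrite (cntXN R n_gt0 m_gt0 pt_inj).
rewrite /cntX natr_sum.
rewrite (sum_pt pt_inj (fun z => (isX (s z))%:R)); apply: ler_sum => y _.
by rewrite ler_nat; case: (isX _); case: (le _ _).
Qed.

(** A point counted by [xcdf] but placed after position [i] in the sorted list must be tied with
    [pt i], and there are at most [T] such points. *)
Lemma xcdf_cnt s i : (i < N)%N -> `|xcdf s (pt i) - (cntX pt s i.+1)%:R / n%:R| <= T%:R / n%:R.
Proof.
move=> iN; rewrite /xcdf [_ / n%:R]mulrC -mulrBr normrM ger0_norm ?invr_ge0 ?ler0n //.
rewrite [leRHS]mulrC ler_wpM2l ?invr_ge0 ?ler0n //.
rewrite -(sum_pt pt_inj (fun y => (isX (s y) && le y (pt i))%:R)) /cntX natr_sum.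
rewrite (big_cat_nat (n := i.+1)) //=.
have -> : \sum_(0 <= k < i.+1) (isX (s (pt k)) && le (pt k) (pt i))%:R = \sum_(0 <= k < i.+1) (isX (s (pt k)))%:R :> R.
  by rewrite !big_nat; apply: eq_bigr => k /andP[_ ki]; rewrite le_pt ?andbT.
rewrite addrAC subrr add0r ger0_norm ?sumr_ge0 //.
apply: (@le_trans _ _ (\sum_(0 <= k < N) (le (pt k) (pt i) && le (pt i) (pt k))%:R)); last first.
  rewrite (sum_pt pt_inj (fun y => (le y (pt i) && le (pt i) y)%:R)).
  rewrite (_ : \sum_y _ = #|[pred y | le y (pt i) && le (pt i) y]|%:R) ?ler_nat ?ties //.
  by rewrite -sum1_card [in RHS]big_mkcond natr_sum; apply: eq_bigr => y _ /=; rewrite inE; case: ifP.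
rewrite [leRHS](big_cat_nat (n := i.+1)) //= -[leLHS]add0r lerD ?sumr_ge0 //.
rewrite !big_nat; apply: ler_sum => k /andP[ki kN]; rewrite (le_pt (ltnW ki) kN) andbT ler_nat.
by case: (isX _).
Qed.

Variable psi : R -> R.
Definition rscore (z : I) : R := psi ((rk z).+1%:R / N%:R).

Lemma sum_rscore (f : R -> R) : \sum_z f (rscore z) = \sum_(0 <= i < N) f (psi (i.+1%:R / N%:R)).
Proof.
rewrite -(sum_pt pt_inj (fun z => f (rscore z))) !big_nat; apply: eq_bigr => i /andP[_ iN].
by rewrite /rscore rk_pt.
Qed.

Lemma lrank_rscore s : lrank pt psi s = \sum_z cl (s z) * rscore z.
Proof.
rewrite -(sum_pt pt_inj (fun z => cl (s z) * rscore z)) /lrank !big_nat; apply: eq_bigr => i /andP[_ iN].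
by rewrite /rscore rk_pt.
Qed.

Lemma Yavg_sum (F : I -> R) s : Yavg pt psi F s = kap / m%:R * \sum_z (~~ isX (s z))%:R * psi (F z).
Proof. by rewrite /Yavg (sum_pt pt_inj (fun z => (~~ isX (s z))%:R * psi (F z))). Qed.

Variables (B tau : R).
Hypothesis psi_lip : forall x y : R, 0 <= x <= 1 -> 0 <= y <= 1 -> `|psi x - psi y| <= B * `|x - y|.
Hypotheses (B0 : 0 < B) (tau1 : 1 <= tau).

Lemma boot_score s z : goodP pt tau s ->
  `|psi (xcdf s z) - rscore z| <= B * (T%:R / n%:R + 16 * tau / Num.sqrt N%:R).
Proof.
move=> g; have zN := rk_lt z.
apply: (le_trans (psi_lip (xcdf01 s z) (rank_unit R n_gt0 zN))); rewrite ler_wpM2l ?(ltW B0) //.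
have := xcdf_cnt s zN; rewrite pt_rk (cntXE R n_gt0 m_gt0) => h1.
have h2 := goodP_dev n_gt0 m_gt0 g zN.
have := ler_normD (xcdf s z - Fpred R pt s (rk z).+1) (Fpred R pt s (rk z).+1 - (rk z).+1%:R / N%:R).
by rewrite addrA subrK; lra.
Qed.

End Ranks.

(** * Orderings induced by directions *)

Section Sauer.
Import fintype.
Local Notation set0 := finset.set0.
Local Open Scope set_scope.
Variable T : finType.
Implicit Types (F : {set {set T}}) (S A B : {set T}).

Definition shatters F S : bool :=
  [forall A : {set T}, (A \subset S) ==> [exists B in F, B :&: S == A]].

Lemma shattersP F S :
  reflect (forall A, A \subset S -> exists2 B, B \in F & B :&: S = A) (shatters F S).
Proof.
apply: (iffP forallP) => [h A AS|h A].
  by have := h A; rewrite AS => /existsP[B /andP[BF /eqP]]; exists B.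
apply/implyP => /h[B BF BA]; apply/existsP; exists B; by rewrite BF BA eqxx.
Qed.

(** Induction on the size of the family: an element [x] on which two members differ splits it into
    two smaller nonempty families, and neither of them shatters a set containing [x]. Sets shattered
    by both halves are counted a second time with [x] added. *)
Lemma pajor F : (#|F| <= #|[set S | shatters F S]|)%N.
Proof.
have [k] := ubnP #|F|; elim: k F => // k ih F; rewrite ltnS => Fk.
have [->|/finset.set0Pn[B0 B0F]] := eqVneq F set0; first by rewrite finset.cards0.
have [F1|] := leqP #|F| 1.
  apply: leq_trans F1 _; apply/card_gt0P; exists set0; rewrite inE; apply/shattersP => A.
  by rewrite finset.subset0 => /eqP->; exists B0 => //; rewrite finset.setI0.
move=> /card_gt1P[B1 [B2 [B1F B2F B12]]].
have [x xB] : exists x, (x \in B1) != (x \in B2).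
  apply/existsP; apply: contraNT B12 => /existsPn h; apply/eqP/setP => x.
  by have := h x; rewrite negbK => /eqP.
pose Fp := [set B in F | x \in B]; pose Fn := [set B in F | x \notin B].
have FE : (#|F| = #|Fp| + #|Fn|)%N.
  rewrite -(finset.cardsID [set B : {set T} | x \in B] F); congr (_ + _)%N; apply: eq_card => B; rewrite !inE //.
  by rewrite andbC.
have Fp0 : (0 < #|Fp|)%N.
  apply/card_gt0P; case: (boolP (x \in B1)) xB => x1; first by exists B1; rewrite inE B1F.
  by case: (boolP (x \in B2)) => // x2 _; exists B2; rewrite inE B2F.
have Fn0 : (0 < #|Fn|)%N.
  apply/card_gt0P; case: (boolP (x \in B1)) xB => x1; last by exists B1; rewrite inE B1F.
  by case: (boolP (x \in B2)) => // x2 _; exists B2; rewrite inE B2F.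
have ihp : (#|Fp| <= #|[set S | shatters Fp S]|)%N by apply: ih; apply: leq_trans Fk; rewrite FE -addn1 leq_add2l.
have ihn : (#|Fn| <= #|[set S | shatters Fn S]|)%N.
  by apply: ih; apply: leq_trans Fk; rewrite FE addnC -addn1 leq_add2l.
pose Sp : {set {set T}} := [set S | shatters Fp S]; pose Sn : {set {set T}} := [set S | shatters Fn S].
have notx (b : bool) S : shatters [set B in F | (x \in B) == b] S -> x \notin S.
  case: b => /shattersP h; apply/negP => xS.
    have [B] := h set0 (finset.sub0set S); rewrite inE => /andP[_ /eqP xb] /setP/(_ x).
    by rewrite !inE xS xb.
  have xS1 : [set x] \subset S by rewrite finset.sub1set.
  have [B] := h _ xS1; rewrite inE => /andP[_ /eqP xb] /setP/(_ x).
  by rewrite !inE xS xb eqxx.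
have FpE : Fp = [set B in F | (x \in B) == true] by apply/setP => B; rewrite !inE eqb_id.
have FnE : Fn = [set B in F | (x \in B) == false] by apply/setP => B; rewrite !inE eqbF_neg.
have mono (G : {set {set T}}) S : G \subset F -> shatters G S -> shatters F S.
  move=> GF /shattersP h; apply/shattersP => A /h[B BG BA]; exists B => //.
  exact: (subsetP GF).
have FpF : Fp \subset F by apply/subsetP => B; rewrite inE => /andP[].
have FnF : Fn \subset F by apply/subsetP => B; rewrite inE => /andP[].
rewrite FE; apply: leq_trans (leq_add ihp ihn) _; rewrite -/Sp -/Sn -finset.cardsUI.
(* A set shattered by both halves stays shattered by [F] after adding [x]: the trace on [x] is
   chosen by choosing the half. This accounts for the double counting of [Sp :&: Sn]. *)
pose Ix : {set {set T}} := [set x |: S | S in Sp :&: Sn].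
have xSp S : S \in Sp -> x \notin S by rewrite inE FpE => /notx.
have xSn S : S \in Sn -> x \notin S by rewrite inE FnE => /notx.
have cI : #|Ix| = #|Sp :&: Sn|.
  apply: card_in_imset => S S'; rewrite !inE => /andP[p1 _] /andP[p2 _] E.
  have x1 : x \notin S by apply: xSp; rewrite inE.
  have x2 : x \notin S' by apply: xSp; rewrite inE.
  by rewrite -(finset.setU1K x1) E finset.setU1K.
have dis : (Sp :|: Sn) :&: Ix = set0.
  apply/setP => S; rewrite finset.in_setI finset.in_set0; apply/negP => /andP[SU].
  move=> /imsetP[S' _ SE]; have : x \in S by rewrite SE !inE eqxx.
  by move: SU; rewrite finset.in_setU => /orP[/xSp|/xSn] /negbTE->.
rewrite -cI -finset.cardsUI dis finset.cards0 addn0.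
apply: subset_leq_card; apply/subsetP => S; rewrite finset.in_setU finset.in_setU -orbA => /or3P[| |].
- by rewrite !inE; exact: mono.
- by rewrite !inE; exact: mono.
move=> /imsetP[S' + ->]; rewrite !inE => /andP[/shattersP hp /shattersP hn].
have x1 : x \notin S' by apply: xSp; rewrite inE; apply/shattersP.
apply/shattersP => A AS; pose A' := A :\ x.
have A'S : A' \subset S' by rewrite finset.subDset.
case: (boolP (x \in A)) => xA.
  have [B] := hp _ A'S; rewrite inE => /andP[BF xB'] BA; exists B => //.
  by rewrite finset.setIUr BA (finset.setIidPr _) ?finset.sub1set // finset.setD1K.
have [B] := hn _ A'S; rewrite inE => /andP[BF xB'] BA; exists B => //.
rewrite finset.setIUr BA (_ : B :&: [set x] = set0) ?finset.set0U; last first.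
  by apply/setP => y; rewrite !inE; case: eqP => [->|]; rewrite ?andbF // andbT (negbTE xB').
apply/setP => y; rewrite !inE; case: eqP => [->|] //=; by rewrite (negbTE xA).
Qed.

(** Every such set is the image of a [k]-tuple of optional elements, and there are [#|T|.+1] options
    per entry. *)
Lemma card_small_sets k : (#|[set S : {set T} | (#|S| <= k)%N]| <= #|T|.+1 ^ k)%N.
Proof.
pose f (g : {ffun 'I_k -> option T}) : {set T} := [set x | [exists i, g i == Some x]].
have -> : (#|T|.+1 ^ k)%N = #|{ffun 'I_k -> option T}| by rewrite card_ffun card_option card_ord.
rewrite -finset.cardsT; apply: leq_trans (leq_imset_card f _).
apply: subset_leq_card; apply/subsetP => S; rewrite inE => Sk.
apply/imsetP; exists [ffun i : 'I_k => nth None (map Some (enum S)) i] => //.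
apply/setP => x; rewrite inE; apply/idP/existsP => [xS|[i]].
  have iS : (index x (enum S) < size (enum S))%N by rewrite index_mem mem_enum.
  have ik : (index x (enum S) < k)%N by apply: leq_trans iS _; rewrite -cardE.
  by exists (Ordinal ik); rewrite ffunE /= (nth_map x) // nth_index ?mem_enum.
rewrite ffunE => /eqP E; have [iS|iS] := ltnP i (size (enum S)).
  by move: E; rewrite (nth_map x) // => -[<-]; rewrite -mem_enum mem_nth.
by move: E; rewrite nth_default // size_map.
Qed.

End Sauer.

Section Directions.
Import fintype.
Variables (R : realType) (p : nat) (T : finType) (w : T -> 'I_p -> R).

(** More than [p] vectors in dimension [p] are dependent; the sign of the relation is chosen so that
    some coefficient is negative, which the closed half-spaces below require. *)
Lemma linear_dependence (S : {set T}) : (p < #|S|)%N ->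
  exists2 l : T -> R, (exists2 t, t \in S & l t < 0) & forall c, \sum_(t in S) l t * w t c = 0.
Proof.
move=> pS; pose A : 'M[R]_(#|S|, p) := \matrix_(i, c) w (enum_val i) c.
have : kermx A != 0.
  by rewrite -mxrank_eq0 mxrank_ker -lt0n subn_gt0 (leq_ltn_trans (rank_leq_col A)).
move=> /rowV0Pn[v /sub_kermxP vA v0].
have [k vk] : exists k, v 0 k != 0.
  apply/existsP; apply: contraNT v0 => /existsPn h; apply/eqP/rowP => k.
  by have := h k; rewrite negbK mxE => /eqP.
have S0 : enum_val k \in S by exact: enum_valP.
pose l (x : R) t := x * v 0 (enum_rank_in S0 t).
exists (l (if v 0 k < 0 then 1 else -1)).
  exists (enum_val k) => //; rewrite /l enum_valK_in; case: (ltP (v 0 k) 0) => h; rewrite ?mul1r //.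
  by rewrite /= mulN1r oppr_lt0 lt_neqAle eq_sym vk.
move=> c; under eq_bigr do rewrite -mulrA; rewrite -mulr_sumr.
have -> : \sum_(t in S) v 0 (enum_rank_in S0 t) * w t c = (v *m A) 0 c.
  by rewrite mxE big_enum_val /=; apply: eq_bigr => i _; rewrite enum_valK_in mxE.
by rewrite vA mxE mulr0.
Qed.

Definition nonneg_set (u : 'I_p -> R) : {set T} := [set t | 0 <= dotp u (w t)]%SET.

(** Radon's argument: a direction realizing the sign pattern of the coefficients [l] would make
    every product [l y * dotp u (w y)] nonnegative and the one at the negative coefficient positive,
    while the products sum to zero. *)
Lemma nonneg_shatter (F : {set {set T}}) (S : {set T}) :
  (forall B, B \in F -> exists u, B = nonneg_set u) -> shatters F S -> (#|S| <= p)%N.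
Proof.
move=> hF /shattersP sh; rewrite leqNgt; apply/negP => /linear_dependence[l [t tS lt0] lw].
have sA : [set y in S | 0 <= l y]%SET \subset S by apply/subsetP => y; rewrite inE => /andP[].
have [B /hF[u ->] BE] := sh _ sA.
have sgn y : y \in S -> (0 <= dotp u (w y)) = (0 <= l y).
  by move=> yS; have /setP/(_ y) := BE; rewrite !inE yS andbT.
have : 0 < \sum_(y in S) l y * dotp u (w y).
  rewrite (bigD1 t) //= ltr_pwDl //.
    by rewrite nmulr_rgt0 // ltNge sgn // -ltNge.
  apply: sumr_ge0 => y /andP[yS _]; have := sgn y yS; case: (leP 0 (l y)) => ly h.
    by rewrite mulr_ge0 // h.
  by rewrite mulr_le0 ?ltW // ltNge h.
rewrite (_ : \sum_(y in S) _ = 0) ?ltxx // /dotp.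
under eq_bigr do rewrite mulr_sumr; rewrite exchange_big /= big1 // => c _.
transitivity (u c * \sum_(y in S) l y * w y c); last by rewrite lw mulr0.
by rewrite mulr_sumr; apply: eq_bigr => y _; ring.
Qed.

(** Each realized sign pattern keeps one representative direction in [U]. With [w] the differences
    of all pairs of pooled points, sign patterns are orderings of the projections. *)
Lemma finite_directions (U : set ('I_p -> R)) : U !=set0 ->
  exists (K : nat) (dirs : 'I_K -> ('I_p -> R)),
    [/\ (0 < K)%N, (K <= #|T|.+1 ^ p)%N, forall k, U (dirs k) &
        forall u, U u -> exists k, forall t, (0 <= dotp u (w t)) = (0 <= dotp (dirs k) (w t))].
Proof.
move=> [u0 Uu0].
pose F : {set {set T}} := [set B | `[< exists2 u, U u & B = nonneg_set u >]]%SET.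
have FP B : reflect (exists2 u, U u & B = nonneg_set u) (B \in F) by rewrite inE; exact: asboolP.
have ex (k : 'I_#|F|) : {u | U u /\ enum_val k = nonneg_set u}.
  by apply: cid; have /FP[u Uu e] := enum_valP k; exists u.
exists #|F|, (fun k => projT1 (ex k)); split.
- by apply/card_gt0P; exists (nonneg_set u0); apply/FP; exists u0.
- apply: leq_trans (pajor F) _; apply: leq_trans (card_small_sets T p).
  apply: subset_leq_card; apply/subsetP => S; rewrite !inE; apply: nonneg_shatter.
  by move=> B /FP[u _ ->]; exists u.
- by move=> k; case: (ex k) => u [].
move=> u Uu; have uF : nonneg_set u \in F by apply/FP; exists u.
exists (enum_rank_in uF (nonneg_set u)) => t; case: (ex _) => v /= [_].
by rewrite enum_rankK_in // => /setP/(_ t); rewrite !inE.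
Qed.

End Directions.

(** * Measurability of order patterns *)

Section CompactProjection.
Context {d : measure_display} {T : measurableType d} {R : realType}.
Variables (p : nat) (L : finType) (f : L -> ('I_p -> R) -> T -> R) (C : T -> R).
Hypothesis f_meas : forall l u, measurable_fun setT (f l u).
Hypothesis C_ge0 : forall z, 0 <= C z.
Hypothesis f_lip : forall l z u v, (forall c, `|u c| <= 2) -> (forall c, `|v c| <= 2) ->
  `|f l u z - f l v z| <= C z * \sum_c `|u c - v c|.
Hypothesis f_box : forall u z, (forall l, 0 <= f l u z) -> forall c, `|u c| <= 1.

Let rv (q : {ffun 'I_p -> rat}) : 'I_p -> R := fun c => ratr (q c).

Let near_bound z (u v : 'I_p -> R) l (x : R) : 0 < x ->
  (forall c, `|u c| <= 2) -> (forall c, `|v c| <= 2) ->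
  (forall c, `|u c - v c| <= x / ((C z + 1) * p.+1%:R)) -> f l u z - x < f l v z.
Proof.
move=> x0 u2 v2 uv; have C0 := C_ge0 z.
have D0 : 0 < (C z + 1) * p.+1%:R by rewrite mulr_gt0 ?ltr0n // ltr_wpDl.
have := f_lip l z u2 v2.
have : C z * \sum_c `|u c - v c| < x.
  apply: (@le_lt_trans _ _ (C z * (p%:R * (x / ((C z + 1) * p.+1%:R))))).
    rewrite ler_wpM2l //; apply: le_trans (ler_sum _ (fun c _ => uv c)) _.
    by rewrite sumr_const card_ord -[X in X <= _]mulr_natl.
  rewrite (_ : _ * _ = x * ((C z * p%:R) / ((C z + 1) * p.+1%:R))); last by ring.
  rewrite gtr_pMr // ltr_pdivrMr // mul1r -natr1.
  have p0 : 0 <= p%:R :> R by rewrite ler0n.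
  by rewrite -subr_gt0 (_ : _ - _ = C z + p%:R + 1) ?ltr_wpDl ?addr_ge0 //; ring.
by rewrite ler_norml => h1 /andP[h2 h3]; lra.
Qed.

(** Compactness turns an uncountable union into countable operations: a solution exists exactly when
    rational points satisfy the closed conditions up to 1 / (k + 1) for every k. Solutions lie in
    the box of radius 1 and their rational approximations are allowed radius 2. *)
Lemma exists_closedE : [set z | exists u, forall l, 0 <= f l u z] =
  \bigcap_k \bigcup_q [set z | (forall c, `|rv q c| <= 2) /\ forall l, - k.+1%:R^-1 < f l (rv q) z].
Proof.
apply/seteqP; split => z.
  move=> [u hu] k _; have u1 := f_box hu.
  have x0 : 0 < k.+1%:R^-1 :> R by rewrite invr_gt0 ltr0n.
  have C0 := C_ge0 z.
  have D0 : 0 < (C z + 1) * p.+1%:R by rewrite mulr_gt0 ?ltr0n // ltr_wpDl.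
  pose dl := k.+1%:R^-1 / ((C z + 1) * p.+1%:R).
  have dl0 : 0 < dl by rewrite divr_gt0.
  have dl1 : dl <= 1.
    rewrite ler_pdivrMr // mul1r; apply: (@le_trans _ _ 1); first by rewrite invf_le1 ?ltr0n // ler1n.
    by rewrite -[leLHS]mulr1 ler_pM ?lerDr ?ler1n.
  have ex c : {q : rat | `|u c - ratr q| <= dl}.
    apply: cid; have /rat_in_itvoo[q] : u c - dl < u c + dl by lra.
    rewrite in_itv /= => /andP[q1 q2]; exists q; rewrite ler_norml; apply/andP; split; lra.
  exists [ffun c => projT1 (ex c)] => //=.
  have near c : `|u c - rv [ffun c => projT1 (ex c)] c| <= dl.
    by rewrite /rv ffunE; case: (ex c).
  have v2 c : `|rv [ffun c => projT1 (ex c)] c| <= 2.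
    have := near c; have := u1 c; have := ler_normB (u c) (u c - rv [ffun c => projT1 (ex c)] c).
    by rewrite opprB addrCA subrr addr0; lra.
  split=> // l; have u2 c : `|u c| <= 2 by apply: le_trans (u1 c) _; rewrite ler1n.
  by apply: le_lt_trans (near_bound l x0 u2 v2 near); rewrite lerBrDl subrr; exact: hu.
move=> hz.
have ex k : {q | (forall c, `|rv q c| <= 2) /\ forall l, - k.+1%:R^-1 < f l (rv q) z}.
  by apply: cid; have [q _ hq] := hz k I; exists q.
pose us k := rv (projT1 (ex k)).
have us2 k c : `|us k c| <= 2 by rewrite /us; case: (ex k) => q [].
have usf k l : - k.+1%:R^-1 < f l (us k) z by rewrite /us; case: (ex k) => q [].
(* The approximate solutions stay in a compact box, so Tychonoff provides a cluster point; the
   Lipschitz bound carries the inequalities over to it. *)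
pose TT := fun _ : 'I_p => (R : topologicalType).
have cpt (c : 'I_p) : compact (`[(-2 : R), 2]%classic : set (TT c)) by exact: segment_compact.
have PF : ProperFilter ((us : nat -> prod_topology TT) @ \oo) by apply: fmap_proper_filter.
have [|a [abox acl]] := tychonoff cpt PF.
  by exists 0%N => // k _ c /=; rewrite in_itv /=; have := us2 k c; rewrite ler_norml.
exists a => l.
have a2 c : `|a c| <= 2 by have := abox c; rewrite /= in_itv /= ler_norml.
rewrite -[f l a z]opprK oppr_ge0; apply/ler_addgt0Pr => x x0; rewrite add0r.
have x20 : 0 < x / 2 by lra.
have D0 : 0 < (C z + 1) * p.+1%:R by rewrite mulr_gt0 ?ltr0n // ltr_wpDl.
pose dl := x / 2 / ((C z + 1) * p.+1%:R).
have dl0 : 0 < dl by rewrite divr_gt0.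
pose K := Num.trunc (2 / x).
have KN : 2 / x < K.+1%:R by exact: truncnS_gt.
pose BB : set (prod_topology TT) := [set v | forall c, `|a c - v c| < dl].
have nB : nbhs (a : prod_topology TT) BB.
  have h c : nbhs (a : prod_topology TT) [set v | `|a c - v c| < dl].
    by apply: (@proj_continuous _ TT c a [set y | `|a c - y| < dl]); apply/nbhs_ballP; exists dl.
  exact: (@filter_forall (prod_topology TT) 'I_p (fun c => [set v | `|a c - v c| < dl]) _ (nbhs_filter _) h).
pose AA : set (prod_topology TT) := [set v | exists2 k, (K <= k)%N & v = us k].
have nA : ((us : nat -> prod_topology TT) @ \oo) AA by exists K => // k /= Kk; exists k.
have [v [[k Kk ->] vB]] := acl _ _ nA nB.
have h1 : f l (us k) z - x / 2 < f l a z.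
  by apply: (near_bound l x20 (us2 k) a2) => c; rewrite distrC ltW //; exact: vB.
have h2 : k.+1%:R^-1 < x / 2.
  rewrite -[x / 2]invrK ltf_pV2 ?posrE ?invr_gt0 ?ltr0n // invf_div.
  by apply: lt_le_trans KN _; rewrite ler_nat.
have fin (fa fu ik : R) : ik < x / 2 -> fu - x / 2 < fa -> - ik < fu -> - fa <= x by lra.
exact: fin h2 h1 (usf k l).
Qed.

Lemma measurable_exists_closed : measurable [set z | exists u, forall l, 0 <= f l u z].
Proof.
rewrite exists_closedE; apply: bigcapT_measurable => k; apply: countable_bigcupT_measurable; first exact: countableP.
move=> q.
have [h|h] := pselect (forall c, `|rv q c| <= 2); last first.
  rewrite (_ : [set _ | _] = set0) //; apply/seteqP; split => z // -[] //.
rewrite (_ : [set _ | _] = \bigcap_(l in [set: L]) [set z | - k.+1%:R^-1 < f l (rv q) z]).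
  apply: fin_bigcap_measurable; first exact: finite_finset.
  move=> l _; rewrite (_ : [set _ | _] = setT `&` (f l (rv q)) @^-1` `]- k.+1%:R^-1, +oo[%classic).
    by apply: f_meas => //; exact: measurable_itv.
  by rewrite setTI; apply/seteqP; split => y /=; rewrite in_itv /= andbT.
by apply/seteqP; split => [z [_ hz] l _|z hz]; [exact: hz|split => // l; exact: hz].
Qed.

End CompactProjection.

Section BorelVectors.
Variables (R : realType) (p : nat).

Definition boxes : set (set ('I_p -> R)) := [set B | exists a b, B = box a b].
Definition vecT := g_sigma_algebraType boxes.

Lemma measurable_coord (c : 'I_p) : measurable_fun setT (fun x : vecT => x c : R).
Proof.
apply: (measurability _ (RGenOInfty.measurableE R)) => _ [_ [a ->] <-]; rewrite setTI.
rewrite (_ : _ @^-1` _ = \bigcup_k box (fun c' => if c' == c then a else - k%:R) (fun=> k%:R)).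
  by apply: bigcupT_measurable => k; apply: sub_sigma_algebra; exists (fun c' => if c' == c then a else - k%:R), (fun=> k%:R).
apply/seteqP; split => x /=; last first.
  by move=> [k _ /(_ c)]; rewrite eqxx in_itv /= andbT => /andP[].
rewrite in_itv /= andbT => ax.
pose k := (Num.trunc (\sum_c' `|x c'|)).+1.
have kb c' : `|x c'| < k%:R.
  apply: le_lt_trans (truncnS_gt _); rewrite (bigD1 c') //= lerDl sumr_ge0 //.
exists k => // c'; have := kb c'; rewrite ltr_norml => /andP[h1 h2].
by case: eqP => [E|_]; rewrite ?h1 h2 ?andbT // E.
Qed.

Lemma measurable_vec_preimage (dO : measure_display) (Om : measurableType dO) (g : Om -> 'I_p -> R) (B : set ('I_p -> R)) :
  (forall c, measurable_fun setT (fun w => g w c)) -> borelRp B -> measurable (g @^-1` B).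
Proof.
move=> mg bB.
have mG : measurable_fun setT (g : Om -> vecT).
  apply: (@measurability _ _ Om vecT setT g boxes erefl) => _ [_ [a [b ->]] <-]; rewrite setTI.
  rewrite (_ : _ @^-1` _ = \bigcap_(c in [set: 'I_p]) ((fun w => g w c) @^-1` `]a c, b c[%classic)).
    apply: fin_bigcap_measurable; first exact: finite_finset.
    by move=> c _; rewrite -[X in measurable X]setTI; apply: mg => //; exact: measurable_itv.
  by apply/seteqP; split => w /= h c => [_|]; have := h c; rewrite /= in_itv /=; [|apply].
by rewrite -[X in measurable X]setTI; exact: mG.
Qed.

Variable I : finType.

Definition rects : set (set (I -> 'I_p -> R)) :=
  [set A | exists2 B : I -> set ('I_p -> R), (forall i, borelRp (B i)) & A = [set zz | forall i, B i (zz i)]].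
Definition arrT := g_sigma_algebraType rects.

Lemma borelT : borelRp (setT : set ('I_p -> R)).
Proof. exact: (@measurableT _ vecT). Qed.

Lemma measurable_entry i c : measurable_fun setT (fun zz : arrT => zz i c : R).
Proof.
move=> _ Y mY; rewrite setTI; apply: sub_sigma_algebra.
exists (fun j => if j == i then [set x | Y (x c)] else setT).
  move=> j; case: eqP => _; last exact: borelT.
  by have := measurable_coord c measurableT mY; rewrite setTI.
apply/seteqP; split => zz /= => [h j|/(_ i)]; last by rewrite eqxx.
by case: eqP => [->|].
Qed.

Lemma measurable_dotp (u : 'I_p -> R) i : measurable_fun setT (fun zz : arrT => dotp u (zz i)).
Proof.
apply: measurable_sum => c; apply: measurable_funM; first exact: measurable_cst.
exact: measurable_entry.
Qed.

Definition pat (u : 'I_p -> R) (zz : I -> 'I_p -> R) : {ffun I * I -> bool} :=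
  [ffun ij => dotp u (zz ij.1) <= dotp u (zz ij.2)].

Definition realized (b : {ffun I * I -> bool}) : set arrT := [set zz | exists2 u, sphere u & pat u zz = b].

(** The sphere is encoded by two opposite inequalities. A strict inequality between projections is
    the union over [q] of closed ones with gap 1 / (q + 1), so that compactness applies for each
    [q]. *)
Let con (b : {ffun I * I -> bool}) (q : nat) (l : bool + I * I) (u : 'I_p -> R) (zz : arrT) : R :=
  match l with
  | inl s => (if s then 1 else -1) * (\sum_c u c ^+ 2 - 1)
  | inr ij => if b ij then dotp u (zz ij.2) - dotp u (zz ij.1)
              else dotp u (zz ij.1) - dotp u (zz ij.2) - q.+1%:R^-1
  end.

Let realizedE b : realized b = \bigcup_q [set zz | exists u, forall l, 0 <= con b q l u zz].
Proof.
apply/seteqP; split => zz.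
  move=> [u su pb].
  pose gap ij := dotp u (zz ij.1) - dotp u (zz ij.2).
  have gap0 ij : b ij = false -> 0 < gap ij.
    by rewrite -pb ffunE => /negbT; rewrite -ltNge subr_gt0.
  exists (Num.trunc (\sum_(ij : I * I) `|gap ij|^-1)) => //; exists u; case => [s|ij] /=.
    by rewrite su subrr mulr0.
  have : pat u zz ij = b ij by rewrite pb.
  rewrite ffunE; case E : (b ij) => h; first by rewrite subr_ge0.
  rewrite subr_ge0 -/(gap ij) -[gap ij]invrK lef_pV2 ?posrE ?invr_gt0 ?ltr0n ?gap0 //.
  apply/ltW/(le_lt_trans _ (truncnS_gt _)).
  rewrite (bigD1 ij) //= (gtr0_norm (gap0 _ E)) lerDl sumr_ge0 // => k _.
move=> [q _ [u hu]]; exists u.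
  have := hu (inl true); have := hu (inl false); rewrite /= mul1r mulN1r oppr_ge0 => h1 h2.
  by apply/eqP; rewrite -subr_eq0 eq_le h1.
apply/ffunP => ij; have := hu (inr ij); rewrite ffunE /=; case: (b ij); first by rewrite subr_ge0.
have : 0 < q.+1%:R^-1 :> R by rewrite invr_gt0 ltr0n.
by move=> h1; rewrite subr_ge0 => h2; apply/negbTE; rewrite -ltNge -subr_gt0 (lt_le_trans h1 h2).
Qed.

Lemma measurable_realized b : measurable (realized b).
Proof.
rewrite realizedE; apply: bigcupT_measurable => q.
pose C (zz : arrT) : R := 4 + \sum_i \sum_j \sum_c `|zz i c - zz j c|.
have dB (u : 'I_p -> R) x y : dotp u x - dotp u y = \sum_c u c * (x c - y c).
  by rewrite /dotp -sumrB; apply: eq_bigr => c _; rewrite mulrBr.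
have S0 (zz : arrT) : 0 <= \sum_i \sum_j \sum_c `|zz i c - zz j c|.
  by apply: sumr_ge0 => i _; apply: sumr_ge0 => j _; apply: sumr_ge0.
have pairle (zz : arrT) i j c : `|zz i c - zz j c| <= C zz.
  rewrite /C (bigD1 i) //= (bigD1 j) //= (bigD1 c) //=.
  set x := `|_|; set y := \sum_(_ | _ != c) _; set z := \sum_(_ | _ != j) _; set w := \sum_(_ | _ != i) _.
  have y0 : 0 <= y by apply: sumr_ge0.
  have z0 : 0 <= z by apply: sumr_ge0 => k _; apply: sumr_ge0.
  have w0 : 0 <= w by apply: sumr_ge0 => k _; apply: sumr_ge0 => k' _; apply: sumr_ge0.
  lra.
have lin (zz : arrT) i j (u v : 'I_p -> R) :
   `|(dotp u (zz i) - dotp u (zz j)) - (dotp v (zz i) - dotp v (zz j))| <= C zz * \sum_c `|u c - v c|.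
  rewrite !dB -sumrB; apply: le_trans (ler_norm_sum _ _ _) _; rewrite mulr_sumr; apply: ler_sum => c _.
  by rewrite -mulrBl normrM mulrC ler_wpM2r.
apply: (@measurable_exists_closed _ _ _ p _ (con b q) C).
- move=> [s|ij] u; first exact: measurable_cst.
  rewrite /con; case: (b ij) => /=; first by apply: measurable_funB; exact: measurable_dotp.
  apply: measurable_funB; last exact: measurable_cst.
  by apply: measurable_funB; exact: measurable_dotp.
- by move=> zz; rewrite addr_ge0.
- move=> [s|ij] zz u v u2 v2 /=.
    rewrite -mulrBr normrM (_ : `|if s then 1 else -1| = 1) ?mul1r; last by case: s; rewrite ?normrN normr1.
    rewrite opprB addrA subrK -sumrB; apply: le_trans (ler_norm_sum _ _ _) _; rewrite mulr_sumr.
    apply: ler_sum => c _; rewrite subr_sqr mulrC normrM mulrC [leRHS]mulrC mulrC.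
    rewrite [leRHS]mulrC ler_wpM2r //; apply: (@le_trans _ _ 4); last by rewrite lerDl.
    apply: le_trans (ler_normD _ _) _; have := u2 c; have := v2 c; lra.
  case: (b ij); first exact: lin.
  rewrite opprB addrA subrK; exact: lin.
- move=> u zz hu c; have := hu (inl true); have := hu (inl false).
  rewrite /= mul1r mulN1r oppr_ge0 => h1 h2.
  have : u c ^+ 2 <= 1.
    apply: (@le_trans _ _ (\sum_c u c ^+ 2)); last by lra.
    by rewrite (bigD1 c) //= lerDl sumr_ge0 // => k _; exact: sqr_ge0.
  by rewrite -[X in _ <= X](expr1n _ 2) -real_normK ?num_real // ler_pXn2r ?nnegrE.
Qed.

(** There are finitely many patterns, so such an event is a finite Boolean combination of the sets
    [realized b]. Measurability of the rejection event follows without any statement about the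
    supremum or the critical value. *)
Lemma measurable_pattern_event (Q : (I -> 'I_p -> R) -> Prop) :
  (forall zz zz', (forall b, realized b zz <-> realized b zz') -> Q zz -> Q zz') ->
  measurable ([set zz | Q zz] : set arrT).
Proof.
move=> Qp.
pose ok (S : {set {ffun I * I -> bool}}) := exists2 zz, Q zz & forall b, realized b zz <-> b \in S.
rewrite (_ : [set zz | Q zz] = \bigcup_(S in [set S | ok S])
   \bigcap_(b in [set: {ffun I * I -> bool}]) [set zz | realized b zz <-> b \in S]).
  apply: fin_bigcup_measurable; first exact: finite_finset.
  move=> S _; apply: fin_bigcap_measurable; first exact: finite_finset.
  move=> b _; case bS : (b \in S).
    rewrite (_ : [set _ | _] = realized b); first exact: measurable_realized.
    by apply/seteqP; split => zz /= => [[_ h]|h]; [exact: h|split].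
  rewrite (_ : [set _ | _] = ~` realized b); first by apply: measurableC; exact: measurable_realized.
  by apply/seteqP; split => zz /= h; [move=> /h|split].
apply/seteqP; split => zz /=.
  move=> Qz; exists [set b | `[< realized b zz >]]%SET.
    by exists zz => // b; rewrite inE; split => [/asboolP|/asboolP].
  by move=> b _ /=; rewrite inE; split => [/asboolP|/asboolP].
move=> [S [zz' Qz' h'] h]; apply: Qp Qz' => b; have := h b Logic.I; have := h' b => /=; tauto.
Qed.

End BorelVectors.

(** * General position *)

Section HyperplaneNull.
Variables (R : realType) (p : nat).
Implicit Types (a x : 'I_p -> R).

Lemma sum_indicator_lt (K M : nat) (v : R) : 0 <= v -> \sum_(k < K) (if (k < M)%N then v else 0) <= M%:R * v.
Proof.
move=> v0; suff -> : \sum_(k < K) (if (k < M)%N then v else 0) = (minn K M)%:R * v.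
  by rewrite ler_wpM2r // ler_nat geq_minr.
elim: K => [|K ih]; first by rewrite big_ord0 min0n mul0r.
rewrite big_ord_recr /= ih; case: ltnP => KM.
  by rewrite (minn_idPl KM) -natr1 mulrDl mul1r.
by rewrite (minn_idPr (leqW KM)) addr0.
Qed.

(** The coordinates other than [r] are cut into q^(p-1) cubes of side [h], and over each cube
    coordinate [r] is determined up to a multiple of [h]. The boxes have volume of order q^(-p), so
    the total is of order 1 / q. *)
Lemma hyperplane_null a (t rad : R) r : a r != 0 -> 0 < rad ->
  lebesgue_null [set x | (forall c, `|x c| < rad) /\ \sum_c a c * x c = t].
Proof.
move=> ar rad0 eps eps0.
pose A := \sum_c `|a c|; have A0 : 0 <= A by apply: sumr_ge0.
have ar0 : 0 < `|a r| by rewrite normr_gt0.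
(* Over a cube of side [h] the solved coordinate varies by less than [A / |a r| * h + h]; the
   additional 1 provides the strict inequality that open boxes require. *)
pose cs := A / `|a r| + 1; have cs0 : 0 < cs by rewrite ltr_wpDl // divr_ge0.
pose V := (4 * rad) ^+ p * cs.
pose q := (Num.trunc (V / eps)).+1.
have qV : V / eps < q%:R by exact: truncnS_gt.
have q0 : 0 < q%:R :> R by rewrite ltr0n.
pose h : R := 2 * rad / q%:R; have h0 : 0 < h by rewrite divr_gt0 // mulr_gt0.
pose T' := {c : 'I_p | c != r}.
pose F := {ffun T' -> 'I_q}.
have cF : #|{: F}| = (q ^ p.-1)%N by rewrite card_ffun card_ord card_sig cardC1 card_ord.
pose fv (f : F) (c : 'I_p) : nat := if insub c is Some c' then f c' : nat else 0%N.
pose y f c : R := - rad + (fv f c)%:R * h.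
pose w f : R := (t - \sum_(c | c != r) a c * y f c) / a r.
pose lo f c : R := if c == r then w f - cs * h else y f c - h.
pose hi f c : R := if c == r then w f + cs * h else y f c + h.
pose f0 : F := [ffun=> ord0].
pose fk k := nth f0 (enum {: F}) k.
(* The finite cover is padded with degenerate boxes of volume 0 so as to be indexed by all natural
   numbers. *)
exists (fun k => if (k < #|{: F}|)%N then lo (fk k) else (fun=> 0)).
exists (fun k => if (k < #|{: F}|)%N then hi (fk k) else (fun=> 0)); split.
  move=> x [xr xt].
  have tr (c : 'I_p) : (Num.trunc ((x c + rad) / h) < q)%N.
    have := xr c; rewrite ltr_norml => /andP[x1 x2].
    have s0 : 0 <= (x c + rad) / h by rewrite divr_ge0 ?(ltW h0) //; lra.
    rewrite -(ltr_nat R); apply: le_lt_trans (_ : (x c + rad) / h < _); first by rewrite truncn_le.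
    rewrite ltr_pdivrMr // /h mulrCA divff ?gt_eqF // mulr1; lra.
  pose f : F := [ffun c' : T' => Ordinal (tr (val c'))].
  have fy c : c != r -> y f c <= x c < y f c + h.
    move=> cr; rewrite /y /fv insubT ffunE /=.
    have := xr c; rewrite ltr_norml => /andP[x1 x2].
    have s0 : 0 <= (x c + rad) / h by rewrite divr_ge0 ?(ltW h0) //; lra.
    have := truncn_itv s0; set k := Num.trunc _ => /andP[k1 k2].
    have e1 : k%:R * h <= x c + rad by rewrite -ler_pdivlMr.
    have e2 : x c + rad < k%:R * h + h.
      have -> : k%:R * h + h = k.+1%:R * h by rewrite -natr1 mulrDl mul1r.
      by rewrite -ltr_pdivrMr.
    by apply/andP; split; lra.
  have wx : `|x r - w f| < cs * h.
    have -> : x r - w f = (\sum_(c | c != r) a c * (y f c - x c)) / a r.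
      have -> : x r = (t - \sum_(c | c != r) a c * x c) / a r.
        by rewrite -xt (bigD1 r) //= addrK mulrAC divff // mul1r.
      rewrite /w -mulrBl opprB addrCA addrA; congr (_ / _).
      rewrite [RHS](eq_bigr (fun c => a c * y f c - a c * x c)); last by move=> c _; rewrite mulrBr.
      by rewrite sumrB; ring.
    rewrite normrM normfV ltr_pdivrMr //.
    apply: (@le_lt_trans _ _ (A * h)).
      apply: le_trans (ler_norm_sum _ _ _) _; rewrite /A [X in _ <= X * h](bigD1 r) //= mulrDl.
      apply: (@le_trans _ _ ((\sum_(c | c != r) `|a c|) * h)); last by rewrite lerDr mulr_ge0 // ltW.
      rewrite mulr_suml; apply: ler_sum => c cr.
      rewrite normrM ler_wpM2l // ler_norml; have /andP[? ?] := fy c cr.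
      by apply/andP; split; lra.
    rewrite mulrAC ltr_pM2r // /cs mulrDl divfK ?gt_eqF // mul1r ltrDl //.
  exists (index f (enum {: F})) => //=.
  have iF : (index f (enum {: F}) < #|{: F}|)%N by rewrite cardE index_mem mem_enum.
  rewrite iF /fk nth_index ?mem_enum // => c; rewrite /lo /hi; case: eqP => [->|/eqP cr].
    by move: wx; rewrite ltr_norml => /andP[? ?]; apply/andP; split; lra.
  by have /andP[? ?] := fy c cr; apply/andP; split; lra.
move=> K; pose v := (2 * h) ^+ p * cs.
have v0 : 0 <= v by rewrite mulr_ge0 ?(ltW cs0) // exprn_ge0 // mulr_ge0 // ltW.
apply: (@le_trans _ _ (\sum_(k < K) (if (k < #|{: F}|)%N then v else 0))).
  apply: ler_sum => k _; case: ltnP => _; last by rewrite (bigD1 r) //= subrr normr0 mul0r.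
  rewrite (bigD1 r) //= /lo /hi eqxx.
  rewrite (eq_bigr (fun=> 2 * h)); last first.
    move=> c /negbTE -> /=; have -> : y (fk k) c + h - (y (fk k) c - h) = 2 * h.
      by move: (y (fk k) c) => yy; ring.
    by rewrite ger0_norm // mulr_ge0 // ltW.
  rewrite prodr_const cardC1 card_ord (_ : _ - _ = 2 * h * cs); last by ring.
  have p0 : (0 < p)%N by apply: leq_trans (ltn_ord r).
  rewrite ger0_norm; last by rewrite mulr_ge0 ?(ltW cs0) // mulr_ge0 // ltW.
  by rewrite /v -[in X in _ <= X](prednK p0) exprS le_eqVlt; apply/orP; left; apply/eqP; ring.
apply: le_trans (sum_indicator_lt _ _ v0) _.
have p0 : (0 < p)%N by apply: leq_trans (ltn_ord r).
have E : #|{: F}|%:R * v = V / q%:R.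
  rewrite cF natrX /v /V /h -{2 3}(prednK p0) !exprS.
  have -> : (2 * (2 * rad / q%:R)) ^+ p.-1 = (4 * rad) ^+ p.-1 / q%:R ^+ p.-1.
    by rewrite -exprVn -exprMn; congr (_ ^+ _); field; rewrite gt_eqF.
  by field; rewrite !gt_eqF ?exprn_gt0.
rewrite E ler_pdivrMr // mulrC -ler_pdivrMr // ltW //.
Qed.

Lemma borel_hyperplane a (t rad : R) :
  borelRp [set x | (forall c, `|x c| < rad) /\ \sum_c a c * x c = t].
Proof.
have mc (c : 'I_p) : measurable_fun setT (fun x : vecT R p => x c) := measurable_coord c.
have ms : measurable_fun setT (fun x : vecT R p => \sum_c a c * x c).
  by apply: measurable_sum => c; apply: measurable_funM => //; exact: measurable_cst.
have m1 : measurable ((fun x : vecT R p => \sum_c a c * x c) @^-1` [set t]).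
  by rewrite -[X in measurable X]setTI; apply: ms => //; exact: measurable_set1.
have m2 (c : 'I_p) : measurable ((fun x : vecT R p => x c) @^-1` `]- rad, rad[%classic).
  by rewrite -[X in measurable X]setTI; apply: mc => //; exact: measurable_itv.
have mI : measurable (\bigcap_(c in [set: 'I_p]) (fun x : vecT R p => x c) @^-1` `]- rad, rad[%classic `&`
     (fun x : vecT R p => \sum_c a c * x c) @^-1` [set t]).
  by apply: measurableI => //; apply: fin_bigcap_measurable => //; exact: finite_finset.
suff -> : [set x | (forall c, `|x c| < rad) /\ \sum_c a c * x c = t] =
    \bigcap_(c in [set: 'I_p]) (fun x : vecT R p => x c) @^-1` `]- rad, rad[%classic `&`
     (fun x : vecT R p => \sum_c a c * x c) @^-1` [set t] by exact: mI.
apply/seteqP; split => x /=.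
  by move=> [h1 h2]; split => // c _; rewrite /= in_itv /= -ltr_norml.
by move=> [h1 h2]; split => // c; have := h1 c I; rewrite /= in_itv /= -ltr_norml.
Qed.

End HyperplaneNull.

Section GeneralPosition.
Context {dO : measure_display} {Omega : measurableType dO} {R : realType}.
Variable P : probability Omega R.
Variables (p' : nat) (I : finType).
Local Notation p := p'.+1.
Variable Z : I -> Omega -> ('I_p -> R).
Hypothesis Z_meas : forall i c, measurable_fun setT (fun w => Z i w c).
Hypothesis Z_indep : mutually_independent P (fun i => events_vec (Z i)).
Hypothesis Z_ac : forall i B, borelRp B -> lebesgue_null B -> P (Z i @^-1` B) = 0%E.

Let S i := events_vec (Z i).

Lemma S_meas i : S i `<=` measurable.
Proof. by move=> _ [B bB <-]; apply: measurable_vec_preimage => //; exact: Z_meas. Qed.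

Lemma S_setI i : setI_closed (S i).
Proof.
move=> _ _ [A bA <-] [B bB <-]; exists (A `&` B); last by rewrite preimage_setI.
exact: (@measurableI _ (vecT R p)).
Qed.

Lemma S_setT i : S i setT.
Proof. by exists setT; [exact: borelT|rewrite preimage_setT]. Qed.

Lemma hyperplane_prob0 i (a : 'I_p -> R) t r : a r != 0 -> P (Z i @^-1` [set x | \sum_c a c * x c = t]) = 0%E.
Proof.
move=> ar.
pose F (k : nat) := Z i @^-1` [set x | (forall c, `|x c| < k.+1%:R) /\ \sum_c a c * x c = t].
have F0 k : P (F k) = 0%E.
  apply: Z_ac; first exact: borel_hyperplane.
  by apply: (@hyperplane_null _ _ a t k.+1%:R r); rewrite // ltr0n.
have mF k : measurable (F k).
  by apply: measurable_vec_preimage; [exact: Z_meas|exact: borel_hyperplane].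
have UF : Z i @^-1` [set x | \sum_c a c * x c = t] = \bigcup_k F k.
  apply/seteqP; split => w; last by move=> [k _ [_ h]].
  move=> /= h; exists (Num.trunc (\sum_c `|Z i w c|)) => //; split => // c.
  by apply: le_lt_trans (truncnS_gt _); rewrite (bigD1 c) //= lerDl sumr_ge0.
rewrite UF; apply/eqP; rewrite eq_le measure_ge0 andbT.
have h : (P (\bigcup_k F k) <= \sum_(0 <= k <oo) P (F k))%E.
  by apply: measure_sigma_subadditive => //; exact: bigcupT_measurable.
apply: le_trans h _.
by rewrite eseries0 // => k _ _; exact: F0.
Qed.

Lemma measurable_det (d : measure_display) (T : measurableType d) (n : nat) (A : T -> 'M[R]_n) :
  (forall i j, measurable_fun setT (fun t => A t i j)) -> measurable_fun setT (fun t => \det (A t)).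
Proof.
move=> mA; rewrite /determinant; apply: measurable_sum => s.
by apply: measurable_funM; [exact: measurable_cst|apply: measurable_prod => i _; exact: mA].
Qed.

Variable io : 'I_p.+1 -> I.
Hypothesis io_inj : injective io.

(** Natural-number indices, converted by [inord], allow the leading minors of all sizes to be
    treated by one induction. *)
Definition dif (i c : nat) (w : Omega) : R :=
  Z (io (inord i.+1)) w (inord c) - Z (io ord0) w (inord c).
Definition difM (r : nat) (w : Omega) : 'M[R]_r := \matrix_(i < r, c < r) dif i c w.

Lemma measurable_dif i c : measurable_fun setT (dif i c).
Proof. by apply: measurable_funB; exact: Z_meas. Qed.

Lemma measurable_minor r : measurable [set w | \det (difM r w) = 0].
Proof.
have := @measurable_det _ Omega r (difM r).
have mE i j : measurable_fun setT (fun w => difM r w i j).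
  by rewrite (_ : (fun w => _) = dif i j) ?measurable_dif //; [exact: measurable_dif|apply/funext => w; rewrite mxE].
move=> /(_ mE) mD; rewrite (_ : [set _ | _] = setT `&` (fun w => \det (difM r w)) @^-1` [set 0]).
  by apply: mD => //; exact: measurable_set1.
by rewrite setTI.
Qed.

(** Expanding the minor along its last row makes it an affine function of one new point, whose last
    coefficient is the previous minor. By induction that minor is almost surely nonzero; the new
    point is independent of the others and falls on the resulting hyperplane with probability
    zero. *)
Lemma minor_prob0 r : (r <= p)%N -> P [set w | \det (difM r w) = 0] = 0%E.
Proof.
elim: r => [|r ih] rp.
  rewrite (_ : [set _ | _] = set0) ?measure0 //; apply/seteqP; split => w //=.
  by rewrite det_mx00 => /eqP; rewrite oner_eq0.
have {}ih := ih (ltnW rp).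
pose i0 := io (inord r.+1).
have neq (i : nat) : (i < r)%N -> io (inord i.+1) != i0.
  move=> ir; apply/eqP => /io_inj /(congr1 (@nat_of_ord _)); rewrite !inordK; lia.
have neq0 : io ord0 != i0.
  apply/eqP => /io_inj /(congr1 (@nat_of_ord _)); rewrite inordK /=; lia.
pose W := restOmega S i0.
have mW j c : j != i0 -> measurable_fun setT (fun w : W => Z j w c).
  move=> ji _ Y mY; rewrite setTI; apply: sub_sigma_algebra; exists j => //.
  exists [set x | Y (x c)] => //; have := measurable_coord c measurableT mY; by rewrite setTI.
pose cf (c : 'I_r.+1) (w : Omega) : R := cofactor (difM r.+1 w) ord_max c.
have mcf c : measurable_fun setT (cf c : W -> R).
  apply: measurable_funM; first exact: measurable_cst.
  apply: (@measurable_det _ W) => i j.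
  rewrite (_ : (fun w => _) = (fun w : W => dif i (lift c j) w)); last first.
    by apply/funext => w; rewrite !mxE lift_max.
  by apply: measurable_funB; apply: mW => //; exact: neq.
have mD : measurable_fun setT (fun w : W => \det (difM r w)).
  apply: (@measurable_det _ W) => i j.
  rewrite (_ : (fun w => _) = (fun w : W => dif i j w)); last by apply/funext => w; rewrite !mxE.
  by apply: measurable_funB; apply: mW => //; exact: neq.
have cfmax w : cf ord_max w = \det (difM r w).
  rewrite /cf /cofactor -signr_odd addnn odd_double expr0 mul1r; congr (\det _).
  by apply/matrixP => i j; rewrite !mxE !lift_max.
(* The cofactors of the last row, extended by 0, involve only points other than [i0] and are
   therefore measurable for the rest. *)
pose ac (c : 'I_p) w : R := if (c < r.+1)%N then cf (inord c) w else 0.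
pose lin (x : 'I_p -> R) w := \sum_c ac c w * (x c - Z (io ord0) w c).
have detE w : \det (difM r.+1 w) = lin (Z i0 w) w.
  rewrite (expand_det_row _ ord_max) /lin (eq_bigr (fun c : 'I_p => if (c < r.+1)%N then
      cf (inord c) w * (Z i0 w c - Z (io ord0) w c) else 0)); last first.
    by move=> c _; rewrite /ac; case: ifP => _; rewrite ?mul0r.
  rewrite -big_mkcond /= (big_ord_narrow rp) /=; apply: eq_bigr => c _.
  have cE : inord c = widen_ord rp c :> 'I_p by apply: val_inj; rewrite /= inordK // (leq_trans (ltn_ord c)).
  by rewrite mxE /dif -/i0 cE inord_val mulrC.
(* The bad event for the pair formed by the point [i0] and the rest: each section over a fixed rest
   is empty or a hyperplane, so Fubini gives probability 0. *)
pose C : set (vecT R p * W) := [set q | lin q.1 q.2 = 0] `&` [set q | \det (difM r q.2) != 0].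
have mC : measurable C.
  apply: measurableI.
    have ml : measurable_fun setT (fun q : vecT R p * W => lin q.1 q.2).
      apply: measurable_sum => c; apply: measurable_funM.
        apply: (@measurableT_comp _ _ _ _ _ _ (ac c : W -> R) _ snd) => //.
        by rewrite /ac; case: (c < r.+1)%N; [exact: mcf|exact: measurable_cst].
      apply: measurable_funB.
        by apply: (@measurableT_comp _ _ _ _ _ _ (fun x : vecT R p => x c) _ fst) => //; exact: measurable_coord.
      by apply: (@measurableT_comp _ _ _ _ _ _ (fun w : W => Z (io ord0) w c) _ snd) => //; exact: mW.
    rewrite (_ : [set _ | _] = setT `&` (fun q : vecT R p * W => lin q.1 q.2) @^-1` [set 0]).
      by apply: ml => //; exact: measurable_set1.
    by rewrite setTI.
  have md : measurable_fun setT (fun q : vecT R p * W => \det (difM r q.2)).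
    exact: (@measurableT_comp _ _ _ _ _ _ (fun w : W => \det (difM r w)) _ snd).
  rewrite (_ : [set _ | _] = setT `&` (fun q : vecT R p * W => \det (difM r q.2)) @^-1` (~` [set 0])).
    by apply: md => //; apply: measurableC; exact: measurable_set1.
  by rewrite setTI; apply/seteqP; split => q /= /eqP.
have Zm : measurable_fun setT (Z i0 : Omega -> vecT R p).
  by move=> _ B mB; rewrite setTI; apply: measurable_vec_preimage => //; exact: Z_meas.
have ZS (A : set (vecT R p)) : measurable A -> S i0 (Z i0 @^-1` A) by move=> mA; exists A.
have PC := @indep_product _ _ _ P I S S_meas S_setI S_setT Z_indep i0 _ (vecT R p) (Z i0) Zm ZS C mC.
have C0 : P (Urest S i0 (Z i0 : Omega -> vecT R p) @^-1` C) = 0%E.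
  rewrite PC.
  have -> : ((lawU P Zm \x lawRest P S_meas i0) C = \int[lawU P Zm]_x fubini_F (lawRest P S_meas i0) (EFin \o \1_C) x)%E.
    by rewrite indic_fubini_tonelli_FE.
  rewrite indic_fubini_tonelli // indic_fubini_tonelli_GE //.
  apply: integral0_eq => w _ /=.
  have [D0|D0] := eqVneq (\det (difM r w)) 0.
    rewrite (_ : ysection C w = set0) ?measure0 //; apply/seteqP; split => x //.
    by rewrite /ysection /= inE => -[_ /=]; rewrite D0 eqxx.
  pose t := \sum_c ac c w * Z (io ord0) w c.
  have acr : ac (Ordinal rp) w != 0.
    rewrite /ac /= ltnSn (_ : inord r = ord_max) ?cfmax //.
    by apply: val_inj; rewrite /= inordK.
  have -> : ysection C w = [set x | \sum_c ac c w * x c = t].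
    apply/seteqP; split => x; rewrite /ysection /= inE.
      move=> [/= l0 _]; apply/eqP; rewrite -subr_eq0 -sumrB -[X in _ == X]l0; apply/eqP/eq_bigr => c _.
      by rewrite mulrBr.
    move=> xt; split => //=; rewrite /lin; under eq_bigr do rewrite mulrBr.
    by rewrite sumrB xt subrr.
  by rewrite /lawU /distribution /pushforward /=; exact: (hyperplane_prob0 i0 t acr).
apply/eqP; rewrite eq_le measure_ge0 andbT.
have mU : measurable (Urest S i0 (Z i0 : Omega -> vecT R p) @^-1` C).
  have mUr : measurable_fun setT (Urest S i0 (Z i0 : Omega -> vecT R p)) by apply: Urest_meas => //; exact: S_meas.
  by rewrite -[X in measurable X]setTI; apply: mUr.
apply: (@le_trans _ _ (P ([set w | \det (difM r w) = 0] `|` Urest S i0 (Z i0 : Omega -> vecT R p) @^-1` C))).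
  apply: le_measure; rewrite ?inE; [exact: measurable_minor|apply: measurableU => //; exact: measurable_minor|].
  move=> w /= dr; have [D0|D0] := eqVneq (\det (difM r w)) 0; [by left|right].
  by split => //=; rewrite -detE.
have h : (P ([set w | (\det (difM r w) = 0)%R] `|` Urest S i0 (Z i0 : Omega -> vecT R p) @^-1` C) <=
    P [set w | (\det (difM r w) = 0)%R] + P (Urest S i0 (Z i0 : Omega -> vecT R p) @^-1` C))%E.
  by apply: measureU2 => //; exact: measurable_minor.
by apply: le_trans h _; rewrite ih C0 adde0.
Qed.

End GeneralPosition.

(** * Calibration for a fixed pooled sample *)

Section Calibration.
Variables (R : realType) (S : finType) (T : S -> R) (K : S -> R -> R) (good rej : pred S).
Variables (eps nu al : R).
Hypothesis S_gt0 : (0 < #|S|)%N.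
Hypothesis eps_ge0 : 0 <= eps.
Hypothesis al01 : 0 < al < 1.
Local Notation H t := (fprob (fun s' => t <= T s') : R).
Local Notation Hs t := (fprob (fun s' => t < T s') : R).
Hypothesis K_H : forall s, good s -> forall t, `|K s t - H t| <= eps.
Hypothesis K_Hs : forall s, good s -> forall t, `|K s t - Hs t| <= eps.
Hypothesis good_nu : fprob (predC good) <= nu.
Hypothesis rej_of : forall s, good s -> K s (T s) <= al -> rej s.
Hypothesis of_rej : forall s, good s -> rej s -> forall t, T s < t -> K s t <= al.

Lemma fprob_le1 (A : pred S) : fprob A <= 1 :> R.
Proof.
rewrite -(@fmean_cst R S 1 S_gt0).
by apply: ler_fmean => s; case: (A s).
Qed.

Lemma fprob_le_good (A B : pred S) : (forall s, good s -> A s -> B s) -> fprob A <= fprob B + nu.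
Proof.
move=> h; apply: le_trans (_ : fprob (predU B (predC good)) <= _).
  apply: fprob_sub => s; rewrite /in_mem /= => As; case: (boolP (good s)) => g; last by rewrite orbT.
  by rewrite (h s).
by apply: le_trans (fprobU _ _) _; rewrite lerD2l.
Qed.

(** On [good] all functions [K s] are close to the same tail, so rejection lies between the events
    [H (T s) <= al - eps] and [Hs (T s) <= al + eps], up to [nu]. The probabilities of these events
    are read off at an extremal value of [T], which exists because [S] is finite. *)
Lemma calibration : `|fprob rej - al| <= 3 * eps + nu.
Proof.
case/andP: al01 => al0 al1; have e0 := eps_ge0.
have [g0|nog] := pickP good; last first.
  have nu1 : 1 <= nu.
    apply: le_trans good_nu; rewrite -(@fmean_cst R S 1 S_gt0); apply: ler_fmean => s.
    by rewrite /= nog.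
  have h0 : 0 <= fprob rej :> R := fprob_ge0 _; have h1 := fprob_le1 rej.
  by rewrite ler_norml; apply/andP; split; lra.
move=> gg0.
(* A single [K s] is close to both the strict and the non-strict tail, hence no value of [T] carries
   more than [2 * eps]. *)
have atom t : H t <= Hs t + 2 * eps.
  have := K_H gg0 t; have := K_Hs gg0 t; rewrite !ler_norml => /andP[? ?] /andP[? ?]; lra.
rewrite ler_norml; apply/andP; split.
  have lo : fprob (fun s => H (T s) <= al - eps) <= fprob rej + nu.
    apply: fprob_le_good => s gs hs; apply: rej_of => //.
    by have := K_H gs (T s); rewrite ler_norml => /andP[_]; lra.
  suff : al - 3 * eps <= fprob (fun s => H (T s) <= al - eps) by lra.
  have [s1 hs1|none] := pickP (fun s => al - eps < H (T s)); last first.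
    apply: (@le_trans _ _ (fmean (fun _ : S => 1 : R))); first by rewrite fmean_cst //; lra.
    apply: ler_fmean => s; have /negbT := none s; rewrite -leNgt => ->; exact: lexx.
  pose ss := [arg max_(s > s1 | al - eps < H (T s)) T s]%O.
  have : al - eps < H (T ss) /\ forall s, al - eps < H (T s) -> T s <= T ss.
    by rewrite /ss; case: arg_maxP.
  move=> [h1 h2].
  have : Hs (T ss) <= fprob (fun s => H (T s) <= al - eps).
    apply: fprob_sub => s; rewrite /in_mem /= => lts; rewrite leNgt; apply/negP => /h2.
    by rewrite leNgt lts.
  by have := atom (T ss); lra.
have up : fprob rej <= fprob (fun s => Hs (T s) <= al + eps) + nu.
  apply: fprob_le_good => s gs rs.
  have [s1 hs1|none] := pickP (fun s' => T s < T s'); last first.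
    rewrite (_ : Hs (T s) = 0); first by lra.
    rewrite /fprob (eq_fmean (g := fun=> 0)) ?fmean_cst // => s'.
    by rewrite none.
  (* [of_rej] needs a threshold strictly above [T s]. A point below the next larger value of [T] is
     taken, where the strict tail is still that of [T s]. *)
  pose ss := [arg min_(s' < s1 | T s < T s') T s']%O.
  have : T s < T ss /\ forall s', T s < T s' -> T ss <= T s' by rewrite /ss; case: arg_minP.
  move=> [h1 h2]; pose t := (T s + T ss) / 2.
  have t1 : T s < t by rewrite /t; lra.
  have t2 : t < T ss by rewrite /t; lra.
  have : Hs (T s) <= Hs t.
    by apply: fprob_sub => s'; rewrite /in_mem /= => /h2; exact: lt_le_trans.
  have := of_rej gs rs t1; have := K_Hs gs t; rewrite ler_norml => /andP[? ?]; lra.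
suff : fprob (fun s => Hs (T s) <= al + eps) <= al + 3 * eps by lra.
have [s1 hs1|none] := pickP (fun s => Hs (T s) <= al + eps); last first.
  rewrite /fprob (eq_fmean (g := fun=> 0)) ?fmean_cst //; first lra.
  by move=> s'; rewrite none.
pose ss := [arg min_(s < s1 | Hs (T s) <= al + eps) T s]%O.
have : Hs (T ss) <= al + eps /\ forall s, Hs (T s) <= al + eps -> T ss <= T s.
  by rewrite /ss; case: arg_minP.
move=> [h1 h2].
have : fprob (fun s => Hs (T s) <= al + eps) <= H (T ss).
  by apply: fprob_sub => s; rewrite /in_mem /= => /h2.
by have := atom (T ss); lra.
Qed.

End Calibration.

Section SoftmaxIndicator.
Variables (R : realType) (J : finType) (be : R).
Hypothesis be_gt0 : 0 < be.
Implicit Types w : J -> R.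

Lemma mass_ge_exists w (x : R) j : x <= w j -> 1 - expR (- (be * x)) <= mass be w.
Proof.
move=> xw; rewrite massE lerB // /wt0 expRN lef_pV2 ?posrE ?expR_gt0 ?denom_gt0 //.
apply: (@le_trans _ _ (expR (be * w j))); first by rewrite ler_expR ler_pM2l.
by rewrite (bigD1 j) //= addrCA lerDl addr_ge0 // sumr_ge0 // => k _; exact: expR_ge0.
Qed.

Lemma mass_le_forall w (x : R) : (forall j, w j <= - x) -> mass be w <= #|J|%:R * expR (- (be * x)).
Proof.
move=> wx; rewrite /mass mulr_natl -sumr_const; apply: ler_sum => j _.
apply: (@le_trans _ _ (expR (be * w j))); last by rewrite ler_expR -mulrN ler_pM2l.
rewrite /wt ler_piMr ?expR_ge0 // /wt0 invf_le1 ?denom_gt0 // lerDl sumr_ge0 // => k _.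
Qed.

End SoftmaxIndicator.

Section BootstrapProbability.
Context {dO : measure_display} {Omega : measurableType dO} {R : realType}.
Variable P : probability Omega R.
Variables (n : nat) (e : 'I_n -> Omega -> R).
Hypothesis e_meas : forall i, measurable_fun setT (e i).
Hypothesis e_normal : forall i B, measurable B -> P (e i @^-1` B) = normal_prob 0 1 B.
Variables (J : finType) (b : 'I_n -> J -> R) (be : R).
Hypothesis be_gt0 : 0 < be.
Hypothesis J_gt0 : (0 < #|J|)%N.

Definition exceed (t : R) : set Omega := [set w | exists j, t < gv b (evec e w) j].
Definition Kb (t : R) : R := fine (P (exceed t)).
Definition exceed_ind (t : R) (v : 'I_n -> R) : R := [exists j, t < gv b v j]%:R.

Let measurable_exists (d : measure_display) (T : measurableType d) (g : 'I_n -> T -> R) t :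
  (forall i, measurable_fun setT (g i)) ->
  measurable [set y : T | exists j, t < gv b (fun i => g i y) j].
Proof.
move=> mg; rewrite (_ : [set _ | _] = \bigcup_(j in [set: J]) [set y | t < gv b (fun i => g i y) j]).
  apply: fin_bigcup_measurable; first exact: finite_finset.
  move=> j _; have mf : measurable_fun setT (fun y => gv b (fun i => g i y) j).
    exact: (mfunc_gv b j) mg.
  rewrite (_ : [set _ | _] = setT `&` (fun y => gv b (fun i => g i y) j) @^-1` `]t, +oo[%classic).
    by apply: mf => //; exact: measurable_itv.
  by rewrite setTI; apply/seteqP; split => y /=; rewrite in_itv /= andbT.
by apply/seteqP; split => [y [j h]|y [j _ h]]; exists j.
Qed.

Lemma measurable_exceed t : measurable (exceed t).
Proof. exact: measurable_exists. Qed.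

Let ind_indic (T : Type) (g : 'I_n -> T -> R) t :
  (fun y => exceed_ind t (fun i => g i y)) = \1_[set y : T | exists j, t < gv b (fun i => g i y) j].
Proof.
apply/funext => y; rewrite indicE /exceed_ind; congr (_%:R); congr nat_of_bool.
by apply/existsP/idP => [h|]; [rewrite in_setE|rewrite in_setE].
Qed.

Lemma nice_exceed_ind t : nice (exceed_ind t).
Proof.
apply: (@nice_bounded _ _ _ 1); last by move=> v; rewrite /exceed_ind; case: existsP; rewrite ?normr1 ?normr0.
by move=> d T g mg; rewrite ind_indic; apply: measurable_indic; exact: measurable_exists.
Qed.

Lemma Kb_EX t : Kb t = EX P e (exceed_ind t).
Proof.
rewrite /EX /Rintegral /Kb; congr fine.
rewrite (_ : (fun w => _) = (fun w => (\1_(exceed t) w)%:E)); last first.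
  by apply/funext => w; rewrite -(ind_indic e t).
rewrite integral_indic ?setIT //; exact: measurable_exceed.
Qed.

(** Error of replacing an indicator by [mass] after a shift by [aa]; the factor [#|J|] is for the
    side where up to that many small weights add up. *)
Definition dlt (aa : R) : R := #|J|%:R * expR (- (be * aa)).

Lemma dlt_ge aa : expR (- (be * aa)) <= dlt aa.
Proof. by rewrite ler_peMl ?expR_ge0 // ler1n. Qed.

Lemma Kb_le t aa : Kb t <= EX P e (fun v => mass be (gX b (fun=> - (t - aa)) 1 v)) + dlt aa.
Proof.
rewrite Kb_EX -(EX_cst P e (dlt aa)) -(EXD e_meas e_normal); [|exact: nice_mass|exact: nice_cst].
apply: (EX_le e_meas e_normal); [exact: nice_exceed_ind|apply: niceD; [exact: nice_mass|exact: nice_cst]|].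
move=> v; rewrite /exceed_ind; case: existsP => [[j tj]|_]; last first.
  by rewrite addr_ge0 ?mass_ge0 // /dlt mulr_ge0 ?ler0n ?expR_ge0.
have : aa <= gX b (fun=> - (t - aa)) 1 v j by rewrite /gX mul1r; move: tj; set z := gv _ _ _; lra.
move=> /(mass_ge_exists be_gt0) h; have := dlt_ge aa; move: h; rewrite /=; set q := expR _; set mm := mass _ _; lra.
Qed.

Lemma Kb_ge t aa : EX P e (fun v => mass be (gX b (fun=> - (t + aa)) 1 v)) <= Kb t + dlt aa.
Proof.
rewrite Kb_EX -(EX_cst P e (dlt aa)) -(EXD e_meas e_normal); [|exact: nice_exceed_ind|exact: nice_cst].
apply: (EX_le e_meas e_normal); [exact: nice_mass|apply: niceD; [exact: nice_exceed_ind|exact: nice_cst]|].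
move=> v; rewrite /exceed_ind; case: existsP => [_|none].
  by apply: le_trans (mass_le1 _ _) _; rewrite lerDl /dlt mulr_ge0 ?ler0n ?expR_ge0.
rewrite add0r; apply: mass_le_forall => // j.
have : gv b v j <= t by rewrite leNgt; apply/negP => h; apply: none; exists j.
by rewrite /gX mul1r; set z := gv _ _ _; lra.
Qed.

End BootstrapProbability.

(** * Uniform comparison for finitely many orderings and scores *)

Section FixedConfiguration.
Context {dO : measure_display} {Omega : measurableType dO} {R : realType}.
Variable P : probability Omega R.
Variables (n m : nat) (e : 'I_n -> Omega -> R).
Hypotheses (n_gt0 : (0 < n)%N) (m_gt0 : (0 < m)%N) (mn : (m <= n)%N).
Hypothesis e_meas : forall i, measurable_fun setT (e i).
Hypothesis e_indep : mutually_independent P (fun i => events_real (e i)).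
Hypothesis e_normal : forall i B, measurable B -> P (e i @^-1` B) = normal_prob 0 1 B.
Local Notation I := ('I_n + 'I_m)%type.
Local Notation N := #|{: I}|.
Local Notation kap := (kap R n m).
Local Notation cl := (@cl R n m).
Variables (K D : finType) (le : K -> rel I) (T : nat).
Hypotheses (K_gt0 : (0 < #|K|)%N) (D_gt0 : (0 < #|D|)%N).
Hypotheses (leT_total : forall k, total (le k)) (leT_trans : forall k, transitive (le k)).
Hypothesis ties : forall k z, (#|[pred y | le k y z && le k z y]| <= T)%N.
Variables (psi : D -> R -> R) (B tau : R).
Hypothesis psi_lip : forall d (x y : R), 0 <= x <= 1 -> 0 <= y <= 1 ->
  `|psi d x - psi d y| <= B * `|x - y|.
Hypothesis psi_sum : forall d k, (0 < k)%N -> `|\sum_(0 <= r < k) psi d (r.+1%:R / k%:R)| <= B.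
Hypothesis psi_sqr : forall d k, (0 < k)%N ->
  `|k%:R^-1 * (\sum_(0 <= r < k) psi d (r.+1%:R / k%:R) ^+ 2) - 1| <= 4 * B ^+ 2 / k%:R.
Hypothesis psi_le : forall d (x : R), 0 <= x <= 1 -> psi d x ^+ 2 <= 8 * B.
Hypotheses (B1 : 1 <= B) (tau1 : 1 <= tau).
Hypothesis harm : \sum_(0 <= i < N) (N - i)%:R^-1 <= tau ^+ 2 :> R.
Local Notation J := (K * D * bool)%type.
Implicit Types (s : {perm I}) (j : J).

Let B0 : 0 < B.
Proof. exact: lt_le_trans ltr01 B1. Qed.
Let N0 : (0 < N)%N.
Proof. by rewrite cardI addn_gt0 n_gt0. Qed.
Let NR : 0 < N%:R :> R.
Proof. by rewrite ltr0n. Qed.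
Let k0 : 0 < kap.
Proof. exact: kap_gt0. Qed.

(* The boolean in an index of [J] is a sign, which turns maxima of absolute values
   into plain maxima. *)
Definition sg (b : bool) : R := if b then -1 else 1.

Lemma sg_norm b : `|sg b| = 1.
Proof. by case: b; rewrite /sg ?normrN normr1. Qed.

Lemma sg_sqr b : sg b ^+ 2 = 1.
Proof. by case: b; rewrite /sg ?sqrrN expr1n. Qed.

Definition sc j (z : I) : R := sg j.2 * rscore (le j.1.1) (psi j.1.2) z.
Definition Yst s j : R := sg j.2 * (kap / m%:R * \sum_z (~~ isX (s z))%:R * psi j.1.2 (xcdf R (le j.1.1) s z)).
Definition bsc s j (z : I) : R := sg j.2 * psi j.1.2 (xcdf R (le j.1.1) s z).
(** [(s^-1)%g (inl i)] is the pooled point that labelling [s] puts at index [i] of the first sample;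
    the multipliers act on these points only. *)
Definition bcoef s (i : 'I_n) j : R := (Num.sqrt n%:R)^-1 * bsc s j ((s^-1)%g (inl i)).

Let M : R := 8 * B.
Let M_gt0 : 0 < M.
Proof. by rewrite mulr_gt0. Qed.

Let sc2 j z : sc j z ^+ 2 <= M.
Proof.
rewrite /sc exprMn sg_sqr mul1r; apply: psi_le.
exact: (rank_unit R n_gt0 (rk_lt _ z)).
Qed.

Let sc_le j z : `|sc j z| <= M.
Proof.
have [h|h] := leP `|sc j z| 1; first by apply: le_trans h _; rewrite /M; move: B1; lra.
apply: le_trans (sc2 j z); rewrite -real_normK ?num_real // expr2 ler_peMr // ltW //.
Qed.

Let scsc_le i j z : `|sc i z * sc j z| <= M.
Proof.
have h1 := sc2 i z; have h2 := sc2 j z.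
rewrite ler_norml; apply/andP; split.
  by have := sqr_ge0 (sc i z + sc j z); rewrite sqrrD mulr2n; move: h1 h2; lra.
by have := sqr_ge0 (sc i z - sc j z); rewrite sqrrB mulr2n; move: h1 h2; lra.
Qed.

Let b1 : R := B / N%:R.
Let b2 : R := 4 * B ^+ 2 / N%:R.

Let mean_le j : `|avgI (sc j)| <= b1.
Proof.
rewrite /avgI /sc -mulr_sumr normrM normfV (ger0_norm (ltW NR)) mulrC ler_wpM2r ?invr_ge0 ?ler0n //.
by rewrite normrM sg_norm mul1r (sum_rscore n_gt0 _ _ id) psi_sum.
Qed.

Let var_le j : `|avgI (fun z => sc j z ^+ 2) - 1| <= b2.
Proof.
rewrite /avgI /sc; under eq_bigr do rewrite exprMn sg_sqr mul1r.
by rewrite (sum_rscore n_gt0 _ _ (fun x => x ^+ 2)) psi_sqr.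
Qed.

Definition goodS s : bool := [&& goodC sc (8 * B) tau s,
  [forall k, goodP (pt n_gt0 (le k)) tau s] &
  [forall kd : K * D, goodM (pt n_gt0 (le kd.1)) (psi kd.2) B tau s]].

(** Union bound: products and single scores for the covariances, the [N.+1] partial sums of labels
    along each ordering, and one martingale for each ordering and score. *)
Definition nuS : R := ((#|{: J}|%:R ^+ 2 + #|{: J}|%:R) + #|K|%:R * N.+1%:R + #|K|%:R * #|D|%:R) *
  (2 * expR (- tau ^+ 2)).

Lemma goodS_tail : fprob (predC goodS) <= nuS.
Proof.
apply: (@le_trans _ _ (fprob (predC (goodC sc (8 * B) tau)) +
   (fprob (fun s => [exists k, predC (goodP (pt n_gt0 (le k)) tau) s]) +
    fprob (fun s => [exists kd : K * D, predC (goodM (pt n_gt0 (le kd.1)) (psi kd.2) B tau) s])))).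
  apply: le_trans (lerD (lexx _) (fprobU _ _)); apply: le_trans (fprobU _ _).
  apply: fprob_sub => s; rewrite /in_mem /= /goodS !negb_and => /or3P[->//| |].
    by move=> /forallPn h; apply/orP; right; apply/orP; left; apply/existsP.
  by move=> /forallPn h; apply/orP; right; apply/orP; right; apply/existsP.
have hC := goodC_tail n_gt0 m_gt0 mn sc_le scsc_le (lt_le_trans ltr01 tau1) M_gt0.
have hP := fprob_exists (fun k => goodP_tail n_gt0 m_gt0 mn (@pt_inj _ _ n_gt0 (le k)) tau1).
have hM := fprob_exists (fun kd : K * D => goodM_tail n_gt0 m_gt0 mn (@pt_inj _ _ n_gt0 (le kd.1)) (psi kd.2) tau1 B0).
apply: le_trans (lerD hC (lerD hP hM)) _; rewrite /nuS.
rewrite (_ : #|{: K * D}|%:R = #|K|%:R * #|D|%:R :> R); last by rewrite card_prod natrM.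
by rewrite le_eqVlt; apply/orP; left; apply/eqP; ring.
Qed.

Definition rS : R := (T%:R + 3) * B / Num.sqrt N%:R +
  408 * Num.sqrt (n%:R / m%:R) * B * tau ^+ 4 / Num.sqrt N%:R.

Lemma Yst_lstat s j : goodS s -> `|Yst s j - lstat cl sc s j| <= rS.
Proof.
case: j => [[k d] b] /and3P[_ /forallP/(_ k) gP /forallP/(_ (k, d)) gM].
have := @linearization R n m n_gt0 m_gt0 mn (pt n_gt0 (le k)) (@pt_inj _ _ _ _) (psi d) B (psi_lip d) tau
  tau1 B0 (psi_sum d n_gt0) harm T (xcdf R (le k) s) s gP gM (xcdf01 R n_gt0 m_gt0 (le k) s)
  (xcdf_cnt R n_gt0 (leT_total k) (@leT_trans k) (ties k) s).
rewrite Yavg_sum lrank_rscore => h.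
rewrite /Yst /lstat /sc /=; under [\sum_z cl _ * _]eq_bigr do rewrite mulrCA.
by rewrite -mulr_sumr -mulrBr normrM sg_norm mul1r.
Qed.

Let om : R := 16 * M * Num.sqrt (n%:R / m%:R) * tau / kap.
Let rho : R := B * (T%:R / n%:R + 16 * tau / Num.sqrt N%:R).
Let D1 : R := om + (om + b1) ^+ 2.
Let D2 : R := om + rho * (2 + b2 + om + rho).
(** The bootstrap and transposition covariances are compared through their common centre, the pooled
    second moment, at distances [D2] and [D1]. [etaS] adds the distance of the pooled variance from
    1, [DlS] is the total distance, and [V0S] is the crude bound for atypical labellings. *)
Definition etaS : R := D2 + b2.
Definition DlS : R := D1 + D2.
Definition V0S : R := 4 * (n%:R / m%:R) * (8 * B) + (1 + etaS).
Definition v0S : R := 4 * (n%:R / m%:R) * (1 + b2).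
Definition dmS : R := 2 * (8 * B) / kap.

Let t0 : 0 <= tau.
Proof. exact: le_trans ler01 tau1. Qed.
Let om_ge0 : 0 <= om.
Proof.
rewrite /om divr_ge0 ?(ltW k0) // mulr_ge0 // mulr_ge0 ?sqrtr_ge0 // mulr_ge0 //.
exact: ltW M_gt0.
Qed.
Let rho_ge0 : 0 <= rho.
Proof.
rewrite mulr_ge0 ?(ltW B0) // addr_ge0 // ?divr_ge0 ?ler0n //.
by rewrite !mulr_ge0 ?invr_ge0 ?sqrtr_ge0.
Qed.
Let b2_ge0 : 0 <= b2.
Proof. by rewrite divr_ge0 ?ler0n // mulr_ge0 // sqr_ge0. Qed.
Let D1_ge0 : 0 <= D1.
Proof. by apply: addr_ge0 => //; exact: sqr_ge0. Qed.
Let D2_ge0 : 0 <= D2.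
Proof. by apply: addr_ge0 => //; apply: mulr_ge0 => //; rewrite !addr_ge0. Qed.
Lemma etaS_ge0 : 0 <= etaS.
Proof. by rewrite addr_ge0. Qed.
Section Good.
Variable s0 : {perm I}.
Hypothesis good0 : goodS s0.

Lemma gcov_avgX i j : gcov (bcoef s0) i j = avgX s0 (fun z => bsc s0 i z * bsc s0 j z).
Proof.
rewrite /gcov /avgX mulr_sumr (reindex_inj (@perm_inj _ s0^-1)%g) /= big_sumType /=.
rewrite [X in _ = _ + X]big1 ?addr0; last by move=> y _; rewrite /xind permKV /= mul0r mulr0.
apply: eq_bigr => i' _; rewrite /bcoef /xind permKV /= mul1r.
rewrite mulrACA; congr (_ * _).
by rewrite -expr2 exprVn sqr_sqrtr ?ler0n.
Qed.

Lemma bsc_near j z : `|bsc s0 j z - sc j z| <= rho.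
Proof.
case: j => [[k d] b]; case/and3P: good0 => _ /forallP/(_ k) gP _.
rewrite /bsc /sc /= -mulrBr normrM sg_norm mul1r.
exact: (boot_score m_gt0 (leT_total k) (@leT_trans k) (ties k) (psi_lip d) B0 z gP).
Qed.

Lemma gcov_near i j : `|gcov (bcoef s0) i j - avgI (fun z => sc i z * sc j z)| <= D2.
Proof.
rewrite gcov_avgX; have /and3P[gC _ _] := good0.
exact: (good_bootcov n_gt0 m_gt0 mean_le var_le i j gC rho_ge0 bsc_near).
Qed.

Lemma gcov_diagS j : `|gcov (bcoef s0) j j - 1| <= etaS.
Proof.
have h1 := gcov_near j j; have h2 := var_le j.
have := ler_normD (gcov (bcoef s0) j j - avgI (fun z => sc j z * sc j z)) (avgI (fun z => sc j z * sc j z) - 1).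
rewrite addrA subrK => /le_trans; apply; rewrite /etaS; apply: lerD => //.
Qed.

Variables (be be1 aa : R).
Hypotheses (be_gt0 : 0 < be) (be1_gt0 : 0 < be1) (aa_ge0 : 0 <= aa).
Hypothesis be_dm : be * dmS <= 1.
Let b := bcoef s0.
Let Mb : R := be1^-1 * ln (1 + #|{: J}|%:R) + 2 * be1 * (1 + etaS).
Let Lb : R := Mb / be + 2 * etaS.
Definition cmpS : R := 3 * be ^+ 2 * (DlS * Lb + V0S * nuS) + 13 * expR 3 * be ^+ 3 * dmS * v0S * Lb.
(** The window [rS + 2 * aa] consists of the linearization error and one smoothing shift on each
    side; it is multiplied by the Lipschitz constant of the smoothed Gaussian tail. *)
Definition epsS : R := nuS + 2 * dlt J be aa + 2 * cmpS + (Mb + 2 * etaS * be) * (rS + 2 * aa).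

Let MbE : Mlse P e b be1 <= Mb.
Proof. exact: (Mlse_bound e_meas e_indep e_normal etaS_ge0 gcov_diagS be1_gt0). Qed.

Let v0_ge0 : 0 <= v0S.
Proof. by rewrite mulr_ge0 // addr_ge0. Qed.
Let dm_ge0 : 0 <= dmS.
Proof. by rewrite divr_ge0 ?(ltW k0) // mulr_ge0 // ltW. Qed.
Let V0_ge0 : 0 <= V0S.
Proof.
apply: addr_ge0; first by apply: mulr_ge0 => //; exact: ltW M_gt0.
by apply: addr_ge0 => //; exact: etaS_ge0.
Qed.
Let Dl_ge0 : 0 <= DlS.
Proof. exact: addr_ge0. Qed.

Lemma cmp_rate_le : cmp_rate P e b etaS be be1 dmS v0S DlS V0S nuS <= cmpS.
Proof.
have L : Mlse P e b be1 / be + 2 * etaS <= Lb by rewrite lerD2r ler_wpM2r // invr_ge0 ltW.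
have q0 : 0 <= be by exact: ltW.
rewrite /cmp_rate /cmpS; apply: lerD; apply: ler_wpM2l => //.
- by rewrite mulr_ge0 // exprn_ge0.
- by rewrite lerD2r ler_wpM2l.
- by apply: mulr_ge0 => //; apply: mulr_ge0 => //; rewrite mulr_ge0 ?exprn_ge0 // mulr_ge0 ?expR_ge0.
Qed.

(** The labelling [s0] fixes the multiplier process while [s] runs over all labellings: the
    bootstrap of one good labelling is compared with the whole relabelling law. *)
Lemma permS x : `|fmean (fun s : {perm I} => mass be (fun j => x j + lstat cl sc s j)) -
   EX P e (fun v => mass be (gX b x 1 v))| <= 2 * cmpS.
Proof.
apply: le_trans (_ : 2 * cmp_rate P e b etaS be be1 dmS v0S DlS V0S nuS <= _); last first.
  by rewrite ler_pM2l // cmp_rate_le.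
apply: (@perm_vs_gauss _ _ _ P n e e_meas e_indep e_normal J b etaS etaS_ge0 gcov_diagS be be1 be_gt0 be1_gt0
  {: I} cl sc N0 (sum_cl R n_gt0 m_gt0) dmS v0S _ be_dm _ dm_ge0 v0_ge0 goodS DlS V0S nuS Dl_ge0 V0_ge0 _ _ goodS_tail).
- exact: (swapd_le n_gt0 m_gt0 sc_le).
- move=> s j; apply: le_trans (swapcov_diag_le n_gt0 m_gt0 mn sc s j) _.
  by rewrite ler_wpM2l //; have := var_le j; rewrite ler_norml => /andP[_]; rewrite lerBlDl.
- move=> s gs i j; have /and3P[gC _ _] := gs.
  have h1 : `|swapcov cl sc s i j - avgI (fun z => sc i z * sc j z)| <= D1.
    exact: (good_swapcov n_gt0 m_gt0 mean_le i j gC).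
  have h2 := gcov_near i j.
  have := ler_normB (swapcov cl sc s i j - avgI (fun z => sc i z * sc j z)) (gcov (bcoef s0) i j - avgI (fun z => sc i z * sc j z)).
  rewrite opprB addrA subrK => /le_trans; apply; exact: lerD.
- move=> s i j; apply: le_trans (ler_normB _ _) _; apply: lerD.
    exact: (swapcov_le n_gt0 m_gt0 mn (ltW M_gt0) scsc_le).
  exact: (gcov_bound gcov_diagS).
Qed.

Lemma lipS (t u : R) : t <= u ->
  EX P e (fun v => mass be (gX b (fun=> - t) 1 v)) <=
  EX P e (fun v => mass be (gX b (fun=> - u) 1 v)) + (Mb + 2 * etaS * be) * (u - t).
Proof.
move=> tu; have := mass_lipschitz e_meas e_indep e_normal etaS_ge0 gcov_diagS be_gt0 be1_gt0 tu.
have : Lip P e b etaS be be1 * (u - t) <= (Mb + 2 * etaS * be) * (u - t).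
  by rewrite ler_wpM2r ?subr_ge0 // /Lip lerD2r.
rewrite -/b; set E1 := EX _ _ _; set E2 := EX _ _ _; set q := Lip _ _ _ _ _ _ * _; set q' := _ * (u - t).
by move=> h; rewrite ler_norml => /andP[h1 h2]; lra.
Qed.

Let r0 : 0 <= rS.
Proof.
have [j _] : exists j : J, true.
  have /card_gt0P[k _] := K_gt0; have /card_gt0P[d _] := D_gt0; by exists (k, d, true).
exact: le_trans (normr_ge0 _) (Yst_lstat j good0).
Qed.

Let J_gt0 : (0 < #|{: J}|)%N.
Proof. by rewrite !card_prod card_bool !muln_gt0 K_gt0 D_gt0. Qed.

Let dlt_ge0 : 0 <= dlt J be aa.
Proof. by rewrite mulr_ge0 ?ler0n ?expR_ge0. Qed.

Lemma fmean_le_good (f g : {perm I} -> R) : (forall s, f s <= 1) -> (forall s, 0 <= g s) ->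
  (forall s, goodS s -> f s <= g s) -> fmean f <= fmean g + nuS.
Proof.
move=> f1 g0 fg; apply: le_trans (lerD (lexx _) goodS_tail); rewrite /fprob -fmeanD.
apply: ler_fmean => s /=; case: (boolP (goodS s)) => gs /=; first by rewrite addr0 fg.
by have := f1 s; have := g0 s => h1 h2; apply: le_trans h2 _; rewrite lerDr.
Qed.

(** The threshold moves from [t - aa] to [t + rS + aa]: smoothing on the Gaussian side, smoothing
    and linearization on the permutation side. [lipS] pays for the move. *)
Lemma Kb_upper t : Kb P e b t <= fprob (fun s => [exists j, t < Yst s j]) + epsS.
Proof.
have h1 := Kb_le e_meas e_normal b be_gt0 J_gt0 t aa.
have tu : t - aa <= t + rS + aa by have := r0; have := aa_ge0; lra.
have h2 := lipS tu.
have h3 := permS (fun=> - (t + rS + aa)).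
have h4 : fmean (fun s : {perm I} => mass be (fun j => - (t + rS + aa) + lstat cl sc s j)) <=
    fprob (fun s => [exists j, t < Yst s j]) + dlt J be aa + nuS.
  rewrite /fprob -[dlt J be aa](@fmean_cst _ {perm I}); last by apply/card_gt0P; exists 1%g.
  rewrite -fmeanD; apply: fmean_le_good => s; first exact: mass_le1.
    by rewrite addr_ge0.
  move=> gs; case: existsP => [_|none] /=.
    by apply: le_trans (mass_le1 _ _) _; rewrite lerDl.
  rewrite add0r; apply: (mass_le_forall be_gt0) => j.
  have yj : Yst s j <= t by rewrite leNgt; apply/negP => h; apply: none; exists j.
  have := Yst_lstat j gs; rewrite ler_norml => /andP[h _]; move: h yj.
  by set y := Yst _ _; set l := lstat _ _ _ _; lra.
move: h1 h2 h3 h4; rewrite ler_norml /epsS (_ : t + rS + aa - (t - aa) = rS + 2 * aa); last by ring.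
set X1 := EX _ _ _; set X2 := EX _ _ _; set X3 := fmean _; set q := _ * (rS + 2 * aa).
clearbody X1 X2 X3 q; move: (Kb _ _ _ _) (fprob _) (dlt _ _ _) nuS cmpS => k1 k2 k3 k4 k5.
by move=> h1 h2 /andP[h3 h3'] h4; lra.
Qed.

(** Mirror image of [Kb_upper], with non-strict exceedance; having one strict and one non-strict
    bound is what lets [calibration] control atoms. *)
Lemma Kb_lower t : fprob (fun s => [exists j, t <= Yst s j]) <= Kb P e b t + epsS.
Proof.
have h1 := Kb_ge e_meas e_normal b be_gt0 t aa.
have tu : t - rS - aa <= t + aa by have := r0; have := aa_ge0; lra.
have h2 := lipS tu.
have h3 := permS (fun=> - (t - rS - aa)).
have h4 : fprob (fun s => [exists j, t <= Yst s j]) <=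
    fmean (fun s : {perm I} => mass be (fun j => - (t - rS - aa) + lstat cl sc s j)) + dlt J be aa + nuS.
  rewrite /fprob -[dlt J be aa](@fmean_cst _ {perm I}); last by apply/card_gt0P; exists 1%g.
  rewrite -fmeanD; apply: fmean_le_good => s; first by case: existsP.
    by rewrite addr_ge0 // mass_ge0.
  move=> gs; case: existsP => [[j tj]|_] /=; last by rewrite addr_ge0 // mass_ge0.
  have : aa <= - (t - rS - aa) + lstat cl sc s j.
    have := Yst_lstat j gs; rewrite ler_norml => /andP[_ h]; move: h tj.
    by set y := Yst _ _; set l := lstat _ _ _ _; lra.
  move=> /(@mass_ge_exists _ J be be_gt0 (fun j => - (t - rS - aa) + lstat cl sc s j)) h.
  have := dlt_ge be J_gt0 aa; move: h; set q := expR _; set mm := mass _ _; lra.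
move: h1 h2 h3 h4; rewrite ler_norml /epsS (_ : t + aa - (t - rS - aa) = rS + 2 * aa); last by ring.
set X1 := EX _ _ _; set X2 := EX _ _ _; set X3 := fmean _; set q := _ * (rS + 2 * aa).
clearbody X1 X2 X3 q; move: (Kb _ _ _ _) (fprob _) (dlt _ _ _) nuS cmpS => k1 k2 k3 k4 k5.
by move=> h1 h2 /andP[h3 h3'] h4; lra.
Qed.

End Good.
End FixedConfiguration.

Section FiniteSup.
Variables (R : realType) (F : finType) (f : F -> R) (S : set R).
Hypothesis F_gt0 : (0 < #|F|)%N.
Hypothesis S_f : forall r, S r <-> exists x, r = f x.

Lemma finite_sup : exists2 x, sup S = f x & forall y, f y <= f x.
Proof.
have /card_gt0P[x0 _] := F_gt0.
pose x := [arg max_(x > x0) f x]%O.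
have xmax y : f y <= f x by rewrite /x; case: arg_maxP => // i _; apply.
have Sx : S (f x) by apply/S_f; exists x.
have ub : ubound S (f x) by move=> r /S_f[y ->].
exists x => //; apply/eqP; rewrite eq_le; apply/andP; split.
  by apply: ge_sup => //; exists (f x).
by apply: ub_le_sup => //; exists (f x).
Qed.

End FiniteSup.

Lemma le_norm_sg (R : realType) (c v t : R) : 0 <= c ->
  (t <= c * `|v|) <-> exists b : bool, t <= sg b * (c * v).
Proof.
move=> c0; rewrite -[X in _ <= X * _](ger0_norm c0) -normrM; split => [|[b]].
  by rewrite ler_normr => /orP[h|h]; [exists false; rewrite mul1r|exists true; rewrite mulN1r].
move=> /le_trans; apply; rewrite -[leRHS]mul1r -(sg_norm (R := R) b) -normrM; exact: ler_norm.
Qed.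

Lemma lt_norm_sg (R : realType) (c v t : R) : 0 <= c ->
  (t < c * `|v|) <-> exists b : bool, t < sg b * (c * v).
Proof.
move=> c0; rewrite -[X in _ < X * _](ger0_norm c0) -normrM; split => [|[b]].
  by rewrite ltr_normr => /orP[h|h]; [exists false; rewrite mul1r|exists true; rewrite mulN1r].
move=> /lt_le_trans; apply; rewrite -[leRHS]mul1r -(sg_norm (R := R) b) -normrM; exact: ler_norm.
Qed.

(** * The test on a relabelled pooled sample in general position *)

Section PooledSample.
Context {dO : measure_display} {Omega : measurableType dO} {R : realType}.
Variable P : probability Omega R.
Variables (p n m d : nat) (e : 'I_n -> Omega -> R).
Hypotheses (p_gt0 : (0 < p)%N) (n_gt0 : (0 < n)%N) (m_gt0 : (0 < m)%N) (mn : (m <= n)%N) (d_gt0 : (0 < d)%N).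
Hypothesis e_meas : forall i, measurable_fun setT (e i).
Hypothesis e_indep : mutually_independent P (fun i => events_real (e i)).
Hypothesis e_normal : forall i B, measurable B -> P (e i @^-1` B) = normal_prob 0 1 B.
Local Notation I := ('I_n + 'I_m)%type.
Local Notation N := #|{: I}|.
Local Notation kap := (kap R n m).
Variable psi : nat -> R -> R.
Implicit Types s : {perm I}.

Definition crit (al : R) (x : 'I_n -> 'I_p -> R) : R :=
  inf [set t : R | (P [set w' | (t < Psi_MB d psi x (fun i => e i w'))%R] <= al%:E)%E].

Definition rejects (al : R) (zz : I -> 'I_p -> R) : Prop :=
  crit al (fun i => zz (inl i)) <= Psi_max d psi (fun i => zz (inl i)) (fun j => zz (inr j)).

(** The inverse appears because [s] sends points to sample indices: index [y] receives the point
    with label [y]. *)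
Definition shuffle (zz : I -> 'I_p -> R) (s : {perm I}) : I -> 'I_p -> R := fun y => zz ((s^-1)%g y).

(** Bounds the ties in every ordering by [p]. The bound must hold for all directions at once, since
    directions that create ties also take part in the suprema. *)
Definition gen_pos (zz : I -> 'I_p -> R) : Prop :=
  forall u t, sphere u -> (#|[pred y | dotp u (zz y) == t]| <= p)%N.

Variable zz : I -> 'I_p -> R.
Hypothesis zz_gp : gen_pos zz.

Definition dle (u : 'I_p -> R) : rel I := fun y z => dotp u (zz y) <= dotp u (zz z).

Lemma ecdf_shuffle u s z :
  ecdf (fun i => shuffle zz s (inl i)) u (dotp u (zz z)) = xcdf R (dle u) s z.
Proof.
rewrite /ecdf /xcdf mulrC; congr (_ * _).
rewrite [RHS](reindex_inj (@perm_inj _ s^-1)%g) /= big_sumType /=.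
rewrite [X in _ = _ + X]big1 ?addr0; last by move=> y _; rewrite permKV.
by apply: eq_bigr => i _; rewrite permKV /= /shuffle /dle; case: ifP.
Qed.

Variables (K : nat) (dirs : 'I_K -> 'I_p -> R).
Hypothesis K_gt0 : (0 < K)%N.
Hypothesis dirs_sphere : forall k, sphere (dirs k).
Hypothesis dirs_all : forall u, sphere u -> exists k, dle u =2 dle (dirs k).

Let le (k : 'I_K) : rel I := dle (dirs k).
Let D := 'I_d.
Let ps (k : D) : R -> R := psi k.+1.
Local Notation J := ('I_K * 'I_d * bool)%type.

Lemma xcdf_eq (l1 l2 : rel I) s z : l1 =2 l2 -> xcdf R l1 s z = xcdf R l2 s z.
Proof. by move=> E; rewrite /xcdf; congr (_ * _); apply: eq_bigr => y _; rewrite E. Qed.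

Definition vmax (s : {perm I}) (kd : 'I_K * 'I_d) : R :=
  m%:R^-1 * \sum_z (~~ isX (s z))%:R * ps kd.2 (xcdf R (le kd.1) s z).

Let F_gt0 : (0 < #|{: 'I_K * 'I_d}|)%N.
Proof. by rewrite card_prod !card_ord muln_gt0 K_gt0. Qed.

Lemma sum_notX s (f : I -> R) : \sum_z (~~ isX (s z))%:R * f z = \sum_j f ((s^-1)%g (inr j)).
Proof.
rewrite (reindex_inj (@perm_inj _ s^-1)%g) /= big_sumType /=.
rewrite [X in X + _]big1 ?add0r; last by move=> y _; rewrite permKV mul0r.
by apply: eq_bigr => i _; rewrite permKV mul1r.
Qed.

(** The data enter only through the ordering of the projections, so each direction may be replaced
    by the representative with the same ordering and the supremum becomes a maximum. *)
Lemma Psi_max_set s r :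
  (exists u k, sphere u /\ (1 <= k <= d)%N /\
    r = `| m%:R^-1 * \sum_(j < m) psi k (ecdf (fun i => shuffle zz s (inl i)) u (dotp u (shuffle zz s (inr j)))) |)
  <-> exists x, r = `|vmax s x|.
Proof.
have E u k (kd : 'I_K * 'I_d) : dle u =2 le kd.1 -> k = kd.2.+1 ->
   m%:R^-1 * \sum_(j < m) psi k (ecdf (fun i => shuffle zz s (inl i)) u (dotp u (shuffle zz s (inr j)))) = vmax s kd.
  move=> ule ->; rewrite /vmax sum_notX; congr (_ * _); apply: eq_bigr => j _.
  by rewrite ecdf_shuffle (xcdf_eq _ _ ule).
split=> [[u [k [su [/andP[k1 kd] ->]]]]|[[k i] ->]].
  have [kk ule] := dirs_all su; have kd' : (k.-1 < d)%N by rewrite prednK.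
  by exists (kk, Ordinal kd'); rewrite (E u k (kk, Ordinal kd')) //= prednK.
exists (dirs k), i.+1; split; first exact: dirs_sphere.
by split; [exact: ltn_ord|rewrite (E _ _ (k, i))].
Qed.

Definition Tst s : R := Psi_max d psi (fun i => shuffle zz s (inl i)) (fun j => shuffle zz s (inr j)).

Let kap0 : 0 <= kap. Proof. exact: ltW (kap_gt0 R n_gt0 m_gt0). Qed.

Lemma Yst_vmax s kd b : Yst le ps s (kd, b) = sg b * (kap * vmax s kd).
Proof. by rewrite /Yst /vmax /= -mulrA. Qed.

Lemma le_Tst s t : (t <= Tst s) = [exists j, t <= Yst le ps s j].
Proof.
have [x sE xm] := finite_sup F_gt0 (Psi_max_set s).
have -> : Tst s = kap * `|vmax s x| by rewrite /Tst /Psi_max sE.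
apply/idP/existsP => [/(le_norm_sg _ _ kap0)[b h]|[[kd b]]].
  by exists (x, b); rewrite Yst_vmax.
rewrite Yst_vmax => h; have := (le_norm_sg (vmax s kd) t kap0).2 (ex_intro _ b h) => /le_trans; apply.
exact: ler_wpM2l (xm _).
Qed.

Lemma lt_Tst s t : (t < Tst s) = [exists j, t < Yst le ps s j].
Proof.
have [x sE xm] := finite_sup F_gt0 (Psi_max_set s).
have -> : Tst s = kap * `|vmax s x| by rewrite /Tst /Psi_max sE.
apply/idP/existsP => [/(lt_norm_sg _ _ kap0)[b h]|[[kd b]]].
  by exists (x, b); rewrite Yst_vmax.
rewrite Yst_vmax => h; have := (lt_norm_sg (vmax s kd) t kap0).2 (ex_intro _ b h) => /lt_le_trans; apply.
exact: ler_wpM2l (xm _).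
Qed.

Definition wmax (s : {perm I}) (es : 'I_n -> R) (kd : 'I_K * 'I_d) : R :=
  (Num.sqrt n%:R)^-1 * \sum_i es i * ps kd.2 (xcdf R (le kd.1) s ((s^-1)%g (inl i))).

Lemma Psi_MB_set s es r :
  (exists u k, sphere u /\ (1 <= k <= d)%N /\
    r = `| (Num.sqrt n%:R)^-1 * \sum_(i < n) es i *
        psi k (ecdf (fun i => shuffle zz s (inl i)) u (dotp u (shuffle zz s (inl i)))) |)
  <-> exists x, r = `|wmax s es x|.
Proof.
have E u k (kd : 'I_K * 'I_d) : dle u =2 le kd.1 -> k = kd.2.+1 ->
   (Num.sqrt n%:R)^-1 * \sum_(i < n) es i *
        psi k (ecdf (fun i => shuffle zz s (inl i)) u (dotp u (shuffle zz s (inl i)))) = wmax s es kd.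
  move=> ule ->; rewrite /wmax; congr (_ * _); apply: eq_bigr => j _.
  by rewrite ecdf_shuffle (xcdf_eq _ _ ule).
split=> [[u [k [su [/andP[k1 kd] ->]]]]|[[k i] ->]].
  have [kk ule] := dirs_all su; have kd' : (k.-1 < d)%N by rewrite prednK.
  by exists (kk, Ordinal kd'); rewrite (E u k (kk, Ordinal kd')) //= prednK.
exists (dirs k), i.+1; split; first exact: dirs_sphere.
by split; [exact: ltn_ord|rewrite (E _ _ (k, i))].
Qed.

Lemma gv_wmax s es kd b : gv (bcoef le ps s) es (kd, b) = sg b * (1 * wmax s es kd).
Proof.
rewrite mul1r /gv /wmax /bcoef /bsc mulrCA mulr_sumr mulr_sumr; apply: eq_bigr => i _ /=; ring.
Qed.

Lemma exceedE s t :
  [set w' | t < Psi_MB d psi (fun i => shuffle zz s (inl i)) (fun i => e i w')] =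
  exceed e (bcoef le ps s) t.
Proof.
apply/seteqP; split => w /=.
  have [x sE xm] := finite_sup F_gt0 (Psi_MB_set s (fun i => e i w)).
  rewrite /Psi_MB sE -[`|_|]mul1r => /(lt_norm_sg _ _ ler01)[b h].
  by exists (x, b); rewrite gv_wmax.
move=> [[kd b]]; rewrite gv_wmax => h.
have [x sE xm] := finite_sup F_gt0 (Psi_MB_set s (fun i => e i w)).
rewrite /Psi_MB sE; apply: lt_le_trans (xm kd); rewrite -[ltRHS]mul1r.
by apply/(lt_norm_sg _ _ ler01); exists b.
Qed.

Variables (B tau : R).
Hypothesis psi_lip : forall k (x y : R), (1 <= k <= d)%N -> 0 <= x <= 1 -> 0 <= y <= 1 ->
  `|psi k x - psi k y| <= B * `|x - y|.
Hypothesis psi_sum : forall k r, (1 <= k <= d)%N -> (0 < r)%N ->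
  `|\sum_(0 <= i < r) psi k (i.+1%:R / r%:R)| <= B.
Hypothesis psi_sqr : forall k r, (1 <= k <= d)%N -> (0 < r)%N ->
  `|r%:R^-1 * (\sum_(0 <= i < r) psi k (i.+1%:R / r%:R) ^+ 2) - 1| <= 4 * B ^+ 2 / r%:R.
Hypothesis psi_le : forall k (x : R), (1 <= k <= d)%N -> 0 <= x <= 1 -> psi k x ^+ 2 <= 8 * B.
Hypotheses (B1 : 1 <= B) (tau1 : 1 <= tau).
Hypothesis harm : \sum_(0 <= i < N) (N - i)%:R^-1 <= tau ^+ 2 :> R.
Variables (be be1 aa : R).
Hypotheses (be_gt0 : 0 < be) (be1_gt0 : 0 < be1) (aa_ge0 : 0 <= aa).
Hypothesis be_dm : be * dmS n m B <= 1.

Section Critical.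
Variables (s : {perm I}) (al : R).
Hypothesis al01 : 0 < al < 1.
Let b := bcoef le ps s.
Let A : set R := [set t : R | (P [set w' | (t < Psi_MB d psi (fun i => shuffle zz s (inl i)) (fun i => e i w'))%R] <= al%:E)%E].

Let A_Kb t : A t <-> Kb P e b t <= al.
Proof.
rewrite /A /= exceedE -/b /Kb -lee_fin fineK //.
by rewrite fin_num_measure //; exact: measurable_exceed.
Qed.

(** Both signs of each index occur, so the maximum is nonnegative and a negative threshold is always
    exceeded. This bounds the set in [crit] from below. *)
Lemma Kb_neg t : t < 0 -> Kb P e b t = 1.
Proof.
move=> t0; rewrite /Kb (_ : exceed e b t = setT) ?probability_setT //.
apply/seteqP; split => // w _; have /card_gt0P[kd _] := F_gt0.
have [h|h] := leP 0 (wmax s (evec e w) kd).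
  by exists (kd, false); rewrite gv_wmax mul1r mul1r (lt_le_trans t0).
by exists (kd, true); rewrite gv_wmax mul1r mulN1r (lt_trans t0) // oppr_gt0.
Qed.

Let A_lb : has_lbound A.
Proof.
exists 0 => t /A_Kb h; rewrite leNgt; apply/negP => /Kb_neg k1; move: h; rewrite k1.
by case/andP: al01 => _ /lt_geF ->.
Qed.

Lemma Kb_mono t u : t <= u -> Kb P e b u <= Kb P e b t.
Proof.
move=> tu; rewrite /Kb fine_le ?fin_num_measure //; try exact: measurable_exceed.
apply: le_measure; rewrite ?inE; try exact: measurable_exceed.
by move=> w [j h]; exists j; exact: le_lt_trans h.
Qed.

(** Markov's inequality for the integrable bound on all coordinates of the Gaussian vector. Together
    with the lower bound it makes the infimum in [crit] a genuine one. *)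
Let A_ex : A !=set0.
Proof.
case/andP: al01 => al0 _.
pose C := (cG b + 1) * EX P e (@sqn R n).
have C0 : 0 <= C.
  rewrite mulr_ge0 ?addr_ge0 ?cG_ge0 // -(EX_cst P e 0).
  by apply: (EX_le e_meas e_normal); [exact: nice_cst|exact: nice_sqn|move=> v; exact: sqn_ge0].
pose t := C / al + 1.
have t0 : 0 < t by rewrite ltr_wpDl // divr_ge0 // ltW.
exists t; apply/A_Kb.
have : t * Kb P e b t <= C.
  have nI := nice_exceed_ind b t.
  rewrite (Kb_EX P e_meas) /C -(EXZ e_meas e_normal) // -(EXZ e_meas e_normal); last exact: nice_sqn.
  apply: (EX_le e_meas e_normal); [exact: niceZ|apply: niceZ; exact: nice_sqn|] => v.
  rewrite /exceed_ind; case: existsP => [[j tj]|_]; last by rewrite mulr0 mulr_ge0 ?sqn_ge0 // addr_ge0 ?cG_ge0.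
  rewrite mulr1; apply: le_trans (KG_le b v); apply: le_trans (gv_KG b v j).
  exact: le_trans (ltW tj) (ler_norm _).
move=> h; have : t * Kb P e b t <= t * al.
  by apply: le_trans h _; rewrite /t mulrDl divfK ?gt_eqF // mul1r lerDl ltW.
by rewrite ler_pM2l.
Qed.

Lemma rejects_of : Kb P e b (Tst s) <= al -> rejects al (shuffle zz s).
Proof. by move=> h; apply: ge_inf => //; exact/A_Kb. Qed.

(** The argument approximates the infimum by elements of the set, which reaches only thresholds
    strictly above the statistic; [calibration] is stated accordingly. *)
Lemma of_rejects : rejects al (shuffle zz s) -> forall t, Tst s < t -> Kb P e b t <= al.
Proof.
move=> rj t Tt; have it : inf A < t by exact: le_lt_trans rj Tt.
have [x Ax xt] := inf_lt A_ex it.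
by apply: le_trans (Kb_mono (ltW xt)) _; exact/A_Kb.
Qed.

End Critical.

Let zip (k : D) : (1 <= k.+1 <= d)%N. Proof. by rewrite ltn_ord. Qed.

Theorem fixed_sample (al : R) : 0 < al < 1 -> 0 <= epsS n m 'I_K 'I_d p B tau be be1 aa ->
  `|fprob (fun s => `[< rejects al (shuffle zz s) >]) - al| <=
  3 * epsS n m 'I_K 'I_d p B tau be be1 aa + nuS n m 'I_K 'I_d tau.
Proof.
move=> al01 eps0.
have tot k : total (le k) by move=> x y; exact: le_total.
have tr k : transitive (le k) by move=> x y z; exact: le_trans.
have tie k z : (#|[pred y | le k y z && le k z y]| <= p)%N.
  apply: leq_trans (zz_gp (dotp (dirs k) (zz z)) (dirs_sphere k)).
  by apply: subset_leq_card; apply/fintype.subsetP => y; rewrite !inE /le /dle eq_le.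
have K0 : (0 < #|'I_K|)%N by rewrite card_ord.
have D0 : (0 < #|D|)%N by rewrite card_ord.
have plip k x y := psi_lip (x := x) (y := y) (zip k); have psum k r := psi_sum (r := r) (zip k).
have psqr k r := psi_sqr (r := r) (zip k); have ple k x := psi_le (x := x) (zip k).
pose good := goodS n_gt0 le ps B tau.
have gt : fprob (predC good) <= nuS n m 'I_K 'I_d tau :> R.
  exact: (goodS_tail n_gt0 m_gt0 mn le ple B1 tau1).
have up s t : good s -> Kb P e (bcoef le ps s) t <= fprob (fun s => [exists j, t < Yst le ps s j]) + epsS n m 'I_K 'I_d p B tau be be1 aa.
  move=> gs; have h := (@Kb_upper _ _ _ P n m e n_gt0 m_gt0 mn e_meas e_indep e_normal 'I_K 'I_d le p K0 D0 tot tr tie ps B tau plip psum psqr ple B1 tau1 harm s gs be be1 aa be_gt0 be1_gt0 aa_ge0 be_dm t).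
  exact h.
have lo s t : good s -> fprob (fun s => [exists j, t <= Yst le ps s j]) <= Kb P e (bcoef le ps s) t + epsS n m 'I_K 'I_d p B tau be be1 aa.
  by move=> gs; exact: (@Kb_lower _ _ _ P n m e n_gt0 m_gt0 mn e_meas e_indep e_normal 'I_K 'I_d le p K0 D0 tot tr tie ps B tau plip psum psqr ple B1 tau1 harm s gs be be1 aa be_gt0 be1_gt0 aa_ge0 be_dm t).
have HE t : fprob (fun s => t <= Tst s) = fprob (fun s => [exists j, t <= Yst le ps s j]) :> R.
  by congr fprob; apply/funext => s; exact: le_Tst.
have HsE t : fprob (fun s => t < Tst s) = fprob (fun s => [exists j, t < Yst le ps s j]) :> R.
  by congr fprob; apply/funext => s; exact: lt_Tst.
have HsH t : fprob (fun s => t < Tst s) <= fprob (fun s => t <= Tst s) :> R.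
  by apply: fprob_sub => s; exact: ltW.
apply: (@calibration R {perm I} Tst (fun s => Kb P e (bcoef le ps s)) good _ _ _ al _ eps0 al01 _ _ gt).
- by apply/card_gt0P; exists 1%g.
- move=> s gs t; have h1 := up s t gs; have h2 := lo s t gs; have h3 := HsH t; rewrite -HE in h2; rewrite -HsE in h1.
  move: h1 h2 h3; set a1 := Kb _ _ _ _; set a2 := fprob _; set a3 := fprob _; set a4 := epsS _ _ _ _ _ _ _ _ _ _.
  by clearbody a1 a2 a3 a4 => h1 h2 h3; rewrite ler_norml; apply/andP; split; lra.
- move=> s gs t; have h1 := up s t gs; have h2 := lo s t gs; have h3 := HsH t; rewrite -HE in h2; rewrite -HsE in h1.
  move: h1 h2 h3; set a1 := Kb _ _ _ _; set a2 := fprob _; set a3 := fprob _; set a4 := epsS _ _ _ _ _ _ _ _ _ _.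
  by clearbody a1 a2 a3 a4 => h1 h2 h3; rewrite ler_norml; apply/andP; split; lra.
- by move=> s gs h; apply/asboolP; exact: rejects_of.
- by move=> s gs /asboolP; exact: of_rejects.
Qed.

End PooledSample.

(** * Averaging over the pooled sample *)

Section GeneralPositionEvent.
Context {dO : measure_display} {Omega : measurableType dO} {R : realType}.
Variable P : probability Omega R.
Variables (p' n m : nat).
Local Notation p := p'.+1.
Local Notation I := ('I_n + 'I_m)%type.
Variable Z : I -> Omega -> ('I_p -> R).
Hypothesis Z_meas : forall i c, measurable_fun setT (fun w => Z i w c).
Hypothesis Z_indep : mutually_independent P (fun i : I => events_vec (Z i)).
Hypothesis Z_ac : forall i B, borelRp B -> lebesgue_null B -> P (Z i @^-1` B) = 0%E.

Definition badZ : set Omega := \bigcup_(io in [set io : {ffun 'I_p.+1 -> I} | injective io])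
  [set w | \det (difM Z io p w) = 0].

Lemma measurable_badZ : measurable badZ.
Proof.
apply: fin_bigcup_measurable; first exact: finite_finset.
by move=> io _; exact: measurable_minor.
Qed.

Lemma badZ_prob0 : P badZ = 0%E.
Proof.
apply/eqP; rewrite eq_le measure_ge0 andbT.
pose F (k : nat) : set Omega := if (unpickle k : option {ffun 'I_p.+1 -> I}) is Some io then
  (if `[< injective io >] then [set w | \det (difM Z io p w) = 0] else set0) else set0.
have mF k : measurable (F k).
  by rewrite /F; case: unpickle => // io; case: asboolP => // _; exact: measurable_minor.
have F0 k : P (F k) = 0%E.
  rewrite /F; case: unpickle => [io|]; last by rewrite measure0.
  by case: asboolP => [ii|_]; [exact: minor_prob0|rewrite measure0].
have sub : badZ `<=` \bigcup_k F k.
  move=> w [io /= ii h]; exists (pickle io) => //; rewrite /F pickleK.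
  by case: asboolP.
have h : (P badZ <= \sum_(0 <= k <oo) P (F k))%E.
  by apply: measure_sigma_subadditive => //; exact: measurable_badZ.
by apply: le_trans h _; rewrite eseries0 // => k _ _; exact: F0.
Qed.

(** If [p + 1] points have the same projection on [u], then [u] is orthogonal to all their
    differences and the difference matrix is singular. *)
Lemma gen_pos_notin w : ~ badZ w -> gen_pos (fun i => Z i w).
Proof.
move=> nb u t su; rewrite leqNgt; apply/negP => big; apply: nb.
pose E := enum [pred y : I | dotp u (Z y w) == t].
have sE : (p < size E)%N by rewrite -cardE.
have /card_gt0P[z0 _] : (0 < #|[pred y : I | dotp u (Z y w) == t]|)%N by exact: leq_trans big.
pose io : {ffun 'I_p.+1 -> I} := [ffun k : 'I_p.+1 => nth z0 E k].
have lE (k : 'I_p.+1) : (k < size E)%N by apply: leq_trans (ltn_ord k) sE.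
have io_t k : dotp u (Z (io k) w) = t.
  by have := mem_nth z0 (lE k); rewrite mem_enum inE ffunE => /eqP.
exists io => /=.
  move=> i j; rewrite !ffunE => /eqP; rewrite nth_uniq ?enum_uniq // => /eqP h; exact: val_inj.
apply/eqP; rewrite -det_tr; apply/det0P; exists (\row_c u c).
  apply/eqP => u0; have := su; rewrite /sphere /= big1 => [/eqP|c _].
    by rewrite eq_sym oner_eq0.
  by have /rowP/(_ c) := u0; rewrite !mxE => ->; rewrite expr0n.
apply/rowP => i; rewrite !mxE.
transitivity (dotp u (Z (io (inord i.+1)) w) - dotp u (Z (io ord0) w)); last by rewrite !io_t subrr.
rewrite /dotp -sumrB; apply: eq_bigr => c _; rewrite !mxE /dif inord_val; ring.
Qed.

End GeneralPositionEvent.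

Section Exchangeability.
Context {dO : measure_display} {Omega : measurableType dO} {R : realType}.
Variable P : probability Omega R.
Variables (p : nat) (I : finType).
Variable Z : I -> Omega -> ('I_p -> R).
Hypothesis Z_meas : forall i c, measurable_fun setT (fun w => Z i w c).
Hypothesis Z_indep : mutually_independent P (fun i : I => events_vec (Z i)).
Hypothesis Z_ident : forall i j B, borelRp B -> P (Z i @^-1` B) = P (Z j @^-1` B).

Definition arr (s : {perm I}) (w : Omega) : arrT R p I := fun i => Z (s i) w.

Lemma measurable_arr s : measurable_fun setT (arr s).
Proof.
apply: (@measurability _ _ Omega (arrT R p I) setT (arr s) (@rects R p I) erefl).
move=> _ [_ [B bB ->] <-]; rewrite setTI.
rewrite (_ : _ @^-1` _ = \bigcap_(i in [set: I]) (Z (s i) @^-1` B i)).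
  apply: fin_bigcap_measurable; first exact: finite_finset.
  by move=> i _; apply: measurable_vec_preimage => //; exact: Z_meas.
by apply/seteqP; split => w /= h i => [_|]; [exact: h|exact: h].
Qed.

HB.instance Definition _ s := isMeasurableFun.Build _ _ _ _ (arr s) (measurable_arr s).

(** Rectangles form a generating pi-system, and on them the two laws agree by independence and
    identical distribution. *)
Lemma exchangeable s (A : set (arrT R p I)) : measurable A -> P (arr s @^-1` A) = P (arr 1%g @^-1` A).
Proof.
move=> mA.
pose m1 : probability (arrT R p I) R := distribution P (arr s).
pose m2 : probability (arrT R p I) R := distribution P (arr 1%g).
have rT : @rects R p I setT.
  by exists (fun=> setT) => [i|]; [exact: borelT|apply/seteqP; split].
apply: (@g_sigma_algebra_measure_unique _ R (arrT R p I) (@rects R p I) _ (fun=> setT) (fun=> rT) _ m1 m2) => //.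
- by move=> B rB; exact: sub_sigma_algebra.
- by rewrite bigcup_const //; exists 0%N.
- move=> _ _ [B bB ->] [B' bB' ->]; exists (fun i => B i `&` B' i).
    by move=> i; exact: (@measurableI _ (vecT R p) _ _ (bB i) (bB' i)).
  by apply/seteqP; split => zz /=; [move=> [h1 h2] i; split|move=> h; split => i; have [] := h i].
- move=> _ [B bB ->]; change (P (arr s @^-1` [set zz | forall i, B i (zz i)]) = P (arr 1%g @^-1` [set zz | forall i, B i (zz i)])).
  have prodE (r : {perm I}) : P (arr r @^-1` [set zz | forall i, B i (zz i)]) = (\prod_i P (Z i @^-1` B ((r^-1)%g i)))%E.
    have -> : arr r @^-1` [set zz | forall i, B i (zz i)] =
       \bigcap_(i in [set i | i \in [set: I]%SET]) (Z i @^-1` B ((r^-1)%g i)).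
      apply/seteqP; split => w /=.
        by move=> h i _ /=; have := h ((r^-1)%g i); rewrite /arr permKV.
      by move=> h i; have := h (r i); rewrite /= permK /arr; apply; rewrite inE.
    rewrite Z_indep; last by move=> i _; exists (B ((r^-1)%g i)).
    by apply: eq_bigl => i; rewrite inE.
  rewrite !prodE (reindex_inj (@perm_inj _ s)) /= [RHS](reindex_inj (@perm_inj _ 1%g)) /=.
  by apply: eq_bigr => i _; rewrite !permK; exact: Z_ident.
by move=> k; apply: (@le_lt_trans _ _ 1%E); [exact: (probability_le1 m1 measurableT)|exact: ltry].
Qed.

End Exchangeability.

Section PatternInvariance.
Context {dO : measure_display} {Omega : measurableType dO} {R : realType}.
Variable P : probability Omega R.
Variables (p n m d : nat) (e : 'I_n -> Omega -> R) (psi : nat -> R -> R).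
Local Notation I := ('I_n + 'I_m)%type.

Let cdfb (b : {ffun I * I -> bool}) (z : I) : R := (\sum_(i < n) (if b (inl i, z) then 1 else 0)) / n%:R.

Let ecdf_pat u (zz : I -> 'I_p -> R) z :
  ecdf (fun i => zz (inl i)) u (dotp u (zz z)) = cdfb (pat u zz) z.
Proof. by rewrite /ecdf /cdfb; congr (_ / _); apply: eq_bigr => i _; rewrite ffunE. Qed.

Let same (zz zz' : I -> 'I_p -> R) := forall b, @realized R p _ b zz <-> @realized R p _ b zz'.

Let Psi_max_pat zz zz' : same zz zz' ->
  Psi_max d psi (fun i => zz (inl i)) (fun j => zz (inr j)) = Psi_max d psi (fun i => zz' (inl i)) (fun j => zz' (inr j)).
Proof.
move=> zs; rewrite /Psi_max; congr (_ * sup _).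
suff h z1 z2 : same z1 z2 -> [set r | exists u k, sphere u /\ (1 <= k <= d)%N /\
    r = `| m%:R^-1 * \sum_(j < m) psi k (ecdf (fun i => z1 (inl i)) u (dotp u (z1 (inr j)))) | ] `<=`
   [set r | exists u k, sphere u /\ (1 <= k <= d)%N /\
    r = `| m%:R^-1 * \sum_(j < m) psi k (ecdf (fun i => z2 (inl i)) u (dotp u (z2 (inr j)))) | ].
  apply/seteqP; split; apply: h => // b; by have := zs b; tauto.
move=> s12 _ [u [k [su [kd ->]]]].
have [v sv vE] := (s12 (pat u z1)).1 (ex_intro2 _ _ u su erefl).
exists v, k; split => //; split => //; congr (`|_ * _|); apply: eq_bigr => j _.
by rewrite !ecdf_pat vE.
Qed.

Let Psi_MB_pat zz zz' es : same zz zz' ->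
  Psi_MB d psi (fun i => zz (inl i)) es = Psi_MB d psi (fun i => zz' (inl i)) es.
Proof.
move=> zs; rewrite /Psi_MB; congr (sup _).
suff h z1 z2 : same z1 z2 -> [set r | exists u k, sphere u /\ (1 <= k <= d)%N /\
    r = `| (Num.sqrt n%:R)^-1 * \sum_(i < n) es i * psi k (ecdf (fun i => z1 (inl i)) u (dotp u (z1 (inl i)))) | ] `<=`
   [set r | exists u k, sphere u /\ (1 <= k <= d)%N /\
    r = `| (Num.sqrt n%:R)^-1 * \sum_(i < n) es i * psi k (ecdf (fun i => z2 (inl i)) u (dotp u (z2 (inl i)))) | ].
  apply/seteqP; split; apply: h => // b; by have := zs b; tauto.
move=> s12 _ [u [k [su [kd ->]]]].
have [v sv vE] := (s12 (pat u z1)).1 (ex_intro2 _ _ u su erefl).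
exists v, k; split => //; split => //; congr (`|_ * _|); apply: eq_bigr => j _.
by rewrite !ecdf_pat vE.
Qed.

(** For every direction on one array there is a direction on the other with the same order pattern,
    hence with the same empirical distribution values; so both suprema coincide. *)
Lemma rejects_pat al (zz zz' : I -> 'I_p -> R) : (forall b, @realized R p _ b zz <-> @realized R p _ b zz') ->
  rejects P d e psi al zz -> rejects P d e psi al zz'.
Proof.
move=> zs; rewrite /rejects (Psi_max_pat zs) (_ : crit _ _ _ _ _ _ = crit P d e psi al (fun i => zz' (inl i))) //.
rewrite /crit; congr inf; apply/funext => t /=; congr (is_true (P _ <= _)%E).
by apply/funext => w /=; rewrite (Psi_MB_pat _ zs).
Qed.

End PatternInvariance.

Section SingleSampleSize.
Context {dO : measure_display} {Omega : measurableType dO} {R : realType}.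
Variable P : probability Omega R.
Variables (p' n m d : nat) (e : 'I_n -> Omega -> R) (psi : nat -> R -> R).
Local Notation p := p'.+1.
Local Notation I := ('I_n + 'I_m)%type.
Variable Z : I -> Omega -> ('I_p -> R).
Hypothesis Z_meas : forall i c, measurable_fun setT (fun w => Z i w c).
Hypothesis Z_indep : mutually_independent P (fun i : I => events_vec (Z i)).
Hypothesis Z_ac : forall i B, borelRp B -> lebesgue_null B -> P (Z i @^-1` B) = 0%E.
Hypothesis Z_ident : forall i j B, borelRp B -> P (Z i @^-1` B) = P (Z j @^-1` B).
Variables (al E : R).
Hypothesis al01 : 0 < al < 1.
Hypothesis E_ge0 : 0 <= E.
Hypothesis fixed : forall zz : I -> 'I_p -> R, gen_pos zz ->
  `|fprob (fun s => `[< rejects P d e psi al (shuffle zz s) >]) - al| <= E.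

Lemma Rintegral_sum_indic (K : Type) (r : seq K) (A : K -> set Omega) : (forall k, measurable (A k)) ->
  P.-integrable setT (EFin \o (fun w => \sum_(k <- r) \1_(A k) w)) /\
  \int[P]_w (\sum_(k <- r) \1_(A k) w) = \sum_(k <- r) fine (P (A k)).
Proof.
move=> mA; elim: r => [|k r [ih1 ih2]].
  rewrite (_ : (fun w => \sum_(k <- [::]) _) = cst 0); last by apply/funext => w; rewrite big_nil.
  split; first exact: finite_measure_integrable_cst.
  by rewrite big_nil /= Rintegral_cst // mul0r.
have iA := integrable_indic P (mA k).
rewrite (_ : (fun w => \sum_(k <- k :: r) _) = (fun w => \1_(A k) w + \sum_(k <- r) \1_(A k) w)); last first.
  by apply/funext => w; rewrite big_cons.
split; first exact: (integrableD measurableT iA ih1).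
rewrite RintegralD // ih2 big_cons; congr (_ + _).
by rewrite /Rintegral integral_indic // setIT.
Qed.

(** By exchangeability all relabelled rejection events have the same probability. Their sum is
    integrated, and for each sample in general position it is controlled by the fixed-sample
    bound. *)
Theorem single_sample_size :
  `|fine (P [set w | rejects P d e psi al (fun i => Z i w)]) - al| <= E.
Proof.
pose A : set (arrT R p I) := [set zz | rejects P d e psi al zz].
have mA : measurable A by apply: measurable_pattern_event => zz zz'; exact: rejects_pat.
pose As (s : {perm I}) : set Omega := [set w | rejects P d e psi al (shuffle (fun i => Z i w) s)].
have AsE s : As s = arr Z (s^-1)%g @^-1` A by [].
have mAs s : measurable (As s).
  by rewrite AsE -[X in measurable X]setTI; exact: (measurable_arr Z_meas).
have PAs s : P (As s) = P [set w | rejects P d e psi al (fun i => Z i w)].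
  rewrite AsE (exchangeable Z_meas Z_indep Z_ident _ mA); congr (P _).
  by apply/seteqP; split => w; rewrite /arr /= (_ : (fun i => Z ((1%g : {perm I}) i) w) = (fun i => Z i w)) //; apply/funext => i; rewrite perm1.
pose M := #|{: {perm I}}|.
have M0 : 0 < M%:R :> R by rewrite ltr0n; apply/card_gt0P; exists 1%g.
have [iS IS] := Rintegral_sum_indic (enum {: {perm I}}) mAs.
pose q := fine (P [set w | rejects P d e psi al (fun i => Z i w)]).
have {}IS : \int[P]_w (\sum_(s <- enum {: {perm I}}) \1_(As s) w) = M%:R * q.
  rewrite IS (eq_bigr (fun=> q)); last by move=> s _; rewrite PAs.
  by rewrite big_const_seq count_predT -cardE iter_addr_0 mulr_natl.
have mb := measurable_badZ Z_meas.
have b0 : fine (P (badZ Z)) = 0 by rewrite (badZ_prob0 Z_meas Z_indep Z_ac).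
have ib := integrable_indic P mb.
have Ib : \int[P]_w \1_(badZ Z) w = 0 by rewrite /Rintegral integral_indic // setIT.
have icst k c : P.-integrable setT (EFin \o (fun w => k + c * \1_(badZ Z) w)).
  have i1 : P.-integrable setT (EFin \o cst k) by exact: finite_measure_integrable_cst.
  have i2 : P.-integrable setT (fun w => c%:E * (\1_(badZ Z) w)%:E)%E by exact: integrableZl.
  exact: (integrableD measurableT i1 i2).
have Icst k c : \int[P]_w (k + c * \1_(badZ Z) w) = k.
  have i1 : P.-integrable setT (EFin \o cst k) by exact: finite_measure_integrable_cst.
  have i2 : P.-integrable setT (EFin \o (fun w => c * \1_(badZ Z) w)).
    have i3 : P.-integrable setT (fun w => c%:E * (\1_(badZ Z) w)%:E)%E by exact: integrableZl.
    exact: i3.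
  rewrite (RintegralD measurableT i1 i2) RintegralZl // Ib mulr0 addr0.
  transitivity (k * fine (P setT)); first exact: Rintegral_cst.
  by rewrite probability_setT mulr1.
have fE w : \sum_(s <- enum {: {perm I}}) \1_(As s) w =
    M%:R * fprob (fun s => `[< rejects P d e psi al (shuffle (fun i => Z i w) s) >]) :> R.
  rewrite /fprob /fmean -/M mulrA divff ?gt_eqF // mul1r big_enum /=; apply: eq_bigr => s _.
  by rewrite indicE; congr (_%:R); congr nat_of_bool; apply/idP/asboolP; rewrite in_setE.
have close w : `|fprob (fun s => `[< rejects P d e psi al (shuffle (fun i => Z i w) s) >]) - al| <= E \/ badZ Z w.
  by have [|nb] := pselect (badZ Z w); [right|left; apply: fixed; exact: gen_pos_notin].
case/andP: al01 => al0 al1; have E0 := E_ge0.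
have S_gt0 : (0 < #|{: {perm I}}|)%N by apply/card_gt0P; exists 1%g.
(* On the null event of degenerate samples the trivial bounds 0 and 1 take over; the indicator that
   pays for them integrates to 0. *)
have bnd w : al - E - \1_(badZ Z) w <= fprob (fun s => `[< rejects P d e psi al (shuffle (fun i => Z i w) s) >])
   <= al + E + \1_(badZ Z) w.
  have [|bw] := close w.
    have i0 : 0 <= \1_(badZ Z) w :> R by rewrite indicE.
    by rewrite ler_norml => /andP[h1 h2]; apply/andP; split; lra.
  have -> : \1_(badZ Z) w = 1 :> R by rewrite indicE mem_set.
  have h0 : 0 <= fprob (fun s => `[< rejects P d e psi al (shuffle (fun i => Z i w) s) >]) :> R := fprob_ge0 _.
  have h1 : fprob (fun s => `[< rejects P d e psi al (shuffle (fun i => Z i w) s) >]) <= 1 :> R := fprob_le1 R S_gt0 _.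
  by apply/andP; split; lra.
have up : M%:R * q <= M%:R * (al + E).
  rewrite -IS -[leRHS](Icst _ M%:R); apply: le_Rintegral => // w _.
  by rewrite fE -mulrDr ler_pM2l //; have /andP[] := bnd w.
have lo : M%:R * (al - E) <= M%:R * q.
  rewrite -IS -[leLHS](Icst _ (- M%:R)); apply: le_Rintegral => // w _.
  by rewrite fE mulNr -mulrBr ler_pM2l //; have /andP[] := bnd w.
rewrite ler_pM2l // in up; rewrite ler_pM2l // in lo.
by rewrite -/q ler_norml; apply/andP; split; lra.
Qed.

End SingleSampleSize.

(** * Rates *)

Section Rates.
Variable R : realType.
Variables (kc y v : R).
Hypotheses (kc1 : 1 <= kc) (y0 : 0 < y) (v0 : 0 < v) (v1 : v <= 1).
Let k1 : R := 12 * kc.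
Hypothesis yk : y * k1 <= 1.

Let kc0 : 0 <= kc.
Proof. exact: le_trans ler01 kc1. Qed.
Let k1_ge1 : 1 <= k1.
Proof. by rewrite /k1; have := kc1; lra. Qed.
Let k1_ge0 : 0 <= k1.
Proof. exact: le_trans ler01 k1_ge1. Qed.
Let kck : kc <= k1.
Proof. by rewrite /k1; have := kc1; lra. Qed.
Let y1 : y <= 1.
Proof. by apply: le_trans yk; rewrite ler_peMr ?(ltW y0) ?k1_ge1. Qed.
Let yX n : y ^+ n.+1 <= y.
Proof. by rewrite exprS ler_piMr ?(ltW y0) // exprn_ile1 ?(ltW y0). Qed.
Let vX n : v ^+ n <= 1.
Proof. exact: exprn_ile1 (ltW v0) v1. Qed.
Let vX0 n : 0 <= v ^+ n.
Proof. exact: exprn_ge0 (ltW v0). Qed.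
Let yX0 n : 0 <= y ^+ n.
Proof. exact: exprn_ge0 (ltW y0). Qed.

(** Once y^4 sqrt n = B L^7 and v = 1 / L, this is B L / sqrt n, the common size of all covariance
    errors. *)
Definition zr : R := y ^+ 4 * v ^+ 6.

Let zy : zr <= y.
Proof. by apply: le_trans (yX 3); rewrite ler_piMr. Qed.
Let zk : k1 * zr <= 1.
Proof. by apply: le_trans yk; rewrite mulrC ler_wpM2r. Qed.

Lemma cov_rates (om rho b1 b2 : R) : 0 <= om <= kc * zr -> 0 <= rho <= kc * zr ->
  0 <= b1 <= kc * zr -> 0 <= b2 <= kc * zr ->
  [/\ 0 <= om + rho * (2 + b2 + om + rho) + b2 <= k1 * zr,
      0 <= om + (om + b1) ^+ 2 + (om + rho * (2 + b2 + om + rho)) <= k1 * zr &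
      b2 <= 1].
Proof.
move=> /andP[om0 om1] /andP[r0 r1] /andP[b10 b11] /andP[b20 b21].
have kz : 12 * (kc * zr) <= 1 by rewrite mulrA; exact: zk.
have q1 : (om + b1) ^+ 2 <= 2 * (om + b1).
  by rewrite expr2 ler_wpM2r ?addr_ge0 //; lra.
have q2 : rho * (2 + b2 + om + rho) <= 5 * rho.
  by rewrite mulrC ler_wpM2r //; lra.
have q3 : 0 <= rho * (2 + b2 + om + rho) by rewrite mulr_ge0 // !addr_ge0.
have q4 := sqr_ge0 (om + b1).
have -> : k1 * zr = 12 * (kc * zr) by rewrite /k1 mulrA.
by split; [apply/andP; split; lra|apply/andP; split; lra|lra].
Qed.

Let be : R := (v ^+ 3 * y)^-1.

Definition ctot : R := 640 * (100 * k1 ^+ 3).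

Let e3 : expR 3 <= 64 :> R.
Proof.
have h1 := @expR_ge1Dx R (- (2^-1)); have h2 : 1 + - 2^-1 = 2^-1 :> R by field.
rewrite h2 expRN in h1.
have g0 : 0 < expR (2^-1) :> R by exact: expR_gt0.
have h3 : expR (2^-1) <= 2 :> R.
  by rewrite -[expR _]invrK -[leRHS]invrK lef_pV2 ?posrE ?invr_gt0.
have -> : 3 = 6%:R * 2^-1 :> R by field.
rewrite expRM_natl (_ : 64 = 2 ^+ 6); last by ring.
by rewrite ler_pXn2r ?nnegrE // ltW.
Qed.

(** Power counting with [be] = 1 / (v^3 y): up to constants the window term is (1 / v) (y v) = y,
    the covariance term y^3 v^2 and the cubic term y^2. *)
Lemma eps_rates (eta Dl V0 v0' dm nu Mb r aa dl : R) :
  0 <= eta <= k1 * zr -> 0 <= Dl <= k1 * zr ->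
  0 <= V0 -> 0 <= nu -> be ^+ 2 * (V0 * nu) <= kc * y -> nu <= kc * y ->
  0 <= v0' <= kc -> 0 <= dm <= kc * (y ^+ 4 * v ^+ 7) ->
  0 <= Mb <= 10 / v -> 0 <= r <= kc * (y ^+ 4 * v ^+ 3) ->
  aa = 6 * (y * v) -> 0 <= dl <= y ->
  let Lb := Mb / be + 2 * eta in
  let cmp := 3 * be ^+ 2 * (Dl * Lb + V0 * nu) + 13 * expR 3 * be ^+ 3 * dm * v0' * Lb in
  let eps := nu + 2 * dl + 2 * cmp + (Mb + 2 * eta * be) * (r + 2 * aa) in
  0 <= eps /\ 3 * eps + nu <= ctot * y.
Proof.
move=> /andP[e0 e1] /andP[D0 D1] V00 nu0 Vn nuy /andP[w0 w1] /andP[d0 d1] /andP[M0 M1] /andP[r0 r1] aaE /andP[l0 l1] Lb cmp eps.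
have vy0 : 0 < v ^+ 3 * y by rewrite mulr_gt0 // exprn_gt0.
have be0 : 0 < be by rewrite invr_gt0.
have b20 : 0 <= be ^+ 2 by rewrite exprn_ge0 // ltW.
have b30 : 0 <= be ^+ 3 by rewrite exprn_ge0 // ltW.
have Lb0 : 0 <= Lb by rewrite /Lb addr_ge0 ?divr_ge0 ?(ltW be0) // mulr_ge0.
have zle : zr <= y * v ^+ 2.
  rewrite /zr (_ : 6%N = (4 + 2)%N) // exprD mulrA; apply: ler_wpM2r => //.
  by apply: le_trans (yX 3); rewrite ler_piMr.
have LbE : Lb <= 12 * k1 * (y * v ^+ 2).
  have h1 : Mb / be <= 10 * (y * v ^+ 2).
    rewrite invrK; apply: le_trans (ler_wpM2r (ltW vy0) M1) _.
    by rewrite le_eqVlt; apply/orP; left; apply/eqP; field; rewrite gt_eqF.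
  have h2 : k1 * zr <= k1 * (y * v ^+ 2) by rewrite ler_wpM2l.
  have h3 : y * v ^+ 2 <= k1 * (y * v ^+ 2) by rewrite ler_peMl // mulr_ge0 // ltW.
  rewrite /Lb -mulrA; lra.
have p1 : be ^+ 2 * (Dl * Lb) <= 12 * k1 ^+ 2 * y.
  apply: (@le_trans _ _ (be ^+ 2 * (k1 * zr * (12 * k1 * (y * v ^+ 2))))).
    by rewrite ler_wpM2l // ler_pM.
  rewrite (_ : _ * _ = 12 * k1 ^+ 2 * (y ^+ 3 * v ^+ 2)); last by rewrite /be /zr; field; rewrite !gt_eqF.
  rewrite ler_wpM2l ?mulr_ge0 ?exprn_ge0 //.
  by apply: le_trans (yX 2); rewrite ler_piMr.
have ee := expR_ge0 (3 : R).
have p2 : 13 * expR 3 * be ^+ 3 * dm * v0' * Lb <= (13 * 64 * 12) * (kc ^+ 2 * k1) * y.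
  apply: (@le_trans _ _ (13 * 64 * be ^+ 3 * (kc * (y ^+ 4 * v ^+ 7)) * kc * (12 * k1 * (y * v ^+ 2)))).
    have g1 : 0 <= 13 * expR 3 * be ^+ 3 by rewrite mulr_ge0 // mulr_ge0.
    have g2 : 0 <= 13 * expR 3 * be ^+ 3 * dm by rewrite mulr_ge0.
    have g3 : 0 <= 13 * expR 3 * be ^+ 3 * dm * v0' by rewrite mulr_ge0.
    apply: ler_pM => //; apply: ler_pM => //; apply: ler_pM => //.
    by rewrite ler_wpM2r // ler_pM2l // e3.
  rewrite (_ : _ * _ = (13 * 64 * 12) * (kc ^+ 2 * k1) * y ^+ 2); last by rewrite /be; field; rewrite !gt_eqF.
  by rewrite ler_wpM2l ?mulr_ge0 ?exprn_ge0.
have c10 : 0 <= 3 * be ^+ 2 * (Dl * Lb + V0 * nu) by apply: mulr_ge0; [rewrite mulr_ge0|apply: addr_ge0; rewrite mulr_ge0].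
have c20 : 0 <= 13 * expR 3 * be ^+ 3 * dm * v0' * Lb.
  by rewrite mulr_ge0 // mulr_ge0 // mulr_ge0 // mulr_ge0 // mulr_ge0.
have cmp0 : 0 <= cmp by rewrite /cmp addr_ge0.
have cmpE : cmp <= 3 * (12 * k1 ^+ 2 * y + kc * y) + (13 * 64 * 12) * (kc ^+ 2 * k1) * y.
  rewrite /cmp; apply: lerD => //.
  by rewrite -mulrA ler_pM2l // mulrDr lerD.
have p3 : Mb + 2 * eta * be <= 12 * k1 / v.
  have h1 : eta * be <= k1 / v.
    apply: le_trans (ler_wpM2r (ltW be0) e1) _.
    rewrite (_ : _ * be = k1 * (y ^+ 3 * v ^+ 3)); last by rewrite /be /zr; field; rewrite !gt_eqF.
    rewrite ler_wpM2l //; apply: (@le_trans _ _ 1).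
      by rewrite -[leRHS]mulr1 ler_pM // exprn_ile1 // ltW.
    by rewrite invf_ge1.
  have h2 : 10 / v <= 10 * (k1 / v).
    by rewrite ler_pM2l // -[leLHS]mul1r ler_pM2r ?invr_gt0.
  rewrite (_ : 12 * k1 / v = 12 * (k1 / v)); last by rewrite mulrA.
  rewrite -[2 * eta * be]mulrA; move: (k1 / v) (eta * be) (10 / v) h1 h2 M1 => q1 q2 q3 *; lra.
have yv0 : 0 <= y * v by rewrite mulr_ge0 // ltW.
have p4 : r + 2 * aa <= 13 * (k1 * (y * v)).
  have h1 : y ^+ 4 * v ^+ 3 <= y * v.
    by apply: ler_pM => //; rewrite exprS ler_piMr // ?(ltW v0).
  have h2 : r <= k1 * (y * v).
    by apply: le_trans r1 _; rewrite ler_pM // mulr_ge0.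
  have h3 : y * v <= k1 * (y * v) by rewrite ler_peMl.
  rewrite aaE; lra.
have aa0 : 0 <= aa by rewrite aaE mulr_ge0.
have m0 : 0 <= Mb + 2 * eta * be by rewrite addr_ge0 // mulr_ge0 ?(ltW be0) // mulr_ge0.
have ra0 : 0 <= r + 2 * aa by rewrite addr_ge0 // mulr_ge0.
have p50 : 0 <= (Mb + 2 * eta * be) * (r + 2 * aa) by rewrite mulr_ge0.
have p5 : (Mb + 2 * eta * be) * (r + 2 * aa) <= 156 * k1 ^+ 2 * y.
  apply: (@le_trans _ _ (12 * k1 / v * (13 * (k1 * (y * v))))); first by apply: ler_pM.
  by rewrite le_eqVlt; apply/orP; left; apply/eqP; field; rewrite gt_eqF.
split; first by rewrite /eps addr_ge0 // addr_ge0 ?mulr_ge0 // addr_ge0 // mulr_ge0.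
have K1 : 1 <= k1 ^+ 2 by rewrite exprn_ege1.
have t1 : k1 ^+ 2 * y <= k1 ^+ 3 * y by rewrite ler_pM2r // [leRHS]exprS ler_peMl // exprn_ge0.
have t2 : kc ^+ 2 * k1 * y <= k1 ^+ 3 * y.
  by rewrite ler_pM2r // [leRHS]exprSr ler_wpM2r // ler_pXn2r ?nnegrE.
have t0 : k1 * y <= k1 ^+ 3 * y by rewrite ler_pM2r // [leRHS]exprS ler_peMr.
have t3 : kc * y <= k1 ^+ 3 * y by apply: le_trans t0; rewrite ler_pM2r.
have t4 : y <= k1 ^+ 3 * y by apply: le_trans t0; rewrite ler_peMl // ltW.
have ctE : ctot * y = 640 * (100 * (k1 ^+ 3 * y)) by rewrite /ctot !mulrA.
rewrite ctE /eps; move: cmpE p5 t1 t2 t3 t4 nuy l1.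
rewrite -![12 * k1 ^+ 2 * y]mulrA -![(13 * 64 * 12) * _ * y]mulrA -![156 * _ * y]mulrA.
move: (cmp) ((Mb + 2 * eta * be) * (r + 2 * aa)) (k1 ^+ 3 * y) (k1 ^+ 2 * y) (kc ^+ 2 * k1 * y) (kc * y) => c1 c2 c3 c4 c5 c6.
move=> *; lra.
Qed.

End Rates.

Section ConcreteRates.
Variables (R : realType) (n m p K d : nat) (c B y : R).
Hypotheses (n_gt0 : (0 < n)%N) (m_gt0 : (0 < m)%N) (mn : (m <= n)%N) (p_gt0 : (0 < p)%N).
Hypotheses (K_gt0 : (0 < K)%N) (K_le : (K <= (((n + m) * (n + m)).+1) ^ p)%N) (d_gt0 : (0 < d)%N) (d_le : (d <= n)%N).
Hypotheses (c_ge1 : 1 <= c) (nm_c : n%:R <= c * m%:R :> R).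
Variable lam : R.
Hypothesis lamE : lam = ln n%:R.
Hypothesis lam4 : 4 <= lam.
Variable ell : R.
Hypothesis ellE : ell = p%:R * lam.
Variable L : R.
Hypothesis LE : L = Num.sqrt ell.
Variable s : R.
Hypothesis sE : s = Num.sqrt n%:R.
Hypothesis B_ge1 : 1 <= B.
Hypothesis y_gt0 : 0 < y.
Hypothesis yE : y ^+ 4 * s = B * L ^+ 7.
Variable kc : R.
Hypothesis kcE : kc = 1000 * (300 * c ^+ 2).
Hypothesis yk : y * (12 * kc) <= 1.
Variable v : R.
Hypothesis vE : v = L^-1.
Variable tau : R.
Hypothesis tauE : tau = 5 * L.
Variable be : R.
Hypothesis beE : be = (v ^+ 3 * y)^-1.
Variable aa : R.
Hypothesis aaE : aa = 6 * (y * v).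
Local Notation N := #|{: 'I_n + 'I_m}|.

Let nR : 0 < n%:R :> R.
Proof. by rewrite ltr0n. Qed.
Let mR : 0 < m%:R :> R.
Proof. by rewrite ltr0n. Qed.
Let p1 : 1 <= p%:R :> R.
Proof. by rewrite ler1n. Qed.
Let lam_ell : lam <= ell.
Proof. by rewrite ellE ler_peMl //; have := lam4; lra. Qed.
Let ell4 : 4 <= ell.
Proof. exact: le_trans lam4 lam_ell. Qed.
Let ell0 : 0 <= ell.
Proof. by have := ell4; lra. Qed.
Let L2 : L ^+ 2 = ell.
Proof. by rewrite LE sqr_sqrtr. Qed.
Let L1 : 1 <= L.
Proof. by rewrite LE -[leLHS]sqrtr1 ler_sqrt //; have := ell4; lra. Qed.
Let L0 : 0 < L.
Proof. exact: lt_le_trans ltr01 L1. Qed.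
Let v0 : 0 < v.
Proof. by rewrite vE invr_gt0. Qed.
Let v1 : v <= 1.
Proof. by rewrite vE invf_le1. Qed.
Let s2 : s ^+ 2 = n%:R.
Proof. by rewrite sE sqr_sqrtr // ltW. Qed.
Let s1 : 1 <= s.
Proof. by rewrite sE -[leLHS]sqrtr1 ler_sqrt ?ler0n // ler1n. Qed.
Let s0 : 0 < s.
Proof. exact: lt_le_trans ltr01 s1. Qed.
Let B0 : 0 < B.
Proof. exact: lt_le_trans ltr01 B_ge1. Qed.
Let c0 : 0 < c.
Proof. exact: lt_le_trans ltr01 c_ge1. Qed.
Let c2 : c <= c ^+ 2.
Proof. by rewrite expr2 ler_peMl // ltW. Qed.
Let kcc : 300 * c <= kc /\ 1 <= kc.
Proof. by have := c2; have := c_ge1; rewrite kcE => *; split; lra. Qed.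
Let kc1 : 1 <= kc.
Proof. by case: kcc. Qed.
Let y1 : y <= 1.
Proof.
apply: le_trans yk; rewrite ler_peMr ?(ltW y_gt0) //.
by have := kc1; lra.
Qed.
Let NE : N%:R = n%:R + m%:R :> R.
Proof. by rewrite cardI natrD. Qed.
Let NR : 0 < N%:R :> R.
Proof. by rewrite NE addr_gt0. Qed.
Let nN : n%:R <= N%:R :> R.
Proof. by rewrite NE lerDl ltW. Qed.
Let sN : s <= Num.sqrt N%:R.
Proof. by rewrite sE ler_sqrt // ltW. Qed.
Let isN : (Num.sqrt N%:R)^-1 <= s^-1.
Proof. by rewrite lef_pV2 ?posrE // sqrtr_gt0. Qed.
Let Bs : B / s = y ^+ 4 * v ^+ 7.
Proof.
apply: (mulIf (x := s)); first by rewrite gt_eqF.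
rewrite divfK ?gt_eqF // mulrAC yE vE exprVn -mulrA divff ?mulr1 // gt_eqF //.
by rewrite exprn_gt0.
Qed.
Let zE : zr y v = B / s * L.
Proof. by rewrite Bs /zr vE; field; rewrite gt_eqF. Qed.
Let z0 : 0 <= zr y v.
Proof. by rewrite zE mulr_ge0 ?divr_ge0 ?(ltW B0) ?(ltW s0) ?(ltW L0). Qed.
Let nmc : n%:R / m%:R <= c.
Proof. by rewrite ler_pdivrMr. Qed.
Let qc : Num.sqrt (n%:R / m%:R) <= c.
Proof.
rewrite -(@ler_pXn2r _ 2) ?nnegrE // ?(ltW c0) // sqr_sqrtr ?divr_ge0 ?ler0n //.
exact: le_trans nmc c2.
Qed.
Let k0 : 0 < kap R n m.
Proof. exact: kap_gt0. Qed.
Let kapV : (kap R n m)^-1 <= 2 * c / s.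
Proof.
rewrite -(@ler_pXn2r _ 2) ?nnegrE ?invr_ge0 ?(ltW k0) ?divr_ge0 ?mulr_ge0 ?(ltW c0) ?(ltW s0) //.
rewrite exprVn kap2 expr_div_n s2 invf_div exprMn.
rewrite ler_pdivrMr ?mulr_gt0 // mulrA mulrAC [leRHS]mulrAC divfK ?gt_eqF //.
have nm : m%:R <= n%:R :> R by rewrite ler_nat.
have h : 2 * n%:R <= 4 * c ^+ 2 * m%:R.
  apply: (@le_trans _ _ (2 * (c * m%:R))); first by rewrite ler_pM2l.
  have : c * m%:R <= c ^+ 2 * m%:R by rewrite ler_pM2r.
  have : 0 <= c ^+ 2 * m%:R by rewrite mulr_ge0 ?sqr_ge0 // ltW.
  by rewrite -[4 * _ * _]mulrA; lra.
have -> : 2 ^+ 2 = 4 :> R by ring.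
by move: h nm; lra.
Qed.
Let LX k : L <= L ^+ k.+1.
Proof. by rewrite exprS ler_peMr ?(ltW L0) // exprn_ege1. Qed.
Let Ls : L <= s.
Proof.
apply: le_trans (LX 6) _; apply: (@le_trans _ _ (B * L ^+ 7)); first by rewrite ler_peMl // exprn_ge0 // ltW.
by rewrite -yE ler_piMl ?(ltW s0) // exprn_ile1 // ltW.
Qed.
Let pL : p%:R <= L ^+ 2.
Proof. by rewrite L2 ellE ler_peMr ?ler0n //; have := lam4; lra. Qed.

Let om : R := 16 * (8 * B) * Num.sqrt (n%:R / m%:R) * tau / kap R n m.
Let rho : R := B * (p%:R / n%:R + 16 * tau / Num.sqrt N%:R).
Let b1 : R := B / N%:R.
Let b2 : R := 4 * B ^+ 2 / N%:R.

Let om_b : 0 <= om <= kc * zr y v.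
Proof.
have t0 : 0 <= tau by rewrite tauE mulr_ge0 // ltW.
apply/andP; split; first by rewrite /om divr_ge0 ?(ltW k0) // mulr_ge0 // mulr_ge0 // mulr_ge0 // mulr_ge0 // ltW.
apply: (@le_trans _ _ (16 * (8 * B) * c * tau * (2 * c / s))).
  rewrite /om; apply: ler_pM => //; rewrite ?invr_ge0 ?(ltW k0) //.
    by rewrite mulr_ge0 // mulr_ge0 // mulr_ge0 // mulr_ge0 // ltW.
  by rewrite ler_wpM2r // ler_wpM2l // mulr_ge0 // mulr_ge0 // ltW.
rewrite (_ : _ * _ = 1280 * (c ^+ 2 * zr y v)); last by rewrite zE tauE; field; rewrite gt_eqF.
have w0 : 0 <= c ^+ 2 * zr y v by rewrite mulr_ge0 ?sqr_ge0.
have fin (w : R) : 0 <= w -> 1280 * w <= 1000 * (300 * w) by lra.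
rewrite kcE (_ : 1000 * (300 * c ^+ 2) * zr y v = 1000 * (300 * (c ^+ 2 * zr y v))); last by rewrite !mulrA.
exact: (fin _ w0).
Qed.

Let c2z : zr y v <= c ^+ 2 * zr y v.
Proof. by rewrite ler_peMl // exprn_ege1. Qed.

Let rho_b : 0 <= rho <= kc * zr y v.
Proof.
have t0 : 0 <= tau by rewrite tauE mulr_ge0 // ltW.
have sq0 : 0 <= (Num.sqrt N%:R)^-1 :> R by rewrite invr_ge0 sqrtr_ge0.
apply/andP; split.
  rewrite /rho mulr_ge0 ?(ltW B0) // addr_ge0 ?divr_ge0 ?ler0n //.
  by rewrite mulr_ge0 // mulr_ge0.
have h1 : p%:R / n%:R <= L / s.
  rewrite -s2; apply: (@le_trans _ _ (L ^+ 2 / s ^+ 2)).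
    by rewrite ler_wpM2r // invr_ge0 exprn_ge0 // ltW.
  rewrite -expr_div_n expr2 ler_piMl ?divr_ge0 ?(ltW L0) ?(ltW s0) //.
  by rewrite ler_pdivrMr // mul1r.
have h2 : 16 * tau / Num.sqrt N%:R <= 80 * (L / s).
  rewrite (_ : 80 * (L / s) = 16 * tau / s); last by rewrite tauE; ring.
  by rewrite ler_wpM2l // mulr_ge0.
apply: (@le_trans _ _ (81 * zr y v)).
  rewrite zE (_ : 81 * _ = B * (81 * (L / s))); last by ring.
  by rewrite /rho ler_pM2l //; move: (L / s) (p%:R / n%:R) (16 * tau / _) h1 h2 => *; lra.
have fin (w z : R) : 0 <= z -> z <= w -> 81 * z <= 1000 * (300 * w) /\ 4 * z <= 1000 * (300 * w) by lra.
rewrite kcE (_ : 1000 * (300 * c ^+ 2) * zr y v = 1000 * (300 * (c ^+ 2 * zr y v))); last by rewrite !mulrA.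
exact: (fin _ _ z0 c2z).1.
Qed.

Let Bs1 : B / s <= 1.
Proof.
rewrite Bs -[leRHS]mulr1 ler_pM ?exprn_ge0 ?(ltW y_gt0) ?(ltW v0) // exprn_ile1 //; exact: ltW.
Qed.

Let Bsz : B / s <= zr y v.
Proof. by rewrite zE ler_peMr // divr_ge0 // ltW. Qed.

Let b1_b : 0 <= b1 <= kc * zr y v.
Proof.
apply/andP; split; first by rewrite divr_ge0 ?(ltW NR) ?(ltW B0).
apply: (@le_trans _ _ (zr y v)); last by rewrite ler_peMl.
apply: le_trans Bsz; rewrite /b1 ler_pM2l // lef_pV2 ?posrE //.
by apply: (le_trans _ nN); rewrite -s2 expr2 ler_peMl // ltW.
Qed.

Let b2_b : 0 <= b2 <= kc * zr y v.
Proof.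
apply/andP; split; first by rewrite divr_ge0 ?(ltW NR) // mulr_ge0 // sqr_ge0.
have Bs0 : 0 <= B / s by rewrite divr_ge0 // ltW.
apply: (@le_trans _ _ (4 * (B / s) ^+ 2)).
  rewrite /b2 -mulrA ler_pM2l // expr_div_n s2 ler_wpM2l ?sqr_ge0 //.
  by rewrite lef_pV2 ?posrE.
apply: (@le_trans _ _ (4 * zr y v)).
  by rewrite ler_pM2l // expr2; apply: le_trans Bsz; rewrite ler_piMl.
have fin (w z : R) : 0 <= z -> z <= w -> 81 * z <= 1000 * (300 * w) /\ 4 * z <= 1000 * (300 * w) by lra.
have [_ h2] := fin _ _ z0 c2z; apply: le_trans h2 _; by rewrite kcE !mulrA.
Qed.

Let nlam : n%:R = expR lam :> R.
Proof. by rewrite lamE lnK ?posrE. Qed.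

Let nE : n%:R <= expR ell :> R.
Proof. by rewrite [leLHS]nlam ler_expR. Qed.

Let eN : expR (- ell) <= y.
Proof.
apply: (@le_trans _ _ (n%:R^-1)).
  by rewrite expRN lef_pV2 ?posrE ?expR_gt0.
apply: (@le_trans _ _ s^-1).
  by rewrite -s2 lef_pV2 ?posrE ?exprn_gt0 // expr2 ler_peMl // ltW.
apply: (@le_trans _ _ (y ^+ 4)); last by rewrite exprS ler_piMr ?(ltW y_gt0) // exprn_ile1 ?(ltW y_gt0).
rewrite -[leLHS]mul1r ler_pdivrMr // yE -[leLHS]mulr1 ler_pM // exprn_ege1 //.
Qed.

Let n5 : 5 <= n%:R :> R.
Proof.
by rewrite [leRHS]nlam; apply: le_trans (expR_ge1Dx _); have := lam4; lra.
Qed.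

(** (n + m)^2 + 1 <= 4 n^2 + 1 <= n^3 because n >= 5, so the number of orderings is at most n^(3
    p). *)
Let KE : K%:R <= expR (3 * ell) :> R.
Proof.
apply: (@le_trans _ _ ((((n + m) * (n + m)).+1)%:R ^+ p)); first by rewrite -natrX ler_nat.
have -> : 3 * ell = p%:R * (3%:R * lam) by rewrite ellE; ring.
rewrite expRM_natl ler_pXn2r ?nnegrE ?ler0n ?expR_ge0 // expRM_natl -nlam.
rewrite -natr1 natrM natrD.
have nm : m%:R <= n%:R :> R by rewrite ler_nat.
have h : (n%:R + m%:R) * (n%:R + m%:R) <= (2 * n%:R) * (2 * n%:R) :> R.
  by apply: ler_pM; rewrite ?addr_ge0 ?ler0n //; lra.
have h2 : 5 * n%:R ^+ 2 <= n%:R ^+ 3 :> R by rewrite [leRHS]exprS ler_wpM2r ?exprn_ge0 ?ler0n.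
have h3 : 1 <= n%:R ^+ 2 :> R by rewrite exprn_ege1 // ler1n.
have h4 : (2 * n%:R) * (2 * n%:R) = 4 * n%:R ^+ 2 :> R by ring.
by move: h h2 h3; rewrite h4; move: (n%:R ^+ 2) (n%:R ^+ 3) => *; lra.
Qed.

Let e1 : 2 <= expR ell :> R.
Proof. by apply: le_trans (expR_ge1Dx _); have := ell4; lra. Qed.

Local Notation J := ('I_K * 'I_d * bool)%type.

Let cJ : #|{: J}|%:R = 2 * (K%:R * d%:R) :> R.
Proof. by rewrite !card_prod card_bool !card_ord !natrM; ring. Qed.

Let dE : d%:R <= expR ell :> R.
Proof. by apply: le_trans nE; rewrite ler_nat. Qed.

Let JE : #|{: J}|%:R <= expR (5 * ell) :> R.
Proof.
rewrite cJ (_ : 5 * ell = ell + (3 * ell + ell)); last by ring.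
rewrite !expRD; apply: ler_pM; [by []|by rewrite mulr_ge0 ?ler0n|exact: e1|].
by apply: ler_pM; rewrite ?ler0n.
Qed.

Let J1 : 1 + #|{: J}|%:R <= expR (6 * ell) :> R.
Proof.
rewrite (_ : 6 * ell = ell + 5 * ell); last by ring.
have h1 : 1 <= expR (5 * ell) :> R.
  by rewrite -expR0 ler_expR mulr_ge0.
rewrite expRD; have := JE; have : 2 * expR (5 * ell) <= expR ell * expR (5 * ell) by rewrite ler_wpM2r ?expR_ge0.
by move: (expR (5 * ell)) (expR ell * _) h1 => *; lra.
Qed.

Let tau2 : tau ^+ 2 = 25 * ell.
Proof. by rewrite tauE exprMn L2; ring. Qed.

(** [tau] is chosen with tau^2 = 25 ell: the union bound over pairs of indices costs exp(10 ell),
    and exp(-15 ell) is left to beat the crude bounds in [Vn]. *)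
Let nu_b : 0 <= nuS n m 'I_K 'I_d tau <= 8 * expR (- (15 * ell)).
Proof.
have j0 : 0 <= #|{: J}|%:R :> R by rewrite ler0n.
apply/andP; split.
  rewrite /nuS mulr_ge0 ?mulr_ge0 ?expR_ge0 // !addr_ge0 ?mulr_ge0 ?exprn_ge0 ?ler0n //.
have a1 : #|{: J}|%:R ^+ 2 <= expR (10 * ell).
  rewrite (_ : 10 * ell = 2%:R * (5 * ell)); last by ring.
  by rewrite expRM_natl ler_pXn2r ?nnegrE ?expR_ge0 ?JE.
have mono (x : R) : x <= 10 -> expR (x * ell) <= expR (10 * ell) by move=> x10; rewrite ler_expR ler_wpM2r.
have a2 : #|{: J}|%:R <= expR (10 * ell) by apply: le_trans JE _; apply: mono; lra.
have a3 : K%:R * N.+1%:R <= expR (10 * ell).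
  apply: (@le_trans _ _ (expR (5 * ell))); last by apply: mono; lra.
  rewrite (_ : 5 * ell = 3 * ell + (ell + ell)); last by ring.
  rewrite !expRD; apply: ler_pM; rewrite ?ler0n //.
  apply: (@le_trans _ _ (5 * n%:R)).
    rewrite -natr1 NE; have nm : m%:R <= n%:R :> R by rewrite ler_nat.
    have : 1 <= n%:R :> R by rewrite ler1n.
    by lra.
  by apply: ler_pM => //; exact: le_trans n5 nE.
have a4 : K%:R * d%:R <= expR (10 * ell).
  apply: (@le_trans _ _ (expR (4 * ell))); last by apply: mono; lra.
  rewrite (_ : 4 * ell = 3 * ell + ell); last by ring.
  by rewrite expRD ler_pM ?ler0n.
rewrite /nuS tau2 !card_ord.
rewrite (_ : - (15 * ell) = 10 * ell + - (25 * ell)); last by ring.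
rewrite expRD; set E := expR (- (25 * ell)); have E0 : 0 <= E by exact: expR_ge0.
apply: (@le_trans _ _ ((4 * expR (10 * ell)) * (2 * E))); last by rewrite le_eqVlt; apply/orP; left; apply/eqP; ring.
rewrite ler_wpM2r ?mulr_ge0 //.
have fin (x1 x2 x3 x4 x5 : R) : x1 <= x5 -> x2 <= x5 -> x3 <= x5 -> x4 <= x5 -> x1 + x2 + x3 + x4 <= 4 * x5 by lra.
exact: fin a1 a2 a3 a4.
Qed.

Let emono (x : R) : 1 <= x -> expR (- (x * ell)) <= y.
Proof.
move=> x1; apply: le_trans eN; rewrite ler_expR lerN2 ler_peMl //.
Qed.

Let V0_b : 0 <= V0S n m p B tau.
Proof.
have [/andP[h _] _ _] := cov_rates kc1 y_gt0 v0 v1 yk om_b rho_b b1_b b2_b.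
rewrite /V0S; apply: addr_ge0; last by apply: addr_ge0.
apply: mulr_ge0; first by rewrite mulr_ge0 ?divr_ge0 ?ler0n.
by rewrite mulr_ge0 // ltW.
Qed.

(** Exponential bounds suffice: be^2 <= exp(4 ell), V0 <= 34 c exp(ell) and nu <= 8 exp(-15 ell)
    leave a multiple of exp(-10 ell), which is below y. *)
Let Vn : be ^+ 2 * (V0S n m p B tau * nuS n m 'I_K 'I_d tau) <= kc * y.
Proof.
have [/andP[h0 h1] _ _] := cov_rates kc1 y_gt0 v0 v1 yk om_b rho_b b1_b b2_b.
have /andP[nu0 nu1] := nu_b.
have eta1 : etaS n m p B tau <= 1.
  apply: le_trans h1 _; apply: le_trans yk; rewrite mulrC ler_wpM2r ?mulr_ge0 ?(le_trans ler01 kc1) //.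
  apply: (@le_trans _ _ (y ^+ 4)); first by rewrite /zr ler_piMr ?exprn_ge0 ?(ltW y_gt0) // exprn_ile1 // ltW.
  by rewrite exprS ler_piMr ?(ltW y_gt0) // exprn_ile1 ?(ltW y_gt0).
have se : s <= expR ell by apply: le_trans nE; rewrite -s2 expr2 ler_peMl // ltW.
have Be : B <= expR ell.
  apply: le_trans se; have := Bs1; by rewrite ler_pdivrMr // mul1r.
have V1 : V0S n m p B tau <= 34 * c * expR ell.
  have g1 : 4 * (n%:R / m%:R) * (8 * B) <= 4 * c * (8 * expR ell).
    apply: ler_pM; rewrite ?mulr_ge0 ?divr_ge0 ?ler0n ?(ltW B0) //.
      by rewrite ler_pM2l.
    by rewrite ler_pM2l.
  have g2 : 1 <= c * expR ell by rewrite -[leLHS]mulr1 ler_pM // ltW // (lt_le_trans _ e1) // ltr1n.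
  rewrite /V0S; move: g1 g2 eta1; rewrite (_ : 4 * c * (8 * expR ell) = 32 * (c * expR ell)); last by ring.
  rewrite -[34 * c * _]mulrA; move: (c * expR ell) (4 * _ * _) (etaS _ _ _ _ _) => *; lra.
have be2 : be ^+ 2 <= expR (4 * ell).
  have -> : be ^+ 2 = L ^+ 6 * (y ^+ 2)^-1 by rewrite beE vE; field; rewrite !gt_eqF.
  rewrite (_ : 4 * ell = 3%:R * ell + ell); last by ring.
  rewrite expRD expRM_natl; apply: ler_pM; rewrite ?invr_ge0 ?exprn_ge0 ?(ltW L0) ?(ltW y_gt0) //.
    rewrite (_ : L ^+ 6 = ell ^+ 3); last by rewrite -L2 -exprM.
    rewrite ler_pXn2r ?nnegrE ?expR_ge0 //; apply: le_trans (expR_ge1Dx _); by rewrite lerDr.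
  apply: le_trans se; rewrite -[leRHS]invrK lef_pV2 ?posrE ?invr_gt0 ?exprn_gt0 //.
  apply: (@le_trans _ _ (y ^+ 4)).
    by rewrite -[leLHS]mul1r ler_pdivrMr // yE -[leLHS]mulr1 ler_pM // exprn_ege1.
  by rewrite (_ : y ^+ 4 = y ^+ 2 * y ^+ 2) ?ler_piMr ?exprn_ge0 ?(ltW y_gt0) ?exprn_ile1 ?(ltW y_gt0) //; ring.
apply: (@le_trans _ _ (expR (4 * ell) * (34 * c * expR ell * (8 * expR (- (15 * ell)))))).
  apply: ler_pM; [|by rewrite mulr_ge0|exact: be2|by rewrite ler_pM].
  by rewrite exprn_ge0 // beE invr_ge0 mulr_ge0 ?exprn_ge0 ?(ltW v0) ?(ltW y_gt0).
have -> : expR (4 * ell) * (34 * c * expR ell * (8 * expR (- (15 * ell)))) = 272 * (c * expR (- (10 * ell))).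
  rewrite (_ : - (10 * ell) = 4 * ell + (ell + - (15 * ell))); last by ring.
  by rewrite !expRD; ring.
have g : c * expR (- (10 * ell)) <= c * y by rewrite ler_pM2l // emono //; lra.
have g2 : 300 * (c * y) <= kc * y by rewrite mulrA ler_pM2r //; case: kcc.
have g3 : 0 <= c * y by rewrite mulr_ge0 // ltW.
move: (c * _) (c * y) (kc * y) g g2 g3 => *; lra.
Qed.

Lemma harm_b : \sum_(0 <= i < N) (N - i)%:R^-1 <= tau ^+ 2 :> R.
Proof.
have N0 : (0 < N)%N by rewrite cardI addn_gt0 n_gt0.
apply: le_trans (harmonic_le R N0) _; rewrite tau2.
have : ln N%:R <= 2 * lam.
  rewrite lamE mulr_natl -lnXn // ler_ln ?posrE ?exprn_gt0 // NE.
  have nm : m%:R <= n%:R :> R by rewrite ler_nat.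
  apply: (@le_trans _ _ (2 * n%:R)); first by lra.
  by rewrite expr2 ler_pM2r //; apply: le_trans n5; rewrite ler_nat.
by have := lam_ell; have := ell4; lra.
Qed.

Lemma tau_ge1 : 1 <= tau.
Proof. by rewrite tauE; have := L1; lra. Qed.

Lemma be_gt0 : 0 < be.
Proof. by rewrite beE invr_gt0 mulr_gt0 // exprn_gt0. Qed.

Let dm_b : 0 <= dmS n m B <= kc * (y ^+ 4 * v ^+ 7).
Proof.
apply/andP; split; first by rewrite /dmS divr_ge0 ?(ltW k0) // mulr_ge0 // mulr_ge0 // ltW.
apply: (@le_trans _ _ (2 * (8 * B) * (2 * c / s))).
  by rewrite /dmS ler_pM2l ?mulr_gt0.
rewrite -Bs (_ : _ * _ = 32 * (c * (B / s))); last by ring.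
have g2 : 300 * (c * (B / s)) <= kc * (B / s) by rewrite mulrA ler_pM2r ?divr_gt0 //; case: kcc.
have g3 : 0 <= c * (B / s) by rewrite mulr_ge0 ?divr_ge0 ?(ltW c0) ?(ltW B0) ?(ltW s0).
move: (c * _) (kc * _) g2 g3 => *; lra.
Qed.

Lemma be_dm_b : be * dmS n m B <= 1.
Proof.
have /andP[h0 h1] := dm_b; have bb := be_gt0.
apply: le_trans (ler_wpM2l (ltW bb) h1) _.
rewrite (_ : be * (kc * (y ^+ 4 * v ^+ 7)) = kc * (y ^+ 3 * v ^+ 4)); last by rewrite beE; field; rewrite !gt_eqF.
apply: le_trans yk; rewrite mulrC; apply: ler_pM; rewrite ?mulr_ge0 ?exprn_ge0 ?(ltW y_gt0) ?(ltW v0) ?(le_trans ler01 kc1) //.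
  apply: (@le_trans _ _ (y ^+ 3)); first by rewrite ler_piMr ?exprn_ge0 ?(ltW y_gt0) // exprn_ile1 // ltW.
  by rewrite exprS ler_piMr ?(ltW y_gt0) // exprn_ile1 ?(ltW y_gt0).
by have := kc1; lra.
Qed.

Let r_b : 0 <= rS n m p B tau <= kc * (y ^+ 4 * v ^+ 3).
Proof.
rewrite /rS; have : 408 = 408 :> R by [].
move: {1 3 4}(408 : R) => a aE.
have a0 : 0 <= a by rewrite aE ler0n.
have sq0 : 0 <= (Num.sqrt N%:R)^-1 :> R by rewrite invr_ge0 sqrtr_ge0.
have t0 : 0 <= tau by rewrite tauE mulr_ge0 // ltW.
have t40 : 0 <= tau ^+ 4 by rewrite exprn_ge0.
have B0' := ltW B0.
have p30 : 0 <= (p%:R + 3) * B by rewrite mulr_ge0 // addr_ge0 // ler0n.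
have aqB : 0 <= a * Num.sqrt (n%:R / m%:R) * B by rewrite mulr_ge0 // mulr_ge0.
have aqBt : 0 <= a * Num.sqrt (n%:R / m%:R) * B * tau ^+ 4 by rewrite mulr_ge0.
apply/andP; split; first by apply: addr_ge0; apply: mulr_ge0.
have E : y ^+ 4 * v ^+ 3 = B / s * L ^+ 4 by rewrite Bs vE; field; rewrite gt_eqF.
set w := y ^+ 4 * v ^+ 3 in E *.
have w0 : 0 <= w by rewrite E mulr_ge0 ?divr_ge0 ?exprn_ge0 ?(ltW L0) ?(ltW s0).
have LL : L ^+ 2 <= L ^+ 4 by rewrite (_ : L ^+ 4 = L ^+ 2 * L ^+ 2) ?ler_peMr ?exprn_ge0 ?exprn_ege1 ?(ltW L0) //; ring.
have L41 : 1 <= L ^+ 4 by rewrite exprn_ege1.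
have g1 : (p%:R + 3) * B / Num.sqrt N%:R <= 4 * w.
  rewrite E (_ : 4 * _ = (4 * L ^+ 4) * B / s); last by ring.
  apply: ler_pM => //.
  rewrite ler_pM2r //; have := pL; move: (L ^+ 2) (L ^+ 4) LL L41 => *; lra.
have g2 : a * Num.sqrt (n%:R / m%:R) * B * tau ^+ 4 / Num.sqrt N%:R <= a * (625 * (c * w)).
  have -> : a * (625 * (c * w)) = a * c * B * tau ^+ 4 / s by rewrite E tauE; ring.
  apply: ler_pM => //; apply: ler_wpM2r => //; apply: ler_wpM2r => //; exact: ler_wpM2l.
have g3 : c * w <= c ^+ 2 * w by rewrite ler_wpM2r.
have g4 : w <= c ^+ 2 * w by rewrite ler_peMl // exprn_ege1.
have fin (x1 x2 w1 w2 w3 : R) : x1 <= 4 * w1 -> x2 <= 408 * (625 * w2) -> 0 <= w1 -> w2 <= w3 -> w1 <= w3 ->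
  x1 + x2 <= 1000 * (300 * w3) by lra.
rewrite kcE (_ : 1000 * (300 * c ^+ 2) * w = 1000 * (300 * (c ^+ 2 * w))); last by rewrite !mulrA.
rewrite aE in g2 *; exact: (fin _ _ _ _ _ g1 g2 w0 g3 g4).
Qed.

Let ln_b : 0 <= ln (1 + #|{: J}|%:R : R) <= 6 * ell.
Proof.
have j0 : 0 <= #|{: J}|%:R :> R by rewrite ler0n.
apply/andP; split; first by rewrite ln_ge0 // lerDl.
by rewrite -[leRHS](@expRK R) ler_ln ?posrE ?expR_gt0 ?J1 // ltr_wpDr.
Qed.

Let v0_b : 0 <= v0S n m B <= kc.
Proof.
have [_ _ b21] := cov_rates kc1 y_gt0 v0 v1 yk om_b rho_b b1_b b2_b.
have /andP[b20 _] := b2_b.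
have q : 0 <= 4 * (n%:R / m%:R) :> R by rewrite mulr_ge0 ?divr_ge0 ?ler0n.
apply/andP; split; first by rewrite /v0S mulr_ge0 // addr_ge0.
apply: (@le_trans _ _ (4 * c * 2)).
  apply: ler_pM => //; first by rewrite addr_ge0.
    by rewrite ler_pM2l.
  by move: b21; rewrite /b2; lra.
by have [h _] := kcc; have := c_ge1; lra.
Qed.

(** [be1 = L] balances the two terms of [Mlse_bound], bounded by 6 L and 4 L. The shift [aa] gives
    be * aa = 6 ell, which exceeds the bound 5 ell on ln #|J| and leaves dlt <= exp(-ell) <= y. *)
Lemma rate_bound :
  0 <= epsS n m 'I_K 'I_d p B tau be L aa /\
  3 * epsS n m 'I_K 'I_d p B tau be L aa + nuS n m 'I_K 'I_d tau <= ctot kc * y.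
Proof.
have [he hD _] := cov_rates kc1 y_gt0 v0 v1 yk om_b rho_b b1_b b2_b.
have /andP[nu0 nu1] := nu_b.
have nuy : nuS n m 'I_K 'I_d tau <= kc * y.
  apply: le_trans nu1 _; apply: (@le_trans _ _ (8 * y)).
    by rewrite ler_pM2l // emono //; lra.
  by rewrite ler_pM2r //; have [h _] := kcc; have := c_ge1; lra.
have Mb : 0 <= L^-1 * ln (1 + #|{: J}|%:R) + 2 * L * (1 + etaS n m p B tau) <= 10 / v.
  have /andP[l0 l1] := ln_b; have /andP[e0 e2] := he.
  have eta1 : etaS n m p B tau <= 1.
    apply: le_trans e2 _; apply: le_trans yk; rewrite mulrC ler_wpM2r ?mulr_ge0 ?(le_trans ler01 kc1) //.
    apply: (@le_trans _ _ (y ^+ 4)); first by rewrite /zr ler_piMr ?exprn_ge0 ?(ltW y_gt0) // exprn_ile1 // ltW.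
    by rewrite exprS ler_piMr ?(ltW y_gt0) // exprn_ile1 ?(ltW y_gt0).
  apply/andP; split.
    apply: addr_ge0; first by rewrite mulr_ge0 ?invr_ge0 ?(ltW L0).
    by apply: mulr_ge0; [rewrite mulr_ge0 // ltW|apply: addr_ge0].
  rewrite vE invrK.
  have g1 : L^-1 * ln (1 + #|{: J}|%:R) <= 6 * L.
    rewrite mulrC ler_pdivrMr // -mulrA -expr2 L2; exact: l1.
  have g2 : 2 * L * (1 + etaS n m p B tau) <= 2 * L * 2 by rewrite ler_pM2l ?mulr_gt0 //; lra.
  by move: (L^-1 * _) (2 * L * (1 + _)) g1 g2 => *; lra.
have dl_b : 0 <= dlt J be aa <= y.
  apply/andP; split; first by rewrite mulr_ge0 ?ler0n ?expR_ge0.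
  have baE : be * aa = 6 * ell by rewrite -L2 beE aaE vE; field; rewrite !gt_eqF.
  rewrite /dlt baE; apply: (@le_trans _ _ (expR (5 * ell) * expR (- (6 * ell)))).
    by rewrite ler_wpM2r ?expR_ge0.
  by rewrite -expRD (_ : 5 * ell + - (6 * ell) = - ell) //; ring.
move: Vn dl_b; rewrite beE => Vn' dl_b'.
exact: (eps_rates kc1 y_gt0 v0 v1 yk he hD V0_b nu0 Vn' nuy v0_b dm_b Mb r_b aaE dl_b').
Qed.

End ConcreteRates.

Lemma mutually_independent_inj (dO : measure_display) (Omega : measurableType dO) (R : realType)
  (P : probability Omega R) (I I' : finType) (h : I' -> I) (S : I -> set (set Omega)) :
  injective h -> mutually_independent P S -> mutually_independent P (fun x => S (h x)).
Proof.
move=> hi iS J A SA.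
pose B i := if [pick x | h x == i] is Some x then A x else setT.
have Bh x : B (h x) = A x.
  by rewrite /B; case: pickP => [x' /eqP /hi -> //|/(_ x)]; rewrite eqxx.
have := iS (h @: J)%SET B.
rewrite big_imset /=; last by move=> x x' _ _; exact: hi.
under eq_bigr do rewrite Bh.
move=> <-; last by move=> _ /imsetP[x xJ ->]; rewrite Bh; exact: SA.
congr (P _); apply/seteqP; split => w /= H i /=.
  by move=> /imsetP[x xJ ->]; rewrite Bh; exact: H.
by move=> iJ; rewrite -Bh; apply: H; exact: imset_f.
Qed.

Lemma kconst_gt0 (R : realFieldType) (c0 : R) : 0 < c0 -> 0 < 1000 * (300 * c0^-1 ^+ 2).
Proof.
by move=> h; do 2?[apply: mulr_gt0; first by rewrite ltr0n]; rewrite exprn_gt0 ?invr_gt0.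
Qed.

Lemma ctot_gt0 (R : realType) (kc : R) : 0 < kc -> 0 < ctot kc.
Proof.
move=> h; rewrite /ctot; do 2?[apply: mulr_gt0; first by rewrite ltr0n].
by rewrite exprn_gt0 // mulr_gt0 // ltr0n.
Qed.

Section OneSampleSize.
Context {dO : measure_display} {Omega : measurableType dO} {R : realType}.
Variable P : probability Omega R.
Variables (c0 C0 C1 c1 : R) (p n m d : nat) (psi dpsi ddpsi : nat -> R -> R).
Variables (X : 'I_n -> Omega -> ('I_p -> R)) (Y : 'I_m -> Omega -> ('I_p -> R)) (e : 'I_n -> Omega -> R).
Hypotheses (c001 : 0 < c0 <= 1) (C1_gt0 : 0 < C1).
Hypothesis n_gt0 : (0 < n)%N.
Hypothesis H0 : setting_H0 P c0 C0 C1 c1 d psi dpsi ddpsi X Y e.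
Let lam : R := ln n%:R.
Hypothesis lam4 : 4 <= lam.
Let kc : R := 1000 * (300 * c0^-1 ^+ 2).

(* Chosen so that [yrate^4 sqrt n = B (p ln n)^(7/2)], with [B] the bound on the
   derivatives of the scores. *)
Definition yrate : R := Num.sqrt (Num.sqrt (2 * Num.sqrt (C1 * lam ^+ 7 * (n%:R `^ (1 - c1)) / n%:R))).

Hypothesis yk : yrate * (12 * kc) <= 1.

Let p_gt0 : (0 < p)%N.
Proof. by case: H0. Qed.
Let nR : 0 < n%:R :> R.
Proof. by rewrite ltr0n. Qed.
Let mnc : c0 * n%:R <= m%:R /\ (m <= n)%N.
Proof. by case: H0 => _ []. Qed.
Let c0_gt0 : 0 < c0.
Proof. by case/andP: c001. Qed.
Let m_gt0 : (0 < m)%N.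
Proof. by rewrite -(ltr0n R); case: mnc => h _; apply: lt_le_trans h; rewrite mulr_gt0. Qed.
Let d_gt0 : (0 < d)%N.
Proof. by case: H0 => _ [_ [[]]]. Qed.
Let d_le : (d <= n)%N.
Proof. by case: H0 => _ [_ [[]]]. Qed.

Let G : R := C1 * (n%:R `^ (1 - c1)).
Let G_gt0 : 0 < G.
Proof. by rewrite mulr_gt0 // powR_gt0. Qed.
Let Bh : R := Num.sqrt (G / p%:R ^+ 7).
(** The factor 2 turns [score_bound_ge], which only gives [2 * Bh >= 1], into [B >= 1]. *)
Let B : R := 2 * Bh.
Let pR : 0 < p%:R :> R.
Proof. by rewrite ltr0n. Qed.
Let Bh0 : 0 <= Bh.
Proof. exact: sqrtr_ge0. Qed.
Let Bh2 : Bh ^+ 2 = G / p%:R ^+ 7.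
Proof. by rewrite sqr_sqrtr // divr_ge0 ?exprn_ge0 ?(ltW pR) ?(ltW G_gt0). Qed.

Let psi_der k : (1 <= k <= d)%N -> has_derivative01 (psi k) (dpsi k).
Proof. by case: H0 => _ [_ [_ [[_ h _ _] _]]] /andP[_]; exact: h. Qed.

Let dpsi_h k z : (1 <= k <= d)%N -> unit_itv z -> `|dpsi k z| <= Bh.
Proof.
case: H0 => _ [_ [_ [_ [h _]]]] kd zU; have [h1 _] := h k z kd zU.
rewrite -(@ler_pXn2r _ 2) ?nnegrE // Bh2 real_normK ?num_real // ler_pdivlMr ?exprn_gt0 //.
by rewrite mulrC.
Qed.

Let dpsi_b k z : (1 <= k <= d)%N -> unit_itv z -> `|dpsi k z| <= B.
Proof. by move=> kd zU; apply: le_trans (dpsi_h kd zU) _; rewrite /B; have := Bh0; lra. Qed.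

Let psi_mean k : (1 <= k <= d)%N -> (\int[lebesgue_measure]_(z in @unit_itv R) (psi k z)%:E = 0)%E.
Proof.
case: H0 => _ [_ [_ [[h1 _ _ h2] _]]] /andP[k1 kd].
transitivity (\int[lebesgue_measure]_(z in @unit_itv R) (psi k z * psi 0%N z)%:E)%E; last first.
  by rewrite (h2 k 0%N kd (leq0n _)) (gtn_eqF k1).
by apply: eq_integral => z /set_mem zU; rewrite h1 // mulr1.
Qed.

Let psi_norm k : (1 <= k <= d)%N -> (\int[lebesgue_measure]_(z in @unit_itv R) (psi k z * psi k z)%:E = 1)%E.
Proof.
by case: H0 => _ [_ [_ [[_ _ _ h2] _]]] /andP[k1 kd]; have := h2 k k kd kd; rewrite eqxx.
Qed.

Let B1 : 1 <= B.
Proof.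
have kd : (1 <= 1 <= d)%N by rewrite d_gt0.
have := score_bound_ge (psi_der kd) (fun z => @dpsi_h 1 z kd) (psi_mean kd) (psi_norm kd).
rewrite (_ : 4 * Bh ^+ 2 = B ^+ 2); last by rewrite /B; ring.
by rewrite -[leLHS](expr1n _ 2) ler_pXn2r ?nnegrE ?mulr_ge0.
Qed.

Let ell : R := p%:R * lam.
Let L : R := Num.sqrt ell.
Let s : R := Num.sqrt n%:R.
Let lam0 : 0 < lam.
Proof. by apply: lt_le_trans lam4. Qed.

Let yrate_gt0 : 0 < yrate.
Proof.
rewrite !sqrtr_gt0 mulr_gt0 // sqrtr_gt0 divr_gt0 // mulr_gt0 ?powR_gt0 // mulr_gt0 // exprn_gt0 //.
Qed.

Lemma yrate8 : yrate ^+ 8 = 4 * (C1 * lam ^+ 7 * (n%:R `^ (1 - c1)) / n%:R).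
Proof.
rewrite (_ : 8%N = (2 * (2 * 2))%N) // !exprM /yrate !sqr_sqrtr ?exprMn ?sqr_sqrtr ?sqrtr_ge0 //.
- by ring.
- by rewrite divr_ge0 ?ler0n // mulr_ge0 ?powR_ge0 // mulr_ge0 ?exprn_ge0 ?(ltW lam0) // ltW.
Qed.

(** After squaring, the p^7 in [Bh ^+ 2] cancels the p^7 in L^14 = (p ln n)^7; this is where the
    power of [p] in the assumption comes from. *)
Let yE : yrate ^+ 4 * s = B * L ^+ 7.
Proof.
have l0 : 0 <= ell by rewrite mulr_ge0 ?ler0n // ltW.
apply/eqP; rewrite -(@eqrXn2 _ 2) ?mulr_ge0 ?exprn_ge0 ?sqrtr_ge0 ?(ltW yrate_gt0) //; apply/eqP.
rewrite exprMn -exprM yrate8 sqr_sqrtr ?ler0n // exprMn /B exprMn Bh2 -exprM mulnC exprM sqr_sqrtr //.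
by rewrite /ell /G exprMn; field; rewrite !gt_eqF ?exprn_gt0.
Qed.

Let Z (y : 'I_n + 'I_m) : Omega -> 'I_p -> R := match y with inl i => X i | inr j => Y j end.

Lemma reject_close (al : R) : 0 < al < 1 ->
  `|fine (reject_prob P d psi X Y e al) - al| <= ctot kc * yrate.
Proof.
move=> al01.
have [_ [_ [_ [_ [_ [[mX mY me] [ind [id1 id2 ac en]]]]]]]] := H0.
have Zm y c : measurable_fun setT (fun w => Z y w c) by case: y => i; [exact: mX|exact: mY].
have Zi : mutually_independent P (fun y : 'I_n + 'I_m => events_vec (Z y)).
  have := @mutually_independent_inj _ _ _ P _ _ (fun y : 'I_n + 'I_m => inl y : ('I_n + 'I_m) + 'I_n) _ _ ind.
  move=> /(_ (fun x y (h : inl x = inl y) => let: erefl := h in erefl)).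
  by congr (mutually_independent P _); apply/funext; case.
have ei : mutually_independent P (fun i => events_real (e i)).
  by apply: (@mutually_independent_inj _ _ _ P _ _ (fun i : 'I_n => inr i : ('I_n + 'I_m) + 'I_n) _ _ ind) => x y [].
have i0 : 'I_n := Ordinal n_gt0.
have idZ (y : 'I_n + 'I_m) Bs : borelRp Bs -> P (Z y @^-1` Bs) = P (X i0 @^-1` Bs).
  by case: y => i bB; [exact: id1|exact: id2].
have Zid y y' Bs : borelRp Bs -> P (Z y @^-1` Bs) = P (Z y' @^-1` Bs).
  by move=> bB; rewrite !idZ.
have Zac y Bs : borelRp Bs -> lebesgue_null Bs -> P (Z y @^-1` Bs) = 0%E.
  by move=> bB nB; rewrite idZ //; exact: ac.
have [p' pE] : exists p', p = p'.+1 by exists p.-1; rewrite prednK.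
have E0 : 0 <= ctot kc * yrate.
  exact: mulr_ge0 (ltW (ctot_gt0 (kconst_gt0 c0_gt0))) (ltW yrate_gt0).
have mn := mnc.2.
have c1' : 1 <= c0^-1 by rewrite invf_ge1 //; case/andP: c001.
have nm : n%:R <= c0^-1 * m%:R :> R by rewrite mulrC ler_pdivlMr // mulrC; exact: mnc.1.
have fix_ (zz : 'I_n + 'I_m -> 'I_p -> R) : gen_pos zz ->
   `|fprob (fun s => `[< rejects P d e psi al (shuffle zz s) >]) - al| <= ctot kc * yrate.
  move=> gp.
  have sph : @sphere R p !=set0.
    exists (fun c => if c == Ordinal p_gt0 then 1 else 0).
    rewrite /sphere /= (bigD1 (Ordinal p_gt0)) //= ?eqxx expr1n big1 ?addr0 // => c /negbTE ->.
    by rewrite expr0n.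
  (* The signs of the projected differences of pooled points, over all ordered pairs, are exactly
     the ordering induced by a direction. *)
  pose w (ij : ('I_n + 'I_m) * ('I_n + 'I_m)) : 'I_p -> R := fun c => zz ij.2 c - zz ij.1 c.
  have [K [dirs [K0 Kle dsph dall]]] := finite_directions w sph.
  have dw u y z : (0 <= dotp u (w (y, z))) = dle zz u y z.
    rewrite /dle -[RHS]subr_ge0; congr (0 <= _); rewrite /dotp -sumrB; apply: eq_bigr => c _.
    by rewrite /w /= mulrBr.
  have dall' u : sphere u -> exists k, dle zz u =2 dle zz (dirs k).
    by move=> /dall[k hk]; exists k => y z; rewrite -!dw hk.
  have Kle' : (K <= (((n + m) * (n + m)).+1) ^ p)%N.
    by move: Kle; rewrite card_prod card_sum !card_ord.
  have [eps0 rb] := @rate_bound R n m p K d c0^-1 B yrate n_gt0 m_gt0 mn p_gt0 Kle' d_le c1' nm lam erefl lam4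
     ell erefl L erefl s erefl B1 yrate_gt0 yE kc erefl yk L^-1 erefl (5 * L) erefl _ erefl _ erefl.
  apply: le_trans rb.
  have L0 : 0 < L by rewrite sqrtr_gt0 mulr_gt0.
  apply: (@fixed_sample _ _ _ P p n m d e n_gt0 m_gt0 mn d_gt0 me ei en psi zz gp K dirs K0 dsph dall'
    B (5 * L) _ _ _ _ B1 _ _ _ L _ _ _ _ _ al al01 eps0) => //.
  - by move=> k x y kd; exact: (derivative01_lipschitz (psi_der kd) (fun z => @dpsi_b k z kd)).
  - by move=> k r kd; exact: (score_sum (psi_der kd) (fun z => @dpsi_b k z kd) (psi_mean kd)).
  - by move=> k r kd; exact: (score_sqr_sum (psi_der kd) (fun z => @dpsi_b k z kd) (psi_mean kd) (psi_norm kd)).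
  - by move=> k x kd; exact: (score_sqr_le (psi_der kd) (fun z => @dpsi_b k z kd) (psi_mean kd) (psi_norm kd) B1).
  - exact: (@tau_ge1 R p p_gt0 lam lam4 ell erefl L erefl).
  - exact: (@harm_b R n m p n_gt0 m_gt0 mn p_gt0 lam erefl lam4 ell erefl L erefl).
  - exact: (@be_gt0 R p yrate p_gt0 lam lam4 ell erefl L erefl yrate_gt0).
  - by rewrite mulr_ge0 // mulr_ge0 ?invr_ge0 ?(ltW L0) ?(ltW yrate_gt0).
  - exact: (@be_dm_b R n m p c0^-1 B yrate n_gt0 m_gt0 mn p_gt0 c1' nm lam lam4 ell erefl L erefl s erefl B1 yrate_gt0 yE kc erefl yk).
change (`|fine (P [set w | rejects P d e psi al (fun y => Z y w)]) - al| <= ctot kc * yrate).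
move: (Z) Zm Zi Zac Zid fix_; rewrite pE => Z' *.
exact: (@single_sample_size _ _ _ P p' n m d e psi Z').
Qed.

End OneSampleSize.

(** By [yrate8], y^8 is 4 C1 (ln n)^7 exp(-c1 ln n). Bounding exp(x) below by (x / 8)^8 leaves a
    constant divided by ln n. *)
Lemma yrate_small (R : realType) (C1 c1 dl : R) : 0 < C1 -> 0 < c1 -> 0 < dl ->
  exists N0 : nat, forall n : nat, (N0 <= n)%N -> [/\ (0 < n)%N, 4 <= ln n%:R :> R & yrate C1 c1 n <= dl].
Proof.
move=> C10 c10 dl0.
pose K := 4 * C1 * 8 ^+ 8 / (c1 ^+ 8 * dl ^+ 8).
have K0 : 0 < K by rewrite divr_gt0 ?mulr_gt0 ?exprn_gt0.
pose N0 := (Num.trunc (expR (K + 4))).+1.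
exists N0 => n nN; have n0 : (0 < n)%N by apply: leq_trans nN.
have nR : 0 < n%:R :> R by rewrite ltr0n.
have lK : K + 4 <= ln n%:R.
  rewrite -[leLHS](@expRK R) ler_ln ?posrE ?expR_gt0 // ltW //.
  by apply: lt_le_trans (truncnS_gt _) _; rewrite ler_nat.
have l4 : 4 <= ln n%:R :> R by move: lK K0; lra.
have lam0 : 0 < ln n%:R :> R by apply: lt_le_trans l4.
split=> //.
have y0 : 0 <= yrate C1 c1 n by exact: sqrtr_ge0.
rewrite -(@ler_pXn2r _ 8) ?nnegrE ?(ltW dl0) // yrate8 //.
set lm := ln n%:R in l4 lam0 lK *.
have nE : n%:R = expR lm :> R by rewrite /lm lnK ?posrE.
rewrite -mulrA (_ : n%:R `^ (1 - c1) / n%:R = expR (- (c1 * lm))); last first.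
  rewrite /powR gt_eqF // -/lm nE -expRN -expRD; congr expR; ring.
have q0 : 0 < c1 * lm / 8 by rewrite divr_gt0 ?mulr_gt0.
have E : expR (- (c1 * lm)) <= ((c1 * lm / 8) ^+ 8)^-1.
  rewrite expRN lef_pV2 ?posrE ?expR_gt0 ?exprn_gt0 //.
  have -> : c1 * lm = 8%:R * (c1 * lm / 8) by field.
  rewrite expRM_natl ler_pXn2r ?nnegrE ?(ltW q0) ?expR_ge0 //.
    rewrite (_ : 8%:R * _ / 8 = c1 * lm / 8); last by field.
    by apply: le_trans (expR_ge1Dx _); rewrite lerDr.
  by rewrite (_ : 8%:R * _ / 8 = c1 * lm / 8) ?(ltW q0) //; field.
apply: (@le_trans _ _ (4 * (C1 * lm ^+ 7 * ((c1 * lm / 8) ^+ 8)^-1))).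
  by rewrite ler_pM2l // ler_pM2l // mulr_gt0 // exprn_gt0.
rewrite (_ : 4 * _ = 4 * C1 * 8 ^+ 8 / c1 ^+ 8 / lm); last by field; rewrite !gt_eqF.
rewrite ler_pdivrMr // [leRHS]mulrC -ler_pdivrMr ?exprn_gt0 //.
have -> : 4 * C1 * 8 ^+ 8 / c1 ^+ 8 / dl ^+ 8 = K by rewrite /K; field; rewrite !gt_eqF.
by move: lK; lra.
Qed.

(** Uniformity in alpha comes for free, since the bound of [reject_close] does not involve alpha;
    the supremum is over a nonempty bounded set. *)
Theorem theorem3 (R : realType) (dO : measure_display) (Omega : measurableType dO)
  (P : probability Omega R) (c0 C0 C1 c1 : R) (p m d : nat -> nat)
  (psi dpsi ddpsi : nat -> nat -> R -> R)
  (X : forall n : nat, 'I_n -> Omega -> ('I_(p n) -> R))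
  (Y : forall n : nat, 'I_(m n) -> Omega -> ('I_(p n) -> R))
  (e : forall n : nat, 'I_n -> Omega -> R) :
  0 < c0 <= 1 -> 0 < C0 -> 0 < C1 -> 0 < c1 < 1 ->
  (forall n : nat, (1 <= n)%N ->
     setting_H0 P c0 C0 C1 c1 (d n) (psi n) (dpsi n) (ddpsi n) (X n) (Y n) (e n)) ->
  (fun n : nat =>
     sup [set `| fine (reject_prob P (d n) (psi n) (X n) (Y n) (e n) alpha) - alpha |
         | alpha in [set a : R | 0 < a < 1]]) @ \oo --> (0 : R).
Proof.
move=> c001 C00 C10 /andP[c10 c11] H.
have c0_gt0 : 0 < c0 by case/andP: c001.
pose kc : R := 1000 * (300 * c0^-1 ^+ 2).
have kc0 : 0 < kc by exact: kconst_gt0.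
have ct0 : 0 < ctot kc by exact: ctot_gt0.
have kc12 : 0 < 12 * kc by apply: mulr_gt0 kc0; rewrite ltr0n.
apply/cvgrPdist_le => eps eps0.
pose dl := Num.min (12 * kc)^-1 (eps / ctot kc).
have dl0 : 0 < dl by rewrite lt_min invr_gt0 kc12 divr_gt0.
have [N0 hN] := yrate_small C10 c10 dl0.
near=> n.
have [n0 lam4 ydl] : [/\ (0 < n)%N, 4 <= ln n%:R :> R & yrate C1 c1 n <= dl].
  by apply: hN; near: n; exact: nbhs_infty_ge.
have yk : yrate C1 c1 n * (12 * kc) <= 1.
  rewrite -(ler_pdivlMr _ _ kc12) mul1r; apply: le_trans ydl _.
  by rewrite ge_min lexx.
have ye : ctot kc * yrate C1 c1 n <= eps.
  rewrite mulrC -ler_pdivlMr //; apply: le_trans ydl _.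
  by rewrite ge_min lexx orbT.
have cl (a : R) : 0 < a < 1 -> `|fine (reject_prob P (d n) (psi n) (X n) (Y n) (e n) a) - a| <= ctot kc * yrate C1 c1 n.
  exact: (reject_close c001 C10 n0 (H n n0) lam4 yk).
set S := [set _ | _ in _].
have S1 : S `|fine (reject_prob P (d n) (psi n) (X n) (Y n) (e n) (2^-1)) - 2^-1|.
  by exists 2^-1 => //=; rewrite invr_gt0 ltr0n /= invf_lt1 ?ltr1n.
have ub : ubound S (ctot kc * yrate C1 c1 n) by move=> _ [a /= a01 <-]; exact: cl.
have s0 : 0 <= sup S.
  by apply: le_trans (normr_ge0 _) (ub_le_sup _ S1); exists (ctot kc * yrate C1 c1 n).
rewrite sub0r normrN ger0_norm //; apply: le_trans ye.
by apply: ge_sup => //; eexists; exact: S1.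
Unshelve. all: by end_near.
Qed.
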